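(* Let $V$ be the rank two fermion vertex operator superalgebra and let $f=e^{2\pi i\alpha a(0)}$, $g=e^{2\pi i\beta a(0)}$ with $\alpha,\beta\in\mathbb R$. The generating function $G_{2n}\!\left[\begin{array}{c}f\\ g\end{array}\right]$ transforms under $\gamma=\left(\begin{array}{cc}a&b\\ c&d\end{array}\right)\in SL(2,\mathbb Z)$ with weight $n$ and multiplier $\varepsilon_\gamma\!\left[\begin{array}{c}f\\ g\end{array}\right]$, that is, $$G_{2n}\!\left(\gamma.\!\left[\begin{array}{c}f\\ g\end{array}\right]\right)\!(\gamma.x_1,\dots,\gamma.x_n;\gamma.y_1,\dots,\gamma.y_n;\gamma.\tau)=(c\tau+d)^n\,\varepsilon_\gamma\!\left[\begin{array}{c}f\\ g\end{array}\right]G_{2n}\!\left[\begin{array}{c}f\\ g\end{array}\right](x_1,\dots,x_n;y_1,\dots,y_n;\tau).$$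
   Context: The rank two fermion VOSA $V$ is generated by odd vectors $\psi^\pm$ with $Y(\psi^\pm,z)=\sum_{n\in\mathbb Z}\psi^\pm(n)z^{-n-1}$, (anti)commutators $[\psi^+(m),\psi^-(n)]=\delta_{m,-n-1}$, $[\psi^\pm(m),\psi^\pm(n)]=0$, $\psi^\pm(k)\mathbf1=0$ for $k\ge0$, and Fock basis $\psi^+(-k_1)\cdots\psi^+(-k_s)\psi^-(-l_1)\cdots\psi^-(-l_t)\mathbf 1$ with $1\le k_1<\dots<k_s$, $1\le l_1<\dots<l_t$. Conformal vector $\omega=\frac12[\psi^+(-2)\psi^-(-1)+\psi^-(-2)\psi^+(-1)]\mathbf 1$ (central charge $1$, $wt(\psi^\pm)=\frac12$). Heisenberg vector $a=\psi^+(-1)\psi^-(-1)\mathbf 1$, $a(0)\psi^\pm=\pm\psi^\pm$; parity automorphism $\sigma=e^{\pi ia(0)}$. $\mathrm{STr}_V(X)=\mathrm{Tr}_{V_{\bar 0}}(X)-\mathrm{Tr}_{V_{\bar1}}(X)$. Put $\kappa=\beta+\frac12$, $h=\kappa a$, so $\sigma g=e^{2\pi ih(0)}$. The $\sigma g$-twisted vertex operators are $Y_{\sigma g}(v,z)=Y(\Delta(-h,z)v,z)$ with $\Delta(-h,z)=z^{-h(0)}\exp\big(\sum_{n\ge1}\frac{h(n)}n(-z)^{-n}\big)$, and $L_{\sigma g}(0)=L(0)-h(0)+\frac{\kappa^2}2$. With $q=e^{2\pi i\tau}$, $q_i=e^{z_i}$, $q_i^A=\exp(z_iA)$, $$F_V\!\left[\begin{array}{c}f\\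 g\end{array}\right]((v_1,z_1),\dots,(v_n,z_n);\tau)=\mathrm{STr}_V\!\left(fY_{\sigma g}(q_1^{L(0)}v_1,q_1)\cdots Y_{\sigma g}(q_n^{L(0)}v_n,q_n)q^{L_{\sigma g}(0)-1/24}\right),$$ $$G_{2n}\!\left[\begin{array}{c}f\\ g\end{array}\right](x_1,\dots,x_n;y_1,\dots,y_n;\tau)=F_V\!\left[\begin{array}{c}f\\ g\end{array}\right]((\psi^+,x_1),(\psi^-,y_1),\dots,(\psi^+,x_n),(\psi^-,y_n);\tau),$$ regarded as meromorphic functions of the insertion points by continuation from the region where the trace converges. (These functions depend on the chosen real pair $(\alpha,\beta)$, which the symbol $\left[\begin{array}{c}f\\ g\end{array}\right]$ stands for.) Actions: $\gamma.\tau=\frac{a\tau+b}{c\tau+d}$, $\gamma.z=\frac z{c\tau+d}$, $\gamma.\left[\begin{array}{c}f\\ g\end{array}\right]=\left[\begin{array}{c}f^ag^b\\ f^cg^d\end{array}\right]$, i.e. $(\alpha,\beta)\mapsto(a\alpha+b\beta,\,c\alpha+d\beta)$ (here $a,b,c,d$ are the matrix entries). Multiplier: $\varepsilon_\gamma\!\left[\begin{array}{c}f\\ g\end{array}\right]\in U(1)$ is generated from its values on $S=\left(\begin{array}{cc}0&1\\-1&0\end{array}\right)$, $T=\left(\begin{array}{cc}1&1\\0&1\end{array}\right)$, namely $\varepsilon_S\!\left[\begin{array}{c}f\\ g\end{array}\right]=\exp(2\pi i(\frac12+\beta)(\frac12-\alpha))$ and $\varepsilon_T\!\left[\begin{array}{c}f\\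 g\end{array}\right]=\exp(\pi i(\beta(\beta+1)+\frac16))$, by $\varepsilon_{\gamma_1\gamma_2}\!\left[\begin{array}{c}f\\ g\end{array}\right]=\varepsilon_{\gamma_1}\!\left(\gamma_2.\!\left[\begin{array}{c}f\\ g\end{array}\right]\right)\varepsilon_{\gamma_2}\!\left[\begin{array}{c}f\\ g\end{array}\right]$ (this is well defined on $SL(2,\mathbb Z)$). *)

(* Defs.v *)
From HB Require Import structures.
From mathcomp Require Import all_boot all_order all_algebra finmap.
From mathcomp Require Import all_classical all_reals all_analysis.
From mathcomp Require Import complex freeg.
From mathcomp.analysis.showcase Require summability.

Set Implicit Arguments.
Unset Strict Implicit.
Unset Printing Implicit Defensive.

Import Order.TTheory GRing.Theory Num.Theory numFieldNormedType.Exports.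

Local Open Scope classical_set_scope.
Local Open Scope ring_scope.

(* Going through numClosedFieldType gives R[i] its topology, and its structure
   of normed module over itself. *)
Definition Cplx (R : realType) : numClosedFieldType := R[i].

Definition toC (R : realType) (x : R) : Cplx R := (x%:C)%C.

Definition cexp (R : realType) (z : Cplx R) : Cplx R :=
  toC (expR (complex.Re z)) *
  Complex (cos (complex.Im z)) (sin (complex.Im z)).

Definition twopii (R : realType) : Cplx R := Complex 0 (2 * pi).

(* (true, j) and (false, j) stand for the creation operators psi^+(-(j+1)) and
   psi^-(-(j+1)), and a finite set {c_1 < ... < c_r} of these, in the order
   le_cre, for the Fock vector c_1 ... c_r 1. *)
Definition creator : choiceType := (bool * nat)%type.
Definition basis : choiceType := {fset creator}.

Definition le_cre (c d : creator) : bool :=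
  if c.1 == d.1 then (c.2 <= d.2)%N else c.1.

Definition creators (b : basis) : seq creator := sort le_cre b.

(* The number of creation operators to the left of c in b. *)
Definition pos (c : creator) (b : basis) : nat :=
  size [seq d <- b : seq creator | le_cre d c & d != c].

Section Fock.
Variable R : realType.
Local Notation C := (Cplx R).

Definition fock := {freeg basis / C}.

Definition vac : fock := [freeg [:: (1, fset0)]].

Definition fockb (b : basis) : fock := [freeg [:: (1, b)]].

Definition create (c : creator) (b : basis) : fock :=
  if c \in b then 0 else (-1) ^+ pos c b *: fockb (c |` b)%fset.

Definition annihilate (c : creator) (b : basis) : fock :=
  if c \in b then (-1) ^+ pos c b *: fockb (b `\ c)%fset else 0.

(* psi true m = psi^+(m), psi false m = psi^-(m).  Recall Negz j = -(j+1);
   for j >= 0, psi^+(j) removes psi^-(-(j+1)) and psi^-(j) removes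
   psi^+(-(j+1)). *)
Definition psi (e : bool) (m : int) (v : fock) : fock :=
  fglift (fun b => match m with
                   | Negz j => create (e, j) b
                   | Posz j => annihilate (~~ e, j) b
                   end) v.

Definition psiv (e : bool) : fock := psi e (Negz 0) vac.

(* The modes of Y(c_1 ... c_r 1, z) = sum_n (c_1 ... c_r 1)(n) z^(-n-1), by the
   associativity formula
     (u(m)v)(n) = sum_(i >= 0) (-1)^i binom(m,i)
                    (u(m-i) v(n+i) - (-1)^(m+|u||v|) v(m+n-i) u(i))
   with u = psi^+ or psi^- and m = -(j+1), so that
   (-1)^i binom(m,i) = 'C(j + i, i).  Applied to a given w, the sum is
   finite. *)
Fixpoint monomial_mode (s : seq creator) (n : int) (w : fock) : fock :=
  match s with
  | [::] => if n == -1 then w else 0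
  | (e, j) :: s' =>
      \sum_(i \in [set: nat]) 'C(j + i, i)%:R *:
        (psi e (Negz (j + i)) (monomial_mode s' (n + i%:Z) w)
         - (-1) ^+ (j.+1 + size s') *:
             monomial_mode s' (n - j.+1%:Z - i%:Z) (psi e i%:Z w))
  end.

(* mode u n = u(n), where Y(u, z) = sum_n u(n) z^(-n-1). *)
Definition mode (u : fock) (n : int) (w : fock) : fock :=
  fglift (fun b => monomial_mode (creators b) n w) u.

Definition omega : fock :=
  2^-1 *: (psi true (-2) (psi false (-1) vac)
           + psi false (-2) (psi true (-1) vac)).

Definition heis : fock := psi true (-1) (psi false (-1) vac).

Definition L0 (v : fock) : fock := mode omega 1 v.

Definition a0 (v : fock) : fock := mode heis 0 v.

(* exp(A) v, the series converging coefficientwise in the Fock basis. *)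
Definition opexp (A : fock -> fock) (v : fock) : fock :=
  xget 0 [set w : fock | forall b : basis,
    series (fun k => (k`!%:R)^-1 * coeff b (iter k A v)) @ \oo
      --> (coeff b w : C)].

(* Delta(-h, z) v for z = exp(zeta); z^(-h(0)) is exp(- zeta h(0)). *)
Definition Delta (h : fock) (zeta : C) (v : fock) : fock :=
  opexp (fun w => - zeta *: mode h 0 w)
    (opexp (fun w => \sum_(n \in [set n : nat | (0 < n)%N])
              (n%:R^-1 * (- cexp zeta) ^- n) *: mode h n%:Z w) v).

Definition kappa (beta : R) : C := toC (beta + 2^-1).

Definition hvec (beta : R) : fock := kappa beta *: heis.

(* The term of index m of Y_(sigma g)(q_i^(L(0)) v, q_i), for q_i = exp(zeta):
   its coefficient (Delta(-h, q_i) q_i^(L(0)) v)(m), times q_i^(-m-1). *)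
Definition Ysg (beta : R) (v : fock) (zeta : C) (m : int) (w : fock) : fock :=
  cexp zeta ^ (- m - 1) *:
  mode (Delta (hvec beta) zeta (opexp (fun u => zeta *: L0 u) v)) m w.

Definition Lsg0 (beta : R) (v : fock) : fock :=
  L0 v - mode (hvec beta) 0 v + (kappa beta ^+ 2 / 2) *: v.

(* exp(2 pi i x a(0)) *)
Definition autom (x : R) (v : fock) : fock :=
  opexp (fun u => (twopii R * toC x) *: a0 u) v.

(* The supertrace of
     f Y_(sigma g)(q_1^L(0) v_1, q_1) ... Y_(sigma g)(q_n^L(0) v_n, q_n)
       q^(L_(sigma g)(0) - 1/24)
   for f = e^(2 pi i fg.1 a(0)), g = e^(2 pi i fg.2 a(0)) and
   vs = [:: (v_1, z_1); ...; (v_n, z_n)], is the unconditional sum of the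
   following family over the modes (m_1, ..., m_n) of the n vertex operators
   and over the Fock basis. *)
Definition trace_term (fg : R * R) (vs : seq (fock * C)) (tau : C)
    (i : (size vs).-tuple int * basis) : C :=
  (-1) ^+ #|` i.2| *
  coeff i.2
    (autom fg.1
       (foldr (fun vm w => Ysg fg.2 vm.1.1 vm.1.2 vm.2 w)
          (opexp (fun u => (twopii R * tau) *: (Lsg0 fg.2 u - 24^-1 *: u))
             (fockb i.2))
          (zip vs i.1))).

Definition FV_cvg fg vs tau : Prop :=
  cvg (summability.partial_sum (@trace_term fg vs tau) @ summability.totally).

Definition FV fg vs tau : C :=
  lim (summability.partial_sum (@trace_term fg vs tau) @ summability.totally).

End Fock.

Section Meromorphic.
Variables (R : realType) (E : normedModType (Cplx R)).
Local Notation C := (Cplx R).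

Definition holomorphic_at (f : E -> C) (p : E) : Prop :=
  \forall z \near p, differentiable f z.

(* A meromorphic function is represented by a total function: locally a
   quotient of holomorphic functions, without removable singularities, and by
   convention equal to 0 at its singular points.  With this convention,
   meromorphic functions that agree on a nonempty open subset of a connected
   domain are equal as functions. *)
Definition meromorphic (G : E -> C) : Prop :=
  [/\ forall p, exists a b : E -> C,
        [/\ holomorphic_at a p, holomorphic_at b p,
            ~ (\forall z \near p, b z = 0) &
            \forall z \near p, b z != 0 -> G z = a z / b z],
      forall p (h : E -> C), holomorphic_at h p ->
        (\forall z \near p, holomorphic_at G z -> G z = h z) ->
        holomorphic_at G p &
      forall p, ~ holomorphic_at G p -> G p = 0].

End Meromorphic.

Section GeneratingFunction.
Variable R : realType.
Local Notation C := (Cplx R).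

Definition insertions n (xy : 'rV[C]_n * 'rV[C]_n) : seq (fock R * C) :=
  flatten [seq [:: (psiv R true, xy.1 0 i); (psiv R false, xy.2 0 i)]
          | i <- enum 'I_n].

Definition is_G2n n (fg : R * R) (tau : C) (G : 'rV[C]_n * 'rV[C]_n -> C) :=
  meromorphic G /\
  forall xy, FV_cvg fg (insertions xy) tau -> G xy = FV fg (insertions xy) tau.

Definition G2n n (fg : R * R) (x y : 'rV[C]_n) (tau : C) : C :=
  xget (fun=> 0) [set G | is_G2n fg tau G] (x, y).

End GeneratingFunction.

Section Modular.
Variable R : realType.
Local Notation C := (Cplx R).

Definition mx2 (a b c d : int) : 'M[int]_2 :=
  \matrix_(i, j) if i == 0 then if j == 0 then a else b
                 else if j == 0 then c else d.

Definition Smx : 'M[int]_2 := mx2 0 1 (-1) 0.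
Definition Tmx : 'M[int]_2 := mx2 1 1 0 1.

Definition autfactor (g : 'M[int]_2) (tau : C) : C :=
  (g 1 0)%:~R * tau + (g 1 1)%:~R.

Definition act_tau (g : 'M[int]_2) (tau : C) : C :=
  ((g 0 0)%:~R * tau + (g 0 1)%:~R) / autfactor g tau.

Definition act_z n (g : 'M[int]_2) (tau : C) (z : 'rV[C]_n) : 'rV[C]_n :=
  (autfactor g tau)^-1 *: z.

Definition act_fg (g : 'M[int]_2) (fg : R * R) : R * R :=
  ((g 0 0)%:~R * fg.1 + (g 0 1)%:~R * fg.2,
   (g 1 0)%:~R * fg.1 + (g 1 1)%:~R * fg.2).

(* These conditions determine eps on SL(2,Z). *)
Definition is_multiplier (eps : 'M[int]_2 -> R * R -> C) : Prop :=
  [/\ forall alpha beta : R,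
        eps Smx (alpha, beta) =
        cexp (twopii R * toC ((2^-1 + beta) * (2^-1 - alpha))),
      forall alpha beta : R,
        eps Tmx (alpha, beta) =
        cexp (twopii R / 2 * toC (beta * (beta + 1) + 6^-1)) &
      forall (g1 g2 : 'M[int]_2) fg, \det g1 = 1 -> \det g2 = 1 ->
        eps (g1 *m g2) fg = eps g1 (act_fg g2 fg) * eps g2 fg].

End Modular.

(* Main.v *)
(** With t = 2 pi i tau and v = 2 pi i (alpha - beta tau), let theta be the odd
    theta function with simple zeros on the lattice spanned by 2 pi i and t, and K
    its derivative at 0.  For insertions z_i of charges e_i with sum zero, and
    S = sum_i e_i z_i, the trace function is
      exp(t beta^2 / 2 + pi i alpha - beta S) K^n theta(v + S)
        prod_(i < j) theta(z_i - z_j)^(e_i e_j).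
    To see this, move the first mode cyclically around the trace (Wick's theorem).
    The resulting recursion has as kernel the sum over k of
    e^(-k z) / (1 - exp(-v + k t)), a quotient of theta functions, and the product
    formula satisfies the same recursion by a partial fraction expansion.  Both are
    cases of the fact that a quotient of entire functions with unimodular
    multipliers along two periods, and without poles, is constant.

    The trace converges exactly when the real parts of the insertion points
    strictly decrease with total spread less than - Re t: outside this set
    infinitely many of its terms stay away from 0.  Hence the trace determines a
    unique meromorphic function, the quotient above with its removable
    singularities removed.  Its behaviour under S and T follows from that of
    theta, where for charge zero the Gaussian factors combine by
    sum_(i < j) e_i e_j (z_i - z_j)^2 = - S^2 and
    sum_(i < j) e_i e_j = - n, and S and T generate SL(2,Z) as a monoid. *)
Require Import Defs.
From HB Require Import structures.
From mathcomp Require Import all_boot all_order all_algebra finmap.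
From mathcomp Require Import all_classical all_reals all_analysis.
From mathcomp Require Import freeg complex ring lra zify.
From mathcomp.analysis.showcase Require summability.
Set Implicit Arguments.
Unset Strict Implicit.
Unset Printing Implicit Defensive.
Import Order.TTheory GRing.Theory Num.Theory numFieldNormedType.Exports.
Local Open Scope classical_set_scope.
Local Open Scope ring_scope.
Local Notation basis := Defs.basis.

(** * Complex calculus *)

(** The recursion divides by 1 - exp(-v + k t), which vanishes for some k when alpha and beta are
    both integers. It is therefore run with alpha or beta not an integer, and the remaining case is
    a limit in alpha. The constant in the inversion of theta is found without Poisson summation: the
    product over the three half periods gives its cube, -i, and continuity along a segment from the
    fixed point t = - 2 pi of the inversion selects the root i. Interchanging the sums over modes
    and over the basis needs absolute convergence of the joint family. Mode k lowers a shifted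
    energy by k, and this energy is never negative, so each sum over k is dominated by a geometric
    series whose ratio comes from the gap between consecutive real parts. The complex analysis goes
    from Goursat's theorem on rectangles to the maximum principle; power series and residues do not
    occur. Divergence outside the domain matters because [is_G2n] constrains the continuation at
    every point where the trace converges, so the quotient must be shown to have the right value at
    all of them. *)

Section ComplexModulus.
Variable R : realType.
Local Notation C := (Cplx R).
Implicit Types (z w h : C) (r : R).

(** A real-valued modulus: the library norm on [Cplx R] takes values in [Cplx R], where the order is
    partial and [lra] does not apply. *)
Definition nm (z : C) : R := Normc.normc z.

Lemma nmE z : `|z| = toC (nm z).
Proof. by case: z. Qed.

Lemma nm_ge0 z : 0 <= nm z.
Proof. by case: z => a b; rewrite /nm /= sqrtr_ge0. Qed.

Lemma nm0 : nm 0 = 0. Proof. exact: Normc.normc0. Qed.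

Lemma nm1 : nm 1 = 1. Proof. exact: Normc.normc1. Qed.

Lemma nm_eq0 z : (nm z == 0) = (z == 0).
Proof.
by apply/eqP/eqP => [/(@Normc.eq0_normc R)|->]; [|exact: nm0].
Qed.

Lemma nm_gt0 z : (0 < nm z) = (z != 0).
Proof. by rewrite lt_def nm_ge0 andbT nm_eq0. Qed.

Lemma nmM z w : nm (z * w) = nm z * nm w.
Proof. exact: Normc.normcM. Qed.

Lemma nmX z n : nm (z ^+ n) = nm z ^+ n.
Proof. by elim: n => [|n IH]; rewrite ?expr0 ?nm1// !exprS nmM IH. Qed.

Lemma nmV z : nm z^-1 = (nm z)^-1.
Proof. exact: Normc.normcV. Qed.

Lemma nmN z : nm (- z) = nm z.
Proof. exact: normcN. Qed.

Lemma nmD z w : nm (z + w) <= nm z + nm w.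
Proof. exact: le_normcD. Qed.

Lemma nmB z w : nm (z - w) <= nm z + nm w.
Proof. by rewrite -[in leRHS](nmN w) nmD. Qed.

Lemma nmBC z w : nm (z - w) = nm (w - z).
Proof. by rewrite -nmN opprB. Qed.

Lemma nm_toC r : nm (toC r) = `|r|.
Proof. by rewrite /nm /toC /= expr0n /= addr0 sqrtr_sqr. Qed.

Lemma nm_nat n : nm n%:R = n%:R.
Proof.
have -> : (n%:R : C) = toC n%:R by rewrite /toC rmorph_nat.
by rewrite nm_toC normr_nat.
Qed.

Lemma nm_ReIm z : nm z ^+ 2 = complex.Re z ^+ 2 + complex.Im z ^+ 2.
Proof. by case: z => a b; rewrite /nm /= sqr_sqrtr// addr_ge0 ?sqr_ge0. Qed.

Lemma Re_le_nm z : `|complex.Re z| <= nm z.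
Proof.
rewrite -(@ler_pXn2r _ 2)// ?nnegrE ?nm_ge0// nm_ReIm real_normK ?num_real//.
by rewrite lerDl sqr_ge0.
Qed.

Lemma Im_le_nm z : `|complex.Im z| <= nm z.
Proof.
rewrite -(@ler_pXn2r _ 2)// ?nnegrE ?nm_ge0// nm_ReIm real_normK ?num_real//.
by rewrite lerDr sqr_ge0.
Qed.

Lemma nm_le_ReIm z : nm z <= `|complex.Re z| + `|complex.Im z|.
Proof.
rewrite -(@ler_pXn2r _ 2)// ?nnegrE ?nm_ge0 ?addr_ge0// nm_ReIm sqrrD.
by rewrite !real_normK ?num_real// lerD2r lerDl mulrn_wge0// mulr_ge0.
Qed.

Lemma nm_lb z w : nm z - nm w <= nm (z + w).
Proof. by rewrite lerBlDr -[in leRHS](nmN w) -{1}(addrK w z) nmD. Qed.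

Lemma toCD r r' : toC (r + r') = toC r + toC r'.
Proof. exact: rmorphD. Qed.
Lemma toCN r : toC (- r) = - toC r. Proof. exact: rmorphN. Qed.
Lemma toCB r r' : toC (r - r') = toC r - toC r'.
Proof. exact: rmorphB. Qed.
Lemma toCM r r' : toC (r * r') = toC r * toC r'.
Proof. exact: rmorphM. Qed.
Lemma toCV r : toC r^-1 = (toC r)^-1.
Proof. exact: fmorphV. Qed.
Lemma toCX r n : toC (r ^+ n) = toC r ^+ n.
Proof. exact: rmorphXn. Qed.
Lemma toC_nat n : toC n%:R = n%:R :> C.
Proof. by rewrite /toC rmorph_nat. Qed.
Lemma toC_int (k : int) : toC k%:~R = k%:~R :> C.
Proof. by rewrite /toC rmorph_int. Qed.
Lemma toC0 : toC 0 = 0 :> C. Proof. by []. Qed.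
Lemma toC1 : toC 1 = 1 :> C. Proof. by []. Qed.
Lemma toC_inj : injective (@toC R).
Proof. by move=> x y []. Qed.
Lemma ReD z w : complex.Re (z + w) = complex.Re z + complex.Re w.
Proof. by case: z; case: w. Qed.
Lemma ImD z w : complex.Im (z + w) = complex.Im z + complex.Im w.
Proof. by case: z; case: w. Qed.
Lemma ReN z : complex.Re (- z) = - complex.Re z. Proof. by case: z. Qed.
Lemma ImN z : complex.Im (- z) = - complex.Im z. Proof. by case: z. Qed.
Lemma ReM z w : complex.Re (z * w) =
  complex.Re z * complex.Re w - complex.Im z * complex.Im w.
Proof. by case: z; case: w. Qed.
Lemma ImM z w : complex.Im (z * w) =
  complex.Re z * complex.Im w + complex.Im z * complex.Re w.
Proof. by case: z => a b; case: w => c d /=; rewrite [b * _]mulrC. Qed.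

Lemma complex_eqP z w :
  complex.Re z = complex.Re w -> complex.Im z = complex.Im w -> z = w.
Proof. by case: z => a b; case: w => c d /= -> ->. Qed.

Lemma lt0C (e : C) : 0 < e -> exists2 r : R, 0 < r & e = toC r.
Proof.
by case: e => a b; rewrite ltcE /= => /andP[/eqP -> a0]; exists a.
Qed.

Lemma toC_gt0 r : (0 < toC r) = (0 < r).
Proof. exact: ltcR. Qed.

Lemma nm_lt z r : (`|z| < toC r) = (nm z < r).
Proof. by rewrite nmE ltcR. Qed.

Lemma nm_le z r : (`|z| <= toC r) = (nm z <= r).
Proof. by rewrite nmE lecR. Qed.

Lemma nbhsCP (E : normedModType C) (p : E) (P : E -> Prop) :
  (\forall z \near p, P z) <->
  exists2 r : R, 0 < r & forall z : E, `|p - z| < toC r -> P z.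
Proof.
split=> [/nbhs_normP[e /= /lt0C[r r0 ->]] pP|[r r0 pP]].
  by exists r => // z zp; exact: pP.
by apply/nbhs_normP; exists (toC r); rewrite /= ?toC_gt0//.
Qed.

Lemma nbhsC (p : C) (P : C -> Prop) : (\forall z \near p, P z) <->
  exists2 r : R, 0 < r & forall z : C, nm (p - z) < r -> P z.
Proof.
split=> [/(nbhsCP (E := (C : normedModType C)))[r r0 H]|[r r0 H]].
  by exists r => // z; rewrite -nm_lt; exact: H.
apply/(nbhsCP (E := (C : normedModType C))).
by exists r => // z; rewrite nm_lt; exact: H.
Qed.

Definition iu : C := Complex 0 1.

Lemma nm_iu : nm iu = 1.
Proof. by rewrite /nm /= expr0n expr1n add0r sqrtr1. Qed.

Lemma iu_sq : iu * iu = -1.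
Proof. by apply: complex_eqP; rewrite ?ReM ?ImM /= ; ring. Qed.

Lemma complex_split z : z = toC (complex.Re z) + iu * toC (complex.Im z).
Proof. by apply: complex_eqP; rewrite ?ReD ?ImD ?ReM ?ImM /=; ring. Qed.

End ComplexModulus.
Arguments nm {R} z : simpl never.

(** * Complex derivatives in epsilon-delta form *)

Section ComplexDerivative.
Variable R : realType.
Local Notation C := (Cplx R).
Implicit Types (f g : C -> C) (z w h d : C).

(** The derivative as an explicit bound on the remainder, which is the form used in all estimates;
    [cdiffP] and [differentiableC] connect it with the derivatives of the library. *)
Definition cdiff (f : C -> C) (z d : C) := forall e : R, 0 < e ->
  exists2 r : R, 0 < r & forall h : C, nm h < r ->
    nm (f (z + h) - f z - d * h) <= e * nm h.

Lemma cdiffP f z d : cdiff f z d <-> is_derive (z : C) (1 : C) f d.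
Proof.
split=> [fd|[]].
  have cv : (fun h : C => h^-1 *: ((f \o shift z) (h *: 1) - f z)) @ 0^' --> d.
    apply/cvgrPdist_le => e /lt0C[r r0 ->].
    have [s s0 fs] := fd _ r0.
    rewrite near_withinE; apply/nbhsC; exists s => // h hs h0.
    rewrite nm_le /= scaler1.
    rewrite sub0r nmN in hs.
    have /= := fs _ hs; rewrite addrC (addrC z) => le1.
    rewrite -(@ler_pM2r _ (nm h)) ?nm_gt0// (le_trans _ le1)// -nmM.
    rewrite -[leRHS]nmN /GRing.scale /= opprD opprK.
    have <- : (d - h^-1 * (f (h + z) - f z)) * h = d * h - (f (h + z) - f z).
      by rewrite mulrBl mulrAC mulVf// mul1r.
    by [].
  by apply: DeriveDef; [apply/cvg_ex; exists d|exact: cvg_lim cv].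
move=> /cvg_ex[d' cv] dd e e0.
have d'd : d' = d by rewrite -dd; apply/esym/(cvg_lim _ cv).
move/cvgrPdist_le : cv => /(_ (toC e)); rewrite toC_gt0 => /(_ e0).
rewrite near_withinE => /nbhsC[r r0 fr].
exists r => // h hr.
have [->|h0] := eqVneq h 0; first by rewrite addr0 subrr mulr0 subr0 nm0 mulr0.
have := fr h; rewrite sub0r nmN => /(_ hr h0).
rewrite nm_le /= scaler1 d'd -(@ler_pM2r _ (nm h)) ?nm_gt0// -nmM.
rewrite -nmN /GRing.scale /= (addrC z).
suff <- : - ((d - h^-1 * (f (h + z) - f z)) * h) = f (h + z) - f z - d * h by [].
by rewrite mulrBl mulrAC mulVf// mul1r opprB.
Qed.

Lemma differentiableC f z : differentiable f z <-> exists d, cdiff f z d.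
Proof.
split=> [/derivable1_diffP/derivableP/cdiffP|[d /cdiffP[]]].
  by exists ('D_1 f z).
by move=> /derivable1_diffP.
Qed.

Lemma cdiff_unique f z d d' : cdiff f z d -> cdiff f z d' -> d = d'.
Proof. by move=> /cdiffP[_ <-] /cdiffP[_ <-]. Qed.

Lemma cdiff_cst c z : cdiff (fun=> c) z 0.
Proof.
by move=> e e0; exists 1 => // h _; rewrite subrr mul0r subr0 nm0 mulr_ge0 ?nm_ge0 1?ltW.
Qed.

Lemma cdiff_id z : cdiff id z 1.
Proof.
move=> e e0; exists 1 => // h _; rewrite mul1r (addrC z) addrK subrr nm0.
by rewrite mulr_ge0 ?nm_ge0 1?ltW.
Qed.

Lemma cdiffD f g z d d' : cdiff f z d -> cdiff g z d' ->
  cdiff (fun x => f x + g x) z (d + d').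
Proof. by move=> /cdiffP ? /cdiffP ?; apply/cdiffP; exact: is_deriveD. Qed.

Lemma cdiffN f z d : cdiff f z d -> cdiff (fun x => - f x) z (- d).
Proof. by move=> /cdiffP ?; apply/cdiffP; exact: is_deriveN. Qed.

Lemma cdiffB f g z d d' : cdiff f z d -> cdiff g z d' ->
  cdiff (fun x => f x - g x) z (d - d').
Proof. by move=> /cdiffP ? /cdiffP ?; apply/cdiffP; exact: is_deriveB. Qed.

Lemma cdiffM f g z d d' : cdiff f z d -> cdiff g z d' ->
  cdiff (fun x => f x * g x) z (d * g z + f z * d').
Proof.
move=> /cdiffP ? /cdiffP ?; apply/cdiffP.
by apply: is_derive_eq; rewrite /GRing.scale /= addrC mulrC [_ * d']mulrC mulrC.
Qed.

Lemma cdiffZ (c : C) f z d : cdiff f z d -> cdiff (fun x => c * f x) z (c * d).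
Proof.
by move=> fd; have := cdiffM (cdiff_cst c z) fd; rewrite mul0r add0r.
Qed.

Lemma cdiff_lip f z d : cdiff f z d -> exists2 r : R, 0 < r & forall h, nm h < r ->
  nm (f (z + h) - f z) <= (nm d + 1) * nm h.
Proof.
move=> /(_ 1 ltr01)[r r0 H]; exists r => // h /H le1.
rewrite -(subrK (d * h) (f _ - _)) mulrDl addrC (le_trans (nmD _ _))//.
by rewrite nmM lerD2l.
Qed.

Lemma cdiff_cont f z d : cdiff f z d -> forall e : R, 0 < e ->
  exists2 r : R, 0 < r & forall h, nm h < r -> nm (f (z + h) - f z) < e.
Proof.
move=> /cdiff_lip[r r0 H] e e0.
have d0 : 0 < nm d + 1 by rewrite ltr_wpDl// nm_ge0.
exists (Num.min r (e / (nm d + 1))) => [|h]; first by rewrite lt_min r0 divr_gt0.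
rewrite lt_min => /andP[/H le1 lt2]; rewrite (le_lt_trans le1)//.
by rewrite mulrC -ltr_pdivlMr.
Qed.

Lemma cdiff_comp f g z d d' : cdiff f z d -> cdiff g (f z) d' ->
  cdiff (fun x => g (f x)) z (d' * d).
Proof.
move=> fd gd e e0.
have d0 : 0 < nm d + 1 by rewrite ltr_wpDl// nm_ge0.
have d'0 : 0 < nm d' + 1 by rewrite ltr_wpDl// nm_ge0.
have [r1 r10 H1] := cdiff_lip fd.
have [r2 r20 H2] := gd (e / 2 / (nm d + 1)) (divr_gt0 (divr_gt0 e0 (ltr0Sn _ _)) d0).
have [r3 r30 H3] := cdiff_cont fd r20.
have [r4 r40 H4] := fd (e / 2 / (nm d' + 1)) (divr_gt0 (divr_gt0 e0 (ltr0Sn _ _)) d'0).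
exists (Num.min r1 (Num.min r3 r4)) => [|h]; first by rewrite !lt_min r10 r30 r40.
rewrite !lt_min => /and3P[/H1 a1 /H3 a3 /H4 a4].
have := H2 _ a3; rewrite [f z + _]addrC subrK => a2.
have -> : g (f (z + h)) - g (f z) - d' * d * h =
  (g (f (z + h)) - g (f z) - d' * (f (z + h) - f z)) +
  d' * (f (z + h) - f z - d * h) by ring.
rewrite (le_trans (nmD _ _))// nmM [e](splitr e) mulrDl lerD//.
  rewrite (le_trans a2)//.
  have k0 : 0 <= e / 2 / (nm d + 1) by rewrite ltW// !divr_gt0.
  rewrite (le_trans (ler_wpM2l k0 a1))//.
  by rewrite mulrA divfK// gt_eqF.
rewrite (le_trans (ler_wpM2l (nm_ge0 _) a4))//.
rewrite mulrA ler_wpM2r ?nm_ge0// mulrCA ler_piMr//; first by rewrite ltW// divr_gt0.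
by rewrite ltW// ltr_pdivrMr// mul1r ltrDl.
Qed.

Lemma cdiff_inv z : z != 0 -> cdiff (fun x : C => x^-1) z (- z^-2).
Proof.
move=> z0 e e0; have nz0 : 0 < nm z by rewrite nm_gt0.
(* The first radius gives |z + h| >= |z| / 2, so the remainder h^2 / (z^2 (z + h)) is at most 2
   |h|^2 / |z|^3; the second radius makes this at most e |h|. *)
exists (Num.min (nm z / 2) (e * nm z ^+ 3 / 2)) => [|h].
  by rewrite lt_min !divr_gt0// mulr_gt0// exprn_gt0.
rewrite lt_min => /andP[h1 h2].
have zh : nm z / 2 <= nm (z + h).
  rewrite (le_trans _ (nm_lb _ _))// lerBrDr -lerBrDl.
  by rewrite (le_trans (ltW h1))// {2}(splitr (nm z)) addrK.
have zh0 : z + h != 0 by rewrite -nm_gt0 (lt_le_trans _ zh)// divr_gt0.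
have -> : (z + h)^-1 - z^-1 - - z^-2 * h = h * (h * (z ^+ 2 * (z + h))^-1).
  by field; rewrite z0 zh0.
rewrite nmM [e * _]mulrC ler_wpM2l ?nm_ge0// nmM nmV nmM nmX.
rewrite ler_pdivrMr ?mulr_gt0 ?exprn_gt0 ?nm_gt0//.
rewrite (le_trans (ltW h2))// -mulrA ler_wpM2l ?(ltW e0)//.
by rewrite exprSr -mulrA ler_wpM2l ?exprn_ge0 ?nm_ge0.
Qed.

Lemma cdiffV f z d : f z != 0 -> cdiff f z d ->
  cdiff (fun x => (f x)^-1) z (- (f z)^-2 * d).
Proof. by move=> fz0 fd; apply: (cdiff_comp fd); exact: cdiff_inv. Qed.

Lemma cdiff_eq f z d d' : cdiff f z d -> d = d' -> cdiff f z d'.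
Proof. by move=> ? <-. Qed.

Lemma cdiff_near f g z d : cdiff f z d ->
  (exists2 r : R, 0 < r & forall h, nm h < r -> g (z + h) = f (z + h)) ->
  cdiff g z d.
Proof.
move=> fd [r r0 gf] e e0; have [s s0 fs] := fd _ e0.
exists (Num.min r s) => [|h]; first by rewrite lt_min r0.
rewrite lt_min => /andP[hr /fs]; rewrite -gf//.
by rewrite -[in f z](addr0 z) -gf ?addr0// nm0.
Qed.

Definition cdf f z := exists d, cdiff f z d.
Definition entire f := forall z, cdf f z.

Lemma cdfD f g z : cdf f z -> cdf g z -> cdf (fun x => f x + g x) z.
Proof. by move=> [d fd] [d' gd]; eexists; exact: cdiffD fd gd. Qed.
Lemma cdfB f g z : cdf f z -> cdf g z -> cdf (fun x => f x - g x) z.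
Proof. by move=> [d fd] [d' gd]; eexists; exact: cdiffB fd gd. Qed.
Lemma cdfM f g z : cdf f z -> cdf g z -> cdf (fun x => f x * g x) z.
Proof. by move=> [d fd] [d' gd]; eexists; exact: cdiffM fd gd. Qed.
Lemma cdf_cst c z : cdf (fun=> c) z.
Proof. by eexists; exact: cdiff_cst. Qed.
Lemma cdf_id z : cdf id z.
Proof. by eexists; exact: cdiff_id. Qed.
Lemma cdf_comp f g z : cdf f z -> cdf g (f z) -> cdf (fun x => g (f x)) z.
Proof. by move=> [d fd] [d' gd]; eexists; exact: cdiff_comp fd gd. Qed.
Lemma cdfV f z : f z != 0 -> cdf f z -> cdf (fun x => (f x)^-1) z.
Proof. by move=> f0 [d fd]; eexists; exact: cdiffV fd. Qed.
Lemma cdfX f n z : cdf f z -> cdf (fun x => f x ^+ n) z.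
Proof.
move=> fd; elim: n => [|n IH]; first exact: cdf_cst.
by under eq_fun do rewrite exprS; exact: cdfM.
Qed.

End ComplexDerivative.
Section RealDerivative.
Variable R : realType.

Definition rdiff (f : R -> R) (x d : R) := forall e : R, 0 < e ->
  exists2 r : R, 0 < r & forall h : R, `|h| < r ->
    `|f (x + h) - f x - d * h| <= e * `|h|.

Lemma rdiffP f x d : rdiff f x d <-> is_derive (x : R) (1 : R) f d.
Proof.
have eqn h : h != 0 ->
    `|d - h^-1 *: ((f \o shift x) (h *: 1) - f x)| * `|h| =
    `|f (x + h) - f x - d * h|.
  move=> h0; rewrite /= scaler1 -normrM mulrBl /GRing.scale /= mulrAC mulVf//.
  by rewrite mul1r distrC (addrC h).
split=> [fd|[]].
  have cv : (fun h : R => h^-1 *: ((f \o shift x) (h *: 1) - f x)) @ 0^' --> d.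
    apply/cvgrPdist_le => e e0; have [s s0 fs] := fd _ e0.
    rewrite near_withinE; apply/nbhs_normP; exists s => // h.
    rewrite /= sub0r normrN => hs h0.
    by rewrite -(@ler_pM2r _ `|h|) ?normr_gt0// eqn//; exact: fs.
  by apply: DeriveDef; [apply/cvg_ex; exists d|exact: cvg_lim cv].
move=> /cvg_ex[d' cv] dd e e0.
have d'd : d' = d by rewrite -dd; apply/esym/(cvg_lim _ cv).
rewrite d'd in cv; move/cvgrPdist_le : cv => /(_ _ e0).
rewrite near_withinE => /nbhs_normP[r /= r0 fr].
exists r => // h hr; have [->|h0] := eqVneq h 0.
  by rewrite addr0 subrr mulr0 subr0 normr0 mulr0.
rewrite -eqn// ler_pM2r ?normr_gt0//; apply: fr => //=.
by rewrite sub0r normrN.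
Qed.

End RealDerivative.

(** * The complex exponential and its Taylor remainder *)

Section ComplexExponential.
Variable R : realType.
Local Notation C := (Cplx R).
Implicit Types (z w h : C).

Lemma Re_toC (r : R) : complex.Re (toC r) = r. Proof. by []. Qed.
Lemma Im_toC (r : R) : complex.Im (toC r) = 0. Proof. by []. Qed.

Lemma cexpRe z : complex.Re (cexp z) = expR (complex.Re z) * cos (complex.Im z).
Proof. by rewrite /cexp ReM Re_toC Im_toC mul0r subr0. Qed.

Lemma cexpIm z : complex.Im (cexp z) = expR (complex.Re z) * sin (complex.Im z).
Proof. by rewrite /cexp ImM Re_toC Im_toC mul0r addr0. Qed.

Lemma cexpD z w : cexp (z + w) = cexp z * cexp w.
Proof.
by apply: complex_eqP; rewrite ?(ReM, ImM, cexpRe, cexpIm, ReD, ImD, expRD, cosD, sinD); ring.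
Qed.

Lemma cexp0 : cexp 0 = 1 :> C.
Proof.
by apply: complex_eqP; rewrite ?cexpRe ?cexpIm /= expR0 mul1r ?cos0 ?sin0.
Qed.

Lemma nm_cexp z : nm (cexp z) = expR (complex.Re z).
Proof.
apply/eqP; rewrite -(@eqrXn2 _ 2)// ?nm_ge0 ?expR_ge0//; apply/eqP.
by rewrite nm_ReIm cexpRe cexpIm !exprMn -mulrDr cos2Dsin2 mulr1.
Qed.

Lemma cexp_neq0 z : cexp z != 0.
Proof. by rewrite -nm_gt0 nm_cexp expR_gt0. Qed.

Lemma cexpN z : cexp (- z) = (cexp z)^-1.
Proof.
by apply: (mulfI (cexp_neq0 z)); rewrite -cexpD subrr cexp0 mulfV// cexp_neq0.
Qed.

Lemma cexpB z w : cexp (z - w) = cexp z / cexp w.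
Proof. by rewrite cexpD cexpN. Qed.

Lemma cexpMn z n : cexp (n%:R * z) = cexp z ^+ n.
Proof.
elim: n => [|n IH]; first by rewrite mul0r cexp0.
by rewrite exprS -IH -cexpD mulrSr mulrDl mul1r addrC.
Qed.

Lemma cexpMz z (k : int) : cexp (k%:~R * z) = cexp z ^ k.
Proof.
case: k => n; first by rewrite -exprnP -cexpMn pmulrn.
by rewrite NegzE mulrNz mulNr cexpN -exprnN -cexpMn pmulrn.
Qed.

Lemma Re_twopii : complex.Re (twopii R) = 0. Proof. by []. Qed.
Lemma Im_twopii : complex.Im (twopii R) = 2 * pi. Proof. by []. Qed.

Lemma cexp_2pii : cexp (twopii R) = 1.
Proof.
by apply: complex_eqP;
   rewrite ?(cexpRe, cexpIm) /= mulr_natl ?(cos2pi, sin2pi) expR0; ring.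
Qed.

Lemma cexp_2piik (k : int) : cexp (k%:~R * twopii R) = 1.
Proof. by rewrite cexpMz cexp_2pii exp1rz. Qed.

Lemma cexpD2pii z : cexp (z + twopii R) = cexp z.
Proof. by rewrite cexpD cexp_2pii mulr1. Qed.

Lemma cexp_pii : cexp (twopii R / 2) = -1.
Proof.
have -> : twopii R / 2 = Complex 0 pi.
  have -> : (2^-1 : C) = toC 2^-1 by rewrite toCV (toC_nat R 2).
  by apply: complex_eqP; rewrite ?ReM ?ImM /= ; field.
by apply: complex_eqP; rewrite ?cexpRe ?cexpIm /= ?cospi ?sinpi expR0; ring.
Qed.

(** The functional equation reduces the derivative of [cexp] to this point. The real part e^a cos b
    - 1 - a and the imaginary part e^a sin b - b of the remainder are bounded by 3/8 and 5/8 of e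
    |h|, using the first-order expansions of exp, sin and cos at 0. *)
Lemma cexp_diff0 : cdiff (@cexp R) 0 1.
Proof.
have rE : rdiff (@expR R) 0 1 
  by apply/rdiffP; apply: is_derive_eq; exact: expR0.
have rS : rdiff (@sin R) 0 1 
  by apply/rdiffP; apply: is_derive_eq; exact: cos0.
have rC : rdiff (@cos R) 0 0.
  by apply/rdiffP; apply: is_derive_eq; rewrite sin0 oppr0.
move=> e e0.
have e8 : 0 < e / 8 by rewrite divr_gt0.
have [r1 r10 H1] := rE _ e8; have [r2 r20 H2] := rS _ e8; have [r3 r30 H3] := rC _ e8.
have [r4 r40 H4] := rE _ ltr01; have [r5 r50 H5] := rS _ ltr01.
exists (Num.min (Num.min (Num.min r1 r2) (Num.min r3 r4))
    (Num.min r5 (Num.min 1 (e / 8)))) => [|h].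
  by rewrite !lt_min r10 r20 r30 r40 r50 ltr01 e8.
rewrite !lt_min => /andP[/andP[/andP[k1 k2] /andP[k3 k4]] /and3P[k5 k6 k7]].
pose a := complex.Re h; pose b := complex.Im h.
have ah : `|a| <= nm h by exact: Re_le_nm.
have bh : `|b| <= nm h by exact: Im_le_nm.
have := H1 a (le_lt_trans ah k1); have := H2 b (le_lt_trans bh k2).
have := H3 b (le_lt_trans bh k3); have := H4 a (le_lt_trans ah k4).
have := H5 b (le_lt_trans bh k5).
rewrite !add0r expR0 sin0 cos0 !mul1r mul0r !subr0 => B5 B4 B3 B2 B1.
rewrite cexp0 (le_trans (nm_le_ReIm _))//.
rewrite !ReD !ImD !ReN !ImN cexpRe cexpIm.
have -> : complex.Re (1 : C) = 1 by []. have -> : complex.Im (1 : C) = 0 by [].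
rewrite -/a -/b oppr0 addr0.
have hp : 0 <= nm h := nm_ge0 h.
have A1 : `|expR a * cos b - 1 - a| <= 3 * (e / 8) * nm h.
  have -> : expR a * cos b - 1 - a = (expR a - 1 - a) * cos b + (1 + a) * (cos b - 1) by ring.
  rewrite (le_trans (ler_normD _ _))// !normrM.
  have t1 : `|expR a - 1 - a| * `|cos b| <= e / 8 * nm h * 1.
    by rewrite ler_pM// ?cos_max// (le_trans B1)// ler_wpM2l// ltW.
  have t2 : `|1 + a| * `|cos b - 1| <= 2 * (e / 8 * nm h).
    rewrite ler_pM//; last by rewrite (le_trans B3)// ler_wpM2l// ltW.
    by rewrite (le_trans (ler_normD _ _))// normr1 -[2]/(1 + 1) lerD2l (le_trans ah)// ltW.
  by nra.
have A2 : `|expR a * sin b - b| <= 5 * (e / 8) * nm h.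
  have -> : expR a * sin b - b = (expR a - 1) * sin b + (sin b - b) by ring.
  rewrite (le_trans (ler_normD _ _))// !normrM.
  have ea : `|expR a - 1| <= 2 * (e / 8).
    rewrite -(subrK a (_ - 1)) (le_trans (ler_normD _ _))//.
    have := le_lt_trans ah k7; lra.
  have sb : `|sin b| <= 2 * nm h.
    rewrite -(subrK b (sin b)) (le_trans (ler_normD _ _))//; lra.
  have t1 : `|expR a - 1| * `|sin b| <= 2 * (e / 8) * (2 * nm h) by rewrite ler_pM.
  have t2 : `|sin b - b| <= e / 8 * nm h by rewrite (le_trans B2)// ler_wpM2l// ltW.
  lra.
rewrite (le_trans (lerD A1 A2))// -mulrDl ler_wpM2r//; lra.
Qed.

Lemma cdiff_cexp z : cdiff (@cexp R) z (cexp z).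
Proof.
have -> : @cexp R = fun x => cexp z * cexp (x - z).
  by apply/funext => x; rewrite -cexpD addrC subrK.
apply: cdiff_eq; first apply: cdiffZ.
  apply: (cdiff_comp (f := fun x => x - z) (d' := 1)).
    by apply: cdiffB; [exact: cdiff_id|exact: cdiff_cst].
  by rewrite subrr; exact: cexp_diff0.
by rewrite /= subrr cexp0 subr0 !mulr1.
Qed.

(** The real mean value theorem is applied to the real and to the imaginary part along the segment;
    each contributes M |h|, hence the factor 2. *)
Lemma mean_value_bound f df z h (M : R) :
  (forall t : R, 0 <= t <= 1 -> cdiff f (z + toC t * h) (df (z + toC t * h))) ->
  (forall t : R, 0 <= t <= 1 -> nm (df (z + toC t * h)) <= M) ->
  nm (f (z + h) - f z) <= 2 * (M * nm h).
Proof.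
move=> fd fM.
have part (p : C -> R) : (forall x y, p (x - y) = p x - p y) ->
    (forall x (t : R), p (x * toC t) = p x * t) -> (forall x, `|p x| <= nm x) ->
    `|p (f (z + h)) - p (f z)| <= M * nm h.
  move=> pB pZ pl.
  pose g t := p (f (z + toC t * h)); pose dg t := p (df (z + toC t * h) * h).
  have gd (t : R) : 0 <= t <= 1 -> is_derive t 1 g (dg t).
    move=> t01; apply/rdiffP => e e0.
    have [h0|h0] := eqVneq h 0.
      exists 1 => // s _; rewrite /g /dg h0 !mulr0 addr0 subrr sub0r -(pZ 0).
      have p0 : p 0 = 0 by have := pB 0 0; rewrite !subrr.
      by rewrite mul0r p0 oppr0 normr0 mulr_ge0// ltW.
    have nh : 0 < nm h by rewrite nm_gt0.
    have [r r0 H] := fd _ t01 (e / nm h) (divr_gt0 e0 nh).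
    exists (r / nm h) => [|s]; first by rewrite divr_gt0.
    rewrite ltr_pdivlMr// => sr.
    have nsh : nm (toC s * h) = `|s| * nm h by rewrite nmM nm_toC.
    have := H (toC s * h); rewrite nsh => /(_ sr).
    have -> : e / nm h * (`|s| * nm h) = e * `|s| by field; rewrite gt_eqF.
    move=> le1; rewrite /g /dg -pZ -!pB (le_trans (pl _))// toCD mulrDl addrA.
    by rewrite -[_ * h * toC s]mulrA [h * _]mulrC.
  have [] := @MVT_segment R g dg 0 1 ler01.
  - by move=> x; rewrite in_itv /= => /andP[x0 x1]; apply: gd; rewrite !ltW.
  - apply: derivable_within_continuous => x; rewrite in_itv /= => x01.
    by have [] := gd _ x01.
  move=> t; rewrite in_itv /= => t01; rewrite /g mul1r mul0r addr0 subr0 mulr1 => ->.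
  by rewrite (le_trans (pl _))// nmM ler_wpM2r ?nm_ge0// fM.
have M0 : 0 <= M by rewrite (le_trans (nm_ge0 _) (fM 0 _))// lexx ler01.
rewrite (le_trans (nm_le_ReIm _))// mulr_natl mulr2n lerD//.
  rewrite ReD ReN; apply: part => [x y|x t|x]; last exact: Re_le_nm.
    by rewrite ReD ReN.
  by rewrite ReM Re_toC Im_toC mulr0 subr0.
rewrite ImD ImN; apply: part => [x y|x t|x]; last exact: Im_le_nm.
  by rewrite ImD ImN.
by rewrite ImM Re_toC Im_toC mulr0 add0r.
Qed.

Definition exp_sum n z : C := \sum_(k < n) z ^+ k / k`!%:R.

Lemma exp_sumS n z : exp_sum n.+1 z = exp_sum n z + z ^+ n / n`!%:R.
Proof. by rewrite /exp_sum big_ord_recr. Qed.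

Lemma cdiff_exp_sum n z : cdiff (exp_sum n.+1) z (exp_sum n z).
Proof.
have dX k : cdiff (fun x : C => x ^+ k.+1) z (k.+1%:R * z ^+ k).
  elim: k => [|k IH]; first by rewrite mulr1; exact: cdiff_id.
  rewrite (_ : (fun x => _) = fun x => x * x ^+ k.+1); last by apply/funext=> x; rewrite exprS.
  apply: cdiff_eq; first by apply: cdiffM IH; exact: cdiff_id.
  by rewrite mul1r mulrCA -exprS -[k.+2]addn1 natrD mulrDl mul1r addrC.
elim: n => [|n IH].
  rewrite (_ : exp_sum 1 = fun=> 1); first by rewrite /exp_sum big_ord0; exact: cdiff_cst.
  by apply/funext => x; rewrite /exp_sum big_ord1 expr0 divr1.
rewrite (_ : exp_sum n.+2 = fun x => exp_sum n.+1 x + (n.+1`!%:R)^-1 * x ^+ n.+1); last first.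
  by apply/funext => x; rewrite exp_sumS [X in _ + X]mulrC.
apply: cdiff_eq; first by apply: cdiffD IH _; apply: cdiffZ; exact: dX.
rewrite exp_sumS; congr (_ + _); rewrite factS natrM invfM.
by rewrite mulrACA mulVf ?pnatr_eq0// mul1r mulrC.
Qed.

(** The derivative of e^(-x) times the partial sum telescopes to - e^(-x) x^n / n!, so
    [mean_value_bound] on the segment from 0 to z controls the distance of this product from 1. *)
Lemma exp_sum_bound n z :
  nm (exp_sum n.+1 z - cexp z) <=
  2 * (expR (2 * nm z) * (nm z * (nm z ^+ n / n`!%:R))).
Proof.
pose F (x : C) : C := cexp (- x) * exp_sum n.+1 x.
pose dF (x : C) : C := - cexp (- x) * x ^+ n / n`!%:R.
have Fd x : cdiff F x (dF x).
  apply: cdiff_eq; first apply: cdiffM (cdiff_exp_sum n x).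
    by apply: cdiff_comp (cdiff_cexp _); apply: cdiffN; exact: cdiff_id.
  by rewrite exp_sumS /dF; ring.
have := @mean_value_bound F dF 0 z (expR (nm z) * (nm z ^+ n / n`!%:R)) _ _; rewrite !add0r.
have -> : F 0 = 1.
  rewrite /F oppr0 cexp0 mul1r /exp_sum big_ord_recl expr0 divr1 big1 ?addr0// => i _.
  by rewrite expr0n mul0r.
have H1 (t : R) : 0 <= t <= 1 -> cdiff F (0 + toC t * z) (dF (0 + toC t * z)) by [].
have H2 (t : R) : 0 <= t <= 1 -> nm (dF (0 + toC t * z)) <= expR (nm z) * (nm z ^+ n / n`!%:R).
  move=> /andP[t0 t1]; rewrite add0r /dF !nmM nmN nm_cexp nmX nmM nm_toC ger0_norm//.
  have tz : t * nm z <= nm z by rewrite ler_piMl// nm_ge0.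
  rewrite -mulrA ler_pM// ?expR_ge0// ?mulr_ge0 ?exprn_ge0 ?mulr_ge0 ?nm_ge0//.
    rewrite ler_expR (le_trans _ tz)// (le_trans (ler_norm _))// (le_trans (Re_le_nm _))//.
    by rewrite nmN nmM nm_toC ger0_norm.
  rewrite nmV nm_nat ler_wpM2r ?invr_ge0 ?ler0n//.
  by rewrite lerXn2r// nnegrE ?mulr_ge0 ?nm_ge0.
move=> /(_ H1 H2) le1.
have -> : exp_sum n.+1 z - cexp z = cexp z * (F z - 1).
  by rewrite /F mulrBr mulrA -cexpD subrr cexp0 mul1r mulr1.
rewrite nmM nm_cexp (le_trans (ler_wpM2l (expR_ge0 _) le1))//.
rewrite mulrCA ler_wpM2l//; set X := nm z ^+ n / _.
have X0 : 0 <= nm z * X by rewrite mulr_ge0 ?divr_ge0 ?exprn_ge0 ?nm_ge0 ?ler0n.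
have -> : expR (complex.Re z) * (expR (nm z) * X * nm z) =
  expR (complex.Re z) * expR (nm z) * (nm z * X) by ring.
rewrite ler_wpM2r//.
rewrite -expRD ler_expR mulr_natl mulr2n lerD2r (le_trans (ler_norm _))//.
exact: Re_le_nm.
Qed.

Lemma cexp_second_order z : nm (cexp z - 1 - z) <= 2 * (expR (2 * nm z) * nm z ^+ 2).
Proof.
have := exp_sum_bound 1 z.
rewrite /exp_sum big_ord_recr big_ord1 /= expr0 !divr1 expr1 nmBC opprD addrA.
by rewrite expr2.
Qed.

End ComplexExponential.
Section ComplexLog.
Variable R : realType.
Local Notation C := (Cplx R).
Implicit Types (z w h : C).

(** After subtraction of a multiple of 2 pi i the imaginary part y lies in [0, 2 pi), and 1 = cos y
    = 1 - 2 sin(y/2)^2 leaves only y = 0. *)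
Lemma cexp_eq1 z : cexp z = 1 -> exists k : int, z = k%:~R * twopii R.
Proof.
move=> z1.
have Rez : complex.Re z = 0.
  by apply: expR_inj; rewrite -nm_cexp z1 nm1 expR0.
pose p2 : R := 2 * pi.
have p20 : 0 < p2 by rewrite mulr_gt0// pi_gt0.
pose k := Num.floor (complex.Im z / p2).
pose w := z - k%:~R * twopii R.
have w1 : cexp w = 1 by rewrite /w cexpB cexp_2piik divr1.
have Imw : complex.Im w = complex.Im z - k%:~R * p2.
  rewrite /w ImD ImN ImM -toC_int Re_toC Im_toC Re_twopii Im_twopii.
  by rewrite mul0r addr0.
have w0 : 0 <= complex.Im w.
  by rewrite Imw subr_ge0 -ler_pdivlMr// floor_le.
have w2 : complex.Im w < p2.
  rewrite Imw ltrBlDr -{1}[p2]mul1r -mulrDl addrC -ltr_pdivrMr//.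
  by rewrite -[1]/(1%:~R) -intrD floorD1_gt.
have Rew : complex.Re w = 0.
  by rewrite /w ReD ReN ReM -toC_int Re_toC Im_toC Re_twopii Im_twopii Rez; ring.
have cw : cos (complex.Im w) = 1.
  by have := cexpRe w; rewrite w1 Rew expR0 mul1r => <-.
suff wI : complex.Im w = 0.
  exists k; apply/eqP; rewrite -subr_eq0; apply/eqP.
  by apply: complex_eqP.
apply/eqP; rewrite eq_le w0 andbT leNgt; apply/negP => wp.
have s0 : 0 < sin (complex.Im w / 2).
  apply: sin_gt0_pi; rewrite divr_gt0//= ltr_pdivrMr// mulrC.
  exact: w2.
have := cosD (complex.Im w / 2) (complex.Im w / 2).
rewrite -splitr cw -!expr2 cos2sin2 => H.
by have := exprn_gt0 2 s0; lra.
Qed.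

End ComplexLog.
(** * Goursat's theorem and the identity theorem *)

Section SegmentIntegral.
Variable R : realType.
Local Notation mu := (@lebesgue_measure R).
Implicit Types (f : R -> R) (a b c : R).

Definition rcont f a b := forall t, a <= t <= b -> {for t, continuous f}.

Definition rint a b f : R := \int[mu]_(x in `[a, b]) f x.

Lemma rcont_integrable f a b : rcont f a b -> mu.-integrable `[a, b] (EFin \o f).
Proof.
move=> fc; apply: continuous_compact_integrable; first exact: segment_compact.
apply: continuous_in_subspaceT => t; rewrite inE /= in_itv /= => tab.
exact: fc.
Qed.

Lemma rintD a b f g : rcont f a b -> rcont g a b ->
  rint a b (fun x => f x + g x) = rint a b f + rint a b g.
Proof. by move=> fc gc; rewrite /rint RintegralD//; exact: rcont_integrable. Qed.

Lemma rintZ a b (k : R) f : rcont f a b -> rint a b (fun x => k * f x) = k * rint a b f.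
Proof. by move=> fc; rewrite /rint RintegralZl//; exact: rcont_integrable. Qed.

Lemma eq_rint a b f g : (forall t, a <= t <= b -> f t = g t) -> rint a b f = rint a b g.
Proof.
by move=> fg; apply: eq_Rintegral => t; rewrite inE /= in_itv /= => /fg.
Qed.

Lemma rint_le a b f g : rcont f a b -> rcont g a b ->
  (forall t, a <= t <= b -> f t <= g t) -> rint a b f <= rint a b g.
Proof.
move=> fc gc fg; by apply: le_Rintegral => //; exact: rcont_integrable.
Qed.

Lemma rcont_cst k a b : rcont (fun=> k) a b.
Proof. by move=> t _; exact: cvg_cst. Qed.

Lemma rint_cst a b (k : R) : a <= b -> rint a b (fun=> k) = k * (b - a).
Proof.
move=> ab; rewrite /rint Rintegral_cst//; congr (_ * _).
apply: (etrans (congr1 fine (@lebesgue_measure_itv R `[a, b]%R))).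
rewrite /= lte_fin; case: ltP => //= ba.
by have -> : a = b; [apply/eqP; rewrite eq_le ab|rewrite subrr].
Qed.

Lemma rint_bound a b f (M : R) : a <= b -> rcont f a b ->
  (forall t, a <= t <= b -> `|f t| <= M) -> `|rint a b f| <= M * (b - a).
Proof.
move=> ab fc fM; rewrite ler_norml; apply/andP; split.
  rewrite -mulNr -rint_cst//; apply: rint_le => //; first exact: rcont_cst.
  by move=> t /fM; rewrite ler_norml => /andP[].
rewrite -rint_cst//; apply: rint_le => //; first exact: rcont_cst.
by move=> t /fM; rewrite ler_norml => /andP[].
Qed.

Lemma rint_split a b c f : a <= c -> c <= b -> rcont f a b ->
  rint a b f = rint a c f + rint c b f.
Proof.
move=> ac cb fc; have itf := rcont_integrable fc.
have := @Rintegral_itvB R f (BLeft a) (BRight b) c itf.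
rewrite !bnd_simp => /(_ ac cb) => H.
rewrite /rint -(Rintegral_itv_obnd_cbnd (r := c)).
  by rewrite -H addrC subrK.
apply: integrableS itf => //; apply: subset_itvr.
by rewrite bnd_simp.
Qed.

Lemma rint_id a b : a <= b -> rint a b id = (b ^+ 2 - a ^+ 2) / 2.
Proof.
move=> ab; have [ab'|ba] := ltP a b; last first.
  have -> : a = b by apply/eqP; rewrite eq_le ab.
  rewrite subrr mul0r /rint set_itv1; exact: Rintegral_set1.
have dF (x : R) : is_derive x 1 (fun t : R => t ^+ 2 / 2) x.
  apply: is_derive_eq.
  by rewrite /GRing.scale /=; field.
have := @continuous_FTC2 R id (fun x => x ^+ 2 / 2) a b ab' _ _ _.
rewrite /rint /Rintegral => ->.
- by rewrite -EFinB /= mulrBl.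
- by apply: continuous_subspaceT => x; exact: cvg_id.
- have fc : {for a, continuous (fun x : R => x ^+ 2 / 2)} /\
            {for b, continuous (fun x : R => x ^+ 2 / 2)}.
    by split; apply/differentiable_continuous/derivable1_diffP; have [] := dF a; have [] := dF b.
  split.
  + by move=> x _; have [] := dF x.
  + by apply: cvg_at_right_filter; case: fc.
  + by apply: cvg_at_left_filter; case: fc.
- by move=> x _; rewrite derive1E; have [_ ->] := dF x.
Qed.

Lemma rint_eq0 a b f : a <= b -> rcont f a b -> (forall t, a <= t <= b -> 0 <= f t) ->
  rint a b f = 0 -> forall t, a < t < b -> f t = 0.
Proof.
move=> ab fc f0 fi t /andP[at_ tb]; have tab : a <= t <= b by rewrite !ltW.
apply/eqP; rewrite eq_le f0// andbT leNgt; apply/negP => ft.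
have /cvgrPdist_lt /(_ (f t / 2)) := fc _ tab.
rewrite divr_gt0// => /(_ isT)/nbhs_normP[r /= r0 H].
pose s := Num.min (Num.min (r / 2) (b - t)) (t - a).
have s0 : 0 < s by rewrite !lt_min divr_gt0// !subr_gt0 at_ tb.
have sr : s < r.
  rewrite (@le_lt_trans _ _ (r / 2))//; first by rewrite /s !ge_min lexx.
  by rewrite ltr_pdivrMr// ltr_pMr// ltr1n.
have sb : t + s <= b by rewrite -lerBrDl /s !ge_min lexx !orbT.
have fl u : t <= u <= t + s -> f t / 2 <= f u.
  move=> /andP[tu us]; have := H u; rewrite /= distrC => /(_ _).
  rewrite ger0_norm ?subr_ge0// ltrBlDl (le_lt_trans us) ?ltrD2l// => /(_ isT).
  by rewrite ltr_norml => /andP[_]; lra.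
have sub x y : a <= x -> y <= b -> rcont f x y.
  by move=> ax yb u /andP[xu uy]; apply: fc; rewrite (le_trans ax)//= (le_trans uy).
have t1 : t <= t + s by rewrite lerDl ltW.
have : 0 < rint a b f; last by rewrite fi ltxx.
rewrite (rint_split (ltW at_) (ltW tb) fc) (rint_split t1 sb (sub _ _ (ltW at_) (lexx _))).
have ge0 x y : a <= x -> x <= y -> y <= b -> 0 <= rint x y f.
  move=> ax xy yb; rewrite -(mul0r (y - x)) -rint_cst//.
  apply: rint_le; [exact: rcont_cst|exact: sub|move=> u /andP[xu uy]].
  by apply: f0; rewrite (le_trans ax)//= (le_trans uy).
have i1 := ge0 a t (lexx _) (ltW at_) (ltW tb).
have i3 := ge0 (t + s) b (le_trans (ltW at_) t1) sb (lexx _).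
suff : 0 < rint t (t + s) f by lra.
rewrite (@lt_le_trans _ _ (f t / 2 * s))//; first by rewrite mulr_gt0// divr_gt0.
rewrite (_ : _ * s = f t / 2 * (t + s - t)); last by rewrite addrAC subrr add0r.
rewrite -rint_cst//; apply: rint_le; [exact: rcont_cst|exact: sub (ltW at_) sb|].
by move=> u; exact: fl.
Qed.

End SegmentIntegral.

(** * Goursat's theorem for rectangles in a half-plane *)

Section Goursat.
Variable R : realType.
Local Notation C := (Cplx R).
Implicit Types (G : R -> C) (a b c d : R) (z w : C).

Definition ccont G a b := rcont (fun t => complex.Re (G t)) a b /\
  rcont (fun t => complex.Im (G t)) a b.

Definition cint a b G : C := Complex (rint a b (fun t => complex.Re (G t)))
  (rint a b (fun t => complex.Im (G t))).

Lemma ccont_line f p w a b :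
  (forall t, a <= t <= b -> cdf f (p + w * toC t)) ->
  ccont (fun t => f (p + w * toC t)) a b.
Proof.
move=> fd.
have main t e : a <= t <= b -> 0 < e -> \forall s \near t,
    nm (f (p + w * toC t) - f (p + w * toC s)) < e.
  move=> /fd[df fdt] e0; have [r r0 H] := cdiff_cont fdt e0.
  have w0 : 0 < nm w + 1 by rewrite ltr_wpDl// nm_ge0.
  apply/nbhs_normP; exists (r / (nm w + 1)) => /=; first by rewrite divr_gt0.
  move=> s /=; rewrite ltr_pdivlMr// => ts.
  have := H (w * toC (s - t)); rewrite nmBC.
  have -> : p + w * toC t + w * toC (s - t) = p + w * toC s.
    by rewrite toCB; ring.
  apply; rewrite nmM nm_toC distrC mulrC (le_lt_trans _ ts)//.
  by rewrite ler_wpM2l// lerDl.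
split=> t tab; apply/cvgrPdist_lt => e e0; near=> s.
  rewrite -ReN -ReD (le_lt_trans (Re_le_nm _))//.
  by near: s; exact: main.
rewrite -ImN -ImD (le_lt_trans (Im_le_nm _))//.
by near: s; exact: main.
Unshelve. all: by end_near. Qed.

Lemma rcontD (f g : R -> R) a b : rcont f a b -> rcont g a b ->
  rcont (fun t => f t + g t) a b.
Proof. by move=> fc gc t tab; apply: cvgD; [exact: fc|exact: gc]. Qed.

Lemma rcontZ (k : R) (f : R -> R) a b : rcont f a b -> rcont (fun t => k * f t) a b.
Proof. by move=> fc t tab; apply: cvgM; [exact: cvg_cst|exact: fc]. Qed.

Lemma ccontD G G' a b : ccont G a b -> ccont G' a b -> ccont (fun t => G t + G' t) a b.
Proof.
move=> [G1 G2] [G'1 G'2]; split.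
  by under eq_fun do rewrite ReD; exact: rcontD.
by under eq_fun do rewrite ImD; exact: rcontD.
Qed.

Lemma ccontZ k G a b : ccont G a b -> ccont (fun t => k * G t) a b.
Proof.
move=> [G1 G2]; split.
  under eq_fun do rewrite ReM -mulNr; apply: rcontD; exact: rcontZ.
under eq_fun do rewrite ImM; apply: rcontD; exact: rcontZ.
Qed.

Lemma cintD a b G G' : ccont G a b -> ccont G' a b ->
  cint a b (fun t => G t + G' t) = cint a b G + cint a b G'.
Proof.
move=> [G1 G2] [G'1 G'2]; apply: complex_eqP; rewrite /= -rintD//.
  by under eq_fun do rewrite ReD.
by under eq_fun do rewrite ImD.
Qed.

Lemma cintZ a b k G : ccont G a b -> cint a b (fun t => k * G t) = k * cint a b G.
Proof.
move=> [G1 G2]; apply: complex_eqP; rewrite ?ReM ?ImM /= -?mulNr -!rintZ// -rintD//.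
- by under eq_fun do rewrite ReM -mulNr.
- exact: rcontZ.
- exact: rcontZ.
- by under eq_fun do rewrite ImM.
- exact: rcontZ.
- exact: rcontZ.
Qed.

Lemma cintB a b G G' : ccont G a b -> ccont G' a b ->
  cint a b (fun t => G t - G' t) = cint a b G - cint a b G'.
Proof.
move=> G1 G2; rewrite -mulN1r -cintZ// -cintD//; last exact: ccontZ.
by congr cint; apply/funext => t; rewrite mulN1r.
Qed.

Lemma eq_cint a b G G' : (forall t, a <= t <= b -> G t = G' t) -> cint a b G = cint a b G'.
Proof.
by move=> GG'; rewrite /cint; congr Complex; apply: eq_rint => t /GG' ->.
Qed.

Lemma cint_split a b c G : a <= c -> c <= b -> ccont G a b ->
  cint a b G = cint a c G + cint c b G.
Proof.
by move=> ac cb [G1 G2]; apply: complex_eqP; rewrite /= -rint_split.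
Qed.

Lemma cint_bound a b G (M : R) : a <= b -> ccont G a b ->
  (forall t, a <= t <= b -> nm (G t) <= M) -> nm (cint a b G) <= 2 * M * (b - a).
Proof.
move=> ab [G1 G2] GM; rewrite (le_trans (nm_le_ReIm _))// mulr_natl mulr2n mulrDl.
rewrite lerD// rint_bound// => t tab.
  by rewrite (le_trans (Re_le_nm _))// GM.
by rewrite (le_trans (Im_le_nm _))// GM.
Qed.

Lemma cint_affine a b A B : a <= b ->
  cint a b (fun t => A + B * toC t) = A * toC (b - a) + B * toC ((b ^+ 2 - a ^+ 2) / 2).
Proof.
move=> ab; have idc k : rcont (fun t : R => k * t) a b.
  by apply: rcontZ => t _; exact: cvg_id.
apply: complex_eqP.
  rewrite /= ReD !ReM !Re_toC !Im_toC !mulr0 !subr0 -rint_cst// -rint_id// -rintZ.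
    rewrite -rintD//; last exact: rcont_cst.
    by under eq_fun do rewrite ReD ReM Re_toC Im_toC mulr0 subr0.
  by move=> t _; exact: cvg_id.
rewrite /= ImD !ImM !Re_toC !Im_toC !mulr0 !add0r -rint_cst// -rint_id// -rintZ.
  rewrite -rintD//; last exact: rcont_cst.
  by under eq_fun do rewrite ImD ImM Re_toC Im_toC mulr0 add0r.
by move=> t _; exact: cvg_id.
Qed.

Variables (g : C -> C) (L : R).
Hypothesis gd : forall w, complex.Re w < L -> cdf g w.
Local Notation i := (iu R).

(** The factor 1 makes horizontal and vertical sides two instances of the parametrization
    [p + w * toC t] of [ccont_line]. *)
Definition hor (f : C -> C) y a b := cint a b (fun t => f (i * toC y + 1 * toC t)).
Definition ver (f : C -> C) x c d := cint c d (fun t => f (toC x + i * toC t)).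

Lemma hor_cont y a b : b < L -> ccont (fun t => g (i * toC y + 1 * toC t)) a b.
Proof.
move=> bL; apply: ccont_line => t /andP[_ tb]; apply: gd.
by rewrite mul1r ReD ReM /= mulr0 mul0r subr0 add0r (le_lt_trans tb).
Qed.

Lemma ver_cont x c d : x < L -> ccont (fun t => g (toC x + i * toC t)) c d.
Proof.
move=> xL; apply: ccont_line => t _; apply: gd.
by rewrite ReD ReM /= mulr0 mul0r !subr0 addr0.
Qed.

Definition bdry (f : C -> C) a b c d :=
  hor f c a b + i * ver f b c d - hor f d a b - i * ver f a c d.

Lemma bdry_split4 a b c d m p : a <= m -> m <= b -> c <= p -> p <= d -> b < L ->
  bdry g a b c d = bdry g a m c p + bdry g m b c p + bdry g a m p d + bdry g m b p d.
Proof.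
move=> am mb cp pd bL; have aL : a < L by rewrite (le_lt_trans (le_trans am mb)).
rewrite /bdry /hor /ver.
rewrite (cint_split am mb (hor_cont c a bL)) (cint_split am mb (hor_cont d a bL)).
rewrite (cint_split cp pd (ver_cont c d bL)) (cint_split cp pd (ver_cont c d aL)).
repeat (move: (cint _ _ _) => ?); ring.
Qed.

Lemma bdry_affine a b c d A B : a <= b -> c <= d -> bdry (fun w => A + B * w) a b c d = 0.
Proof.
move=> ab cd; rewrite /bdry /hor /ver.
have h y : cint a b (fun t => A + B * (i * toC y + 1 * toC t)) =
    (A + B * i * toC y) * toC (b - a) + B * toC ((b ^+ 2 - a ^+ 2) / 2).
  rewrite -cint_affine//; congr cint; apply/funext => t; ring.
have v x : cint c d (fun t => A + B * (toC x + i * toC t)) =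
    (A + B * toC x) * toC (d - c) + B * i * toC ((d ^+ 2 - c ^+ 2) / 2).
  rewrite -cint_affine//; congr cint; apply/funext => t; ring.
rewrite !h !v !toCB; ring.
Qed.

(** The affine part of g at z integrates to 0 ([bdry_affine]), and the remainder is at most e (l +
    m) on the rectangle. The perimeter 2 (l + m) and the factor 2 of [cint_bound] give the constant
    4. *)
Lemma goursat_local a c l m (e r : R) (z d : C) : 0 <= l -> 0 <= m ->
  a + l < L -> 0 < e ->
  a <= complex.Re z <= a + l -> c <= complex.Im z <= c + m ->
  (forall h, nm h < r -> nm (g (z + h) - g z - d * h) <= e * nm h) ->
  l + m < r -> nm (bdry g a (a + l) c (c + m)) <= 4 * e * (l + m) ^+ 2.
Proof.
move=> l0 m0 aL e0 /andP[z1 z2] /andP[z3 z4] H lmr.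
pose A := g z - d * z; pose rho w := g w - (A + d * w).
have all_a : a <= a + l by rewrite lerDl.
have all_c : c <= c + m by rewrite lerDl.
have aL' : a < L by rewrite (le_lt_trans all_a).
have rb w : a <= complex.Re w <= a + l -> c <= complex.Im w <= c + m ->
    nm (rho w) <= e * (l + m).
  move=> /andP[w1 w2] /andP[w3 w4].
  have wz : nm (w - z) <= l + m.
    rewrite (le_trans (nm_le_ReIm _))// ReD ImD ReN ImN.
    by rewrite lerD// ler_norml; apply/andP; split; lra.
  have := H (w - z) (le_lt_trans wz lmr); rewrite [z + _]addrC subrK.
  have -> : g w - g z - d * (w - z) = rho w by rewrite /rho /A; ring.
  by move=> /le_trans; apply; rewrite ler_wpM2l// ltW.
have ch (B D : C) y : ccont (fun t => B + D * (i * toC y + 1 * toC t)) a (a + l).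
  apply: (ccont_line (f := fun x => B + D * x)) => t _.
  by apply: cdfD; [exact: cdf_cst|apply: cdfM; [exact: cdf_cst|exact: cdf_id]].
have cv (B D : C) x : ccont (fun t => B + D * (toC x + i * toC t)) c (c + m).
  apply: (ccont_line (f := fun x => B + D * x)) => t _.
  by apply: cdfD; [exact: cdf_cst|apply: cdfM; [exact: cdf_cst|exact: cdf_id]].
have cN G x y : ccont G x y -> ccont (fun t => - G t) x y.
  by move=> Gc; under eq_fun do rewrite -mulN1r; exact: ccontZ.
have -> : bdry g a (a + l) c (c + m) = bdry rho a (a + l) c (c + m).
  rewrite -[LHS]subr0 -(bdry_affine A d all_a all_c) /bdry /hor /ver /rho.
  rewrite (cintB (hor_cont c a aL) (ch A d c)) (cintB (hor_cont (c + m) a aL) (ch A d (c + m))).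
  rewrite (cintB (ver_cont c (c + m) aL) (cv A d (a + l))).
  rewrite (cintB (ver_cont c (c + m) aL') (cv A d a)).
  repeat (move: (cint _ _ _) => ?); ring.
have rc y : ccont (fun t => rho (i * toC y + 1 * toC t)) a (a + l).
  by apply: ccontD; [exact: hor_cont|exact: cN].
have rc' x : x < L -> ccont (fun t => rho (toC x + i * toC t)) c (c + m).
  by move=> xL; apply: ccontD; [exact: ver_cont|exact: cN].
have hb y : c <= y <= c + m -> nm (hor rho y a (a + l)) <= 2 * (e * (l + m)) * l.
  move=> yc; have -> : 2 * (e * (l + m)) * l = 2 * (e * (l + m)) * (a + l - a) by ring.
  apply: cint_bound => // t tab; apply: rb.
    by rewrite mul1r ReD ReM /= mulr0 mul0r subr0 add0r.
  by rewrite mul1r ImD ImM /= mul0r add0r mul1r addr0.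
have vb x : x < L -> a <= x <= a + l -> nm (i * ver rho x c (c + m)) <= 2 * (e * (l + m)) * m.
  move=> xL xa; have -> : 2 * (e * (l + m)) * m = 2 * (e * (l + m)) * (c + m - c) by ring.
  rewrite nmM nm_iu mul1r; apply: cint_bound => //; first exact: rc'.
  move=> t tab; apply: rb.
    by rewrite ReD ReM /= mulr0 mul0r !subr0 addr0.
  by rewrite ImD ImM /= mul0r !add0r mul1r.
have B1 := hb c; have B2 := hb (c + m); have B3 := vb a aL'; have B4 := vb _ aL.
rewrite !lexx all_a in B3 B4; rewrite !lexx all_c in B1 B2.
have nm4 (x1 x2 x3 x4 : C) : nm (x1 + x2 - x3 - x4) <= nm x1 + nm x2 + nm x3 + nm x4.
  by rewrite (le_trans (nmB _ _))// lerD2r (le_trans (nmB _ _))// lerD2r nmD.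
rewrite /bdry; apply: (le_trans (nm4 _ _ _ _)).
have -> : 4 * e * (l + m) ^+ 2 = 2 * (e * (l + m)) * l + 2 * (e * (l + m)) * m +
  2 * (e * (l + m)) * l + 2 * (e * (l + m)) * m by ring.
by apply: lerD; [apply: lerD; [apply: lerD|]|]; [exact: B1|exact: B4|exact: B2|exact: B3].
Qed.

Lemma quarter_le (x x2 x3 x4 x5 : R) : x <= x2 + x3 + x4 + x5 -> 4 * x2 < x ->
  4 * x3 < x -> 4 * x4 < x -> x <= 4 * x5.
Proof. lra. Qed.

(** Repeated quartering: some quarter always carries at least a quarter of the modulus of the
    boundary integral. The nested rectangles have a common point z, and there the local bound of
    order e' (l + m)^2 / 4^n cancels the factor 4^n. *)
Lemma goursat a b c d : a <= b -> c <= d -> b < L -> bdry g a b c d = 0.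
Proof.
move=> ab cd bL.
pose l := b - a; pose m := d - c.
have l0 : 0 <= l by rewrite subr_ge0. have m0 : 0 <= m by rewrite subr_ge0.
pose ln n : R := l / 2 ^+ n; pose mn n : R := m / 2 ^+ n.
have ln0 n : 0 <= ln n by rewrite divr_ge0// exprn_ge0.
have mn0 n : 0 <= mn n by rewrite divr_ge0// exprn_ge0.
have lnS n : ln n = ln n.+1 + ln n.+1.
  by rewrite /ln exprS; field; rewrite expf_neq0.
have mnS n : mn n = mn n.+1 + mn n.+1.
  by rewrite /mn exprS; field; rewrite expf_neq0.
pose E n (p : R * R) := bdry g p.1 (p.1 + ln n) p.2 (p.2 + mn n).
(* That the rectangle stays left of L is a premise, so that [choice] yields a total function; [uL]
   establishes it along the sequence. *)
pose step (np : nat * (R * R)) (q : R * R) := np.2.1 + ln np.1 < L ->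
  [/\ np.2.1 <= q.1, q.1 + ln np.1.+1 <= np.2.1 + ln np.1,
   np.2.2 <= q.2, q.2 + mn np.1.+1 <= np.2.2 + mn np.1 &
   nm (E np.1 np.2) <= 4 * nm (E np.1.+1 q)].
have [nxt nxtP] : {nxt & forall np, step np (nxt np)}.
  apply: choice => -[n [x y]]; rewrite /step /=.
  have [xL|xL] := ltP (x + ln n) L; last by exists (0, 0).
  have := @bdry_split4 x (x + ln n) y (y + mn n) (x + ln n.+1) (y + mn n.+1).
  have l1 := ln0 n.+1; have m1 := mn0 n.+1.
  have ls := lnS n; have ms := mnS n.
  have xn : x + ln n = x + ln n.+1 + ln n.+1 by rewrite ls addrA.
  have yn : y + mn n = y + mn n.+1 + mn n.+1 by rewrite ms addrA.
  have h1 : x <= x + ln n.+1 by lra.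
  have h2 : x + ln n.+1 <= x + ln n by lra.
  have h3 : y <= y + mn n.+1 by lra.
  have h4 : y + mn n.+1 <= y + mn n by lra.
  move=> /(_ h1 h2 h3 h4 xL).
  set E1 := bdry _ _ _ _ _; set E2 := bdry _ _ _ _ _; set E3 := bdry _ _ _ _ _.
  set E4 := bdry _ _ _ _ _; set E5 := bdry _ _ _ _ _ => EE.
  have nE : nm E1 <= nm E2 + nm E3 + nm E4 + nm E5.
    rewrite EE (le_trans (nmD _ _))// lerD2r (le_trans (nmD _ _))// lerD2r.
    exact: nmD.
  have [k2|k2] := leP (nm E1) (4 * nm E2).
    by exists (x, y) => _; split; [exact: lexx|exact: h2|exact: lexx|exact: h4|exact: k2].
  have [k3|k3] := leP (nm E1) (4 * nm E3).
    exists (x + ln n.+1, y) => _; split; [exact: h1| |exact: lexx|exact: h4|].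
      by rewrite /= -xn.
    by rewrite /E /= -xn; exact: k3.
  have [k4|k4] := leP (nm E1) (4 * nm E4).
    exists (x, y + mn n.+1) => _; split; [exact: lexx|exact: h2|exact: h3| |].
      by rewrite /= -yn.
    by rewrite /E /= -yn; exact: k4.
  exists (x + ln n.+1, y + mn n.+1) => _; split; [exact: h1| |exact: h3| |].
  - by rewrite /= -xn.
  - by rewrite /= -yn.
  by rewrite /E /= -xn -yn; exact: quarter_le nE k2 k3 k4.
pose u := fix u n := if n is n'.+1 then nxt (n', u n') else (a, c).
have uL n : (u n).1 + ln n < L.
  elim: n => [|n IH]; first by rewrite /= /ln expr0 divr1 /l addrC subrK.
  by have [_ h _ _ _] := nxtP (n, u n) IH; rewrite (le_lt_trans h).
have uE n : nm (bdry g a b c d) <= 4 ^+ n * nm (E n (u n)).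
  elim: n => [|n IH].
    by rewrite expr0 mul1r /E /= /ln /mn expr0 !divr1 /l /m ![_ + (_ - _)]addrC !subrK.
  have [_ _ _ _ h] := nxtP (n, u n) (uL n).
  by rewrite exprSr -mulrA; apply: (le_trans IH); apply: ler_wpM2l h; rewrite exprn_ge0.
have mono1 n k : (u n).1 <= (u (n + k)%N).1 /\ (u (n + k)%N).1 + ln (n + k)%N <= (u n).1 + ln n.
  elim: k => [|k [i1 i2]]; first by rewrite addn0.
  have [h1 h2 _ _ _] := nxtP ((n + k)%N, u (n + k)%N) (uL _).
  by rewrite addnS; split; [rewrite (le_trans i1)|rewrite (le_trans h2)].
have mono2 n k : (u n).2 <= (u (n + k)%N).2 /\ (u (n + k)%N).2 + mn (n + k)%N <= (u n).2 + mn n.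
  elim: k => [|k [i1 i2]]; first by rewrite addn0.
  have [_ _ h1 h2 _] := nxtP ((n + k)%N, u (n + k)%N) (uL _).
  by rewrite addnS; split; [rewrite (le_trans i1)|rewrite (le_trans h2)].
have nested (x ll : nat -> R) : (forall n, 0 <= ll n) ->
    (forall n k, x n <= x (n + k)%N /\ x (n + k)%N + ll (n + k)%N <= x n + ll n) ->
    exists s, forall n, x n <= s <= x n + ll n.
  move=> ll0 H; have ub n k : x k <= x n + ll n.
    have [_ h1] := H n k; have [h2 _] := H k n; rewrite addnC in h2.
    by rewrite (le_trans h2)// (le_trans _ h1)// lerDl.
  exists (sup (range x)) => n; apply/andP; split.
    apply: ub_le_sup; last by exists n.
    by exists (x 0%N + ll 0%N) => _ [k _ <-].
  apply: ge_sup; first by exists (x 0%N); exists 0%N.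
  by move=> _ [k _ <-].
have [s1 s1P] := nested (fun n => (u n).1) ln ln0 mono1.
have [s2 s2P] := nested (fun n => (u n).2) mn mn0 mono2.
pose z : C := Complex s1 s2.
have zL : complex.Re z < L.
  by have /andP[_ h] := s1P 0%N; rewrite /= (le_lt_trans h)//; exact: uL.
have [dz zd] := gd zL.
apply/eqP; rewrite -nm_eq0 eq_le nm_ge0 andbT.
apply/ler_addgt0Pl => e e0; rewrite addr0.
(* The final bound is 4 e' q, which is below e; q + 1 instead of q covers a degenerate rectangle. *)
pose q := (l + m) ^+ 2; pose e' := e / (4 * (q + 1)).
have q1 : 0 < q + 1 by rewrite ltr_wpDl// sqr_ge0.
have e'0 : 0 < e' by rewrite divr_gt0// mulr_gt0.
have [r r0 H] := zd _ e'0.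
have [n nr] : exists n, ln n + mn n < r.
  exists (Num.truncn ((l + m) / r)).+1.
  rewrite /ln /mn -mulrDl ltr_pdivrMr ?exprn_gt0// mulrC -ltr_pdivrMr//.
  rewrite (lt_trans (truncnS_gt _))//.
  rewrite -natrX ltr_nat; exact: ltn_expl.
have := @goursat_local _ _ _ _ e' r z dz (ln0 n) (mn0 n) (uL n) e'0 (s1P n) (s2P n) H nr.
have := uE n; rewrite /E; set N := nm (bdry _ _ _ _ _); set N' := nm (bdry _ _ _ _ _) => b1 b2.
have b3 : N <= 4 ^+ n * (4 * e' * (ln n + mn n) ^+ 2).
  by rewrite (le_trans b1)// ler_wpM2l// exprn_ge0.
rewrite (le_trans b3)// /ln /mn -mulrDl expr_div_n -exprM mulnC exprM.
have -> : (2 ^+ 2 : R) = 4 by rewrite expr2; ring.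
have -> : 4 ^+ n * (4 * e' * ((l + m) ^+ 2 / 4 ^+ n)) = 4 * e' * (l + m) ^+ 2.
  by field; rewrite expf_neq0.
rewrite -/q; have -> : 4 * e' * q = e * (q / (q + 1)) by rewrite /e'; field; rewrite gt_eqF.
by rewrite ler_piMr ?(ltW e0)// ler_pdivrMr// mul1r lerDl.
Qed.

End Goursat.

(** * The mean value property and the maximum principle *)

Section MaximumPrinciple.
Variable R : realType.
Local Notation C := (Cplx R).
Local Notation i := (iu R).

Definition ccont_at (f : C -> C) (p : C) := forall e : R, 0 < e ->
  exists2 r : R, 0 < r & forall h : C, nm h < r -> nm (f (p + h) - f p) < e.

Lemma cdf_ccont_at f z : cdf f z -> ccont_at f z.
Proof. by move=> [d fd] e e0; exact: cdiff_cont fd e e0. Qed.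

(* In the variable [log (z - p)] a punctured disc becomes a half-plane, and the
   horizontal sides of a rectangle of height 2 pi cancel by periodicity. *)
Lemma mean_value_circle (f : C -> C) (rho : R) :
  1 < rho -> (forall z : C, z != 0 -> nm z < rho -> cdf f z) -> ccont_at f 0 ->
  cint 0 (2 * pi) (fun t => f (cexp (toC 0 + i * toC t))) = toC (2 * pi) * f 0.
Proof.
move=> rho1 fd f0.
have rho0 : 0 < rho by rewrite (lt_trans _ rho1).
have pi2 : 0 <= 2 * pi :> R by rewrite mulr_ge0// pi_ge0.
pose g w := f (cexp w); pose L := ln rho.
have eL w : complex.Re w < L -> nm (cexp w) < rho.
  by rewrite nm_cexp /L -ltr_expR lnK ?posrE.
have gd w : complex.Re w < L -> cdf g w.
  move=> wL; apply: cdf_comp; first by exists (cexp w); exact: cdiff_cexp.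
  by apply: fd; [exact: cexp_neq0|exact: eL].
have L0 : 0 < L by rewrite ln_gt0.
have ver_eq s : s <= 0 -> ver g 0 0 (2 * pi) = ver g s 0 (2 * pi).
  move=> s0; have := goursat gd s0 pi2 L0; rewrite /bdry.
  have -> : hor g (2 * pi) s 0 = hor g 0 s 0.
    rewrite /hor /g; congr cint; apply/funext => t; congr (f _).
    have -> : i * toC (2 * pi) = twopii R.
      by apply: complex_eqP; rewrite ?ReM ?ImM /=; ring.
    by rewrite toC0 mulr0 add0r addrC cexpD2pii.
  move: (hor _ _ _ _) (ver g 0 _ _) (ver g s _ _) => x y z H.
  have : i * (y - z) = 0 by rewrite -H; ring.
  by move/eqP; rewrite mulf_eq0 -nm_eq0 nm_iu oner_eq0 /= subr_eq0 => /eqP.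
apply/eqP; rewrite -subr_eq0 -nm_eq0 eq_le nm_ge0 andbT.
apply/ler_addgt0Pl => e e0; rewrite addr0.
have p40 : 0 < 4 * pi + 1 :> R by rewrite ltr_wpDl// mulr_ge0// pi_ge0.
have [r r0 H] := f0 (e / (4 * pi + 1)) (divr_gt0 e0 p40).
pose s := Num.min 0 (ln (r / 2)).
have s0 : s <= 0 by rewrite ge_min lexx.
have sr : expR s < r.
  rewrite (@le_lt_trans _ _ (r / 2))//; last by rewrite ltr_pdivrMr// ltr_pMr// ltr1n.
  by rewrite -[leRHS]lnK ?posrE ?divr_gt0// ler_expR ge_min lexx orbT.
have -> : toC (2 * pi) * f 0 = cint 0 (2 * pi) (fun=> f 0).
  have := cint_affine (f 0) 0 pi2; under eq_cint do rewrite mul0r addr0.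
  by move=> ->; rewrite mul0r addr0 subr0 mulrC.
have cc : ccont (fun=> f 0) 0 (2 * pi) by split; exact: rcont_cst.
have := ver_eq s s0; rewrite /ver /g => ->.
have cv : ccont (fun t => f (cexp (toC s + i * toC t))) 0 (2 * pi).
  by apply: (ver_cont gd); rewrite (le_lt_trans s0).
rewrite -cintB//.
have cB : ccont (fun t => f (cexp (toC s + i * toC t)) - f 0) 0 (2 * pi).
  apply: ccontD => //; split; exact: rcont_cst.
rewrite (le_trans (cint_bound (M := e / (4 * pi + 1)) pi2 cB _))//.
  move=> t _; rewrite ltW//.
  have := H (cexp (toC s + i * toC t)); rewrite add0r; apply.
  by rewrite nm_cexp ReD ReM /= mulr0 mul0r !subr0 addr0.
rewrite subr0.
have -> : 2 * (e / (4 * pi + 1)) * (2 * pi) = e * (4 * pi / (4 * pi + 1)).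
  by move: p40; set D := 4 * pi + 1 => p40; field; rewrite gt_eqF.
by rewrite ler_piMr ?(ltW e0)// ler_pdivrMr// mul1r lerDl.
Qed.

(** On the circle around p through z the mean of f / f(p) is 1 and its modulus is at most 1, so its
    real part is constantly 1 and then the value itself is 1. At the centre only continuity is
    required, because the lemma is applied to quotients at zeros of the denominator. *)
Lemma strong_maximum (f : C -> C) (p : C) (rho : R) :
  (forall z : C, z != p -> nm (z - p) < rho -> cdf f z) -> ccont_at f p ->
  (forall z, nm (z - p) < rho -> nm (f z) <= nm (f p)) ->
  forall z, nm (z - p) < rho -> f z = f p.
Proof.
move=> fd fp fM z zr.
have [fp0|fp0] := eqVneq (f p) 0.
  by apply/eqP; rewrite fp0 -nm_eq0 eq_le nm_ge0 andbT (le_trans (fM _ zr))// fp0 nm0.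
have [->//|zp] := eqVneq z p.
pose c := z - p; have c0 : 0 < nm c by rewrite nm_gt0 subr_eq0.
(* The sign puts z at the angle pi: [rint_eq0] gives information only in the interior of
   [0, 2 pi]. *)
pose F x := f (p - c * x) / f p.
have rc1 : 1 < rho / nm c by rewrite ltr_pdivlMr// mul1r.
have inr x : nm x < rho / nm c -> nm (p - c * x - p) < rho.
  by move=> xr; rewrite addrAC subrr sub0r nmN nmM mulrC -ltr_pdivlMr.
have Fd x : x != 0 -> nm x < rho / nm c -> cdf F x.
  move=> x0 xr; apply: cdfM; last exact: cdf_cst.
  apply: (cdf_comp (f := fun x => p - c * x)).
    by apply: cdfB; [exact: cdf_cst|apply: cdfM; [exact: cdf_cst|exact: cdf_id]].
  apply: fd; last exact: inr.
  by rewrite -subr_eq0 addrAC subrr sub0r oppr_eq0 mulf_neq0// -nm_gt0.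
have F0 : ccont_at F 0.
  move=> e e0; have efp : 0 < e * nm (f p) by rewrite mulr_gt0// nm_gt0.
  have [r r0 H] := fp _ efp.
  exists (r / nm c) => [|h]; first by rewrite divr_gt0.
  rewrite ltr_pdivlMr// => hr; rewrite /F add0r mulr0 subr0 -mulrBl nmM nmV.
  rewrite ltr_pdivrMr ?nm_gt0//; apply: H.
  by rewrite nmN nmM mulrC.
have F1 : F 0 = 1 by rewrite /F mulr0 subr0 divff.
have FM x : nm x < rho / nm c -> nm (F x) <= 1.
  move=> xr; rewrite /F nmM nmV ler_pdivrMr ?nm_gt0// mul1r; apply: fM.
  exact: inr.
have pi0 : 0 < pi :> R by exact: pi_gt0.
have pi2 : 0 <= 2 * pi :> R by rewrite mulr_ge0// pi_ge0.
have := mean_value_circle rc1 Fd F0; rewrite F1 mulr1.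
pose G (t : R) := F (cexp (toC 0 + i * toC t)).
have ex1 (t : R) : nm (cexp (toC 0 + i * toC t)) = 1.
  by rewrite nm_cexp ReD ReM /= mulr0 mul0r subr0 addr0 expR0.
have cG : ccont G 0 (2 * pi).
  apply: (ccont_line (f := fun w => F (cexp w))) => t _.
  apply: cdf_comp; first by eexists; exact: cdiff_cexp.
  by apply: Fd; [exact: cexp_neq0|rewrite ex1].
rewrite -/G => /(congr1 (@complex.Re R)); rewrite /= => HI.
have Gle t : complex.Re (G t) <= 1.
  by rewrite (le_trans (ler_norm _))// (le_trans (Re_le_nm _))// FM// ex1.
have c1 : rcont (fun t => 1 + -1 * complex.Re (G t)) 0 (2 * pi).
  by apply: rcontD; [exact: rcont_cst|apply: rcontZ; case: cG].
have I0 : rint 0 (2 * pi) (fun t => 1 + -1 * complex.Re (G t)) = 0.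
  rewrite rintD; [|exact: rcont_cst|by apply: rcontZ; case: cG].
  rewrite rintZ; last by case: cG.
  rewrite rint_cst// HI; ring.
have := rint_eq0 pi2 c1 _ I0 (t := pi) _.
have h1 t : 0 <= t <= 2 * pi -> 0 <= 1 + -1 * complex.Re (G t).
  by move=> _; have := Gle t; lra.
have h2 : 0 < (pi : R) < 2 * pi by rewrite pi0/= ltr_pMl// ltr1n.
move=> /(_ h1 h2) RG.
have Gpi : G pi = f z / f p.
  rewrite /G /F; have -> : toC 0 + i * toC pi = twopii R / 2.
    have -> : (2^-1 : C) = toC 2^-1 by rewrite toCV (toC_nat R 2).
    by apply: complex_eqP; rewrite ?(ReD, ImD, ReM, ImM) /= ; field.
  by rewrite cexp_pii mulrN1 opprK /c addrC subrK.
have RG1 : complex.Re (G pi) = 1 by move: RG; lra.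
have nG : nm (G pi) <= 1 by rewrite FM// ex1.
have IG : complex.Im (G pi) = 0.
  have := nm_ReIm (G pi); rewrite RG1 => H.
  have n0 := nm_ge0 (G pi).
  by apply/eqP; rewrite -sqrf_eq0; apply/eqP; nra.
have G1 : G pi = 1 by apply: complex_eqP.
by rewrite -[LHS](divfK fp0) -Gpi G1 mul1r.
Qed.

Lemma max_parallelogram (G : C -> R) (p w1 w2 : C) :
  (forall s t e : R, 0 <= s <= 1 -> 0 <= t <= 1 -> 0 < e ->
     exists2 r : R, 0 < r & forall h, nm h < r ->
     `|G (p + w1 * toC s + w2 * toC t + h) - G (p + w1 * toC s + w2 * toC t)| < e) ->
  exists s t : R, [/\ 0 <= s <= 1, 0 <= t <= 1 &
    forall s' t' : R, 0 <= s' <= 1 -> 0 <= t' <= 1 ->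
    G (p + w1 * toC s' + w2 * toC t') <= G (p + w1 * toC s + w2 * toC t)].
Proof.
move=> Gc; pose F (x : R * R) := G (p + w1 * toC x.1 + w2 * toC x.2).
pose A := (`[0, 1]%classic `*` `[0, 1]%classic : set (R * R)).
have Fc : {in A, continuous F}.
  move=> x; rewrite inE => -[/= x1 x2]; rewrite !in_itv /= in x1 x2.
  apply/cvgrPdist_lt => e e0.
  have [r r0 H] := Gc _ _ e x1 x2 e0.
  pose W := nm w1 + nm w2 + 1.
  have W0 : 0 < W by rewrite ltr_wpDl// addr_ge0 ?nm_ge0.
  have rW : 0 < r / W by rewrite divr_gt0.
  exists (ball x.1 (r / W), ball x.2 (r / W)).
    by split; exact: nbhsx_ballx.
  move=> y [/= b1 b2]; rewrite /F distrC.
  have := H (w1 * toC (y.1 - x.1) + w2 * toC (y.2 - x.2)).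
  have -> : p + w1 * toC x.1 + w2 * toC x.2 + (w1 * toC (y.1 - x.1) + w2 * toC (y.2 - x.2))
    = p + w1 * toC y.1 + w2 * toC y.2 by rewrite !toCB; ring.
  apply; rewrite (le_lt_trans (nmD _ _))// !nmM !nm_toC.
  move: b1 b2; rewrite /ball /= (distrC x.1) (distrC x.2) => b1 b2.
  have b1' := ltW b1; have b2' := ltW b2.
  rewrite (@le_lt_trans _ _ ((nm w1 + nm w2) * (r / W)))//.
    by rewrite mulrDl lerD// ler_wpM2l// nm_ge0.
  by rewrite mulrA ltr_pdivrMr// mulrC ltr_pM2l// /W ltrDl.
have cA : compact A.
  by apply: compact_setX; exact: segment_compact.
have A0 : A !=set0.
  by exists (0, 0); split; rewrite /= in_itv /= lexx ler01.
have [[s t] st M] := compact_EVT_max A0 cA (continuous_in_subspaceT Fc).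
move: st; rewrite inE => -[/= sP tP]; exists s, t; split.
- by move: sP; rewrite in_itv.
- by move: tP; rewrite in_itv.
move=> s' t' s'P t'P; apply: (M (s', t')); rewrite inE.
by split; rewrite /= in_itv.
Qed.

Lemma ccont_nm f z : ccont_at f z -> forall e : R, 0 < e -> exists2 r : R, 0 < r &
     forall h, nm h < r -> `|nm (f (z + h)) - nm (f z)| < e.
Proof.
move=> fc e e0; have [r r0 H] := fc e e0; exists r => // h /H; apply: le_lt_trans.
have h1 := nmD (f (z + h) - f z) (f z); have h2 := nmD (f z - f (z + h)) (f (z + h)).
rewrite !subrK in h1 h2; rewrite nmBC in h2.
by rewrite ler_norml; apply/andP; split; lra.
Qed.

End MaximumPrinciple.

(** * The identity theorem by the maximum principle *)

Section IdentityTheorem.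
Variable R : realType.
Local Notation C := (Cplx R).
Local Notation i := (iu R).

Lemma const_on_closure (f : C -> C) (p c z : C) (rho : R) : 0 < rho ->
  (forall x, nm (x - p) < rho -> f x = c) -> ccont_at f z -> nm (z - p) <= rho ->
  f z = c.
Proof.
move=> rho0 fc fz zr.
apply/eqP; rewrite -subr_eq0 -nm_eq0 eq_le nm_ge0 andbT.
apply/ler_addgt0Pl => e e0; rewrite addr0.
have [r r0 H] := fz e e0.
pose s := Num.min 1 (r / (2 * rho)).
have s0 : 0 < s by rewrite lt_min ltr01 divr_gt0// mulr_gt0.
have s1 : s <= 1 by rewrite ge_min lexx.
have sr : s * rho < r.
  rewrite (@le_lt_trans _ _ (r / (2 * rho) * rho))//.
    by rewrite ler_wpM2r ?(ltW rho0)// ge_min lexx orbT.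
  by rewrite invfM mulrA divfK ?gt_eqF// ltr_pdivrMr// ltr_pMr// ltr1n.
have := H ((p - z) * toC s).
have -> : f (z + (p - z) * toC s) = c.
  apply: fc; have -> : z + (p - z) * toC s - p = (z - p) * toC (1 - s).
    by rewrite toCB; ring.
  rewrite nmM nm_toC ger0_norm ?subr_ge0//.
  rewrite (@le_lt_trans _ _ (rho * (1 - s)))//; first by rewrite ler_wpM2r ?subr_ge0.
  by rewrite mulrBr mulr1 ltrBlDr ltrDl mulr_gt0.
rewrite nmM nm_toC (gtr0_norm s0) [nm (p - z)]nmBC => /(_ _)/ltW h1.
rewrite nmBC; apply: h1.
by rewrite (le_lt_trans _ sr)// mulrC ler_wpM2l// ltW.
Qed.

Lemma expr_small (x e : R) : 0 <= x < 1 -> 0 < e -> exists k, x ^+ k < e.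
Proof.
move=> /andP[x0 x1] e0.
have xn : `|x| < 1 by rewrite ger0_norm.
have /cvgrPdist_lt/(_ e e0)[k _ /(_ k (leqnn k))] := cvg_expr xn.
by rewrite /= sub0r normrN ger0_norm ?exprn_ge0// => ?; exists k.
Qed.

Lemma max_square (G : C -> C) (r : R) : 0 < r ->
  (forall z, nm z <= 2 * r -> ccont_at G z) ->
  exists z0, [/\ `|complex.Re z0| <= r, `|complex.Im z0| <= r &
    forall z, `|complex.Re z| <= r -> `|complex.Im z| <= r -> nm (G z) <= nm (G z0)].
Proof.
move=> r0 Gc; pose p := toC (- r) + i * toC (- r).
pose w1 := toC (2 * r); pose w2 := i * toC (2 * r).
have RI (s t : R) : complex.Re (p + w1 * toC s + w2 * toC t) = 2 * r * s - r /\
    complex.Im (p + w1 * toC s + w2 * toC t) = 2 * r * t - r.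
  by rewrite /p /w1 /w2; split; rewrite ?(ReD, ImD, ReM, ImM) /=; ring.
have bd (s : R) : 0 <= s <= 1 -> `|2 * r * s - r| <= r.
  by move=> /andP[s0 s1]; rewrite ler_norml; apply/andP; split; nra.
have [|s [t [s01 t01 M]]] := @max_parallelogram R (fun z => nm (G z)) p w1 w2.
  move=> s t e s01 t01 e0; apply: ccont_nm e0; apply: Gc.
  have [h1 h2] := RI s t.
  rewrite (le_trans (nm_le_ReIm _))// h1 h2.
  by have := bd _ s01; have := bd _ t01; lra.
have [h1 h2] := RI s t.
exists (p + w1 * toC s + w2 * toC t); split; rewrite ?h1 ?h2 ?bd// => z z1 z2.
pose s' := (complex.Re z + r) / (2 * r); pose t' := (complex.Im z + r) / (2 * r).
have zE : z = p + w1 * toC s' + w2 * toC t'.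
  have [h3 h4] := RI s' t'; apply: complex_eqP; rewrite ?h3 ?h4 /s' /t'.
    by field; rewrite gt_eqF.
  by field; rewrite gt_eqF.
have r20 : 0 < 2 * r by rewrite mulr_gt0.
have in01 (x : R) : `|x| <= r -> 0 <= (x + r) / (2 * r) <= 1.
  rewrite ler_norml => /andP[x1 x2]; rewrite ler_pdivrMr// mul1r.
  by rewrite ler_pdivlMr// mul0r; apply/andP; split; lra.
by rewrite [in leLHS]zE; apply: M; exact: in01.
Qed.

(** If the maximum over the square is attained in its interior, G is constant on the largest disc
    around that point that fits in the square. The closure of this disc meets the boundary, whose
    points have modulus at least r. *)
Lemma max_square_boundary (G : C -> C) (r : R) : 0 < r ->
  (forall z, nm z <= 2 * r -> cdf G z) -> forall w, nm w <= r ->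
  exists z, [/\ r <= nm z, `|complex.Re z| <= r, `|complex.Im z| <= r &
    nm (G w) <= nm (G z)].
Proof.
move=> r0 Gd w wr.
have Gc z : nm z <= 2 * r -> ccont_at G z by move=> /Gd; exact: cdf_ccont_at.
have [z0 [zx zy M]] := max_square r0 Gc.
have sq z : `|complex.Re z| <= r -> `|complex.Im z| <= r -> nm z <= 2 * r.
  by move=> z1 z2; rewrite (le_trans (nm_le_ReIm _))// mulr_natl mulr2n lerD.
have Mw : nm (G w) <= nm (G z0).
  by apply: M; rewrite (le_trans _ wr)// ?Re_le_nm// Im_le_nm.
pose d := Num.min (r - `|complex.Re z0|) (r - `|complex.Im z0|).
have [d0|d0] := leP d 0.
  exists z0; split=> //; move: d0; rewrite /d ge_min.
  case/orP; rewrite subr_le0 => /le_trans; apply; [exact: Re_le_nm|exact: Im_le_nm].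
have din z : nm (z - z0) <= d -> `|complex.Re z| <= r /\ `|complex.Im z| <= r.
  rewrite le_min => /andP[z1 z2].
  have h1 := Re_le_nm (z - z0); have h2 := Im_le_nm (z - z0).
  rewrite ReD ReN in h1; rewrite ImD ImN in h2; split.
    have := ler_normD (complex.Re z - complex.Re z0) (complex.Re z0).
    rewrite subrK; lra.
  have := ler_normD (complex.Im z - complex.Im z0) (complex.Im z0).
  rewrite subrK; lra.
have cst z : nm (z - z0) < d -> G z = G z0.
  apply: strong_maximum.
  - by move=> x _ /ltW/din[x1 x2]; apply: Gd; exact: sq.
  - exact: Gc (sq _ zx zy).
  - by move=> x /ltW/din[x1 x2]; exact: M.
have sgx (x : R) : exists2 s : R, `|s| = 1 & `|x + s * (r - `|x|)| = r \/ r < `|x|.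
  have [x0|x0] := leP 0 x.
    by exists 1; rewrite ?normr1//; left; rewrite (ger0_norm x0) mul1r addrC subrK gtr0_norm.
  exists (-1); rewrite ?normrN1//; left; rewrite (ltr0_norm x0) opprK.
  by rewrite mulN1r opprD addrC -addrA addNr addr0 normrN gtr0_norm.
have fin z : nm (z - z0) <= d -> r <= nm z ->
    exists z, [/\ r <= nm z, `|complex.Re z| <= r, `|complex.Im z| <= r &
    nm (G w) <= nm (G z)].
  move=> zd rz; exists z; have [z1 z2] := din _ zd; split=> //.
  by rewrite (const_on_closure d0 cst (Gc _ (sq _ z1 z2)) zd).
have [dE|dE] : d = r - `|complex.Re z0| \/ d = r - `|complex.Im z0|.
- by rewrite /d /Num.min; case: ifP; [left|right].
- have [s s1 [hs|hs]] := sgx (complex.Re z0); last by move: zx; rewrite leNgt hs.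
  apply: (fin (z0 + toC (s * d))).
    by rewrite addrAC subrr add0r nm_toC normrM s1 mul1r gtr0_norm.
  by rewrite -hs -dE (le_trans _ (Re_le_nm _))// ReD.
- have [s s1 [hs|hs]] := sgx (complex.Im z0); last by move: zy; rewrite leNgt hs.
  apply: (fin (z0 + i * toC (s * d))).
    by rewrite addrAC subrr add0r nmM nm_iu mul1r nm_toC normrM s1 mul1r gtr0_norm.
  by rewrite -hs -dE (le_trans _ (Im_le_nm _))// ImD ImM /= mul0r add0r mul1r.
Qed.

(** Since F vanishes near 0, the quotient F(x) / x^k is holomorphic for every k. The maximum
    principle on a square gives |F(c)| <= M' (|c| / r)^k with |c| < r and M' independent of k, and k
    tends to infinity. The radius 2 rho leaves room for the square around the disc. *)
Lemma identity_theorem (f : C -> C) (p : C) (rho delta : R) : 0 < delta ->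
  (forall z, nm (z - p) < 2 * rho -> cdf f z) ->
  (forall z, nm (z - p) < delta -> f z = 0) ->
  forall z, nm (z - p) < rho -> f z = 0.
Proof.
move=> delta0 fd f0 w wr; apply/eqP; apply: contraT => fw.
pose c := w - p; have fc : f (p + c) != 0 by rewrite /c addrC subrK.
have c0 : 0 < nm c.
  by rewrite nm_gt0; apply: contra fc => /eqP ->; rewrite addr0 f0// subrr nm0.
pose r := (nm c + rho) / 2.
have cr : nm c < r by rewrite /r ltr_pdivlMr//; move: wr; rewrite -/c; lra.
have rr : r < rho by rewrite /r ltr_pdivrMr//; move: wr; rewrite -/c; lra.
have r0 : 0 < r by rewrite (lt_trans c0).
pose F (x : C) := f (p + x).
have Fd z : nm z <= 2 * r -> cdf F z.
  move=> zr; apply: (cdf_comp (f := fun x => p + x)).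
    by apply: cdfD; [exact: cdf_cst|exact: cdf_id].
  by apply: fd; rewrite addrAC subrr add0r (le_lt_trans zr)// ltr_pM2l.
have F0 z : nm z < delta -> F z = 0.
  by move=> zd; apply: f0; rewrite addrAC subrr add0r.
have Gd k z : nm z <= 2 * r -> cdf (fun x => F x / x ^+ k) z.
  move=> zr; have [z0|z0] := eqVneq z 0.
    have [d dP] := cdf_cst (0 : C) z; exists d; apply: (cdiff_near dP).
    by exists delta => // h hd; rewrite z0 add0r F0// mul0r.
  apply: cdfM; first exact: Fd.
  by apply: cdfV; [rewrite expf_neq0|apply: cdfX; exact: cdf_id].
have Fc z : nm z <= 2 * r -> ccont_at F z by move=> /Fd; exact: cdf_ccont_at.
have [zm [_ _ Mm]] := max_square r0 Fc.
set M := nm (F zm) in Mm.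
have x01 : 0 <= nm c / r < 1.
  by rewrite divr_ge0 ?nm_ge0 ?(ltW r0)//= ltr_pdivrMr// mul1r.
have Fcp : 0 < nm (F c) / (M + 1).
  by rewrite divr_gt0 ?nm_gt0// ltr_wpDl// nm_ge0.
have [k kP] := expr_small x01 Fcp.
have [z [rz z1 z2]] := max_square_boundary r0 (Gd k) (ltW cr).
have nz0 : 0 < nm z by rewrite (lt_le_trans r0).
rewrite !nmM !nmV !nmX => H.
have M1 : 0 < M + 1 by rewrite ltr_wpDl// nm_ge0.
have : nm (F c) / nm c ^+ k <= (M + 1) / r ^+ k.
  rewrite (le_trans H)// ler_pM ?nm_ge0 ?invr_ge0 ?exprn_ge0 ?nm_ge0//.
    by rewrite (le_trans (Mm _ z1 z2))// lerDl.
  rewrite lef_pV2 ?posrE ?exprn_gt0// lerXn2r// nnegrE ?(ltW r0) ?nm_ge0//.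
rewrite ler_pdivrMr ?exprn_gt0// -mulrA [r ^- k * _]mulrC -expr_div_n leNgt.
by rewrite mulrC -ltr_pdivlMr// kP.
Qed.

End IdentityTheorem.

(** * Quotients of entire functions with unimodular multipliers *)

Section EllipticQuotient.
Variable R : realType.
Local Notation C := (Cplx R).
Variables (N B : C -> C) (w1 w2 : C).
Hypothesis Nd : entire N.
Hypothesis Bd : entire B.
Hypothesis zeros : forall z, B z = 0 -> N z = 0 /\ exists2 d, d != 0 & cdiff B z d.
Hypothesis lattice : forall z, exists (s t : R) (m n : int),
  [/\ 0 <= s <= 1, 0 <= t <= 1 &
   z = w1 * toC s + w2 * toC t + (m%:~R * w1 + n%:~R * w2)].
Hypothesis quasi : forall w, w = w1 \/ w = w2 -> forall z,
  (B (z + w) == 0) = (B z == 0) /\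
  exists2 k, nm k = 1 & N (z + w) * B z = k * N z * B (z + w).

Lemma zero_isolated z d : d != 0 -> B z = 0 -> cdiff B z d ->
  exists2 r : R, 0 < r & forall h, nm h < r -> nm d / 2 * nm h <= nm (B (z + h)).
Proof.
move=> d0 Bz Bdz; have nd0 : 0 < nm d by rewrite nm_gt0.
have [r r0 H] := Bdz (nm d / 2) (divr_gt0 nd0 (ltr0Sn _ _)).
exists r => // h /H; rewrite Bz subr0 => le1.
have := nmD (B (z + h)) (d * h - B (z + h)).
rewrite addrC subrK nmM nmBC => le2.
have := nm_ge0 h; lra.
Qed.

(** At a simple zero of B, where N vanishes too, the value N' / B' makes the quotient continuous.
    Continuity there is all that [strong_maximum] asks of the centre. *)
Lemma quotient_ext : exists F : C -> C, [/\ forall z, B z != 0 -> F z = N z / B z,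
  forall z, B z != 0 -> cdf F z & forall z, ccont_at F z].
Proof.
have [dN dNP] : {dN : C -> C & forall z, cdiff N z (dN z)} by apply: choice; exact: Nd.
have [dB dBP] : {dB : C -> C & forall z, cdiff B z (dB z)} by apply: choice; exact: Bd.
pose F z := if B z == 0 then dN z / dB z else N z / B z.
have FE z : B z != 0 -> F z = N z / B z by rewrite /F; case: eqP.
have Fd z : B z != 0 -> cdf F z.
  move=> Bz; have Bnz : 0 < nm (B z) by rewrite nm_gt0.
  have [d dP] : cdf (fun z => N z / B z) z.
    by apply: cdfM; [exact: Nd|apply: cdfV => //; exact: Bd].
  exists d; apply: (cdiff_near dP).
  have [r r0 H] := cdiff_cont (dBP z) Bnz.
  exists r => // h /H hr; apply: FE; apply: contraTneq hr => ->.
  by rewrite sub0r nmN ltxx.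
exists F; split=> // z.
have [Bz|Bz] := eqVneq (B z) 0; last by apply: cdf_ccont_at; exact: Fd.
have [Nz [d d0 Bdz]] := zeros Bz.
have dBE : dB z = d by apply: cdiff_unique (dBP z) Bdz.
have nd0 : 0 < nm d by rewrite nm_gt0.
have [r0 r00 H0] := zero_isolated d0 Bz Bdz.
move=> e e0; pose n := dN z; pose K := nm d + nm n.
have K0 : 0 < K by rewrite ltr_pwDl// nm_ge0.
pose e1 := e * (nm d) ^+ 2 / (4 * K).
have e10 : 0 < e1 by rewrite divr_gt0 ?mulr_gt0 ?exprn_gt0.
have [r1 r10 H1] := dNP z e1 e10; have [r2 r20 H2] := Bdz e1 e10.
exists (Num.min r0 (Num.min r1 r2)) => [|h]; first by rewrite !lt_min r00 r10.
rewrite !lt_min => /and3P[/H0 h0 /H1 h1 /H2 h2].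
have [->|hn] := eqVneq h 0; first by rewrite addr0 subrr nm0.
have nh : 0 < nm h by rewrite nm_gt0.
have Bh : B (z + h) != 0.
  by rewrite -nm_gt0 (lt_le_trans _ h0)// mulr_gt0// divr_gt0.
have -> : F z = n / d by rewrite /F Bz eqxx dBE.
rewrite (FE _ Bh).
rewrite Nz subr0 -/n in h1; rewrite Bz subr0 in h2.
have -> : N (z + h) / B (z + h) - n / d =
    ((N (z + h) - n * h) * d - n * (B (z + h) - d * h)) / (B (z + h) * d).
  by field; rewrite Bh d0.
rewrite nmM nmV [nm (_ * d)]nmM ltr_pdivrMr ?mulr_gt0 ?nm_gt0//.
have a1 : nm ((N (z + h) - n * h) * d - n * (B (z + h) - d * h)) <= e1 * nm h * K.
  rewrite (le_trans (nmB _ _))// !nmM /K mulrDr lerD//.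
    by rewrite ler_wpM2r// nm_ge0.
  by rewrite mulrC ler_wpM2r// nm_ge0.
rewrite (le_lt_trans a1)//.
have -> : e1 * nm h * K = e / 2 * (nm d / 2 * nm h) * nm d.
  by rewrite /e1; field; rewrite gt_eqF.
rewrite [ltRHS]mulrA ltr_pM2r// (@lt_le_trans _ _ (e * (nm d / 2 * nm h)))//.
  rewrite ltr_pM2r ?mulr_gt0 ?divr_gt0//; first by rewrite ltr_pdivrMr// ltr_pMr// ltr1n.
by rewrite ler_wpM2l// ltW.
Qed.

Lemma isolated z : exists2 r : R, 0 < r & forall x, x != z -> nm (x - z) < r -> B x != 0.
Proof.
have [Bz|Bz] := eqVneq (B z) 0.
  have [_ [d d0 Bdz]] := zeros Bz; have [r r0 H] := zero_isolated d0 Bz Bdz.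
  exists r => // x xz /H; rewrite [z + _]addrC subrK -nm_gt0; apply: lt_le_trans.
  by rewrite mulr_gt0 ?divr_gt0 ?nm_gt0// subr_eq0.
have [d Bdz] := Bd z; have Bnz : 0 < nm (B z) by rewrite nm_gt0.
have [r r0 H] := cdiff_cont Bdz Bnz.
exists r => // x _ /H; rewrite [z + _]addrC subrK => lt1.
by apply: contraTneq lt1 => ->; rewrite sub0r nmN ltxx.
Qed.

(** The modulus of the extended quotient F is doubly periodic, so its maximum over a period
    parallelogram is a global one. Then F is constant near that point, and the identity theorem
    applied to N - F(z0) B gives the claim everywhere. *)
Lemma elliptic_quotient : exists c, forall z, N z = c * B z.
Proof.
have [F [FE Fd Fc]] := quotient_ext.
have per w z : w = w1 \/ w = w2 -> B z != 0 -> B (z + w) != 0 /\ nm (F (z + w)) = nm (F z).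
  move=> ww Bz; have [Bw [k k1 H]] := quasi ww z; rewrite Bw; split=> //.
  have Bzw : B (z + w) != 0 by rewrite Bw.
  rewrite !FE// -[RHS]mul1r -k1 -nmM; congr nm.
  apply: (mulIf Bz); rewrite mulrAC H; field; rewrite Bz Bzw //.
have perz w z (m : int) : w = w1 \/ w = w2 -> B z != 0 ->
    B (z + m%:~R * w) != 0 /\ nm (F (z + m%:~R * w)) = nm (F z).
  move=> ww; have nat_case (k : nat) x : B x != 0 ->
      B (x + k%:R * w) != 0 /\ nm (F (x + k%:R * w)) = nm (F x).
    elim: k => [|k IH] Bx; first by rewrite mul0r addr0.
    have [h1 h2] := IH Bx; have [h3 h4] := per _ _ ww h1.
    by rewrite mulrSr mulrDl mul1r addrA h4.
  move: m => [k|k] Bz; first by rewrite -pmulrn; exact: nat_case.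
  have nb (j : nat) x : B (x + j%:R * w) != 0 -> B x != 0.
    elim: j => [|j IH]; first by rewrite mul0r addr0.
    rewrite mulrSr mulrDl mul1r addrA => h; apply: IH.
    by have [<- _] := quasi ww (x + j%:R * w).
  rewrite NegzE mulrNz mulNr -pmulrn; set y := z - _.
  have zE : z = y + k.+1%:R * w by rewrite /y subrK.
  have By : B y != 0 by apply: (nb k.+1); rewrite -zE.
  by have [_] := nat_case k.+1 y By; rewrite -zE => ->.
have [|s [t [s01 t01 M]]] := @max_parallelogram R (fun z => nm (F z)) 0 w1 w2.
  by move=> s t e _ _ e0; apply: ccont_nm e0; exact: Fc.
set z0 := 0 + w1 * toC s + w2 * toC t in M.
have M1 z : B z != 0 -> nm (F z) <= nm (F z0).
  move=> Bz; have [s' [t' [m [n [s'01 t'01 zE]]]]] := lattice z.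
  have [h1 h2] := perz w2 z (- n) (or_intror erefl) Bz.
  have [h3 h4] := perz w1 _ (- m) (or_introl erefl) h1.
  rewrite -h2 -h4.
  have -> : z + (- n)%:~R * w2 + (- m)%:~R * w1 = 0 + w1 * toC s' + w2 * toC t'.
    by rewrite zE !mulrNz; ring.
  exact: M.
(* Periodicity is known only off the zeros of B; at a zero the bound is carried over from nearby
   points by continuity. *)
have M2 z : nm (F z) <= nm (F z0).
  have [Bz|] := eqVneq (B z) 0; last exact: M1.
  apply/ler_addgt0Pl => e e0.
  have [r r0 H] := ccont_nm (Fc z) e0; have [r' r'0 H'] := isolated z.
  pose h : C := toC (Num.min r r' / 2).
  have m0 : 0 < Num.min r r' / 2 by rewrite divr_gt0// lt_min r0.
  have nh : nm h = Num.min r r' / 2 by rewrite nm_toC gtr0_norm.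
  have hlt : nm h < Num.min r r'.
    by rewrite nh ltr_pdivrMr// ltr_pMr ?ltr1n// lt_min r0.
  have [hr hr'] : nm h < r /\ nm h < r' by move: hlt; rewrite lt_min => /andP[].
  have Bh : B (z + h) != 0.
    apply: H'; last by rewrite addrAC subrr add0r.
    by rewrite -subr_eq0 addrAC subrr add0r -nm_gt0 nh.
  have := M1 _ Bh; have := H _ hr; rewrite ltr_norml => /andP[h1 _]; lra.
have [r r0 H] := isolated z0.
have cst : forall z, nm (z - z0) < r -> F z = F z0.
  by apply: strong_maximum => // z zz0 zr; apply: Fd; exact: H.
exists (F z0) => z; apply/eqP; rewrite -subr_eq0; apply/eqP.
pose D x := N x - F z0 * B x.
apply: (@identity_theorem _ D z0 (nm (z - z0) + 1) r r0) => [x _|x xr|].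
- by apply: cdfB; [exact: Nd|apply: cdfM; [exact: cdf_cst|exact: Bd]].
- have [Bx|Bx] := eqVneq (B x) 0.
    by rewrite /D Bx (zeros Bx).1 mulr0 subrr.
  by rewrite /D -(cst x xr) FE// divfK// subrr.
- by rewrite ltrDl.
Qed.

(** The constant c of [elliptic_quotient] satisfies c = k c, so it is 0 as soon as one multiplier
    differs from 1. *)
Lemma elliptic_quotient0 w k z : w = w1 \/ w = w2 -> k != 1 ->
  (forall z, N (z + w) * B z = k * N z * B (z + w)) -> N z = 0.
Proof.
move=> ww k1 H; have [c NE] := elliptic_quotient.
have [r r0 Br] := isolated 0.
pose h : C := toC (r / 2).
have h0 : 0 < r / 2 by rewrite divr_gt0.
have Bh : B h != 0.
  apply: Br; first by rewrite -nm_gt0 nm_toC gtr0_norm.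
  by rewrite subr0 nm_toC gtr0_norm// ltr_pdivrMr// ltr_pMr// ltr1n.
have Bhw : B (h + w) != 0 by have [-> _] := quasi ww h.
have := H h; rewrite !NE => /eqP.
have -> : c * B (h + w) * B h = c * (B h * B (h + w)) by ring.
have -> : k * (c * B h) * B (h + w) = k * c * (B h * B (h + w)) by ring.
rewrite -subr_eq0 -mulrBl mulf_eq0 (mulf_eq0 (B h)) (negbTE Bh) (negbTE Bhw) /= orbF.
rewrite -{1}[c]mul1r -mulrBl mulf_eq0 subr_eq0 eq_sym (negbTE k1) /= => /eqP ->.
by rewrite mul0r.
Qed.

End EllipticQuotient.
(** * Unconditional sums *)

Section UnconditionalSums.
Variable R : realType.
Local Notation C := (Cplx R).

Definition psum (I : choiceType) (f : I -> C) (A : {fset I}) : C := \sum_(i <- A) f i.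

Definition has_sum (I : choiceType) (f : I -> C) (l : C) := forall e : R, 0 < e ->
  exists A : {fset I}, forall B, (A `<=` B)%fset -> nm (psum f B - l) < e.

(** Summability of a nonnegative family with its bound made explicit, since iterated sums such as
    [bsum_pair] need bounds on the inner sums. *)
Definition bsum (I : choiceType) (g : I -> R) (M : R) :=
  (forall i, 0 <= g i) /\ forall s : seq I, uniq s -> \sum_(i <- s) g i <= M.

Definition asum (I : choiceType) (f : I -> C) := exists M, bsum (fun i => nm (f i)) M.

Definition tsum (I : choiceType) (f : I -> C) : C := xget 0 [set l | has_sum f l].

Lemma sum_subset (V : nmodType) (I : eqType) (f : I -> V) (s s' : seq I) :
  uniq s -> uniq s' -> {subset s <= s'} ->
  \sum_(i <- s') f i = \sum_(i <- s) f i + \sum_(i <- s' | i \notin s) f i.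
Proof.
move=> us us' ss'; rewrite (bigID (mem s)) /=; congr (_ + _).
rewrite -big_filter; apply: perm_big; apply: uniq_perm => //; first exact: filter_uniq.
by move=> x; rewrite mem_filter; case xs: (x \in s) => //=; exact: ss'.
Qed.

Lemma ler_sum_subset (I : eqType) (g : I -> R) (s s' : seq I) : (forall i, 0 <= g i) ->
  uniq s -> uniq s' -> {subset s <= s'} -> \sum_(i <- s) g i <= \sum_(i <- s') g i.
Proof.
by move=> g0 us us' ss'; rewrite (sum_subset g us us' ss') lerDl sumr_ge0.
Qed.

Lemma psum_seq (I : choiceType) (f : I -> C) (s : seq I) : uniq s ->
  psum f [fset x in s]%fset = \sum_(i <- s) f i.
Proof.
by move=> us; apply: perm_big; apply: uniq_perm => //= x; rewrite !inE.
Qed.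

Lemma nm_sum (I : Type) (s : seq I) (f : I -> C) :
  nm (\sum_(i <- s) f i) <= \sum_(i <- s) nm (f i).
Proof.
elim/big_rec2 : _ => [|i y x _ h]; first by rewrite nm0.
by rewrite (le_trans (nmD _ _))// lerD2l.
Qed.

Lemma bsum_ge0 (I : choiceType) (g : I -> R) M : bsum g M -> 0 <= M.
Proof. by move=> [g0 /(_ [::] isT)]; rewrite big_nil. Qed.

Lemma bsum_le (I : choiceType) (g g' : I -> R) M : (forall i, 0 <= g' i <= g i) ->
  bsum g M -> bsum g' M.
Proof.
move=> gg' [g0 gM]; split=> [i|s us]; first by have /andP[] := gg' i.
by rewrite (le_trans _ (gM s us))// ler_sum// => i _; have /andP[] := gg' i.
Qed.

Lemma bsumZ (I : choiceType) (g : I -> R) M k : 0 <= k -> bsum g M ->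
  bsum (fun i => k * g i) (k * M).
Proof.
move=> k0 [g0 gM]; split=> [i|s us]; first by rewrite mulr_ge0.
by rewrite -mulr_sumr ler_wpM2l// gM.
Qed.

Lemma bsumD (I : choiceType) (g g' : I -> R) M M' : bsum g M -> bsum g' M' ->
  bsum (fun i => g i + g' i) (M + M').
Proof.
move=> [g0 gM] [g'0 gM']; split=> [i|s us]; first by rewrite addr_ge0.
by rewrite big_split /= lerD// ?gM ?gM'.
Qed.

Lemma bsum_inj (I J : choiceType) (h : J -> I) (g : I -> R) M : injective h ->
  bsum g M -> bsum (fun j => g (h j)) M.
Proof.
move=> hi [g0 gM]; split=> // s us.
by have := gM (map h s); rewrite map_inj_uniq// big_map => /(_ us).
Qed.

Lemma bsum_pair (I J : choiceType) (g : I * J -> R) (m : I -> R) M :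
  (forall i, bsum (fun j => g (i, j)) (m i)) -> bsum m M -> bsum g M.
Proof.
move=> gm [m0 mM]; split=> [[i j]|s us]; first by have [+ _] := gm i; exact.
pose s1 := undup (map fst s); pose s2 := undup (map snd s).
have sub : {subset s <= [seq (i, j) | i <- s1, j <- s2]}.
  move=> [i j] ijs; apply/allpairsP; exists (i, j); rewrite !mem_undup.
  by split=> //; apply/mapP; exists (i, j).
have us1 : uniq s1 by exact: undup_uniq.
have us2 : uniq s2 by exact: undup_uniq.
have upair : uniq [seq (i, j) | i <- s1, j <- s2].
  by apply: allpairs_uniq => // -[x1 x2] [y1 y2] _ _ [-> ->].
have g0 ij : 0 <= g ij by case: ij => i j; have [+ _] := gm i; exact.
rewrite (le_trans (ler_sum_subset g0 us upair sub))//.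
rewrite big_allpairs_dep (le_trans _ (mM _ us1))// ler_sum// => i _.
by have [_] := gm i; exact.
Qed.

Lemma has_sum_unique (I : choiceType) (f : I -> C) l l' :
  has_sum f l -> has_sum f l' -> l = l'.
Proof.
move=> h h'; apply/eqP; rewrite -subr_eq0 -nm_eq0 eq_le nm_ge0 andbT.
apply/ler_addgt0Pl => e e0; rewrite addr0.
have [A AP] := h _ (divr_gt0 e0 (ltr0Sn _ 1)); have [B BP] := h' _ (divr_gt0 e0 (ltr0Sn _ 1)).
have := AP _ (fsubsetUl A B); have := BP _ (fsubsetUr A B).
set x := psum f _; rewrite [nm (x - l)]nmBC => h1 h2.
have -> : l - l' = (l - x) + (x - l') by ring.
by rewrite (le_trans (nmD _ _))// [e]splitr ltW// ltrD.
Qed.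

Lemma tsumE (I : choiceType) (f : I -> C) l : has_sum f l -> tsum f = l.
Proof.
move=> fl; rewrite /tsum; case: xgetP => [x _ /= fx|/(_ l)] //.
exact: has_sum_unique fx fl.
Qed.

Lemma eq_has_sum (I : choiceType) (f g : I -> C) l : f =1 g -> has_sum f l -> has_sum g l.
Proof. by move=> /funext ->. Qed.

Lemma has_sumD (I : choiceType) (f g : I -> C) l l' : has_sum f l -> has_sum g l' ->
  has_sum (fun i => f i + g i) (l + l').
Proof.
move=> h h' e e0.
have [A AP] := h _ (divr_gt0 e0 (ltr0Sn _ 1)); have [B BP] := h' _ (divr_gt0 e0 (ltr0Sn _ 1)).
exists (A `|` B)%fset => D; rewrite fsubUset => /andP[/AP h1 /BP h2].
rewrite /psum big_split /= -/(psum f D) -/(psum g D).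
have -> : psum f D + psum g D - (l + l') = (psum f D - l) + (psum g D - l') by ring.
by rewrite (le_lt_trans (nmD _ _))// [e]splitr ltrD.
Qed.

Lemma has_sumZ (I : choiceType) (f : I -> C) l k : has_sum f l ->
  has_sum (fun i => k * f i) (k * l).
Proof.
move=> h e e0; have k0 : 0 < nm k + 1 by rewrite ltr_wpDl// nm_ge0.
have [A AP] := h _ (divr_gt0 e0 k0); exists A => B /AP lt1.
rewrite /psum -mulr_sumr -mulrBr nmM.
rewrite (@le_lt_trans _ _ ((nm k + 1) * nm (psum f B - l)))//.
  by rewrite ler_wpM2r ?nm_ge0// lerDl.
by rewrite mulrC -ltr_pdivlMr.
Qed.

Lemma has_sumN (I : choiceType) (f : I -> C) l : has_sum f l ->
  has_sum (fun i => - f i) (- l).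
Proof.
move=> h; rewrite -mulN1r; apply: eq_has_sum (has_sumZ (-1) h) => i.
by rewrite mulN1r.
Qed.

Lemma has_sumB (I : choiceType) (f g : I -> C) l l' : has_sum f l -> has_sum g l' ->
  has_sum (fun i => f i - g i) (l - l').
Proof. by move=> h h'; apply: has_sumD => //; exact: has_sumN. Qed.

Lemma has_sum0 (I : choiceType) : has_sum (fun _ : I => 0) 0.
Proof. by move=> e e0; exists fset0 => B _; rewrite /psum big1// subrr nm0. Qed.

Lemma has_sum_sum (I : choiceType) (T : eqType) (s : seq T) (f : T -> I -> C) (l : T -> C) :
  (forall t, t \in s -> has_sum (f t) (l t)) ->
  has_sum (fun i => \sum_(t <- s) f t i) (\sum_(t <- s) l t).
Proof.
elim: s => [|t s IH] h.
  by rewrite big_nil; apply: eq_has_sum (has_sum0 I) => i; rewrite big_nil.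
rewrite big_cons; apply: eq_has_sum (has_sumD (h t (mem_head _ _)) (IH _)).
  by move=> i; rewrite big_cons.
by move=> u us; apply: h; rewrite inE us orbT.
Qed.

Lemma has_sum_nm_le (I : choiceType) (f : I -> C) (g : I -> R) l M :
  has_sum f l -> bsum g M -> (forall i, nm (f i) <= g i) -> nm l <= M.
Proof.
move=> fl [g0 gM] fg; apply/ler_addgt0Pl => e e0.
have [A /(_ A (fsubset_refl _)) h] := fl e e0.
have -> : l = psum f A - (psum f A - l) by ring.
rewrite (le_trans (nmB _ _))// addrC lerD ?(ltW h)// /psum.
rewrite (le_trans (nm_sum _ _))// (le_trans _ (gM A (fset_uniq _)))//.
exact: ler_sum.
Qed.

Lemma has_sum_toC (I : choiceType) (g : I -> R) M : bsum g M ->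
  exists s, has_sum (fun i => toC (g i)) (toC s).
Proof.
move=> [g0 gM]; pose S := [set x : R | exists A : {fset I}, x = \sum_(i <- A) g i].
have hS : has_sup S.
  split; first by exists 0, fset0; rewrite big_seq_fset0.
  by exists M => _ [A ->]; exact: gM.
exists (sup S) => e e0.
have [_ [A ->] lt1] := sup_adherent e0 hS.
have toC_sum (B : {fset I}) : \sum_(i <- B) toC (g i) = toC (\sum_(i <- B) g i).
  by rewrite /toC rmorph_sum.
exists A => B AB; rewrite /psum toC_sum -toCB nm_toC distrC.
have leB : \sum_(i <- B) g i <= sup S.
  by apply: ub_le_sup; [case: hS|exists B].
rewrite ger0_norm ?subr_ge0// ltrBlDr -ltrBlDl (lt_le_trans lt1)//.
by apply: ler_sum_subset; rewrite ?fset_uniq//; exact/fsubsetP.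
Qed.

Lemma asum_has_sum (I : choiceType) (f : I -> C) : asum f -> has_sum f (tsum f).
Proof.
move=> [M fM].
have part (p : I -> R) : (forall i, `|p i| <= nm (f i)) ->
    exists l, has_sum (fun i => toC (p i)) l.
  move=> pf.
  have b1 : bsum (fun i => p i + nm (f i)) (2 * M).
    apply: (bsum_le (g := fun i => 2 * nm (f i))); last exact: bsumZ.
    move=> i; have := pf i; rewrite ler_norml => /andP[h1 h2]; apply/andP; split; lra.
  have [s1 h1] := has_sum_toC b1; have [s2 h2] := has_sum_toC fM.
  exists (toC s1 - toC s2); apply: eq_has_sum (has_sumB h1 h2) => i.
  by rewrite -toCB addrK.
have [l1 h1] := part _ (fun i => Re_le_nm (f i)).
have [l2 h2] := part _ (fun i => Im_le_nm (f i)).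
have h : has_sum f (l1 + iu R * l2).
  apply: eq_has_sum (has_sumD h1 (has_sumZ (iu R) h2)) => i /=.
  by rewrite [RHS]complex_split.
by rewrite (tsumE h).
Qed.

Lemma asum_le (I : choiceType) (f : I -> C) g M : bsum g M -> (forall i, nm (f i) <= g i) ->
  asum f.
Proof.
by move=> gM fg; exists M; apply: bsum_le gM => i; rewrite nm_ge0 fg.
Qed.

Lemma has_sum_inj (I J : choiceType) (h : J -> I) (f : I -> C) l : injective h ->
  (forall i, (forall j, i <> h j) -> f i = 0) -> has_sum f l <-> has_sum (fun j => f (h j)) l.
Proof.
move=> hi f0.
have key (A : {fset I}) (B : {fset J}) :
    (forall j, h j \in A -> j \in B) -> (forall j, j \in B -> h j \in A) ->
    psum f A = psum (fun j => f (h j)) B.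
  move=> AB BA; rewrite /psum -(big_map h predT f).
  rewrite (sum_subset f (s := map h B) (s' := A)).
  - rewrite [X in _ + X]big1_seq ?addr0// => i /andP[iB iA].
    by apply: f0 => j ij; move: iB; rewrite ij mem_map// AB// -ij.
  - by rewrite map_inj_uniq// fset_uniq.
  - exact: fset_uniq.
  - by move=> _ /mapP[j jB ->]; exact: BA.
pose hinv i : option J := if pselect (exists j, i = h j) is left p then Some (projT1 (cid p)) else None.
pose pre (A : {fset I}) := [fset x in pmap hinv A]%fset.
have preP A j : (j \in pre A) = (h j \in A).
  rewrite inE /= mem_pmap; apply/mapP/idP => [[i iA]|hA].
    by rewrite /hinv; case: pselect => // p [->]; case: (cid p) => /= j' <-.
  exists (h j) => //; rewrite /hinv; case: pselect => [p|[]]; last by exists j.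
  by case: (cid p) => j' /= /hi ->.
split=> fl e /fl[A AP].
  exists (pre A) => B /fsubsetP AB.
  rewrite -(key (A `|` [fset h j | j in B])%fset B).
  - by apply: AP; exact: fsubsetUl.
  - move=> j; rewrite inE => /orP[hA|/imfsetP[j' /= j'B /hi ->//]].
    by apply: AB; rewrite preP.
  - by move=> j jB; rewrite inE; apply/orP; right; apply/imfsetP; exists j.
exists [fset h j | j in A]%fset => B /fsubsetP AB.
rewrite (key B (pre B)) => [|j|j]; rewrite ?preP//.
apply: AP; apply/fsubsetP => j jA; rewrite preP; apply: AB.
by apply/imfsetP; exists j.
Qed.

Lemma has_sum_pair (I J : choiceType) (f : I * J -> C) (g : I -> C) l : has_sum f l ->
  (forall i, has_sum (fun j => f (i, j)) (g i)) -> has_sum g l.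
Proof.
move=> fl fg e e0.
have [A AP] := fl _ (divr_gt0 e0 (ltr0Sn _ 1)).
pose A1 := [fset x.1 | x in A]%fset; pose A2 := [fset x.2 | x in A]%fset.
exists A1 => B A1B.
have hB := has_sum_sum (s := B) (fun t _ => fg t).
have [D DP] := hB _ (divr_gt0 e0 (ltr0Sn _ 1)).
(* Adding the second coordinates of A makes the rectangle B x D' contain A. *)
pose D' := (D `|` A2)%fset; have := DP D' (fsubsetUl _ _).
pose s := [seq (i, j) | i <- B, j <- D'].
have us : uniq s.
  by apply: allpairs_uniq; rewrite ?fset_uniq// => -[x1 x2] [y1 y2] _ _ [-> ->].
have AS : (A `<=` [fset x in s])%fset.
  apply/fsubsetP => -[i j] ijA; rewrite inE /=; apply/allpairsP; exists (i, j); split=> //=.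
    by apply: (fsubsetP A1B); apply/imfsetP; exists (i, j).
  by rewrite inE; apply/orP; right; apply/imfsetP; exists (i, j).
have := AP _ AS; rewrite psum_seq// big_allpairs_dep /psum exchange_big /=.
set X := \sum_(j <- D') _ => h1 h2; set Y := \sum_(i <- B) _.
have -> : Y - l = (X - l) - (X - Y) by ring.
by rewrite (le_lt_trans (nmB _ _))// [e]splitr ltrD.
Qed.

Lemma asum_slice (I J : choiceType) (f : I * J -> C) i : asum f -> asum (fun j => f (i, j)).
Proof.
by move=> [M fM]; exists M; apply: (bsum_inj (h := fun j => (i, j))) fM => j j' [].
Qed.

Lemma tsum_pair (I J : choiceType) (f : I * J -> C) : asum f ->
  has_sum (fun i => tsum (fun j => f (i, j))) (tsum f).
Proof.
move=> fa; apply: has_sum_pair (asum_has_sum fa) _ => i.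
exact/asum_has_sum/asum_slice.
Qed.

Lemma bsum_prod (I J : choiceType) (f : I -> R) (g : J -> R) M M' :
  bsum f M -> bsum g M' -> bsum (fun x => f x.1 * g x.2) (M * M').
Proof.
move=> fM gM; apply: (bsum_pair (m := fun i => f i * M')) => [i|] /=.
  by apply: bsumZ => //; case: fM.
have M'0 := bsum_ge0 gM.
apply: (bsum_le (g := fun i => M' * f i)) => [i|]; last by rewrite mulrC; exact: bsumZ.
by rewrite mulrC lexx andbT mulr_ge0//; case: fM.
Qed.

Lemma has_sum_prod (I J : choiceType) (f : I -> C) (g : J -> C) l l' :
  has_sum f l -> has_sum g l' -> asum f -> asum g ->
  has_sum (fun x => f x.1 * g x.2) (l * l').
Proof.
move=> fl gl [M fM] [M' gM].
have fga : asum (fun x : I * J => f x.1 * g x.2).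
  apply: (asum_le (bsum_prod fM gM)) => x; rewrite nmM.
  exact: lexx.
have h := asum_has_sum fga.
have h1 := has_sum_pair h (g := fun i => f i * l') (fun i => has_sumZ (f i) gl).
have h2 : has_sum (fun i => f i * l') (l * l').
  by rewrite mulrC; apply: eq_has_sum (has_sumZ l' fl) => i; rewrite mulrC.
by rewrite -(has_sum_unique h1 h2).
Qed.

Lemma bsum_tail (I : choiceType) (g : I -> R) M (e : R) : bsum g M -> 0 < e ->
  exists A : {fset I}, forall s, uniq s -> (forall i, i \in s -> i \notin A) ->
    \sum_(i <- s) g i < e.
Proof.
move=> gM e0; have [l /(_ _ (divr_gt0 e0 (ltr0Sn _ 1)))[A AP]] := has_sum_toC gM.
exists A => s us sA; have [g0 _] := gM.
pose B := (A `|` [fset x in s])%fset.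
have toC_sum (D : seq I) : \sum_(i <- D) toC (g i) = toC (\sum_(i <- D) g i).
  by rewrite /toC rmorph_sum.
have := AP _ (fsubset_refl _); have := AP B (fsubsetUl _ _).
rewrite /psum !toC_sum -!toCB !nm_toC.
rewrite (sum_subset g (fset_uniq A) (fset_uniq B) (fsubsetP (fsubsetUl _ _))).
set X := \sum_(i <- A) _; set Y := \sum_(i <- B | _) _.
have -> : Y = \sum_(i <- s) g i.
  rewrite /Y -big_filter; apply: perm_big; apply: uniq_perm => //.
    by rewrite filter_uniq// fset_uniq.
  move=> x; rewrite mem_filter !inE /=; case xA: (x \in A) => //=.
  by apply/esym/negbTE/negP => /sA; rewrite xA.
rewrite !ltr_norml => /andP[h1 h2] /andP[h3 h4]; lra.
Qed.

(** Dominated convergence: outside a finite set the domination makes all tails small at once, and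
    inside it finitely many continuity conditions remain. The neighbourhoods of t0 are an abstract
    relation so that one-sided limits are allowed. *)
Lemma has_sum_dominated (I : choiceType) (T : Type) (f : T -> I -> C) (F : T -> C) (t0 : T)
    (near : R -> T -> Prop) (g : I -> R) M :
  bsum g M -> (forall t i, nm (f t i) <= g i) -> (forall t, has_sum (f t) (F t)) ->
  (forall r r' t, r <= r' -> near r t -> near r' t) ->
  (forall i (e : R), 0 < e -> exists2 r : R, 0 < r & forall t, near r t -> nm (f t i - f t0 i) < e) ->
  forall e : R, 0 < e -> exists2 r : R, 0 < r & forall t, near r t -> nm (F t - F t0) < e.
Proof.
move=> gM fg fF nearM fc e e0.
have e8 : 0 < e / 8 by rewrite divr_gt0.
have [A AP] := bsum_tail gM e8.
have tail t : nm (F t - \sum_(i <- A) f t i) <= e / 4.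
  have [D DP] := fF t _ e8.
  pose B := (A `|` D)%fset; have := DP B (fsubsetUr _ _); rewrite /psum.
  rewrite (sum_subset _ (fset_uniq A) (fset_uniq B) (fsubsetP (fsubsetUl _ _))).
  set X := \sum_(i <- A) _; set Y := \sum_(i <- B | _) _ => h1.
  have h2 : nm Y <= e / 8.
    rewrite /Y -big_filter (le_trans (nm_sum _ _))//.
    rewrite (@le_trans _ _ (\sum_(i <- [seq i <- B | i \notin A]) g i)) ?ler_sum//.
    rewrite ltW// AP ?filter_uniq ?fset_uniq// => i.
    by rewrite mem_filter => /andP[].
  have -> : F t - X = Y - (X + Y - F t) by ring.
  by rewrite (le_trans (nmB _ _))//; lra.
have [r r0 rP] : exists2 r : R, 0 < r &
    forall t, near r t -> nm (\sum_(i <- A) f t i - \sum_(i <- A) f t0 i) <= e / 4.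
  pose n : R := (size A)%:R + 1; have n0 : 0 < n by rewrite ltr_wpDl// ler0n.
  have en : 0 < e / 4 / n by rewrite !divr_gt0.
  have [r0 [r00 H]] : exists r, 0 < r /\ forall i, i \in (A : seq I) -> forall t, near r t ->
      nm (f t i - f t0 i) < e / 4 / n.
    elim: (enum_fset A) => [|i s [r [r0 IH]]]; first by exists 1.
    have [r' r'0 H] := fc i _ en; exists (Num.min r r'); split; first by rewrite lt_min r0.
    move=> j; rewrite inE => /predU1P[->|js] t nt.
      by apply: H; apply: nearM nt; rewrite ge_min lexx orbT.
    by apply: IH => //; apply: nearM nt; rewrite ge_min lexx.
  exists r0 => // t nt; rewrite -sumrB (le_trans (nm_sum _ _))//.
  rewrite (@le_trans _ _ (\sum_(i <- A) e / 4 / n))//.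
    by rewrite !big_seq ler_sum// => i iA; rewrite ltW// H.
  rewrite big_const_seq count_predT iter_addr_0 -[leLHS]mulr_natr.
  rewrite -mulrA ler_piMr//; first by rewrite divr_ge0// ltW.
  by rewrite mulrC ler_pdivrMr// mul1r /n lerDl.
exists r => // t /rP h; have h1 := tail t; have h2 := tail t0; rewrite nmBC in h2.
set X := \sum_(i <- A) f t i in h h1; set Y := \sum_(i <- A) f t0 i in h h2.
have -> : F t - F t0 = (F t - X) + ((X - Y) + (Y - F t0)) by ring.
have := nmD (F t - X) ((X - Y) + (Y - F t0)); have := nmD (X - Y) (Y - F t0); lra.
Qed.

End UnconditionalSums.

(** * Termwise differentiation of exponential series *)

Section ExponentialSeries.
Variable R : realType.
Local Notation C := (Cplx R).

Lemma expR_sq_bound (x : R) : 0 <= x -> x ^+ 2 <= 2 * expR x.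
Proof.
move=> x0; have := expR_ge1Dxn 1 x0; rewrite (_ : 2`! = 2%N)// => h.
have : x ^+ 2 / 2 <= expR x by rewrite (le_trans _ h)// lerDr.
by rewrite ler_pdivrMr// mulrC.
Qed.

(** By [cexp_second_order] the remainder of a term involves e^(2 |k| delta) |k x|^2, and absorbing
    |k|^2 costs another e^(|k| delta). This is the origin of the weight e^(3 |k| delta) in the
    hypothesis. *)
Lemma exp_series (I : choiceType) (a k : I -> C) (F : C -> C) (z : C) (delta M : R) :
  0 < delta ->
  bsum (fun i => nm (a i) * expR (complex.Re (k i * z) + 3 * (nm (k i) * delta))) M ->
  (forall x, nm x < delta -> has_sum (fun i => a i * cexp (k i * (z + x))) (F (z + x))) ->
  exists2 d, cdiff F z d & has_sum (fun i => a i * k i * cexp (k i * z)) d.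
Proof.
move=> d0 aM FS.
have kd0 i : 0 <= nm (k i) * delta by rewrite mulr_ge0 ?nm_ge0// ltW.
pose W i := nm (a i) * expR (complex.Re (k i * z) + 3 * (nm (k i) * delta)).
have WE i : W i = nm (a i) * expR (complex.Re (k i * z)) * expR (3 * (nm (k i) * delta)).
  by rewrite /W expRD mulrA.
have a1 : asum (fun i => a i * k i * cexp (k i * z)).
  apply: (asum_le (g := fun i => delta^-1 * W i)).
    by apply: bsumZ aM; rewrite invr_ge0 ltW.
  move=> i; rewrite WE 2!nmM nm_cexp.
  set X := nm (a i); set K := nm (k i); set E := expR (complex.Re _).
  rewrite ler_pdivlMl//; have -> : delta * (X * K * E) = X * E * (K * delta) by ring.
  rewrite ler_wpM2l ?mulr_ge0 ?nm_ge0 ?expR_ge0//.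
  by have := kd0 i; have := expR_ge1Dx (3 * (K * delta)); rewrite /K; lra.
have dsum := asum_has_sum a1; exists (tsum (fun i => a i * k i * cexp (k i * z))) => //.
set d := tsum _ in dsum *.
have Fz : has_sum (fun i => a i * cexp (k i * z)) (F z).
  by have := FS 0; rewrite nm0 addr0; exact.
have M0 : 0 <= M by exact: bsum_ge0 aM.
pose Q := 4 * delta^-1 ^+ 2 * M.
have Q0 : 0 <= Q by rewrite mulr_ge0// mulr_ge0// exprn_ge0// invr_ge0 ltW.
have key x : nm x < delta -> nm (F (z + x) - F z - d * x) <= Q * nm x ^+ 2.
  move=> xd.
  have h := has_sumB (has_sumB (FS x xd) Fz) (has_sumZ x dsum).
  rewrite [d * x]mulrC /Q mulrAC.
  apply: (has_sum_nm_le h (g := fun i => 4 * delta^-1 ^+ 2 * nm x ^+ 2 * W i)).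
    apply: bsumZ aM; rewrite mulr_ge0 ?exprn_ge0 ?nm_ge0//.
    by rewrite mulr_ge0 ?exprn_ge0 ?invr_ge0// ltW.
  move=> i; have -> : a i * cexp (k i * (z + x)) - a i * cexp (k i * z) -
      x * (a i * k i * cexp (k i * z)) =
      a i * cexp (k i * z) * (cexp (k i * x) - 1 - k i * x).
    by rewrite mulrDr cexpD; ring.
  rewrite 2!nmM nm_cexp WE.
  set X := nm (a i); set E := expR (complex.Re _).
  have XE : 0 <= X * E by rewrite mulr_ge0 ?nm_ge0 ?expR_ge0.
  have := cexp_second_order (k i * x); rewrite nmM.
  set K := nm (k i); set H := nm x => h1.
  have K0 : 0 <= K by exact: nm_ge0. have H0 : 0 <= H by exact: nm_ge0.
  have KH : K * H <= K * delta by rewrite ler_wpM2l// ltW.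
  have h2 : expR (2 * (K * H)) <= expR (2 * (K * delta)) by rewrite ler_expR; lra.
  have h3 := expR_sq_bound (kd0 i); rewrite -/K in h3.
  have h4 : (K * H) ^+ 2 <= 2 * expR (K * delta) * delta^-1 ^+ 2 * H ^+ 2.
    have -> : (K * H) ^+ 2 = (K * delta) ^+ 2 * delta^-1 ^+ 2 * H ^+ 2.
      by field; rewrite gt_eqF.
    by rewrite ler_wpM2r ?exprn_ge0// ler_wpM2r// exprn_ge0// invr_ge0 ltW.
  rewrite (le_trans (ler_wpM2l XE h1))//.
  have -> : 4 * delta^-1 ^+ 2 * H ^+ 2 * (X * E * expR (3 * (K * delta))) =
    X * E * (2 * (expR (2 * (K * delta)) * (2 * expR (K * delta) * delta^-1 ^+ 2 * H ^+ 2))).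
    by rewrite (_ : 3 * (K * delta) = 2 * (K * delta) + K * delta) ?expRD; ring.
  rewrite ler_wpM2l// ler_wpM2l// ler_pM ?expR_ge0 ?exprn_ge0 ?mulr_ge0//.
move=> e e0; exists (Num.min delta (e / (Q + 1))) => [|x].
  by rewrite lt_min d0 divr_gt0// ltr_wpDl.
rewrite lt_min => /andP[xd xe]; rewrite (le_trans (key x xd))// expr2 mulrA.
rewrite ler_wpM2r ?nm_ge0//; move: xe; rewrite ltr_pdivlMr ?ltr_wpDl//.
by have := nm_ge0 x; nra.
Qed.

End ExponentialSeries.

Section FiniteSubsets.
Variable R : realType.
Local Notation C := (Cplx R).

Lemma sum_fpowerset (V : comNzRingType) (K : choiceType) (w : K -> V) (A : {fset K}) :
  \sum_(b <- fpowerset A) \prod_(c <- b) w c = \prod_(c <- A) (1 + w c).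
Proof.
elim/finSet_rect: A => A IH.
have [->|[c cA]] := fset_0Vmem A.
  by rewrite fpowerset0 big_seq_fset1 !big_seq_fset0.
pose A' := (A `\ c)%fset.
have cA' : c \notin A' by rewrite !inE eqxx.
have AE : A = (c |` A')%fset by rewrite fsetD1K.
rewrite AE big_fsetU1//= -IH ?fproperD1// mulrDl mul1r mulr_sumr.
have -> : \sum_(b <- fpowerset A') w c * \prod_(d <- b) w d =
    \sum_(b <- [seq (c |` b)%fset | b <- fpowerset A']) \prod_(d <- b) w d.
  rewrite big_map big_seq [RHS]big_seq; apply: eq_bigr => b.
  rewrite fpowersetE => /fsubsetP bA'; rewrite big_fsetU1//.
  by apply: contra cA'; exact: bA'.
rewrite -big_cat; apply: perm_big; apply: uniq_perm; first exact: fset_uniq.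
  rewrite cat_uniq fset_uniq map_inj_in_uniq ?fset_uniq ?andbT//=; last first.
    move=> b b'; rewrite !fpowersetE => /fsubsetP bA /fsubsetP bA' E.
    have cb : c \notin b by apply: contra cA'; exact: bA.
    have cb' : c \notin b' by apply: contra cA'; exact: bA'.
    by rewrite -(fsetU1K cb) E fsetU1K.
  apply/hasPn => b /mapP[b' _ ->]; rewrite fpowersetE; apply: contra cA' => /fsubsetP.
  by apply; rewrite !inE eqxx.
move=> b; rewrite mem_cat !fpowersetE.
apply/idP/orP => [bA|[bA|/mapP[b' + ->]]].
- have [cb|cb] := boolP (c \in b).
    right; apply/mapP; exists (b `\ c)%fset; last by rewrite fsetD1K.
    by rewrite fpowersetE; apply/fsubsetP => x; rewrite !inE => /andP[xc xb];
       have := fsubsetP bA x xb; rewrite !inE (negbTE xc).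
  left; apply/fsubsetP => x xb; have := fsubsetP bA x xb.
  by rewrite !inE; case: eqP => //= xc; move: cb; rewrite -xc xb.
- by rewrite (fsubset_trans bA)// fsubsetU1.
- by rewrite fpowersetE => bA; rewrite fsetUS.
Qed.

Lemma prod_1D_expR (K : Type) (w : K -> R) (s : seq K) : (forall c, 0 <= w c) ->
  \prod_(c <- s) (1 + w c) <= expR (\sum_(c <- s) w c).
Proof.
move=> w0; elim: s => [|c s IH]; first by rewrite !big_nil expR0.
rewrite !big_cons expRD ler_pM ?expR_ge1Dx// ?addr_ge0//.
by rewrite prodr_ge0// => c' _; rewrite addr_ge0.
Qed.

(** Finitely many finite sets are all subsets of their union, so the sum of their products is at
    most the product of the 1 + w c over that union, hence at most e^W. *)
Lemma bsum_subsets (K : choiceType) (w : K -> R) W : bsum w W ->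
  bsum (fun b : {fset K} => \prod_(c <- b) w c) (expR W).
Proof.
move=> [w0 wW].
have p0 (b : {fset K}) : 0 <= \prod_(c <- b) w c by rewrite prodr_ge0.
split=> // s us.
pose U := (\bigcup_(b <- s) b)%fset.
have sub : {subset s <= fpowerset U}.
  by move=> b bs; rewrite fpowersetE; exact: bigfcup_sup.
rewrite (le_trans (ler_sum_subset p0 us (fset_uniq _) sub))// sum_fpowerset.
by rewrite (le_trans (prod_1D_expR _ w0))// ler_expR wW// fset_uniq.
Qed.

Lemma nm_prod (K : Type) (w : K -> C) (s : seq K) :
  nm (\prod_(c <- s) w c) = \prod_(c <- s) nm (w c).
Proof.
by elim/big_rec2 : _ => [|c y x _ <-]; [exact: nm1|rewrite nmM].
Qed.

Lemma nm_prod_1D_sub1 (K : Type) (w : K -> C) (s : seq K) :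
  nm (\prod_(c <- s) (1 + w c) - 1) <= expR (\sum_(c <- s) nm (w c)) - 1.
Proof.
elim: s => [|c s IH]; first by rewrite !big_nil subrr nm0 expR0 subrr.
rewrite !big_cons expRD.
set P := \prod_(j <- s) _ in IH *; set E := expR (\sum_(j <- s) _) in IH *.
have -> : (1 + w c) * P - 1 = (1 + w c) * (P - 1) + w c by ring.
have h1 : nm (1 + w c) <= expR (nm (w c)).
  by rewrite (le_trans (nmD _ _))// nm1 expR_ge1Dx.
have h2 := expR_ge1Dx (nm (w c)).
rewrite (le_trans (nmD _ _))// nmM.
have h3 : nm (1 + w c) * nm (P - 1) <= expR (nm (w c)) * (E - 1).
  by rewrite ler_pM ?nm_ge0.
lra.
Qed.

End FiniteSubsets.
(** * The theta function *)

Section FockProducts.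
Variable R : realType.
Local Notation C := (Cplx R).

Lemma climitP (u : nat -> C) (l : C) : u @ \oo --> l <->
  forall e : R, 0 < e -> exists N, forall n, (N <= n)%N -> nm (u n - l) < e.
Proof.
split=> [/cvgrPdist_lt H e e0|H].
  have /H[N _ HN] : 0 < toC e by rewrite toC_gt0.
  by exists N => n /HN /=; rewrite nm_lt nmBC.
apply/cvgrPdist_lt => _ /lt0C[e e0 ->]; have [N HN] := H e e0.
by exists N => // n /HN; rewrite nm_lt nmBC.
Qed.

Lemma climit_unique (u : nat -> C) (l l' : C) : u @ \oo --> l -> u @ \oo --> l' -> l = l'.
Proof. by move=> h h'; rewrite -(cvg_lim _ h)// -(cvg_lim _ h'). Qed.

Lemma climit_eq (u v : nat -> C) (l : C) : u =1 v -> u @ \oo --> l -> v @ \oo --> l.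
Proof. by move=> /funext ->. Qed.

Lemma climit_expr (x : C) : nm x < 1 -> (fun n => x ^+ n) @ \oo --> (0 : C).
Proof.
move=> x1; apply/climitP => e e0.
have xx : 0 <= nm x < 1 by rewrite nm_ge0.
have [k kP] := expr_small xx e0; exists k => n kn.
rewrite subr0 nmX (le_lt_trans _ kP)// ler_wiXn2l ?nm_ge0 ?ltW//.
Qed.

Lemma bsum_geometric (r : R) : 0 <= r < 1 -> bsum (fun n : nat => r ^+ n) (1 - r)^-1.
Proof.
move=> /andP[r0 r1]; split=> [n|s us]; first exact: exprn_ge0.
pose N := (\max_(n <- s) n).+1.
have sub : {subset s <= iota 0 N}.
  by move=> n ns; rewrite mem_iota /= add0n ltnS; exact: leq_bigmax_seq.
rewrite (le_trans (ler_sum_subset (fun n => exprn_ge0 n r0) us (iota_uniq _ _) sub))//.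
have := subrX1 r N; rewrite -(big_mkord predT (fun i => r ^+ i)) /index_iota subn0.
set S := \sum_(i <- _) _ => h.
by rewrite -[_^-1]mul1r ler_pdivlMr ?subr_gt0//; have := exprn_ge0 N r0; nra.
Qed.

Lemma bsum_creator (g : nat -> R) M : bsum g M ->
  bsum (fun c : creator => g c.2) (2 * M).
Proof.
move=> gM; have M0 := bsum_ge0 gM.
apply: (@bsum_pair R bool nat _ (fun=> M)); first by [].
split=> // s us; have sub : {subset s <= [:: true; false]} by case; rewrite !inE.
rewrite (le_trans (ler_sum_subset (fun=> M0) us _ sub))//.
by rewrite !big_cons big_nil addr0 mulr_natl.
Qed.

Definition box (N : nat) : {fset creator} :=
  [fset x in [seq (e, j) | e <- [:: true; false], j <- iota 0 N]]%fset.

Lemma mem_box N c : (c \in box N) = (c.2 < N)%N.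
Proof.
case: c => e j; rewrite !inE /= ?in_nil ?orbF; apply/orP/idP.
  by case=> /mapP[k]; rewrite mem_iota => kN [_ ->].
by move=> jN; case: e; [left|right]; apply/mapP; exists j; rewrite ?mem_iota.
Qed.

Lemma big_box (w : creator -> C) N : \prod_(c <- box N) w c =
  \prod_(0 <= j < N) (w (true, j) * w (false, j)).
Proof.
have us : uniq [seq (e, j) | e <- [:: true; false], j <- iota 0 N].
  by apply: allpairs_uniq; rewrite ?iota_uniq// => -[x1 x2] [y1 y2] _ _ [-> ->].
rewrite (perm_big [seq (e, j) | e <- [:: true; false], j <- iota 0 N]).
  by rewrite big_allpairs_dep /= !big_cons big_nil mulr1 big_split /= /index_iota subn0.
apply: uniq_perm; [exact: fset_uniq|exact: us|move=> [e j]].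
rewrite mem_box; apply/idP/allpairsP => [jN|[[e' j'] [_ + [_ ->]]]].
  by exists (e, j); split=> //=; [by case: (e); rewrite !inE|rewrite mem_iota].
by rewrite mem_iota.
Qed.

Variables (w : creator -> C) (W : R).
Hypothesis wW : bsum (fun c => nm (w c)) W.

Lemma fock_asum : asum (fun b : basis => \prod_(c <- b) w c).
Proof.
apply: (asum_le (bsum_subsets wW)) => b; rewrite nm_prod; exact: lexx.
Qed.

Definition fock_sum : C := tsum (fun b : basis => \prod_(c <- b) w c).

Lemma fock_has_sum : has_sum (fun b : basis => \prod_(c <- b) w c) fock_sum.
Proof. exact/asum_has_sum/fock_asum. Qed.

(** The Fock vectors built from the creators in [box N] form a power set, over which the sum is a
    finite product. The boxes exhaust all creators, so the sum over the Fock basis is an infinite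
    product. *)
Lemma fock_box : (fun N => \prod_(0 <= j < N) ((1 + w (true, j)) * (1 + w (false, j))))
  @ \oo --> fock_sum.
Proof.
apply/climitP => e e0; have [A AP] := fock_has_sum e0.
pose N0 := (\max_(b <- A) \max_(c <- (b : basis)) c.2.+1)%N.
exists N0 => N NN; rewrite -(big_box (fun c => 1 + w c)) -sum_fpowerset.
apply: AP; apply/fsubsetP => b bA; rewrite fpowersetE; apply/fsubsetP => c cb.
rewrite mem_box (leq_trans _ NN)//.
have h1 : (\max_(d <- b) d.2.+1 <= N0)%N.
  by apply: (@leq_bigmax_seq _ _ _ (fun b : basis => \max_(d <- b) d.2.+1)).
by rewrite (leq_trans _ h1)//; apply: (@leq_bigmax_seq _ _ _ (fun d : creator => d.2.+1)).
Qed.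

(** Beyond some box the remaining w have total modulus below 1/4, so the remaining factors multiply
    to something within 1/2 of 1. Hence the partial products never fall below half of a fixed
    nonzero one. *)
Lemma fock_sum_neq0 : (forall c, 1 + w c != 0) -> fock_sum != 0.
Proof.
move=> w1.
have q0 : 0 < 1 / 4 :> R by rewrite divr_gt0.
have [A AP] := bsum_tail wW q0.
pose M := (\max_(c <- A) c.2.+1)%N.
pose P N := \prod_(0 <= j < N) ((1 + w (true, j)) * (1 + w (false, j))).
have PM : P M != 0.
  by rewrite /P; elim/big_ind : _ => [|x y x0 y0|j _]; rewrite ?oner_neq0// mulf_neq0.
have lb N : (M <= N)%N -> nm (P M) / 2 <= nm (P N).
  move=> MN; rewrite /P -!(big_box (fun c => 1 + w c)).
  have bb : {subset box M <= box N} by move=> c; rewrite !mem_box => /leq_trans; exact.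
  pose s := [seq c <- box N | c \notin box M].
  have -> : \prod_(c <- box N) (1 + w c) = \prod_(c <- box M) (1 + w c) * \prod_(c <- s) (1 + w c).
    rewrite (bigID (mem (box M))) /=; congr (_ * _); last by rewrite /s big_filter.
    rewrite -big_filter; apply: perm_big; apply: uniq_perm; rewrite ?filter_uniq ?fset_uniq//.
    by move=> x; rewrite mem_filter; case xs: (x \in box M) => //=; exact: bb.
  rewrite nmM; set X := nm (\prod_(c <- box M) _); set Y := \prod_(c <- s) _.
  have sA : \sum_(c <- s) nm (w c) < 1 / 4.
    apply: AP => [|c]; first by rewrite filter_uniq// fset_uniq.
    rewrite mem_filter mem_box -leqNgt => /andP[Mc _]; apply: contraTN Mc => cA.
    by rewrite -ltnNge; apply: (@leq_bigmax_seq _ _ _ (fun d : creator => d.2.+1)).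
  have e12 : expR (\sum_(c <- s) nm (w c)) <= 3 / 2.
    set x := \sum_(c <- s) _ in sA *.
    have := expR_ge1Dx (- x); rewrite expRN => h.
    have e0 := expR_gt0 x.
    have := ler_wpM2r (ltW e0) h; rewrite mulVf ?gt_eqF//.
    nra.
  have Yh : nm (Y - 1) <= 1 / 2 by rewrite (le_trans (nm_prod_1D_sub1 _ _))//; lra.
  have : 1 / 2 <= nm Y.
    have := nmB Y (Y - 1); rewrite opprB addrC subrK nm1; lra.
  have X0 : 0 <= X by exact: nm_ge0.
  nra.
apply/eqP => f0; have := fock_box; rewrite f0 => /climitP.
have p2 : 0 < nm (P M) / 2 by rewrite divr_gt0 ?nm_gt0.
move=> /(_ _ p2)[N HN]; have := HN (maxn M N) (leq_maxr _ _).
by rewrite subr0 ltNge lb// leq_maxl.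
Qed.

End FockProducts.
Section ThetaProduct.
Variable R : realType.
Local Notation C := (Cplx R).
Implicit Types (t v : C) (c : creator) (m : pred creator).

Definition dgr c : C := if c.1 then 1 else -1.

(** The weight j + 1/2 of the creator minus half its charge. This accounts for the 1/2 in kappa =
    beta + 1/2; the part beta is contained in v. *)
Definition ht c : nat := (c.2 + ~~ c.1)%N.

(* With t = 2 pi i tau and v = 2 pi i (alpha - beta tau), the factor that c contributes to
   f q^(L_sigma_g(0) - 1/24) and to the sign of the supertrace. *)
Definition wt m t v c : C :=
  if m c then - cexp (dgr c * v + (ht c)%:R * t) else 0.

(** The mask m deletes factors from the product: [predT] keeps all of them, and [predC1 c] gives the
    cofactor of the factor of c. *)
Definition pth m t v : C := fock_sum (wt m t v).

Lemma Re_natM (n : nat) (z : C) : complex.Re (n%:R * z) = n%:R * complex.Re z.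
Proof. by rewrite -toC_nat ReM Re_toC Im_toC mul0r subr0. Qed.

Lemma Re_dgrM c v : complex.Re (dgr c * v) <= nm v.
Proof.
rewrite (le_trans (ler_norm _))// (le_trans (Re_le_nm _))// nmM /dgr.
by case: ifP; rewrite ?nmN nm1 mul1r.
Qed.

Lemma nm_wt m t v c : complex.Re t < 0 ->
  nm (wt m t v c) <= expR (nm v) * expR (complex.Re t) ^+ c.2.
Proof.
move=> t0; rewrite /wt; case: ifP => _; last first.
  by rewrite nm0 mulr_ge0 ?exprn_ge0 ?expR_ge0.
rewrite nmN nm_cexp ReD expRD ler_pM ?expR_ge0 ?ler_expR ?Re_dgrM//.
rewrite Re_natM -expRM_natl ler_expR ler_wnM2r ?(ltW t0)// ler_nat.
exact: leq_addr.
Qed.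

Lemma bsum_wt m t v (k : R) : complex.Re t < 0 -> 0 <= k ->
  exists W, bsum (fun c => k * nm (wt m t v c)) W.
Proof.
move=> t0 k0; have r1 : 0 <= expR (complex.Re t) < 1 by rewrite expR_ge0 expR_lt1.
have h := bsumZ (mulr_ge0 k0 (expR_ge0 (nm v))) (bsum_creator (bsum_geometric r1)).
eexists; apply: (bsum_le _ h) => c.
by rewrite mulr_ge0 ?nm_ge0//= -mulrA ler_wpM2l// nm_wt.
Qed.

Lemma bsum_wt1 m t v : complex.Re t < 0 -> exists W, bsum (fun c => nm (wt m t v c)) W.
Proof.
move=> t0; have [W H] := bsum_wt m v t0 ler01; exists W.
by apply: (bsum_le _ H) => c; rewrite mul1r nm_ge0 lexx.
Qed.

Lemma pth_has_sum m t v : complex.Re t < 0 ->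
  has_sum (fun b : basis => \prod_(c <- b) wt m t v c) (pth m t v).
Proof. by move=> t0; have [W H] := bsum_wt1 m v t0; exact: fock_has_sum H. Qed.

Lemma pth_box m t v : complex.Re t < 0 ->
  (fun N => \prod_(0 <= j < N) ((1 + wt m t v (true, j)) * (1 + wt m t v (false, j))))
  @ \oo --> pth m t v.
Proof. by move=> t0; have [W H] := bsum_wt1 m v t0; exact: fock_box H. Qed.

Lemma pth_neq0 m t v : complex.Re t < 0 -> (forall c, 1 + wt m t v c != 0) ->
  pth m t v != 0.
Proof. by move=> t0; have [W H] := bsum_wt1 m v t0; exact: fock_sum_neq0 H. Qed.

Definition chg (b : basis) : C := \sum_(c <- b) dgr c.

Lemma prod_cexp (K : Type) (s : seq K) (f : K -> C) :
  \prod_(c <- s) cexp (f c) = cexp (\sum_(c <- s) f c).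
Proof.
elim: s => [|c s IH]; first by rewrite !big_nil cexp0.
by rewrite !big_cons IH cexpD.
Qed.

Lemma wtD m t v v' c : wt m t (v + v') c = wt m t v c * cexp (dgr c * v').
Proof.
rewrite /wt; case: ifP => _; last by rewrite mul0r.
by rewrite mulNr -cexpD mulrDr addrAC.
Qed.

Lemma prod_wt m t v (b : basis) :
  \prod_(c <- b) wt m t v c = \prod_(c <- b) wt m t 0 c * cexp (chg b * v).
Proof.
rewrite /chg mulr_suml -prod_cexp -big_split /=; apply: eq_bigr => c _.
by rewrite -wtD add0r.
Qed.

Lemma nm_chg (b : basis) : nm (chg b) <= \sum_(c <- b) 1.
Proof.
rewrite (le_trans (nm_sum _ _))// ler_sum// => c _.
by rewrite /dgr; case: ifP; rewrite ?nmN nm1.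
Qed.

Lemma expR_sum1 (b : basis) k : expR (\sum_(c <- b) k) = \prod_(c <- b) expR k :> R.
Proof. by rewrite expR_sum. Qed.

(** As a function of v the sum over b is an exponential series with exponents [chg b]. Their modulus
    is at most the number of creators, so the weight e^(3 |chg b|) is absorbed by multiplying each
    factor by e^3. *)
Lemma entire_pth m t : complex.Re t < 0 -> entire (pth m t).
Proof.
move=> t0 v; have [W H] := bsum_wt m v t0 (expR_ge0 (3 : R)).
have [] := @exp_series R _ (fun b : basis => \prod_(c <- b) wt m t 0 c) chg (pth m t) v 1
  (expR W) ltr01.
- apply: (bsum_le _ (bsum_subsets H)) => b; rewrite mulr_ge0 ?nm_ge0 ?expR_ge0//=.
  rewrite expRD mulrA -nm_cexp -nmM -prod_wt mulr1 big_split /= mulrC -nm_prod.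
  rewrite ler_wpM2r ?nm_ge0// -expR_sum1 ler_expR.
  have -> : \sum_(c <- b) (3 : R) = 3 * \sum_(c <- b) 1.
    by rewrite mulr_sumr; apply: eq_bigr => c _; rewrite mulr1.
  by have := nm_chg b; lra.
- move=> x _; apply: eq_has_sum (pth_has_sum m (v + x) t0) => b.
  by rewrite prod_wt.
by move=> d dP _; exists d.
Qed.

Definition hgt (b : basis) : C := \sum_(c <- b) (ht c)%:R.

Lemma pth0_cont m t : complex.Re t < 0 -> cdf (fun t => pth m t 0) t.
Proof.
(* With 3 d = - r / 2 the dominating family is the one of the period r / 2. *)
move=> t0; pose r := complex.Re t; pose d := - r / 6.
have d0 : 0 < d by rewrite divr_gt0// oppr_gt0.
have t20 : complex.Re (toC (r / 2)) < 0.
  by rewrite Re_toC ltr_pdivrMr// mul0r.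
have [W H] := bsum_wt1 m 0 t20.
have prodE t' (b : basis) : \prod_(c <- b) wt m t' 0 c =
    \prod_(c <- b) (if m c then -1 else 0) * cexp (hgt b * t').
  rewrite /hgt mulr_suml -prod_cexp -big_split /=; apply: eq_bigr => c _.
  by rewrite /wt mulr0 add0r; case: ifP => _; rewrite ?mul0r// mulN1r.
have hgtR (b : basis) : hgt b = toC (\sum_(c <- b) (ht c)%:R).
  by rewrite /hgt /toC rmorph_sum; apply: eq_bigr => c _; rewrite -[RHS]/(toC _) toC_nat.
have hgt0 (b : basis) : 0 <= \sum_(c <- b) (ht c)%:R :> R by rewrite sumr_ge0.
have [] := @exp_series R _ (fun b : basis => \prod_(c <- b) (if m c then -1 else 0)) hgt
  (fun t => pth m t 0) t d (expR W) d0.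
- apply: (bsum_le _ (bsum_subsets H)) => b; rewrite mulr_ge0 ?nm_ge0 ?expR_ge0//=.
  rewrite -nm_prod prodE nmM nm_cexp ler_wpM2l ?nm_ge0// ler_expR hgtR nm_toC.
  rewrite ger0_norm// !ReM !Re_toC !Im_toC !mul0r !subr0 -/r /d.
  by have := hgt0 b; lra.
- move=> x xd; have tx : complex.Re (t + x) < 0.
    rewrite ReD -/r; have := Re_le_nm x; rewrite ler_norml => /andP[_ h].
    by rewrite /d in xd; have : r < 0 by []; lra.
  by apply: eq_has_sum (pth_has_sum m 0 tx) => b; rewrite prodE.
by move=> z zP _; exists z.
Qed.

End ThetaProduct.

(** * Quasi-periods and zeros of theta *)

Section Theta.
Variable R : realType.
Local Notation C := (Cplx R).
Variable t : C.
Hypothesis t0 : complex.Re t < 0.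
Implicit Types (v z : C).

Definition th v : C := pth predT t v.
Definition ths v : C := pth (predC1 (true, 0%N)) t v.

Definition fac v (j : nat) : C := (1 - cexp (v + j%:R * t)) * (1 - cexp (- v + j.+1%:R * t)).

Lemma climit_shift (u : nat -> C) (l : C) : u @ \oo --> l -> (fun n => u n.+1) @ \oo --> l.
Proof.
move=> /climitP h; apply/climitP => e /h[N NP]; exists N => n Nn.
by apply: NP; rewrite (leq_trans Nn).
Qed.

Lemma th_box v : (fun N => \prod_(0 <= j < N) fac v j) @ \oo --> th v.
Proof.
apply: (climit_eq _ (@pth_box R predT t v t0)) => N; apply: eq_bigr => j _.
by rewrite /wt /dgr /ht /= mul1r mulN1r addn0 addn1.
Qed.

Lemma cvg_cexp_nat v : (fun N : nat => cexp (v + N%:R * t)) @ \oo --> (0 : C).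
Proof.
have h : nm (cexp t) < 1 by rewrite nm_cexp expR_lt1.
have h2 : (fun N : nat => cexp v * cexp t ^+ N) @ \oo --> cexp v * 0.
  by apply: cvgM; [exact: cvg_cst|exact: climit_expr].
rewrite mulr0 in h2; apply: (climit_eq _ h2) => N.
by rewrite cexpD cexpMn.
Qed.

(** Replacing v by - v exchanges the two factors of [fac] with a shift of the index by one, so the
    partial products differ only by their end factors. *)
Lemma th_telescope v N :
  \prod_(0 <= j < N) fac (- v) j * ((1 - cexp v) * (1 - cexp (- v + N%:R * t))) =
  \prod_(0 <= j < N) fac v j * ((1 - cexp (- v)) * (1 - cexp (v + N%:R * t))).
Proof.
elim: N => [|N IH]; first by rewrite !big_geq// !mul0r !addr0 mulrC; ring.
rewrite !big_nat_recr//=; set A := \prod_(0 <= j < N) _ in IH *.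
set B := \prod_(0 <= j < N) _ in IH *.
rewrite /fac opprK; move: IH; set x := cexp (v + N%:R * t); set y := cexp (- v + N%:R * t).
set x' := cexp (v + N.+1%:R * t); set y' := cexp (- v + N.+1%:R * t) => IH.
have -> : A * ((1 - y) * (1 - x')) * ((1 - cexp v) * (1 - y')) =
  A * ((1 - cexp v) * (1 - y)) * ((1 - x') * (1 - y')) by ring.
by rewrite IH; ring.
Qed.

Lemma th_opp_mul v : th (- v) * (1 - cexp v) = th v * (1 - cexp (- v)).
Proof.
have lim1 w : (fun N : nat => 1 - cexp (w + N%:R * t)) @ \oo --> (1 : C).
  apply/climitP => e e0; have /climitP/(_ e e0)[N NP] := cvg_cexp_nat w.
  by exists N => n /NP; rewrite subr0 addrAC subrr sub0r nmN.
have h1 : (fun N => \prod_(0 <= j < N) fac (- v) j * ((1 - cexp v) * (1 - cexp (- v + N%:R * t))))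
    @ \oo --> th (- v) * ((1 - cexp v) * 1).
  apply: cvgM; first exact: th_box.
  by apply: cvgM; [exact: cvg_cst|exact: lim1].
have h2 : (fun N => \prod_(0 <= j < N) fac v j * ((1 - cexp (- v)) * (1 - cexp (v + N%:R * t))))
    @ \oo --> th v * ((1 - cexp (- v)) * 1).
  apply: cvgM; first exact: th_box.
  by apply: cvgM; [exact: cvg_cst|exact: lim1].
rewrite !mulr1 in h1 h2; apply: (climit_unique h1); apply: (climit_eq _ h2) => N.
by rewrite th_telescope.
Qed.

Lemma th_ths v : th v = (1 - cexp v) * ths v.
Proof.
have h1 := @th_box v; have h2 := @pth_box R (predC1 (true, 0%N)) t v t0.
have {}h1 := climit_shift h1; have {}h2 := climit_shift h2.
apply: (climit_unique h1).
have h3 : (fun N : nat => (1 - cexp v) * \prod_(0 <= j < N.+1)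
  ((1 + wt (predC1 (true, 0%N)) t v (true, j)) * (1 + wt (predC1 (true, 0%N)) t v (false, j))))
   @ \oo --> (1 - cexp v) * ths v.
  by apply: cvgM; [exact: cvg_cst|exact: h2].
apply: (climit_eq _ h3) => N; rewrite !big_nat_recl// mulrA; congr (_ * _).
  by rewrite /fac /wt /dgr /ht /= mul0r !addr0 !mul1r mulN1r.
apply: eq_bigr => j _; rewrite /fac /wt /dgr /ht /=.
by rewrite mul1r mulN1r addn0 addn1.
Qed.

Lemma th_opp v : th (- v) = - cexp (- v) * th v.
Proof.
have [e1|e1] := eqVneq (cexp v) 1.
  by rewrite !th_ths cexpN e1 invr1 subrr !mul0r mulr0.
have n1 : 1 - cexp v != 0 by rewrite subr_eq0 eq_sym.
apply: (mulIf n1); rewrite th_opp_mul cexpN; field.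
exact: cexp_neq0.
Qed.

(** The factors of th(v + t) are those of th(- v) in the opposite order, which reduces the shift by
    t to [th_opp]. *)
Lemma thDt v : th (v + t) = - cexp (- v) * th v.
Proof.
rewrite -th_opp; apply: (climit_unique (@th_box (v + t))).
apply: (climit_eq _ (@th_box (- v))) => N; apply: eq_bigr => j _; rewrite /fac opprK mulrC.
have -> : v + t + j%:R * t = v + j.+1%:R * t by rewrite -natr1; ring.
by have -> : - (v + t) + j.+1%:R * t = - v + j%:R * t by rewrite -natr1; ring.
Qed.

Lemma thD2pii v : th (v + twopii R) = th v.
Proof.
rewrite /th /pth; congr fock_sum; apply/funext => c; rewrite wtD /dgr.
by case: ifP => _; rewrite ?mul1r ?mulN1r ?cexpN cexp_2pii ?invr1 mulr1.
Qed.

(* The Jacobi theta function theta_1 divided by i eta, for q = exp t. *)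
Definition theta v : C := cexp (t / 12 - v / 2) * th v.

Lemma cdf_cexp (f : C -> C) z : cdf f z -> cdf (fun x => cexp (f x)) z.
Proof. by move=> fd; apply: cdf_comp => //; eexists; exact: cdiff_cexp. Qed.

Lemma entire_theta : entire theta.
Proof.
move=> v; apply: cdfM; last exact: entire_pth.
apply: cdf_cexp; apply: cdfB; first exact: cdf_cst.
by apply: cdfM; [exact: cdf_id|exact: cdf_cst].
Qed.

Lemma thetaD2pii v : theta (v + twopii R) = - theta v.
Proof.
rewrite /theta thD2pii mulrDl opprD addrA cexpD.
by rewrite cexpN cexp_pii invrN invr1 mulrN1 mulNr.
Qed.

Lemma thetaDt v : theta (v + t) = - cexp (- t / 2 - v) * theta v.
Proof.
rewrite /theta thDt; set y := th v.
rewrite [LHS](_ : _ = - (cexp (t / 12 - (v + t) / 2) * cexp (- v)) * y); last by ring.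
rewrite [RHS](_ : _ = - (cexp (- t / 2 - v) * cexp (t / 12 - v / 2)) * y); last by ring.
rewrite -2!cexpD.
by have -> : t / 12 - (v + t) / 2 + - v = - t / 2 - v + (t / 12 - v / 2) by field.
Qed.

Lemma thetaN v : theta (- v) = - theta v.
Proof.
rewrite /theta th_opp; set y := th v.
rewrite [LHS](_ : _ = - (cexp (t / 12 - (- v) / 2) * cexp (- v)) * y); last by ring.
rewrite -cexpD.
have -> : t / 12 - (- v) / 2 + - v = t / 12 - v / 2 by field.
by rewrite mulNr.
Qed.

Definition K : C := - (cexp (t / 12) * ths 0).

Lemma K_neq0 : K != 0.
Proof.
rewrite oppr_eq0 mulf_neq0 ?cexp_neq0//; apply: pth_neq0 => // c.
rewrite /wt /=; case: ifP => [c0|_]; last by rewrite addr0 oner_neq0.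
rewrite mulr0 add0r subr_eq0; apply/eqP => /(congr1 (@nm R)).
rewrite nm1 nm_cexp Re_natM => /esym/eqP.
apply/negP; rewrite lt_eqF// expR_lt1 nmulr_llt0// ltr0n /ht.
by move: c0; case: c => [[] [|j]]; rewrite /= ?addn1 ?addn0.
Qed.

Lemma theta0 : theta 0 = 0.
Proof. by rewrite /theta th_ths cexp0 subrr !mul0r mulr0. Qed.

Lemma cdiff_theta0 : cdiff theta 0 K.
Proof.
have [d dP] : cdf (fun v => cexp (t / 12 - v / 2) * ths v) 0.
  apply: cdfM; last exact: entire_pth.
  apply: cdf_cexp; apply: cdfB; first exact: cdf_cst.
  by apply: cdfM; [exact: cdf_id|exact: cdf_cst].
have -> : theta = fun v => (1 - cexp v) * (cexp (t / 12 - v / 2) * ths v).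
  by apply/funext => v; rewrite /theta th_ths; ring.
apply: cdiff_eq; first apply: cdiffM dP.
  by apply: cdiffB; [exact: cdiff_cst|exact: cdiff_cexp].
by rewrite /= cexp0 subrr !mul0r addr0 subr0 sub0r mulN1r.
Qed.

Definition simple_zero z := theta z = 0 /\ exists2 d, d != 0 & cdiff theta z d.

Lemma simple_zero_shift (E : C -> C) w z : entire E -> (forall x, E x != 0) ->
  (forall x, theta x = E x * theta (x - w)) -> simple_zero z -> simple_zero (z + w).
Proof.
move=> Ed E0 EE [z0 [d d0 zd]].
have zw : z + w - w = z by rewrite addrK.
split; first by rewrite EE zw z0 mulr0.
have [e eP] := Ed (z + w).
exists (E (z + w) * d); first by rewrite mulf_neq0.
have -> : theta = fun x => E x * theta (x - w) by apply/funext.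
apply: cdiff_eq; first apply: cdiffM eP _.
  apply: (cdiff_comp (f := fun x => x - w)); last by rewrite zw; exact: zd.
  by apply: cdiffB; [exact: cdiff_id|exact: cdiff_cst].
by rewrite /= zw z0 mulr0 add0r subr0 mulr1.
Qed.

Lemma simple_zero_lattice (m n : int) : simple_zero (m%:~R * twopii R + n%:~R * t).
Proof.
have s0 : simple_zero 0 by split; [exact: theta0|exists K; [exact: K_neq0|exact: cdiff_theta0]].
have lin (a b : C) : entire (fun x => - cexp (a + b * x)).
  move=> x; have -> : (fun x => - cexp (a + b * x)) = fun x => -1 * cexp (a + b * x).
    by apply/funext => y; rewrite mulN1r.
  apply: cdfM; first exact: cdf_cst.
  apply: cdf_cexp; apply: cdfD; first exact: cdf_cst.
  by apply: cdfM; [exact: cdf_cst|exact: cdf_id].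
have lin0 (a b : C) x : - cexp (a + b * x) != 0 by rewrite oppr_eq0 cexp_neq0.
have sp z : simple_zero z -> simple_zero (z + twopii R).
  apply: (simple_zero_shift (lin 0 0) (lin0 0 0)) => x.
  by rewrite mul0r addr0 cexp0 mulN1r -thetaD2pii subrK.
have sm z : simple_zero z -> simple_zero (z + - twopii R).
  apply: (simple_zero_shift (lin 0 0) (lin0 0 0)) => x.
  by rewrite mul0r addr0 cexp0 mulN1r opprK thetaD2pii opprK.
have tp z : simple_zero z -> simple_zero (z + t).
  apply: (simple_zero_shift (lin (- t / 2 + t) (-1)) (lin0 _ _)) => x.
  rewrite -{1}(subrK t x) thetaDt; congr (- cexp _ * _); ring.
have tm z : simple_zero z -> simple_zero (z + - t).
  apply: (simple_zero_shift (lin (t / 2) 1) (lin0 _ _)) => x.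
  rewrite opprK thetaDt mulrA mulrNN -cexpD (_ : _ + _ = 0) ?cexp0 ?mul1r//.
  by field.
have natp (k : nat) w z : (forall z, simple_zero z -> simple_zero (z + w)) ->
    simple_zero z -> simple_zero (z + k%:R * w).
  move=> H; elim: k => [|k IH] sz; first by rewrite mul0r addr0.
  by rewrite mulrSr mulrDl mul1r addrA; apply/H/IH.
have intp (k : int) w z : (forall z, simple_zero z -> simple_zero (z + w)) ->
    (forall z, simple_zero z -> simple_zero (z + - w)) ->
    simple_zero z -> simple_zero (z + k%:~R * w).
  case: k => k H H' sz; first by rewrite -pmulrn; exact: natp.
  by rewrite NegzE mulrNz mulNr -mulrN -pmulrn; exact: natp.
by apply: (intp n) => //; rewrite -[_ * _]add0r; exact: (intp m).
Qed.

(** By [pth_neq0] the product vanishes only if one of its factors does, and [cexp_eq1] solves the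
    resulting equation. *)
Lemma theta_eq0 z : theta z = 0 -> exists m n : int, z = m%:~R * twopii R + n%:~R * t.
Proof.
move/eqP; rewrite mulf_eq0 (negbTE (cexp_neq0 _)) /= => /eqP tz.
have [c ceq] : exists c, 1 + wt predT t z c = 0.
  apply: contrapT => /forallNP H; have := @pth_neq0 R predT t z t0.
  by rewrite -/(th z) tz eqxx => /(_ (fun c => introN eqP (H c))).
have : cexp (dgr R c * z + (ht c)%:R * t) = 1.
  by apply/eqP; rewrite eq_sym -subr_eq0 -ceq /wt /=.
move=> /cexp_eq1[k kE].
case: c ceq kE => [[] j] _; rewrite /dgr /ht /= => kE.
  exists k, (- (j + 0)%:Z); rewrite -kE mulrNz pmulrn; ring.
exists (- k), (j + 1)%:Z; rewrite mulrNz mulNr -kE pmulrn; ring.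
Qed.

Lemma theta_zero_simple z : theta z = 0 -> exists2 d, d != 0 & cdiff theta z d.
Proof. by move=> /theta_eq0[m [n ->]]; have [] := simple_zero_lattice m n. Qed.

Lemma lattice_cover z : exists (s s' : R) (m n : int),
  [/\ 0 <= s <= 1, 0 <= s' <= 1 &
   z = twopii R * toC s + t * toC s' + (m%:~R * twopii R + n%:~R * t)].
Proof.
(* Since 2 pi i has real part 0, the coefficient of t is determined by real parts alone. *)
pose y := complex.Re z / complex.Re t.
pose x := (complex.Im z - y * complex.Im t) / (2 * pi).
have zE : z = twopii R * toC x + t * toC y.
  have p0 : (pi : R) != 0 by rewrite gt_eqF// pi_gt0.
  have gen (rz iz rt it q : R) : rt != 0 -> q != 0 ->
      rz = 0 * ((iz - rz / rt * it) / (2 * q)) - 2 * q * 0 + (rt * (rz / rt) - it * 0) /\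
      iz = 0 * 0 + 2 * q * ((iz - rz / rt * it) / (2 * q)) + (rt * 0 + it * (rz / rt)).
    by move=> r0 q0; split; field; rewrite ?r0 ?q0.
  have [g1 g2] := gen (complex.Re z) (complex.Im z) (complex.Re t) (complex.Im t) pi
    (negbT (lt_eqF t0)) p0.
  by apply: complex_eqP; rewrite ?(ReD, ImD, ReM, ImM) /= /x /y.
have fl (r : R) : 0 <= r - (Num.floor r)%:~R <= 1.
  rewrite subr_ge0 floor_le/= lerBlDl ltW//.
  by rewrite -[X in _ + X]/(1%:~R) -intrD floorD1_gt.
exists (x - (Num.floor x)%:~R), (y - (Num.floor y)%:~R), (Num.floor x), (Num.floor y).
by split; rewrite ?fl// {1}zE !toCB !toC_int; ring.
Qed.

End Theta.
(** * Modular transformations of the theta function *)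

Section ThetaModular.
Variable R : realType.
Local Notation C := (Cplx R).
Implicit Types (t v z : C).
Local Notation P := (twopii R).

(** For t = 2 pi i tau this is 2 pi i (- 1 / tau). *)
Definition inv_period t : C := - P ^+ 2 / t.

Lemma Re_lt0_neq0 t : complex.Re t < 0 -> t != 0.
Proof. by move=> t0; apply/eqP => tE; rewrite tE ltxx in t0. Qed.

Lemma ReV t : t != 0 -> complex.Re t^-1 = complex.Re t / nm t ^+ 2.
Proof.
move=> t0; have /(congr1 (@complex.Re R)) := mulfV t0.
have /(congr1 (@complex.Im R)) := mulfV t0; rewrite ReM ImM /= nm_ReIm.
have : nm t ^+ 2 != 0 by rewrite expf_neq0// nm_eq0.
rewrite nm_ReIm; move: (complex.Re t) (complex.Im t) (complex.Re t^-1) (complex.Im t^-1).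
move=> a b c d n0 h1 h2; apply: (mulIf n0); rewrite divfK//.
have -> : c * (a ^+ 2 + b ^+ 2) = a * (a * c - b * d) + b * (a * d + b * c) by ring.
by rewrite h1 h2 mulr1 mulr0 addr0.
Qed.

Lemma twopii_neq0 : P != 0.
Proof.
apply/eqP => /(congr1 (@complex.Im R)) /= /eqP; apply/negP.
by rewrite gt_eqF// mulr_gt0// pi_gt0.
Qed.

Lemma sqr_twopii : P ^+ 2 = - toC ((2 * pi) ^+ 2).
Proof.
by apply: complex_eqP; rewrite expr2 ?ReM ?ImM /= ?mul0r ?mulr0 ?addr0 ?sub0r ?oppr0 -?expr2.
Qed.

Lemma inv_period_lt0 t : complex.Re t < 0 -> complex.Re (inv_period t) < 0.
Proof.
move=> t0; have tn := Re_lt0_neq0 t0.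
rewrite /inv_period sqr_twopii opprK ReM Re_toC Im_toC mul0r subr0 ReV//.
rewrite pmulr_rlt0 ?exprn_gt0 ?mulr_gt0 ?pi_gt0//.
by rewrite pmulr_llt0// invr_gt0 exprn_gt0// nm_gt0.
Qed.

Lemma thetaB2pii t v : theta t (v - P) = - theta t v.
Proof. by rewrite -{2}(subrK P v) thetaD2pii opprK. Qed.

Definition gauss t z : C := cexp (- z ^+ 2 / (2 * t)).

(** Adding 2 pi i or t to z shifts the argument of the transformed theta by the new period t' or by
    - 2 pi i; the Gaussian restores the multipliers of [theta t]. *)
Definition thetaS t z : C := theta (inv_period t) (- P * z / t) * gauss t z.

Lemma thetaS_D2pii t z : complex.Re t < 0 -> thetaS t (z + P) = - thetaS t z.
Proof.
move=> t0; have tn := Re_lt0_neq0 t0; rewrite /thetaS /gauss.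
have -> : - P * (z + P) / t = - P * z / t + inv_period t by rewrite /inv_period; field.
rewrite thetaDt ?inv_period_lt0//; set y := theta _ (- P * z / t).
rewrite [LHS](_ : _ = - (y * (cexp (- inv_period t / 2 - - P * z / t) *
  cexp (- (z + P) ^+ 2 / (2 * t))))); last by move: (cexp _) (cexp _) => a b; ring.
by rewrite -cexpD; congr (- (y * cexp _)); rewrite /inv_period; field.
Qed.

Lemma thetaS_Dt t z : complex.Re t < 0 -> thetaS t (z + t) = - cexp (- t / 2 - z) * thetaS t z.
Proof.
move=> t0; have tn := Re_lt0_neq0 t0; rewrite /thetaS /gauss.
have -> : - P * (z + t) / t = - P * z / t - P by field.
rewrite thetaB2pii; set y := theta _ (- P * z / t).
rewrite [RHS](_ : _ = - (y * (cexp (- t / 2 - z) * cexp (- z ^+ 2 / (2 * t))))); last first.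
  by move: (cexp _) (cexp _) => a b; ring.
by rewrite -cexpD mulNr; congr (- (y * cexp _)); field.
Qed.

Lemma entire_thetaS t : complex.Re t < 0 -> entire (thetaS t).
Proof.
move=> t0 z; apply: cdfM.
  apply: (@cdf_comp R (fun z => - P * z / t)); last exact/entire_theta/inv_period_lt0.
  apply: cdfM; last exact: cdf_cst.
  by apply: cdfM; [exact: cdf_cst|exact: cdf_id].
apply: cdf_cexp; apply: cdfM; last exact: cdf_cst.
have -> : (fun z : C => - z ^+ 2) = fun z => -1 * z ^+ 2 by apply/funext => x; rewrite mulN1r.
by apply: cdfM; [exact: cdf_cst|apply: cdfX; exact: cdf_id].
Qed.

Definition inv_const t : C := - P / t * K (inv_period t) / K t.

(** Both functions have the same multipliers and the same zeros, so [elliptic_quotient] makes them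
    proportional; derivatives at 0 give the factor. *)
Lemma thetaS_E t z : complex.Re t < 0 -> thetaS t z = inv_const t * theta t z.
Proof.
move=> t0; have tn := Re_lt0_neq0 t0; have t'0 := inv_period_lt0 t0.
have [c cE] : exists c, forall z, thetaS t z = c * theta t z.
  apply: (@elliptic_quotient R (thetaS t) (theta t) P t).
  - exact: entire_thetaS.
  - exact: entire_theta.
  - move=> x x0; split; last exact: theta_zero_simple x0.
    have [m [n xE]] := theta_eq0 t0 x0; rewrite /thetaS.
    have -> : - P * x / t = (- n)%:~R * P + m%:~R * inv_period t.
      by rewrite xE mulrNz /inv_period; field.
    by have [-> _] := simple_zero_lattice t'0 (- n) m; rewrite mul0r.
  - exact: lattice_cover.
  - move=> w ww x; split; first case: ww => ->.
    + by rewrite thetaD2pii oppr_eq0.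
    + by rewrite thetaDt// mulNr oppr_eq0 mulf_eq0 (negbTE (cexp_neq0 _)).
    exists 1; rewrite ?nm1// mul1r; case: ww => ->.
      by rewrite thetaS_D2pii// thetaD2pii mulNr mulrN.
    rewrite thetaS_Dt// thetaDt//; move: (thetaS t x) (theta t x) (cexp _) => a b k.
    by ring.
have d1 : cdiff (thetaS t) 0 (- P / t * K (inv_period t)).
  have [d dP] : cdf (gauss t) 0.
    apply: cdf_cexp; apply: cdfM; last exact: cdf_cst.
    have -> : (fun z : C => - z ^+ 2) = fun z => -1 * z ^+ 2.
      by apply/funext => x; rewrite mulN1r.
    by apply: cdfM; [exact: cdf_cst|apply: cdfX; exact: cdf_id].
  apply: cdiff_eq; first apply: cdiffM dP.
    apply: (@cdiff_comp R (fun z => - P * z / t)).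
      apply: cdiffM; last exact: cdiff_cst.
      by apply: cdiffM; [exact: cdiff_cst|exact: cdiff_id].
    by rewrite /= mulr0 mul0r; exact: cdiff_theta0.
  have -> : gauss t 0 = 1 by rewrite /gauss expr0n /= oppr0 mul0r cexp0.
  rewrite /=; have -> : theta (inv_period t) (- P * 0 / t) = 0 by rewrite mulr0 mul0r theta0.
  by move: (K _) (t^-1) (P) => k y p; ring.
have d2 : cdiff (thetaS t) 0 (c * K t).
  have -> : thetaS t = fun z => c * theta t z by apply/funext.
  apply: cdiff_eq; first by apply: cdiffM; [exact: cdiff_cst|exact: cdiff_theta0].
  by rewrite mul0r add0r.
have := cdiff_unique d1 d2; rewrite cE /inv_const => ->; rewrite mulfK//.
exact: K_neq0.
Qed.

Lemma climitM (a b : nat -> C) (l l' : C) : a @ \oo --> l -> b @ \oo --> l' ->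
  (fun n => a n * b n) @ \oo --> l * l'.
Proof. by move=> h h'; exact: (cvgM h h'). Qed.

(** With A, O, D the partial products of 1 + q^j, 1 - q^(2j - 1) and 1 - q^j, the product of the
    three truncated theta products is 2 (A O)^2 up to a factor tending to 1. As A_N O_N D_N = D_(2N)
    and D has a nonzero limit, A O tends to 1. *)
Lemma euler_half t : complex.Re t < 0 ->
  th t (P / 2) * th t (t / 2) * th t (P / 2 + t / 2) = 2.
Proof.
move=> t0; pose q : C := cexp t.
pose A N := \prod_(0 <= j < N) (1 + q ^+ j.+1).
pose O N := \prod_(0 <= j < N) (1 - q ^+ j.*2.+1).
pose D N := \prod_(0 <= j < N) (1 - q ^+ j.+1).
have AOD N : A N * O N * D N = D N.*2.
  elim: N => [|N IH]; first by rewrite /A /O /D !big_geq// !mulr1.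
  rewrite doubleS /A /O /D !big_nat_recr//= -/(A N) -/(O N) -/(D N) -/(D N.*2) -IH.
  have -> : q ^+ N.*2.+2 = q ^+ N.+1 * q ^+ N.+1 by rewrite -exprD addnn doubleS.
  by ring.
pose F N := \prod_(0 <= j < N) fac t (P / 2) j * \prod_(0 <= j < N) fac t (t / 2) j
  * \prod_(0 <= j < N) fac t (P / 2 + t / 2) j.
have FE N : F N * (1 + q ^+ N) = 2 * (A N * O N) ^+ 2.
  elim: N => [|N IH]; first by rewrite /F /A /O !big_geq// !mulr1 !mul1r expr1n mulr1.
  rewrite /F /A /O !big_nat_recr//= -/(A N) -/(O N).
  set f1 := \prod_(0 <= j < N) fac t (P / 2) j.
  set f2 := \prod_(0 <= j < N) fac t (t / 2) j.
  set f3 := \prod_(0 <= j < N) fac t (P / 2 + t / 2) j.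
  have hP : cexp (P / 2) = -1 by exact: cexp_pii.
  have hP' : cexp (- (P / 2)) = -1 by rewrite cexpN hP invrN invr1.
  have e1 : fac t (P / 2) N = (1 + q ^+ N) * (1 + q ^+ N.+1).
    by rewrite /fac 2!cexpD hP hP' !mulN1r !opprK 2!cexpMn.
  pose y := cexp (t / 2 + N%:R * t).
  have yy : y * y = q ^+ N.*2.+1.
    have nE : N.*2.+1%:R = N%:R * 2 + 1 :> C by rewrite -natr1 -muln2 natrM.
    by rewrite /y -cexpD /q -cexpMn nE; congr cexp; field.
  have y' : cexp (- (t / 2) + N.+1%:R * t) = y by rewrite /y; congr cexp; rewrite -natr1; field.
  have e2 : fac t (t / 2) N = (1 - y) * (1 - y) by rewrite /fac y'.
  have e3 : fac t (P / 2 + t / 2) N = (1 + y) * (1 + y).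
    rewrite /fac opprD -!addrA cexpD hP -/y mulN1r opprK.
    by rewrite [cexp (- (P / 2) + _)]cexpD hP' y' mulN1r opprK.
  rewrite e1 e2 e3 -yy.
  have -> : f1 * ((1 + q ^+ N) * (1 + q ^+ N.+1)) * (f2 * ((1 - y) * (1 - y))) *
     (f3 * ((1 + y) * (1 + y))) * (1 + q ^+ N.+1) =
     (f1 * f2 * f3 * (1 + q ^+ N)) * ((1 + q ^+ N.+1) * (1 - y * y)) ^+ 2 by ring.
  by rewrite -/(F N) IH; ring.
pose m : pred creator := fun c => ~~ c.1.
pose L := pth m t 0.
have L0 : L != 0.
  apply: pth_neq0 => // -[e j]; rewrite /wt; case: ifP => [|_]; last by rewrite addr0 oner_neq0.
  rewrite /m /= => /negbTE ->; rewrite mulr0 add0r subr_eq0; apply/eqP => /(congr1 (@nm R)).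
  rewrite nm1 nm_cexp Re_natM => /esym/eqP; apply/negP.
  by rewrite lt_eqF// expR_lt1 nmulr_llt0// ltr0n /ht /= addn1.
have DL : D @ \oo --> L.
  apply: (climit_eq _ (@pth_box R m t 0 t0)) => N; apply: eq_bigr => j _.
  by rewrite /wt /m /= addr0 mul1r mulr0 add0r /ht /= addn1 cexpMn.
have DL2 : (fun N => D N.*2) @ \oo --> L.
  apply/climitP => e e0; have /climitP/(_ e e0)[N NP] := DL.
  by exists N => n Nn; apply: NP; rewrite (leq_trans Nn)// -addnn leq_addr.
have q1 : (fun N : nat => 1 + q ^+ N) @ \oo --> (1 : C).
  have qn : nm q < 1 by rewrite nm_cexp expR_lt1.
  apply/climitP => e e0; have /climitP/(_ e e0)[N NP] := climit_expr qn.
  by exists N => n /NP; rewrite subr0 addrAC subrr add0r.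
have h1 := climitM (climitM (climitM (climitM (@th_box R t t0 (P / 2)) (@th_box R t t0 (t / 2)))
  (@th_box R t t0 (P / 2 + t / 2))) q1) (climitM DL DL).
have c2 : (fun=> 2) @ \oo --> (2 : C) by exact: cvg_cst.
have h2 := climitM c2 (climitM DL2 DL2).
have LL : L * L != 0 by rewrite mulf_neq0.
apply: (mulIf LL); rewrite -[X in X * (L * L)]mulr1; apply: (climit_unique h1).
apply: (climit_eq _ h2) => N; rewrite -/(F N) FE -AOD.
by move: (A N) (O N) (D N) => a o d; ring.
Qed.

Lemma half_periods t : complex.Re t < 0 ->
  theta t (P / 2) * theta t (t / 2) * theta t (P / 2 + t / 2) = - 2 * cexp (- t / 4).
Proof.
move=> t0; rewrite /theta; have := euler_half t0.
move: (th t (P / 2)) (th t (t / 2)) (th t (P / 2 + t / 2)) => a b c abc.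
set e1 := cexp _; set e2 := cexp _; set e3 := cexp _.
have -> : e1 * a * (e2 * b) * (e3 * c) = (e1 * e2 * e3) * (a * b * c) by ring.
rewrite abc /e1 /e2 /e3 -2!cexpD.
have -> : t / 12 - P / 2 / 2 + (t / 12 - t / 2 / 2) + (t / 12 - (P / 2 + t / 2) / 2) =
  - t / 4 - P / 2 by field.
by rewrite cexpB cexp_pii invrN invr1 mulrN1; move: (cexp _) => x; ring.
Qed.

Lemma cexp_quarter : cexp (P / 4) = iu R.
Proof.
have -> : P / 4 = Complex 0 (pi / 2).
  have -> : (4 : C)^-1 = toC (4^-1) by rewrite toCV toC_nat.
  by apply: complex_eqP; rewrite ?ReM ?ImM /= ?mul0r ?mulr0 ?subr0 ?add0r//; field.
rewrite /cexp /= expR0 cos_pihalf sin_pihalf.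
by apply: complex_eqP; rewrite ?ReM ?ImM /= ?mul0r ?mulr0 ?subr0 ?add0r ?addr0 ?mul1r.
Qed.

(* The constant is read off at the three half periods, which the inversion
   permutes; by euler_half the product of the values there is the same for t
   and for its inverse. *)
Lemma inv_const_cube t : complex.Re t < 0 -> inv_const t ^+ 3 = - iu R.
Proof.
move=> t0; have tn := Re_lt0_neq0 t0; have t'0 := inv_period_lt0 t0.
set t' := inv_period t in t'0.
have h1 := thetaS_E (P / 2) t0; have h2 := thetaS_E (t / 2) t0; have h3 := thetaS_E (P / 2 + t / 2) t0.
have H : inv_const t ^+ 3 * (theta t (P / 2) * theta t (t / 2) * theta t (P / 2 + t / 2)) =
   thetaS t (P / 2) * thetaS t (t / 2) * thetaS t (P / 2 + t / 2).
  by rewrite h1 h2 h3; move: (inv_const t) (theta t _) (theta t _) (theta t _) => a b c d; ring.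
have e1 : thetaS t (P / 2) = theta t' (t' / 2) * cexp (t' / 8).
  by rewrite /thetaS /gauss; congr (theta _ _ * cexp _); rewrite /t' /inv_period; field.
have e2 : thetaS t (t / 2) = - theta t' (P / 2) * cexp (- t / 8).
  rewrite /thetaS /gauss; have -> : - P * (t / 2) / t = P / 2 - P by field.
  by rewrite thetaB2pii; congr (_ * cexp _); field.
have e3 : thetaS t (P / 2 + t / 2) = - theta t' (P / 2 + t' / 2) * cexp (t' / 8 - P / 4 - t / 8).
  rewrite /thetaS /gauss.
  have -> : - P * (P / 2 + t / 2) / t = P / 2 + t' / 2 - P by rewrite /t' /inv_period; field.
  by rewrite thetaB2pii; congr (_ * cexp _); rewrite /t' /inv_period; field.
have hp := half_periods t0; have hp' := half_periods t'0.
move: H; rewrite e1 e2 e3 hp.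
have -> : theta t' (t' / 2) * cexp (t' / 8) * (- theta t' (P / 2) * cexp (- t / 8)) *
  (- theta t' (P / 2 + t' / 2) * cexp (t' / 8 - P / 4 - t / 8)) =
  (theta t' (P / 2) * theta t' (t' / 2) * theta t' (P / 2 + t' / 2)) *
  (cexp (t' / 8) * cexp (- t / 8) * cexp (t' / 8 - P / 4 - t / 8)).
  by move: (theta _ _) (theta _ _) (theta _ _) (cexp _) (cexp _) (cexp _) => a b c d e f; ring.
rewrite hp' -2!cexpD [X in _ = X -> _](_ : _ = - 2 * (cexp (- t' / 4) *
  cexp (t' / 8 + - t / 8 + (t' / 8 - P / 4 - t / 8)))); last by exact/esym/mulrA.
rewrite -[in X in _ = X -> _]cexpD.
have -> : - t' / 4 + (t' / 8 + - t / 8 + (t' / 8 - P / 4 - t / 8)) = - t / 4 - P / 4 by field.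
rewrite cexpB cexp_quarter => H.
have c0 : - 2 * cexp (- t / 4) != 0 by rewrite mulf_neq0 ?cexp_neq0// oppr_eq0 pnatr_eq0.
apply: (mulIf c0); rewrite H.
have -> : (iu R)^-1 = - iu R.
  have i0 : iu R != 0 by rewrite -nm_eq0 nm_iu oner_neq0.
  by apply: (mulIf i0); rewrite mulVf// mulNr iu_sq opprK.
by move: (cexp _) (iu R) => a b; ring.
Qed.

Lemma cube_root_Im (x : C) : x ^+ 3 = - iu R -> complex.Im x != 0.
Proof.
move=> x3; apply/eqP => x0.
have xE : x = toC (complex.Re x) by apply: complex_eqP => /=.
by have /(congr1 (@complex.Im R)) := x3; rewrite xE -toCX Im_toC /= => /eqP;
  rewrite eq_sym oppr_eq0 oner_eq0.
Qed.

Lemma cube_root_unique (x : C) : x ^+ 3 = - iu R -> 0 < complex.Im x -> x = iu R.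
Proof.
move=> x3 x0; apply/eqP; rewrite -subr_eq0.
have : (x - iu R) * (x ^+ 2 + iu R * x - 1) = 0.
  have -> : (x - iu R) * (x ^+ 2 + iu R * x - 1) = x ^+ 3 - x - (iu R * iu R) * x + iu R by ring.
  by rewrite x3 iu_sq; ring.
move=> /eqP; rewrite mulf_eq0 => /orP[//|/eqP h].
have := congr1 (@complex.Re R) h; have := congr1 (@complex.Im R) h.
rewrite expr2 !(ReD, ImD, ReN, ImN, ReM, ImM) /=.
move: (complex.Re x) (complex.Im x) x0 => a b b0 h1 h2.
have a0 : a * (2 * b + 1) = 0 by lra.
have b1 : 2 * b + 1 != 0 by rewrite gt_eqF//; lra.
move/eqP: a0; rewrite mulf_eq0 (negbTE b1) orbF => /eqP a0; rewrite a0 in h2.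
by exfalso; clear x x3 h; nra.
Qed.

Lemma cdf_K t : complex.Re t < 0 -> cdf (@K R) t.
Proof.
move=> t0; have -> : @K R = fun t => -1 * (cexp (t / 12) * pth (predC1 (true, 0%N)) t 0).
  by apply/funext => s; rewrite mulN1r.
apply: cdfM; first exact: cdf_cst.
apply: cdfM; last exact: pth0_cont.
by apply: cdf_cexp; apply: cdfM; [exact: cdf_id|exact: cdf_cst].
Qed.

Lemma cdf_inv_const t : complex.Re t < 0 -> cdf inv_const t.
Proof.
move=> t0; have tn := Re_lt0_neq0 t0.
have cV : cdf (fun t : C => t^-1) t by apply: cdfV => //; exact: cdf_id.
apply: cdfM; last by apply: cdfV; [exact: K_neq0|exact: cdf_K].
apply: cdfM; first by apply: cdfM => //; exact: cdf_cst.
apply: (@cdf_comp R inv_period); last exact/cdf_K/inv_period_lt0.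
by apply: cdfM => //; exact: cdf_cst.
Qed.

(** The point t = - 2 pi, that is tau = i, is fixed by the inversion, so the two values of [K]
    cancel. *)
Lemma inv_const_base : inv_const (toC (- (2 * pi))) = iu R.
Proof.
have p0 : (2 * pi : R) != 0 by rewrite gt_eqF// mulr_gt0// pi_gt0.
have n0 : toC (- (2 * pi)) != 0 :> C by rewrite -toC0 (inj_eq (@toC_inj R)) oppr_eq0.
have -> : inv_const (toC (- (2 * pi))) = - P / toC (- (2 * pi)).
  have -> : inv_const (toC (- (2 * pi))) = - P / toC (- (2 * pi)) *
      (K (inv_period (toC (- (2 * pi)))) / K (toC (- (2 * pi)))) by rewrite /inv_const mulrA.
  have -> : inv_period (toC (- (2 * pi))) = toC (- (2 * pi)).
    rewrite /inv_period sqr_twopii opprK; apply: (mulIf n0); rewrite divfK//.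
    by rewrite -toCM; congr toC; ring.
  rewrite divff ?mulr1//; apply: K_neq0; rewrite Re_toC oppr_lt0.
  by rewrite mulr_gt0// pi_gt0.
apply: (mulIf n0); rewrite divfK//.
by apply: complex_eqP; rewrite ?ReN ?ImN ?ReM ?ImM /= ?mul0r ?mulr0 ?mul1r ?subr0 ?add0r ?addr0 ?oppr0.
Qed.

(** The segment from - 2 pi to t stays in the left half-plane. Along it the imaginary part of
    [inv_const] starts at 1 and never vanishes, so it stays positive, and i is the only cube root of
    - i with that property. *)
Lemma inv_constE t : complex.Re t < 0 -> inv_const t = iu R.
Proof.
move=> t0; apply: cube_root_unique; first exact: inv_const_cube.
rewrite ltNge; apply/negP => le0.
pose p0 : C := toC (- (2 * pi)).
have p00 : complex.Re p0 < 0 by rewrite Re_toC oppr_lt0 mulr_gt0// pi_gt0.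
pose w s : C := p0 + toC s * (t - p0).
have w0 s : 0 <= s <= 1 -> complex.Re (w s) < 0.
  move=> /andP[s0 s1]; rewrite /w ReD ReM Re_toC Im_toC mul0r subr0 ReD ReN.
  move: (complex.Re p0) (complex.Re t) p00 t0 => a b a0 b0; nra.
pose f (s : R) : R := complex.Im (inv_const (w s)).
have f0 : f 0 = 1 by rewrite /f /w toC0 mul0r addr0 inv_const_base.
have f1 : f 1 <= 0 by rewrite /f /w toC1 mul1r addrC subrK.
have fc : {within `[0, 1], continuous f}.
  apply: continuous_in_subspaceT => s; rewrite inE /= in_itv /= => s01.
  have := cdf_ccont_at (cdf_inv_const (w0 s s01)) => cc.
  apply/cvgrPdist_lt => e e0; have [r r0 rP] := cc e e0.
  have d0 : 0 < nm (t - p0) + 1 by rewrite ltr_wpDl// nm_ge0.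
  apply/nbhs_ballP; exists (r / (nm (t - p0) + 1)); first by rewrite /= divr_gt0.
  move=> y; rewrite /ball /= distrC => yd; rewrite distrC.
  have := rP (toC (y - s) * (t - p0)).
  have -> : w s + toC (y - s) * (t - p0) = w y by rewrite /w toCB; ring.
  rewrite nmM nm_toC => H; rewrite /f.
  have -> : complex.Im (inv_const (w y)) - complex.Im (inv_const (w s)) = complex.Im (inv_const (w y) - inv_const (w s)).
    by rewrite ImD ImN.
  apply: (le_lt_trans (Im_le_nm _)); apply: H.
  move: yd; rewrite ltr_pdivlMr//; apply: le_lt_trans.
  by rewrite ler_wpM2l// lerDl.
have [s s01 fs] : exists2 s, s \in `[0, 1]%R & f s = 0.
  apply: IVT => //; rewrite f0; apply/andP; split.
    by rewrite ge_min f1 orbT.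
  by rewrite le_max ler01.
have s01' : 0 <= s <= 1 by rewrite in_itv in s01.
by have := cube_root_Im (inv_const_cube (w0 s s01')); rewrite -/(f s) fs eqxx.
Qed.

Lemma theta_inv t z : complex.Re t < 0 ->
  theta (inv_period t) (- P * z / t) = iu R * cexp (z ^+ 2 / (2 * t)) * theta t z.
Proof.
move=> t0; have := thetaS_E z t0; rewrite (inv_constE t0) /thetaS /gauss => h.
have e0 := cexp_neq0 (- z ^+ 2 / (2 * t)).
apply: (mulIf e0); rewrite h [RHS](_ : _ = iu R * theta t z *
  (cexp (z ^+ 2 / (2 * t)) * cexp (- z ^+ 2 / (2 * t)))); last first.
  by move: (cexp _) (cexp _) => a b; ring.
by rewrite -cexpD mulNr subrr cexp0 mulr1.
Qed.

Lemma K_inv t : complex.Re t < 0 -> K (inv_period t) = - t / P * iu R * K t.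
Proof.
move=> t0; have K0 := K_neq0 t0; have tn := Re_lt0_neq0 t0; have P0 := twopii_neq0.
rewrite -(inv_constE t0) /inv_const; move: (K t) (K _) K0 (twopii R) P0 => k k' k0 p p0.
by field; rewrite k0 p0 tn.
Qed.

Lemma thDperiod t v : th (t + P) v = th t v.
Proof.
rewrite /th /pth; congr fock_sum; apply/funext => c; rewrite /wt /= mulrDr addrA cexpD.
have -> : (ht c)%:R * P = (ht c)%:~R * P :> C by rewrite -pmulrn.
by rewrite cexp_2piik mulr1.
Qed.

Lemma theta_shift t v : theta (t + P) v = cexp (P / 12) * theta t v.
Proof. by rewrite /theta thDperiod mulrA -cexpD; congr (cexp _ * _); ring. Qed.

Lemma K_shift t : K (t + P) = cexp (P / 12) * K t.
Proof.
rewrite /K mulrN mulrA -cexpD; congr (- (cexp _ * _)); first by ring.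
rewrite /ths /pth; congr fock_sum; apply/funext => c; rewrite /wt; case: ifP => // _.
rewrite mulrDr addrA cexpD.
have -> : (ht c)%:R * P = (ht c)%:~R * P :> C by rewrite -pmulrn.
by rewrite cexp_2piik mulr1.
Qed.

End ThetaModular.
#[local] Opaque cexp.
(** * The kernel and Fay's identity *)

Section Kernel.
Variable R : realType.
Local Notation C := (Cplx R).
Local Notation P := (twopii R).
Variable t : C.
Hypothesis t0 : complex.Re t < 0.
Implicit Types (v z : C) (k : int) (c : creator) (b : basis).

Lemma climit_shiftn (u : nat -> C) (l : C) n0 :
  u @ \oo --> l -> (fun n => u (n + n0)%N) @ \oo --> l.
Proof.
move=> /climitP h; apply/climitP => e /h[N NP]; exists N => n Nn.
by apply: NP; rewrite (leq_trans Nn)// leq_addr.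
Qed.

Lemma pth_split c v : pth predT t v = (1 + wt predT t v c) * pth (predC1 c) t v.
Proof.
have h1 := climit_shiftn c.2.+1 (@pth_box R predT t v t0).
have h2 := climit_shiftn c.2.+1 (@pth_box R (predC1 c) t v t0).
have cc : (fun=> 1 + wt predT t v c) @ \oo --> 1 + wt predT t v c by exact: cvg_cst.
apply: (climit_unique h1); apply: (climit_eq _ (climitM cc h2)) => n /=.
rewrite -(big_box (fun d => 1 + wt (predC1 c) t v d)) -(big_box (fun d => 1 + wt predT t v d)).
have cb : c \in box (n + c.2.+1) by rewrite mem_box addnS ltnS leq_addl.
rewrite (bigD1_seq c)//= [RHS](bigD1_seq c)//=.
have -> : wt (predC1 c) t v c = 0 by rewrite /wt /= eqxx.
rewrite addr0 mul1r.
by congr (_ * _); apply: eq_bigr => d dc; rewrite /wt /= dc.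
Qed.

(** The creator whose factor in [th] vanishes where 1 - exp(- v + k t) does. For k > 0 the two
    factors are equal; for k <= 0 the creator contributes 1 - exp(v - k t), and [kcoef] and [kexp]
    supply the ratio - exp(v - k t). *)
Definition kcre k : creator :=
  match k with Posz 0 => (true, 0%N) | Posz n.+1 => (false, n) | Negz n => (true, n.+1) end.

Definition kexp k : C := if k is Posz n.+1 then 0 else 1.

Definition kcoef k : C := if k is Posz n.+1 then 1 else - cexp (- (k%:~R * t)).

(* [M k v] is [th t v / (1 - exp (- v + k t))], with the removable
   singularities removed. *)
Definition M k v : C := kcoef k * cexp (kexp k * v) * pth (predC1 (kcre k)) t v.

Lemma M_mul k v : th t v = (1 - cexp (- v + k%:~R * t)) * M k v.
Proof.
rewrite /th (pth_split (kcre k)) /M mulrA; congr (_ * _).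
have nP (n : nat) (x : C) : n%:~R * x = n%:R * x by rewrite -pmulrn.
have aux (x y : C) : x * y = 1 -> 1 - y = (1 - x) * (- y).
  move=> h; have -> : (1 - x) * (- y) = x * y - y by ring.
  by rewrite h.
case: k => [[|n]|n]; rewrite /kcoef /kexp /kcre /wt /dgr /ht /=.
- rewrite !mulr0z !mul0r !addr0 oppr0 cexp0 mul1r.
  by rewrite cexpN; field; rewrite cexp_neq0.
- by rewrite mul1r mul0r cexp0 mulr1 mulN1r nP addn1.
- rewrite !mul1r addn0 [- cexp _ * _]mulNr -cexpD NegzE mulrNz -pmulrn mulNr opprK.
  rewrite [n.+1%:R * t + v]addrC; apply: aux; rewrite -cexpD.
  by rewrite (_ : _ + _ = 0) ?cexp0//; ring.
Qed.

(** The zeros of theta are isolated, so continuity covers them. This carries identities between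
    kernels, proved off these zeros, to all v. *)
Lemma entire_eq0 (h : C -> C) : entire h -> (forall z, theta t z != 0 -> h z = 0) ->
  forall z, h z = 0.
Proof.
move=> hd h0 z; have [vz|] := eqVneq (theta t z) 0; last exact: h0.
have [d d0 dP] := theta_zero_simple t0 vz.
have [r r0 rP] := zero_isolated d0 vz dP.
apply/eqP; rewrite -nm_eq0 eq_le nm_ge0 andbT; apply/ler_addgt0Pl => e e0; rewrite addr0.
have [r' r'0 r'P] := cdf_ccont_at (hd z) e0.
pose x := Num.min r r' / 2; have m0 : 0 < Num.min r r' by rewrite lt_min r0.
have x0 : 0 < x by rewrite divr_gt0.
have xm : x < Num.min r r' by rewrite ltr_pdivrMr// ltr_pMr// ltr1n.
move: xm; rewrite lt_min => /andP[xr xr'].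
have nx : nm (toC x) = x by rewrite nm_toC gtr0_norm.
have := r'P (toC x); rewrite nx => /(_ xr'); rewrite h0 ?sub0r ?nmN; first exact: ltW.
rewrite -nm_gt0; apply: lt_le_trans (rP (toC x) _); rewrite nx//.
by rewrite mulr_gt0// divr_gt0// nm_gt0.
Qed.

Lemma has_sum1 (I : choiceType) (f : I -> C) i0 : (forall i, i != i0 -> f i = 0) ->
  has_sum f (f i0).
Proof.
move=> f0 e e0; exists [fset i0]%fset => B /fsubsetP sB.
have i0B : i0 \in B by apply: sB; rewrite inE.
by rewrite /psum (bigD1_seq i0)//= big1 ?addr0 ?subrr ?nm0// => i /f0.
Qed.

Lemma bsum_int (r : R) (r01 : 0 <= r < 1) :
  bsum (fun k => r ^+ (match k with Posz n => n | Negz n => n end)) (2 * (1 - r)^-1).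
Proof.
have h := bsum_creator (bsum_geometric r01).
pose f (k : int) : creator := match k with Posz n => (true, n) | Negz n => (false, n) end.
have fi : injective f by move=> [m|m] [n|n] //= [->].
by apply: bsum_le (bsum_inj fi h) => -[n|n] /=; rewrite lexx andbT exprn_ge0//;
  have /andP[] := r01.
Qed.

Lemma lattice_ind (Q : C -> Prop) : (forall x, Q x <-> Q (x + P)) ->
  (forall x, Q x <-> Q (x + t)) ->
  forall (m n : int) x, Q x -> Q (x + (m%:~R * P + n%:~R * t)).
Proof.
have step w : (forall x, Q x <-> Q (x + w)) -> forall (m : int) x, Q x -> Q (x + m%:~R * w).
  move=> H m x Qx; elim: m => [|n IH|n IH]; first by rewrite mulr0z mul0r addr0.
    have -> : x + n.+1%:~R * w = (x + n%:~R * w) + w by rewrite -!pmulrn -natr1; ring.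
    exact: (H _).1.
  apply: (H _).2.
  have -> : x + (- n.+1%:Z)%:~R * w + w = x + (- n%:Z)%:~R * w.
    by rewrite !mulrNz -!pmulrn -natr1; ring.
  exact: IH.
by move=> H1 H2 m n x Qx; rewrite addrA; apply: (step t) => //; exact: (step P).
Qed.

Variable z : C.
Hypothesis z0 : 0 < complex.Re z < - complex.Re t.

(** Expanding the product in [M k v] over the Fock basis gives one exponential series in v over the
    pairs (k, b), to which [exp_series] applies. *)
Definition kterm v (x : int * basis) : C :=
  cexp (- (x.1%:~R * z)) * (kcoef x.1 * cexp (kexp x.1 * v)) *
  \prod_(c <- x.2) wt (predC1 (kcre x.1)) t v c.

(** For k > 0 the modulus is e^(- k Re z), and for k < 0 it is e^(|k| (Re z + Re t)). The ratio r is
    read off the smaller distance of Re z to the two edges of the strip. *)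
Lemma kcoef_bound : exists2 r : R, 0 <= r < 1 & forall k,
  nm (cexp (- (k%:~R * z)) * kcoef k) <= r ^+ (match k with Posz n => n | Negz n => n end).
Proof.
have /andP[z1 z2] := z0.
pose rho := Num.min (complex.Re z) (- complex.Re t - complex.Re z).
have rho0 : 0 < rho by rewrite lt_min z1 subr_gt0.
exists (expR (- rho)); first by rewrite expR_ge0 expR_lt1 oppr_lt0.
have l1 : rho <= complex.Re z by rewrite ge_min lexx.
have l2 : rho <= - complex.Re t - complex.Re z by rewrite ge_min lexx orbT.
have n0 (n : nat) : 0 <= n%:R :> R by exact: ler0n.
case=> [[|n]|n]; rewrite -expRM_natl.
- by rewrite /= !mulr0z !mul0r oppr0 cexp0 mul1r nmN nm1 expR0.
- rewrite /= mulr1 nm_cexp ler_expR ReN -pmulrn Re_natM mulrN lerN2 ler_wpM2l//.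
- rewrite /= mulrN nmN -cexpD nm_cexp ler_expR ReD !ReN NegzE !mulrNz !mulNr !ReN !opprK.
  rewrite -!pmulrn !Re_natM -natr1; move: (n%:R) (n0 n) => m m0; nra.
Qed.

Lemma kterm_bound v : exists M0, bsum (fun x : int * basis =>
  nm (kterm 0 x) * expR (nm ((kexp x.1 + chg R x.2)) * (nm v + 3))) M0.
Proof.
have [r r01 rP] := kcoef_bound.
pose E := expR (nm v + 3).
have [W WP] := bsum_wt predT 0 t0 (expR_ge0 (nm v + 3)).
have h := bsum_prod (bsumZ (expR_ge0 (nm v + 3)) (bsum_int r01)) (bsum_subsets WP).
eexists; apply: bsum_le h => -[k b] /=.
rewrite mulr_ge0 ?nm_ge0 ?expR_ge0//= /kterm /= mulr0 cexp0 mulr1.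
rewrite nmM [leRHS]mulrAC [leRHS]mulrC -mulrA.
apply: ler_pM; rewrite ?nm_ge0 ?mulr_ge0 ?nm_ge0 ?expR_ge0//.
rewrite [X in _ <= _ * X](_ : _ = \prod_(c <- b) expR (nm v + 3) *
  \prod_(c <- b) nm (wt predT t 0 c)); last by rewrite big_split.
rewrite -expR_sum1 mulrA -expRD mulrC; apply: ler_pM; rewrite ?nm_ge0 ?expR_ge0//.
- rewrite ler_expR.
  have h1 : nm (kexp k + chg R b) <= 1 + \sum_(c <- b) 1.
    rewrite (le_trans (nmD _ _))// lerD ?nm_chg//.
    by rewrite /kexp; case: (k) => [[|n]|n]; rewrite ?nm0 ?nm1.
  have -> : \sum_(c <- b) (nm v + 3) = (\sum_(c <- b) 1) * (nm v + 3) :> R.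
    by rewrite mulr_suml; apply: eq_bigr => c _; rewrite mul1r.
  by have := nm_ge0 v; move: (nm v) (nm _) (\sum_(c <- b) 1) h1 => x y w; nra.
- rewrite nm_prod; apply: ler_prod => c _; rewrite nm_ge0 /= /wt; case: ifP => _ //.
  by rewrite nm0 nm_ge0.
Qed.

Lemma ktermE v x : kterm v x = kterm 0 x * cexp ((kexp x.1 + chg R x.2) * v).
Proof.
rewrite /kterm prod_wt mulr0 cexp0 mulr1 mulrDl cexpD.
by move: (cexp _) (kcoef _) (cexp _) (\prod_(c <- _) _) (cexp _) => a b c d e; ring.
Qed.

Lemma kterm_asum v : asum (kterm v).
Proof.
have [M0 H] := kterm_bound v; apply: (asum_le H) => x; rewrite ktermE nmM ler_wpM2l ?nm_ge0//.
rewrite nm_cexp ler_expR (le_trans (ler_norm _))// (le_trans (Re_le_nm _))// nmM.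
by rewrite ler_wpM2l ?nm_ge0// lerDl.
Qed.

(** The kernel multiplied by [th t v], which removes its poles and makes it entire in v. *)
Definition Nk v : C := tsum (kterm v).

Lemma Nk_has_sum v : has_sum (fun k => cexp (- (k%:~R * z)) * M k v) (Nk v).
Proof.
apply: eq_has_sum (tsum_pair (kterm_asum v)) => k; apply: tsumE.
rewrite /M mulrA /kterm /=; apply: has_sumZ; exact: pth_has_sum.
Qed.

Lemma entire_Nk : entire Nk.
Proof.
move=> v; have [M0 H] := kterm_bound v.
have [] := @exp_series R _ (kterm 0) (fun x => kexp x.1 + chg R x.2) Nk v 1 M0 ltr01.
- apply: bsum_le H => x; rewrite mulr_ge0 ?nm_ge0 ?expR_ge0//= ler_wpM2l ?nm_ge0// ler_expR.
  rewrite mulr1 mulrDr lerD//; last by rewrite mulrC.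
  by rewrite (le_trans (ler_norm _))// (le_trans (Re_le_nm _))// nmM.
- move=> x _; apply: eq_has_sum (asum_has_sum (kterm_asum (v + x))) => y.
  by rewrite ktermE.
by move=> d dP _; exists d.
Qed.

Lemma Nk_asum v : asum (fun k => cexp (- (k%:~R * z)) * M k v).
Proof.
have [r r01 rP] := kcoef_bound.
have [W WP] := bsum_wt1 predT v t0.
have h := bsumZ (mulr_ge0 (expR_ge0 (nm v)) (expR_ge0 W)) (bsum_int r01).
apply: (asum_le h) => k; rewrite /M.
rewrite (_ : _ * _ = cexp (kexp k * v) * pth (predC1 (kcre k)) t v *
  (cexp (- (k%:~R * z)) * kcoef k)); last first.
  by move: (cexp _) (cexp _) (kcoef k) (pth _ _ _) => a b c d; ring.
rewrite 2!nmM; apply: ler_pM; rewrite ?mulr_ge0 ?nm_ge0//.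
apply: ler_pM; rewrite ?nm_ge0//.
  rewrite nm_cexp ler_expR /kexp; have := Re_le_nm v; rewrite ler_norml => /andP[_ h1].
  by case: (k) => [[|n]|n]; rewrite ?mul0r ?mul1r ?nm_ge0.
apply: (has_sum_nm_le (pth_has_sum (predC1 (kcre k)) v t0) (bsum_subsets WP)) => b.
rewrite nm_prod; apply: ler_prod => c _; rewrite nm_ge0 /= /wt; case: ifP => _ //.
by rewrite nm0 nm_ge0.
Qed.

Lemma th_neq0 v : theta t v != 0 -> th t v != 0.
Proof. by apply: contraNneq => h; rewrite /theta h mulr0. Qed.

(* Where theta t v = 0 some of these denominators vanish; this is why Nk is
   built from the M k. *)
Lemma kernel_has_sum v : theta t v != 0 ->
  has_sum (fun k => cexp (- (k%:~R * z)) / (1 - cexp (- v + k%:~R * t))) (Nk v / th t v).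
Proof.
move=> v0; have tv := th_neq0 v0; rewrite mulrC.
apply: eq_has_sum (has_sumZ (th t v)^-1 (Nk_has_sum v)) => k.
have := M_mul k v; set x := 1 - _ => tE.
have x0 : x != 0 by apply: contraNneq tv => x0; rewrite tE x0 mul0r.
have m0 : M k v != 0 by apply: contraNneq tv => x1; rewrite tE x1 mulr0.
by rewrite tE; field; rewrite x0 m0.
Qed.

Lemma Nk2pii v : Nk (v + P) = Nk v.
Proof.
rewrite /Nk; congr tsum; apply/funext => -[k b]; rewrite /kterm /=; congr (_ * _ * _).
  congr (_ * _); rewrite mulrDr cexpD /kexp; case: k => [[|n]|n];
  by rewrite ?mul0r ?mul1r ?cexp0 ?cexp_2pii mulr1.
apply: eq_bigr => c _; rewrite wtD /dgr; case: ifP => _;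
by rewrite ?mul1r ?mulN1r ?cexpN cexp_2pii ?invr1 mulr1.
Qed.

(** In the kernel, v + t with index k + 1 has the same denominator as v with index k, so the shift
    only costs e^(- z). *)
Lemma NkDt v : Nk (v + t) = - cexp (- v - z) * Nk v.
Proof.
pose h v := Nk (v + t) + cexp (- v - z) * Nk v.
suff h0 : h v = 0 by apply/eqP; rewrite mulNr -addr_eq0 -/(h v) h0.
apply: entire_eq0 v => [v|v v0].
  apply: cdfD.
    apply: (@cdf_comp R (fun v => v + t)); last exact: entire_Nk.
    by apply: cdfD; [exact: cdf_id|exact: cdf_cst].
  apply: cdfM; last exact: entire_Nk.
  apply: cdf_cexp; have -> : (fun x : C => - x - z) = fun x => -1 * x - z.
    by apply/funext => x; rewrite mulN1r.
  by apply: cdfB; [apply: cdfM; [exact: cdf_cst|exact: cdf_id]|exact: cdf_cst].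
have theta0' : theta t (v + t) != 0 by rewrite thetaDt// mulf_neq0// oppr_eq0 cexp_neq0.
have h1 := kernel_has_sum v0; have h2 := kernel_has_sum theta0'.
have inj : injective (fun k : int => k + 1) by exact: addIr.
have h3 : has_sum (fun k => cexp (- ((k + 1)%:~R * z)) / (1 - cexp (- (v + t) + (k + 1)%:~R * t)))
    (Nk (v + t) / th t (v + t)).
  apply/(has_sum_inj (h := fun k : int => k + 1) (f := fun k : int =>
    cexp (- (k%:~R * z)) / (1 - cexp (- (v + t) + k%:~R * t)))) => // k Hk.
  by case: (Hk (k - 1)); rewrite subrK.
have h4 := has_sumZ (cexp (- z)) h1.
have e34 : Nk (v + t) / th t (v + t) = cexp (- z) * (Nk v / th t v).
  apply: (has_sum_unique h3); apply: eq_has_sum h4 => k.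
  rewrite mulrA -cexpD; congr (cexp _ / (1 - cexp _)); rewrite intrD; ring.
have tv := th_neq0 v0; have tv' := th_neq0 theta0'.
have c0 := cexp_neq0 (- v).
move: e34 => /(canRL (mulfVK tv')); rewrite /h => ->; rewrite thDt// cexpB.
rewrite -[in X in _ + X](invrK (cexp z)) -cexpN.
by field; rewrite tv cexp_neq0.
Qed.

Lemma theta_z_neq0 : theta t z != 0.
Proof.
have /andP[z1 z2] := z0; apply/eqP => /(theta_eq0 t0)[m [n zE]].
move: z1 z2; rewrite zE.
rewrite ReD -!toC_int !ReM !Re_toC !Im_toC ?Re_twopii !mul0r mulr0 !subr0 add0r.
rewrite nmulr_lgt0// ltrz0 => n0 h.
have : (-1 < n)%R.
  have h' : (-1 : R) < n%:~R.
    by move: h t0; move: (n%:~R) (complex.Re t) => a b h b0; nra.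
  by rewrite -(ltr_int R).
by lia.
Qed.

(** At v = 0 only the term k = 0 survives, so the difference f of the two sides vanishes there, and
    then on the whole lattice. After multiplication by an exponential its quotient by theta has
    unimodular multipliers, one of them different from 1, and [elliptic_quotient0] applies. *)
Lemma Nk_E v : Nk v = - ths t 0 * th t (v + z) / th t z.
Proof.
have /andP[z1 z2] := z0.
have tz := th_neq0 theta_z_neq0.
have N0 : Nk 0 = - ths t 0.
  apply: (has_sum_unique (Nk_has_sum 0)).
  have -> : - ths t 0 = cexp (- (0%:~R * z)) * M 0 0.
    rewrite mulr0z mul0r oppr0 cexp0 mul1r /M /= mulr0z mul0r oppr0 cexp0 mulr0 cexp0 mulr1 mulN1r.
    by [].
  apply: (has_sum1 (f := fun k => cexp (- (k%:~R * z)) * M k 0)) => k k0.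
  suff -> : M k 0 = 0 by rewrite mulr0.
  have := M_mul k 0; rewrite th_ths// cexp0 subrr mul0r oppr0 add0r => /esym/eqP.
  rewrite mulf_eq0 => /orP[|/eqP //]; rewrite subr_eq0 => /eqP/esym/(congr1 (@nm R)).
  rewrite nm1 nm_cexp -toC_int ReM Re_toC Im_toC mul0r subr0 => h.
  have /eqP : k%:~R * complex.Re t = 0 by apply: expR_inj; rewrite expR0.
  rewrite mulf_eq0 intr_eq0 (negbTE k0) /= => /eqP tE.
  by move: t0; rewrite tE ltxx.
(* This s makes s t - z purely imaginary, so the multiplier along t is unimodular. The strip gives
   -1 < s < 0, so the multiplier e^(2 pi i s) along 2 pi i is not 1. *)
pose s := complex.Re z / complex.Re t.
have tn : complex.Re t != 0 by rewrite lt_eqF.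
have s1 : -1 < s < 0.
  by rewrite /s ltr_ndivlMr// mulN1r z2 ltr_ndivrMr// mul0r.
pose c := - ths t 0 / th t z.
pose f v := Nk v - c * th t (v + z).
pose F v := f v * cexp ((toC s - 2^-1) * v).
have fP v' : f (v' + P) = f v'.
  by rewrite /f Nk2pii addrAC thD2pii.
have fT v' : f (v' + t) = - cexp (- v' - z) * f v'.
  by rewrite /f NkDt addrAC thDt// opprD; move: (cexp _) (Nk _) (th _ _) => a b d; ring.
have f0 : f 0 = 0 by rewrite /f N0 add0r /c divfK// subrr.
have FP v' : F (v' + P) = - cexp (toC s * P) * F v'.
  rewrite /F fP.
  have -> : (toC s - 2^-1) * (v' + P) = (toC s - 2^-1) * v' + (toC s * P - P / 2) by ring.
  rewrite cexpD cexpB cexp_pii invrN invr1 mulrN1.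
  by move: (cexp _) (cexp _) (f v') => a b d; ring.
have FT v' : F (v' + t) = - cexp (- t / 2 - v' + (toC s * t - z)) * F v'.
  rewrite /F fT.
  have -> : (toC s - 2^-1) * (v' + t) = (toC s - 2^-1) * v' + (toC s - 2^-1) * t by rewrite mulrDr.
  have -> : - t / 2 - v' + (toC s * t - z) = (- v' - z) + (toC s - 2^-1) * t by field.
  rewrite [cexp (- v' - z + _)]cexpD [cexp (_ * v' + _)]cexpD.
  move: (cexp (- v' - z)) (cexp (_ * v')) (cexp (_ * t)) (f v') => a b d e; ring.
have Fd : entire F.
  move=> x; apply: cdfM; last first.
    by apply: cdf_cexp; apply: cdfM; [exact: cdf_cst|exact: cdf_id].
  apply: cdfB; first exact: entire_Nk.
  apply: cdfM; first exact: cdf_cst.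
  apply: (@cdf_comp R (fun v => v + z)); last exact: entire_pth.
  by apply: cdfD; [exact: cdf_id|exact: cdf_cst].
suff fv x : F x = 0.
  have /eqP := fv v; rewrite mulf_eq0 (negbTE (cexp_neq0 _)) orbF subr_eq0 => /eqP ->.
  by rewrite /c mulrAC.
apply: (@elliptic_quotient0 R F (theta t) P t _ _ _ _ _ P (cexp (toC s * P))).
- exact: Fd.
- exact: entire_theta.
- move=> y y0; split; last exact: theta_zero_simple.
  have [m [n yE]] := theta_eq0 t0 y0; rewrite yE -[X in F X]add0r.
  apply: (@lattice_ind (fun x => F x = 0)) => [x0|x0|]; last by rewrite /F f0 mul0r.
    rewrite FP; split=> [->|/eqP]; first by rewrite mulr0.
    by rewrite mulf_eq0 oppr_eq0 (negbTE (cexp_neq0 _)) => /eqP.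
  rewrite FT; split=> [->|/eqP]; first by rewrite mulr0.
  by rewrite mulf_eq0 oppr_eq0 (negbTE (cexp_neq0 _)) => /eqP.
- exact: lattice_cover.
- move=> w ww y; split; first case: ww => ->.
  + by rewrite thetaD2pii oppr_eq0.
  + by rewrite thetaDt// mulNr oppr_eq0 mulf_eq0 (negbTE (cexp_neq0 _)).
  case: ww => ->.
    exists (cexp (toC s * P)); last first.
      by rewrite FP thetaD2pii; move: (cexp _) (F y) (theta t y) => a b d; ring.
    by rewrite nm_cexp ReM Re_toC Im_toC Re_twopii mulr0 mul0r subr0 expR0.
  exists (cexp (toC s * t - z)).
    by rewrite nm_cexp ReD ReN ReM Re_toC Im_toC mul0r subr0 /s divfK// subrr expR0.
  rewrite FT thetaDt// [cexp (- t / 2 - y + _)]cexpD.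
  by move: (cexp _) (cexp _) (F y) (theta t y) => a b d e; ring.
- by left.
- apply/eqP => /cexp_eq1[k /(congr1 (@complex.Im R))].
  rewrite -toC_int !ImM !Re_toC !Im_toC ?Re_twopii ?Im_twopii ?mul0r ?mulr0 ?addr0 => kE.
  have sk : s = k%:~R.
    by apply: mulIf kE; rewrite mulf_neq0 ?pnatr_eq0// gt_eqF// pi_gt0.
  move: s1; rewrite sk -[-1]/((-1)%:~R : R) -[0]/(0%:~R : R) !ltr_int; lia.
by move=> y; rewrite FP thetaD2pii; move: (cexp _) (F y) (theta t y) => a b d; ring.
Qed.

Lemma kernel_E v : theta t v != 0 ->
  Nk v / th t v = K t * theta t (v + z) / (theta t v * theta t z).
Proof.
move=> v0; have tv := th_neq0 v0; have tz := th_neq0 theta_z_neq0.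
have c1 := cexp_neq0 (t / 12 - v / 2); have c2 := cexp_neq0 (t / 12 - z / 2).
rewrite Nk_E /K /theta.
have -> : cexp (t / 12 - (v + z) / 2) =
    cexp (t / 12 - v / 2) * cexp (t / 12 - z / 2) / cexp (t / 12).
  by rewrite -cexpD -cexpB; congr cexp; field.
have c3 := cexp_neq0 (t / 12).
move: (cexp (t / 12)) (cexp _) (cexp _) (th t z) (th t v) (th t _) (ths t 0) c1 c2 c3 tv tz.
move=> a b c d e f g *.
by field; do ?[apply/andP; split].
Qed.

End Kernel.

(** * The product formula and its recursion *)

Section Fay.
Variable R : realType.
Local Notation C := (Cplx R).
Local Notation P := (twopii R).
Local Notation ins := (bool * C)%type.
Variable t : C.
Hypothesis t0 : complex.Re t < 0.
Implicit Types (x y z v : C) (a b c : ins) (s : seq ins).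

Definition sgn (e : bool) : C := if e then 1 else -1.

Lemma sgn_sqr e : sgn e * sgn e = 1.
Proof. by case: e; rewrite /sgn ?mul1r ?mulrNN ?mulr1. Qed.

Lemma sgnN e : sgn (~~ e) = - sgn e.
Proof. by case: e; rewrite /sgn ?opprK. Qed.

Definition pair_factor a b : C :=
  if a.1 == b.1 then theta t (a.2 - b.2) else (theta t (a.2 - b.2))^-1.

Fixpoint pair_prod s : C := if s is a :: s' then (\prod_(b <- s') pair_factor a b) * pair_prod s' else 1.

Definition Sg s : C := \sum_(a <- s) sgn a.1 * a.2.

Definition del (T : Type) j (s : seq T) := take j s ++ drop j.+1 s.

Definition gen s := pairwise (fun a b => theta t (a.2 - b.2) != 0) s.

Lemma pair_factorC a b : pair_factor a b = - pair_factor b a.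
Proof.
rewrite /pair_factor eq_sym -opprB thetaN //; case: ifP => // _.
by rewrite invrN.
Qed.

(** Moving b to the front reverses [size s1] differences, and theta is odd. *)
Lemma pair_prod_split s1 b s2 :
  pair_prod (s1 ++ b :: s2) = (-1) ^+ size s1 * (\prod_(c <- s1 ++ s2) pair_factor b c) * pair_prod (s1 ++ s2).
Proof.
elim: s1 => [|a s1 IH] /=; first by rewrite expr0 mul1r.
rewrite IH !big_cat !big_cons big_cat /= pair_factorC exprS.
set x := \prod_(_ <- s1) _; set y := \prod_(_ <- s2) _; set x' := \prod_(_ <- s1) _.
by set y' := \prod_(_ <- s2) _; move: (_ ^+ _) (pair_prod _) (pair_factor _ _) => m p q; ring.
Qed.

Lemma nth_split T (d : T) j (s : seq T) : (j < size s)%N ->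
  s = take j s ++ nth d s j :: drop j.+1 s.
Proof. by move=> js; rewrite -drop_nth// cat_take_drop. Qed.

Lemma size_del T j (s : seq T) : (j < size s)%N -> size (del j s) = (size s).-1.
Proof.
move=> js; rewrite size_cat size_take js size_drop.
by clear -js; lia.
Qed.

Lemma perm_del (T : eqType) (d : T) j (s : seq T) : (j < size s)%N ->
  perm_eq s (nth d s j :: del j s).
Proof. by move=> js; rewrite {1}(nth_split d js) perm_catC /= perm_cons perm_catC. Qed.

Lemma gen_del s j d : (j < size s)%N -> gen s ->
  gen (del j s) /\ forall c, c \in del j s -> theta t ((nth d s j).2 - c.2) != 0.
Proof.
move=> js; rewrite {1}(nth_split d js) /gen pairwise_cat /= allrel_consr.
move=> /and3P[/andP[h1 h2] h3 /andP[h4 h5]]; split; first by rewrite pairwise_cat h2 h3.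
move=> c; rewrite mem_cat => /orP[] cs; last by move/allP: h4; exact.
by rewrite -opprB thetaN// oppr_eq0; move/allP: h1; exact.
Qed.

Lemma theta_eq0B x y : theta t x = 0 -> theta t y = 0 -> theta t (x - y) = 0.
Proof.
move=> /(theta_eq0 t0)[m [n ->]] /(theta_eq0 t0)[m' [n' ->]].
have -> : m%:~R * P + n%:~R * t - (m'%:~R * P + n'%:~R * t) =
  (m - m')%:~R * P + (n - n')%:~R * t by rewrite !intrB; ring.
by have [] := simple_zero_lattice t0 (m - m') (n - n').
Qed.

Lemma thetaD_sgn e y : theta t (y + sgn e * t) = - cexp (- t / 2 - sgn e * y) * theta t y.
Proof.
case: e; rewrite /sgn ?mul1r ?mulN1r; first exact: thetaDt.
have h := thetaDt t0 (y - t); rewrite subrK in h; rewrite h opprK mulrA mulNr mulrN opprK -cexpD.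
by rewrite [X in cexp X](_ : _ = 0) ?cexp0 ?mul1r//; field.
Qed.

Lemma thetaD_sgnP e y : theta t (y + sgn e * P) = - theta t y.
Proof. by case: e; rewrite /sgn ?mul1r ?mulN1r ?thetaD2pii ?thetaB2pii. Qed.

Lemma entire_prod (I : Type) (r : seq I) (p : pred I) (F : I -> C -> C) :
  (forall i, entire (F i)) -> entire (fun x => \prod_(i <- r | p i) F i x).
Proof.
move=> Fd; elim: r => [|i r IH] x.
  have -> : (fun x => \prod_(i <- [::] | p i) F i x) = fun=> 1.
    by apply/funext => y; rewrite big_nil.
  exact: cdf_cst.
case pi: (p i).
  have -> : (fun x => \prod_(i <- i :: r | p i) F i x) =
      fun x => F i x * \prod_(i <- r | p i) F i x.
    by apply/funext => y; rewrite big_cons pi.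
  by apply: cdfM; [exact: Fd|exact: IH].
have -> : (fun x => \prod_(i <- i :: r | p i) F i x) = fun x => \prod_(i <- r | p i) F i x.
  by apply/funext => y; rewrite big_cons pi.
exact: IH.
Qed.

Lemma entire_sum (I : Type) (r : seq I) (p : pred I) (F : I -> C -> C) :
  (forall i, entire (F i)) -> entire (fun x => \sum_(i <- r | p i) F i x).
Proof.
move=> Fd; elim: r => [|i r IH] x.
  have -> : (fun x => \sum_(i <- [::] | p i) F i x) = fun=> 0.
    by apply/funext => y; rewrite big_nil.
  exact: cdf_cst.
case pi: (p i).
  have -> : (fun x => \sum_(i <- i :: r | p i) F i x) =
      fun x => F i x + \sum_(i <- r | p i) F i x.
    by apply/funext => y; rewrite big_cons pi.
  by apply: cdfD; [exact: Fd|exact: IH].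
have -> : (fun x => \sum_(i <- i :: r | p i) F i x) = fun x => \sum_(i <- r | p i) F i x.
  by apply/funext => y; rewrite big_cons pi.
exact: IH.
Qed.

Lemma entire_thetaB (e c : C) : entire (fun x => theta t (c + e * x)).
Proof.
move=> x; apply: (@cdf_comp R (fun x => c + e * x)); last exact: entire_theta.
by apply: cdfD; [exact: cdf_cst|apply: cdfM; [exact: cdf_cst|exact: cdf_id]].
Qed.

Lemma prod_thetaP (p : pred ins) (s : seq ins) x :
  \prod_(b <- s | p b) theta t (x + P - b.2) =
  (-1) ^+ count p s * \prod_(b <- s | p b) theta t (x - b.2).
Proof.
elim: s => [|b s IH] /=; first by rewrite !big_nil mulr1.
rewrite !big_cons; case: ifP => pb; last by rewrite IH.
by rewrite IH addrAC thetaD2pii add1n exprS; move: (_ ^+ _) (theta _ _) (bigop.body _ _ _) => a b' c; ring.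
Qed.

Lemma prod_thetaT (p : pred ins) (s : seq ins) x :
  \prod_(b <- s | p b) theta t (x + t - b.2) =
  (-1) ^+ count p s * cexp ((count p s)%:R * (- t / 2 - x) + \sum_(b <- s | p b) b.2) *
  \prod_(b <- s | p b) theta t (x - b.2).
Proof.
elim: s => [|b s IH] /=; first by rewrite !big_nil mul0r addr0 cexp0 !mulr1.
rewrite !big_cons; case: ifP => pb; last by rewrite IH.
rewrite IH addrAC thetaDt// add1n exprS; set m := count p s; set S := \sum_(_ <- _ | _) _.
have -> : m.+1%:R * (- t / 2 - x) + (b.2 + S) =
    (- t / 2 - (x - b.2)) + (m%:R * (- t / 2 - x) + S) by rewrite -natr1; ring.
rewrite [cexp (- t / 2 - (x - b.2) + _)]cexpD.
by move: (cexp _) (cexp _) (_ ^+ _) (theta _ _) (bigop.body _ _ _) => a c e f g; ring.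
Qed.

Lemma prod_pair_factor a s : \prod_(c <- s) pair_factor a c =
  \prod_(c <- s | c.1 == a.1) theta t (a.2 - c.2) / \prod_(c <- s | c.1 != a.1) theta t (a.2 - c.2).
Proof.
rewrite (bigID (fun c : ins => c.1 == a.1)) /=; congr (_ * _).
  by apply: eq_bigr => c /eqP ca; rewrite /pair_factor ca eqxx.
by rewrite -prodfV; apply: eq_bigr => c /negbTE ca; rewrite /pair_factor eq_sym ca.
Qed.

Variables (al be : R).
Let bt : C := toC be.
Let v : C := toC al * P - toC be * t.

Definition closed_form s : C := cexp (- bt * Sg s) * K t ^+ (size s)./2 * theta t (v + Sg s) * pair_prod s.

(** The contraction of a with b. For opposite charges it is the sum over the modes k of a when b has
    mode - k ([kap_sum]). *)
Definition ker a b : C := cexp (- bt * sgn a.1 * (a.2 - b.2)) *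
  (K t * theta t (sgn a.1 * v + (a.2 - b.2)) / (theta t (sgn a.1 * v) * theta t (a.2 - b.2))).

Definition balanced s := (count (fun a => a.1) s == count (fun a => ~~ a.1) s)%N.

Hypothesis generic : (forall m : int, al <> m%:~R) \/ (forall m : int, be <> m%:~R).

(** Comparing real and then imaginary parts, a zero of theta at v would make both beta and alpha
    integers. *)
Lemma generic_theta e : theta t (sgn e * v) != 0.
Proof.
have hv : theta t v != 0.
  apply/eqP => /(theta_eq0 t0)[m [n vE]].
  have := congr1 (@complex.Re R) vE; have := congr1 (@complex.Im R) vE.
  rewrite /v -!toC_int !(ReD, ImD, ReN, ImN, ReM, ImM) !Re_toC !Im_toC ?Re_twopii ?Im_twopii.
  rewrite /= ?mulr0 ?mul0r ?add0r ?addr0 ?subr0 ?sub0r ?oppr0 ?add0r => h1 h2.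
  have p0 : (pi : R) != 0 by rewrite gt_eqF// pi_gt0.
  have tn : complex.Re t != 0 by rewrite lt_eqF.
  have b1 : be = (- n)%:~R by rewrite intrN; apply: (mulIf tn); rewrite mulNr -h2 opprK.
  case: generic => [/(_ m)|/(_ (- n))] //; apply.
  have : al * (2 * pi) = m%:~R * (2 * pi).
    by move: h1; rewrite b1 intrN mulNr opprK => /addIr.
  by apply: mulIf; rewrite mulf_neq0// pnatr_eq0.
by case: e; rewrite /sgn ?mul1r// mulN1r thetaN// oppr_eq0.
Qed.

(* Both sides are, in the variable x0, quotients of theta functions with the same
   multipliers and the same residues at their simple poles. *)
Lemma fay e x0 s d : gen ((e, x0) :: s) -> balanced ((e, x0) :: s) ->
  closed_form ((e, x0) :: s) =
  \sum_(j < size s) (if (nth d s j).1 == e then 0 else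
     (-1) ^+ j * ker (e, x0) (nth d s j) * closed_form (del j s)).
Proof.
move=> gs bal; have [g0 gs'] : all (fun b => theta t (x0 - b.2) != 0) s /\ gen s.
  by move: gs; rewrite /gen /= => /andP[].
pose opp : pred ins := fun b => b.1 != e.
(* As functions of x0 both sides have poles at the points of opposite charge; multiplication by
   [Bf s] clears them and leaves the entire functions [N1] and [N2]. The points of equal charge give
   the zeros [Sf]. *)
pose Bf (r : seq ins) x := \prod_(b <- r | opp b) theta t (x - b.2).
pose Sf (r : seq ins) x := \prod_(b <- r | ~~ opp b) theta t (x - b.2).
have odd_s : count opp s = (count (predC opp) s).+1.
  move: bal; rewrite /balanced /=.
  have -> : count (predC opp) s = count (fun b => b.1 == e) s.
    by apply: eq_count => b /=; rewrite negbK.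
  rewrite /opp; case: e {gs opp Bf Sf} => /= /eqP; rewrite ?add0n ?add1n => h.
    by rewrite (eq_count (a2 := fun b => ~~ b.1)) ?(eq_count (a2 := fun b => b.1) (a1 := fun b => b.1 == true)) ?h// => -[[] ?].
  by rewrite (eq_count (a2 := fun b => b.1)) ?(eq_count (a2 := fun b => ~~ b.1) (a1 := fun b => b.1 == false)) ?h// => -[[] ?].
have size_s : size s = (count (predC opp) s).*2.+1.
  by rewrite -(count_predC opp) odd_s -addnn addSn.
have SgE : sgn e * Sg s = \sum_(b <- s | ~~ opp b) b.2 - \sum_(b <- s | opp b) b.2.
  rewrite /Sg mulr_sumr (bigID opp) /= addrC; congr (_ + _).
    by apply: eq_bigr => b; rewrite negbK => /eqP ->; rewrite mulrA sgn_sqr mul1r.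
  rewrite -sumrN; apply: eq_bigr => b; rewrite /opp => be_.
  have -> : b.1 = ~~ e by move: be_; case: (b.1); case: (e).
  by rewrite sgnN mulrA mulrN sgn_sqr mulN1r.
pose N1 x := cexp (- bt * (Sg s + sgn e * x)) * K t ^+ (size s).+1./2 *
  theta t (v + Sg s + sgn e * x) * (Sf s x * pair_prod s).
pose N2j (j : 'I_(size s)) x := if (nth d s j).1 == e then 0 else
  (-1) ^+ j * (cexp (- bt * sgn e * (x - (nth d s j).2)) * K t / theta t (sgn e * v) *
    theta t (sgn e * v - (nth d s j).2 + 1 * x)) * Bf (del j s) x * closed_form (del j s).
pose N2 x := \sum_(j < size s) N2j j x.
pose N x := N1 x - N2 x.
have BfE (j : 'I_(size s)) x : (nth d s j).1 != e -> Bf s x = theta t (x - (nth d s j).2) * Bf (del j s) x.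
  by move=> h; rewrite /Bf (perm_big _ (perm_del d (ltn_ord j))) big_cons /= /opp h.
have SfE (j : 'I_(size s)) x : (nth d s j).1 != e -> Sf s x = Sf (del j s) x.
  by move=> h; rewrite /Sf (perm_big _ (perm_del d (ltn_ord j))) big_cons /= /opp h.
have Bf0 : Bf s x0 != 0.
  rewrite /Bf prodf_seq_neq0; apply/allP => b bs; apply/implyP => _.
  by move/allP: g0 => /(_ _ bs).
pose m := count (predC opp) s.
have ev0 := generic_theta e.
suff N0 : N x0 = 0.
  apply: (mulIf Bf0); rewrite mulr_suml.
  transitivity (N1 x0).
    have SgC : Sg ((e, x0) :: s) = Sg s + sgn e * x0 by rewrite /Sg big_cons addrC.
    rewrite /closed_form /N1 /= SgC [v + (_ + _)]addrA -!mulrA; congr (_ * (_ * (_ * _))).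
    rewrite prod_pair_factor /=.
    have -> : \prod_(c <- s | c.1 == e) theta t (x0 - c.2) = Sf s x0.
      by apply: eq_bigl => c; rewrite /opp negbK.
    have -> : \prod_(c <- s | c.1 != e) theta t (x0 - c.2) = Bf s x0 by [].
    by field.
  have /eqP := N0; rewrite subr_eq0 => /eqP ->; rewrite /N2; apply: eq_bigr => j _.
  rewrite /N2j; case: ifP => [_|/negbT h]; first by rewrite mul0r.
  rewrite (BfE j)// /ker /= mul1r.
  have xj : theta t (x0 - (nth d s j).2) != 0.
    by move/allP: g0 => /(_ (nth d s j)); apply; exact: mem_nth.
  have -> : sgn e * v - (nth d s j).2 + x0 = sgn e * v + (x0 - (nth d s j).2) by ring.
  move: (closed_form _) (Bf _ _) (theta t (x0 - (nth d s j).2)) (theta t (sgn e * v)) (theta t (_ + _)) (cexp _) (_ ^+ _) (K t) xj ev0.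
  move=> a1 a2 a3 a4 a5 a6 a7 a8 h1 h2.
  by field; rewrite h1 h2.
have cdel (j : 'I_(size s)) : (nth d s j).1 != e -> count opp (del j s) = m.
  move=> h; have := odd_s; rewrite (permP (perm_del d (ltn_ord j))) /= {1}/opp h add1n -/m.
  by case.
have sdel (j : 'I_(size s)) : (nth d s j).1 != e ->
    (nth d s j).2 + \sum_(b <- del j s | opp b) b.2 = \sum_(b <- s | opp b) b.2.
  by move=> h; rewrite [RHS](perm_big _ (perm_del d (ltn_ord j))) big_cons /= {2}/opp h.
pose O := \sum_(b <- s | opp b) b.2.
(* Here and in [NT] the multiplier of N is that of [Bf s] times a unimodular constant depending only
   on beta, respectively alpha; when that parameter is not an integer the constant is not 1. *)
have NP x : N (x + P) = cexp (- bt * sgn e * P) * (-1) ^+ m.+1 * N x.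
  rewrite /N mulrBr; congr (_ - _).
    rewrite /N1 /Sf prod_thetaP -/m.
    have -> : - bt * (Sg s + sgn e * (x + P)) = - bt * (Sg s + sgn e * x) + - bt * sgn e * P by ring.
    have -> : v + Sg s + sgn e * (x + P) = v + Sg s + sgn e * x + sgn e * P by ring.
    rewrite thetaD_sgnP [cexp (_ + - bt * sgn e * P)]cexpD exprS.
    by move: (cexp _) (cexp _) (theta _ _) (_ ^+ m) (_ ^+ _) (bigop.body _ _ _) (pair_prod s) => *; ring.
  rewrite /N2 mulr_sumr; apply: eq_bigr => j _; rewrite /N2j; case: ifP => [_|/negbT h].
    by rewrite mulr0.
  rewrite /Bf prod_thetaP cdel//.
  have -> : - bt * sgn e * (x + P - (nth d s j).2) =
    - bt * sgn e * (x - (nth d s j).2) + - bt * sgn e * P by ring.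
  have -> : sgn e * v - (nth d s j).2 + 1 * (x + P) =
    sgn e * v - (nth d s j).2 + 1 * x + P by ring.
  rewrite thetaD2pii [cexp (_ + - bt * sgn e * P)]cexpD exprS.
  move: (cexp _) (cexp _) (theta _ _) (theta _ _) (K t) (_ ^+ m) (_ ^+ _) (bigop.body _ _ _) (closed_form _) => *.
  by ring.
have NT x : N (x + t) = cexp (- sgn e * toC al * P) *
    ((-1) ^+ m.+1 * cexp (m.+1%:R * (- t / 2 - x) + O)) * N x.
  have sq y : sgn e * (sgn e * y) = y by rewrite mulrA sgn_sqr mul1r.
  rewrite /N mulrBr; congr (_ - _).
    rewrite /N1 /Sf prod_thetaT -/m.
    have -> : - bt * (Sg s + sgn e * (x + t)) = - bt * (Sg s + sgn e * x) + - bt * sgn e * t by ring.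
    have -> : v + Sg s + sgn e * (x + t) = v + Sg s + sgn e * x + sgn e * t by ring.
    rewrite thetaD_sgn [cexp (_ + - bt * sgn e * t)]cexpD exprS.
    set c1 := cexp (- bt * sgn e * t); set c2 := cexp (- t / 2 - _); set c3 := cexp (m%:R * _ + _).
    set c4 := cexp (- sgn e * toC al * P); set c5 := cexp (m.+1%:R * _ + _).
    have cE : c1 * c2 * c3 = c4 * c5.
      rewrite /c1 /c2 /c3 /c4 /c5 -!cexpD; congr cexp.
      have -> : sgn e * (v + Sg s + sgn e * x) = sgn e * v + (\sum_(b <- s | ~~ opp b) b.2 - O) + x.
        by rewrite !mulrDr sq SgE.
      by rewrite /v /bt -natr1; field.
    transitivity (- (c1 * c2 * c3) * (-1) ^+ m * (cexp (- bt * (Sg s + sgn e * x)) *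
      K t ^+ (size s).+1./2 * theta t (v + Sg s + sgn e * x) *
      (\prod_(b <- s | ~~ opp b) theta t (x - b.2) * pair_prod s))).
      by move: c1 c2 c3 {cE} (cexp _) (theta _ _) (_ ^+ m) (_ ^+ _) (bigop.body _ _ _) (pair_prod s) => *; ring.
    by rewrite cE; move: c4 c5 {cE} (cexp _) (theta _ _) ((-1) ^+ m) (K t ^+ _) (bigop.body _ _ _) (pair_prod s) => *; ring.
  rewrite /N2 mulr_sumr; apply: eq_bigr => j _; rewrite /N2j; case: ifP => [_|/negbT h].
    by rewrite mulr0.
  rewrite /Bf prod_thetaT cdel//.
  have -> : - bt * sgn e * (x + t - (nth d s j).2) =
    - bt * sgn e * (x - (nth d s j).2) + - bt * sgn e * t by ring.
  have -> : sgn e * v - (nth d s j).2 + 1 * (x + t) =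
    sgn e * v - (nth d s j).2 + 1 * x + t by ring.
  rewrite thetaDt// [cexp (_ + - bt * sgn e * t)]cexpD exprS.
  set c1 := cexp (- bt * sgn e * t); set c2 := cexp (- t / 2 - _); set c3 := cexp (m%:R * _ + _).
  set c4 := cexp (- sgn e * toC al * P); set c5 := cexp (m.+1%:R * _ + _).
  have cE : c1 * c2 * c3 = c4 * c5.
    rewrite /c1 /c2 /c3 /c4 /c5 -!cexpD; congr cexp.
    by rewrite /O -(sdel j h) /v /bt -natr1; field.
  set c6 := cexp _; set v1 := theta t (sgn e * v); set v2 := theta t _; set p1 := (-1) ^+ j.
  set p2 := (-1) ^+ m; set pd := \prod_(_ <- _ | _) _.
  transitivity (- (c1 * c2 * c3) * p1 * p2 * (c6 * K t / v1 * v2) * pd * closed_form (del j s)).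
    by clearbody c1 c2 c3 c6 v1 v2 p1 p2 pd; move: (closed_form _) (K t) => *; ring.
  by rewrite cE; clearbody c4 c5 c6 v1 v2 p1 p2 pd; move: (closed_form _) (K t) => *; ring.
(* Equality of residues: at the point of index j every other summand of [N2] contains a vanishing
   factor of its [Bf], and the j-th one equals [N1] by [pair_prod_split]. *)
have Nz (j : 'I_(size s)) : (nth d s j).1 != e -> N (nth d s j).2 = 0.
  move=> h; set zj := (nth d s j).2.
  have us : uniq s.
    by apply: pairwise_uniq gs' => b /=; apply: negbF; apply/eqP; rewrite subrr (theta0 t0).
  have [gd nd] := gen_del d (ltn_ord j) gs'.
  rewrite /N /N2 (bigD1 j)//= big1 ?addr0 => [|i ij]; last first.
    rewrite /N2j; case: ifP => // _.
    have jd : nth d s j \in del i s.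
      have : nth d s j \in nth d s i :: del i s.
        by rewrite -(perm_mem (perm_del d (ltn_ord i))) mem_nth.
      rewrite inE nth_uniq// => /orP[/eqP ji|//].
      by rewrite (ord_inj ji) eqxx in ij.
    suff -> : Bf (del i s) zj = 0 by rewrite mulr0 mul0r.
    rewrite /Bf (big_rem _ jd) /=.
by rewrite {1}/opp h /= -/zj subrr (theta0 t0) mul0r.
  have jE : (nth d s j).1 = ~~ e by move: h; case: (nth d s j).1; case: (e).
  have SdE : Sg s + sgn e * zj = Sg (del j s).
    rewrite /Sg (perm_big _ (perm_del d (ltn_ord j))) big_cons /= jE sgnN -/zj.
    by rewrite mulNr addrAC addNr add0r.
  have sz : size (del j s) = m.*2 by rewrite size_del// size_s.
  have hs : (size s).+1./2 = m.+1 by rewrite size_s -doubleS doubleK.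
  rewrite /N1 /N2j (negbTE h) -/zj hs -addrA SdE.
  have e1 : cexp (- bt * sgn e * (zj - zj)) = 1 by rewrite subrr mulr0 cexp0.
  have e2 : sgn e * v - zj + 1 * zj = sgn e * v by rewrite mul1r subrK.
  rewrite e1 e2 mul1r divfK// /closed_form sz doubleK.
  have pair_prodE : Sf s zj * pair_prod s = (-1) ^+ j * Bf (del j s) zj * pair_prod (del j s).
    rewrite {2}(nth_split d (ltn_ord j)) pair_prod_split size_take ltn_ord -/(del j s) prod_pair_factor.
    rewrite (SfE j)// jE.
    have -> : \prod_(c <- del j s | c.1 == ~~ e) theta t ((nth d s j).2 - c.2) = Bf (del j s) zj.
      by apply: eq_bigl => c; rewrite /opp; case: c.1; case: (e).
    have -> : \prod_(c <- del j s | c.1 != ~~ e) theta t ((nth d s j).2 - c.2) = Sf (del j s) zj.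
      by apply: eq_bigl => c; rewrite /opp; case: c.1; case: (e).
    have S0 : Sf (del j s) zj != 0.
      by rewrite /Sf prodf_seq_neq0; apply/allP => c cs; apply/implyP => _; exact: nd.
    by field.
  rewrite pair_prodE exprS; clear; move: (cexp _) (K t) (_ ^+ m) (_ ^+ j) (theta _ _) (Bf _ _) (pair_prod _) => *.
  by ring.
(* The zeros of [Bf s] are all lattice translates of these points, so N must vanish at the
   translates as well. *)
have Nlat j (k l : int) : (j < size s)%N -> (nth d s j).1 != e ->
    N ((nth d s j).2 + (k%:~R * P + l%:~R * t)) = 0.
  move=> js h; have := Nz (Ordinal js) h.
  have mulI0 (k' y : C) : k' != 0 -> k' * y = 0 -> y = 0.
    by move=> k0 /eqP; rewrite mulf_eq0 (negbTE k0) => /eqP.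
  have c0 x : (-1) ^+ m.+1 * cexp x != 0 by rewrite mulf_neq0 ?cexp_neq0// expf_neq0// oppr_eq0 oner_neq0.
  apply: (@lattice_ind R t (fun x => N x = 0)) => x.
    rewrite NP; split=> [->|]; first by rewrite mulr0.
    by apply: mulI0; rewrite mulrC c0.
  rewrite NT; split=> [->|]; first by rewrite mulr0.
  by apply: mulI0; rewrite mulf_neq0 ?cexp_neq0 ?c0.
have BP x : Bf s (x + P) = (-1) ^+ m.+1 * Bf s x by rewrite /Bf prod_thetaP odd_s.
have BT x : Bf s (x + t) = (-1) ^+ m.+1 * cexp (m.+1%:R * (- t / 2 - x) + O) * Bf s x.
  by rewrite /Bf prod_thetaT odd_s.
have exp0 : (-1) ^+ m.+1 != 0 :> C by rewrite expf_neq0// oppr_eq0 oner_neq0.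
have key w k : w = P \/ w = t -> nm k = 1 -> k != 1 ->
    (forall y, N (y + w) * Bf s y = k * N y * Bf s (y + w)) -> N x0 = 0.
  move=> ww k1 kn H; apply: (@elliptic_quotient0 R N (Bf s) P t _ _ _ _ _ w k) => //.
  - move=> x; apply: cdfB.
      apply: cdfM; last first.
        apply: cdfM; last exact: cdf_cst.
        have -> : Sf s = fun x => \prod_(b <- s | ~~ opp b) theta t (- b.2 + 1 * x).
          by apply/funext => y; apply: eq_bigr => b _; rewrite mul1r addrC.
        by apply: entire_prod => b; exact: entire_thetaB.
      apply: cdfM; last exact: entire_thetaB.
      apply: cdfM; last exact: cdf_cst.
      apply: cdf_cexp; apply: cdfM; first exact: cdf_cst.
      by apply: cdfD; [exact: cdf_cst|apply: cdfM; [exact: cdf_cst|exact: cdf_id]].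
    apply: entire_sum => j y; rewrite /N2j.
    case: (_ == e); first exact: cdf_cst.
    apply: cdfM; last exact: cdf_cst.
    apply: cdfM; last first.
      have -> : Bf (del j s) = fun x => \prod_(b <- del j s | opp b) theta t (- b.2 + 1 * x).
        by apply/funext => y'; apply: eq_bigr => b _; rewrite mul1r addrC.
      by apply: entire_prod => b; exact: entire_thetaB.
    apply: cdfM; first exact: cdf_cst.
    apply: cdfM; last exact: entire_thetaB.
    apply: cdfM; last exact: cdf_cst.
    apply: cdfM; last exact: cdf_cst.
    apply: cdf_cexp; apply: cdfM; first exact: cdf_cst.
    by apply: cdfB; [exact: cdf_id|exact: cdf_cst].
  - have -> : Bf s = fun x => \prod_(b <- s | opp b) theta t (- b.2 + 1 * x).
      by apply/funext => y'; apply: eq_bigr => b _; rewrite mul1r addrC.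
    by apply: entire_prod => b; exact: entire_thetaB.
  - move=> y /eqP; rewrite /Bf prodf_seq_eq0 => /hasP[b bs /andP[ob /eqP yb]].
    pose j := index b s; have js : (j < size s)%N by rewrite index_mem.
    have jb : nth d s j = b by exact: nth_index.
    have [k' [l yE]] := theta_eq0 t0 yb.
    have y_ : y = b.2 + (k'%:~R * P + l%:~R * t) by rewrite -yE addrC subrK.
    split; first by rewrite y_ -jb Nlat// jb.
    have [dd dd0 ddP] := theta_zero_simple t0 yb.
    have [gd nd] := gen_del d js gs'.
    have Bd0 : Bf (del j s) y != 0.
      rewrite /Bf prodf_seq_neq0; apply/allP => c cs; apply/implyP => _.
      apply/eqP => yc; have := nd c cs; rewrite jb.
      have -> : b.2 - c.2 = (y - c.2) - (y - b.2) by ring.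
      by rewrite theta_eq0B ?eqxx.
    have Bfun : Bf s = fun x => theta t (x - b.2) * Bf (del j s) x.
      by apply/funext => x; rewrite (BfE (Ordinal js)) /= jb.
    have [d' d'P] : cdf (Bf (del j s)) y.
      have -> : Bf (del j s) = fun x => \prod_(b <- del j s | opp b) theta t (- b.2 + 1 * x).
        by apply/funext => y'; apply: eq_bigr => b' _; rewrite mul1r addrC.
      by apply: entire_prod => b'; exact: entire_thetaB.
    exists (dd * Bf (del j s) y); first by rewrite mulf_neq0.
    suff : cdiff (Bf s) y (dd * Bf (del j s) y) by [].
    rewrite Bfun; apply: cdiff_eq; first apply: cdiffM d'P.
      apply: (@cdiff_comp R (fun x => x - b.2)); last exact: ddP.
      by apply: cdiffB; [exact: cdiff_id|exact: cdiff_cst].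
    by rewrite /= yb mul0r addr0 subr0 mulr1.
  - exact: lattice_cover.
  - move=> w' [] -> y; split.
    + by rewrite BP mulf_eq0 (negbTE exp0).
    + exists (cexp (- bt * sgn e * P)); last by rewrite NP BP; move: (cexp _) (_ ^+ _) (N y) (Bf s y) => *; ring.
      rewrite nm_cexp; have -> : complex.Re (- bt * sgn e * P) = 0; last by rewrite expR0.
      rewrite /bt /sgn; case: (e); rewrite ?mulr1 ?mulrN1 ?opprK ?mulNr ?ReN ReM Re_toC Im_toC;
      by rewrite mul0r ?mulr0 ?subr0 ?oppr0.
    + by rewrite BT mulf_eq0 mulf_eq0 (negbTE exp0) (negbTE (cexp_neq0 _)).
    + exists (cexp (- sgn e * toC al * P)); last first.
        by rewrite NT BT; move: (cexp _) (cexp _) (_ ^+ _) (N y) (Bf s y) => *; ring.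
      rewrite nm_cexp; have -> : complex.Re (- sgn e * toC al * P) = 0; last by rewrite expR0.
      rewrite /sgn; case: (e); rewrite ?opprK ?mulN1r ?mul1r ?mulNr ?ReN ReM Re_toC Im_toC;
      by rewrite mul0r ?mulr0 ?subr0 ?oppr0.
have unit_P (r : R) : (forall k : int, r <> k%:~R) -> nm (cexp (toC r * P)) = 1 /\ cexp (toC r * P) != 1.
  move=> rk; split.
    by rewrite nm_cexp ReM Re_toC Im_toC mul0r ?mulr0 subr0 expR0.
  apply/eqP => /cexp_eq1[k /(mulIf (twopii_neq0 R))]; rewrite -toC_int => /toC_inj.
  exact: rk.
have sgn_int (r : R) : (forall k : int, r <> k%:~R) -> forall k : int, (if e then - r else r) <> k%:~R.
  by case: (e) => // rk k rE; apply: (rk (- k)); rewrite intrN -rE opprK.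
case: generic => [/sgn_int/unit_P[h1 h2]|/sgn_int/unit_P[h1 h2]].
  apply: (key t (cexp (toC (if e then - al else al) * P))) => //; first by right.
  move=> y; rewrite NT BT.
  have -> : - sgn e * toC al * P = toC (if e then - al else al) * P.
    by rewrite /sgn; case: (e); rewrite ?toCN ?opprK ?mul1r ?mulN1r.
  by move: (cexp _) (cexp _) (_ ^+ _) (N y) (Bf s y) => *; ring.
apply: (key P (cexp (toC (if e then - be else be) * P))) => //; first by left.
move=> y; rewrite NP BP.
have -> : - bt * sgn e * P = toC (if e then - be else be) * P.
  by rewrite /sgn /bt; case: (e); rewrite ?toCN ?mulr1 ?mulrN1 ?opprK.
by move: (cexp _) (_ ^+ _) (N y) (Bf s y) => *; ring.
Qed.

End Fay.
(** * The Fock space and Wick's theorem *)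

Section FockAlgebra.
Variable R : realType.
Local Notation C := (Cplx R).
Local Notation fock := (fock R).
Local Notation fockb := (@fockb R).
Implicit Types (b : basis) (c d : creator) (v w : fock).

Definition lin (f : fock -> fock) :=
  (forall v w, f (v + w) = f v + f w) /\ forall (k : C) v, f (k *: v) = k *: f v.

Lemma freegUZ (k : C) b : [freeg [:: (k, b)]] = k *: fockb b.
Proof. by apply/eqP/freeg_eqP => x; rewrite coeffZ !coeffU mul1r. Qed.

Lemma coeff_fockb b b' : coeff b (fockb b') = (b' == b)%:R.
Proof. by rewrite coeffU mul1r. Qed.

Lemma fock_ind (Q : fock -> Prop) : Q 0 -> (forall k b v, Q v -> Q (k *: fockb b + v)) ->
  forall v, Q v.
Proof.
move=> Q0 QS; apply: freeg_ind_dom0 => // k b v _ _ Qv; rewrite freegUZ; exact: QS.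
Qed.

Lemma fglift0 (g : basis -> fock) : fglift g 0 = 0.
Proof.
have h := lift_is_additive g; have := h 0 0; rewrite subrr => ->.
by rewrite subrr.
Qed.

Lemma fgliftB (g : basis -> fock) v w : fglift g (v - w) = fglift g v - fglift g w.
Proof. exact: lift_is_additive. Qed.

Lemma fgliftD (g : basis -> fock) v w : fglift g (v + w) = fglift g v + fglift g w.
Proof. by rewrite -{1}(opprK w) fgliftB -[- w]sub0r fgliftB fglift0 sub0r opprK. Qed.

Lemma fglift_lin (g : basis -> fock) : lin (fglift g).
Proof.
split=> [|k v]; first exact: fgliftD.
elim/fock_ind: v => [|k' b v IH]; first by rewrite scaler0 fglift0 scaler0.
rewrite scalerDr !fgliftD IH scalerDr scalerA -!freegUZ !liftU.
by rewrite scalerA.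
Qed.

Lemma fglift_fockb (g : basis -> fock) b : fglift g (fockb b) = g b.
Proof. by rewrite liftU scale1r. Qed.

Lemma lin0 f : lin f -> f 0 = 0.
Proof. by move=> [_ fZ]; rewrite -[0 in LHS](scale0r (0 : fock)) fZ scale0r. Qed.

Lemma lin_ext f g : lin f -> lin g -> (forall b, f (fockb b) = g (fockb b)) -> forall v, f v = g v.
Proof.
move=> lf lg fg; elim/fock_ind => [|k b v IH]; first by rewrite !lin0.
by rewrite lf.1 lg.1 lf.2 lg.2 IH fg.
Qed.

Lemma lin_comp f g : lin f -> lin g -> lin (fun v => f (g v)).
Proof. by move=> lf lg; split=> [v w|k v]; rewrite ?lg.1 ?lf.1 ?lg.2 ?lf.2. Qed.

Lemma lin_id : lin id. Proof. by []. Qed.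

Lemma linD f g : lin f -> lin g -> lin (fun v => f v + g v).
Proof.
move=> lf lg; split=> [v w|k v]; first by rewrite lf.1 lg.1 addrACA.
by rewrite lf.2 lg.2 scalerDr.
Qed.

Lemma lin_cst0 : lin (fun=> 0).
Proof. by split=> *; rewrite ?addr0 ?scaler0. Qed.

Lemma psi_lin e m : lin (@psi R e m).
Proof. exact: fglift_lin. Qed.

(** Creation and annihilation both toggle a creator and differ only in the presence they require;
    [cop] treats them together. *)
Definition tog c b : basis := if c \in b then (b `\ c)%fset else (c |` b)%fset.

Definition lt_cre d c := le_cre d c && (d != c).

Definition cop c (s : bool) b : fock :=
  if (c \in b) == s then (-1) ^+ pos c b *: fockb (tog c b) else 0.

(* psi e m toggles the creator pc e m: it removes it if ps m, and adds it
   otherwise. *)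
Definition pc (e : bool) (m : int) : creator :=
  match m with Negz j => (e, j) | Posz j => (~~ e, j) end.

Definition ps (m : int) : bool := if m is Posz _ then true else false.

Lemma psi_fockb e m b : psi e m (fockb b) = cop (pc e m) (ps m) b.
Proof.
rewrite /psi fglift_fockb; case: m => j; rewrite /cop /annihilate /create /tog /=;
by case: (_ \in b).
Qed.

Lemma mem_tog c d b : (c \in tog d b) = if c == d then c \notin b else c \in b.
Proof.
rewrite /tog; case: eqVneq => [->|cd].
  by case: ifP => db; rewrite !inE eqxx ?db.
by case: ifP => db; rewrite !inE ?cd ?(negbTE cd).
Qed.

Lemma togK c b : tog c (tog c b) = b.
Proof.
by apply/fsetP => d; rewrite !mem_tog; case: eqVneq => // ->; rewrite negbK.
Qed.

Lemma togC c d b : tog c (tog d b) = tog d (tog c b).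
Proof.
apply/fsetP => x; rewrite !mem_tog; case: (eqVneq x c) => [->|_]; case: eqVneq => //.
Qed.

Lemma prod_tog (F : creator -> C) c b : (forall d, F d != 0) ->
  \prod_(d <- tog c b) F d = \prod_(d <- b) F d * (if c \in b then (F c)^-1 else F c).
Proof.
move=> F0; rewrite /tog; case: ifP => cb; last by rewrite big_fsetU1 ?cb//= mulrC.
by rewrite [in RHS](big_fsetD1 c cb)/= mulrC mulKf.
Qed.

Lemma posE c b : pos c b = (\sum_(d <- b) lt_cre d c)%N.
Proof. by rewrite /pos size_filter -sum1_count big_mkcond /=; apply: eq_bigr => d _; rewrite /lt_cre; case: ifP. Qed.

Lemma pos_tog c d b : (-1) ^+ pos c (tog d b) = (-1) ^+ pos c b * (-1) ^+ lt_cre d c :> C.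
Proof.
rewrite !posE /tog; case: ifP => db; last first.
  by rewrite big_fsetU1 ?db//= exprD mulrC.
by rewrite [in RHS](big_fsetD1 d db) /= exprD mulrAC -expr2 sqrr_sign mul1r.
Qed.

Lemma lt_cre_anti c d : c != d -> lt_cre c d = ~~ lt_cre d c.
Proof.
move=> cd; rewrite /lt_cre cd [d == c]eq_sym cd !andbT /le_cre.
case: c d cd => [e i] [e' j] /=; case: (eqVneq e e') => [->|]; last by case: e; case: e'.
rewrite xpair_eqE eqxx /= => ij; by rewrite -ltnNge ltn_neqAle ij.
Qed.

Lemma sgn_sq (n : nat) : (-1) ^+ n * (-1) ^+ n = 1 :> C.
Proof. by rewrite -expr2 sqrr_sign. Qed.

Definition copl c s : fock -> fock := fglift (cop c s).

Lemma copl_lin c s : lin (copl c s). Proof. exact: fglift_lin. Qed.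

Lemma psiE e m v : psi e m v = copl (pc e m) (ps m) v.
Proof.
apply: lin_ext v => [||b]; [exact: psi_lin|exact: copl_lin|].
by rewrite psi_fockb /copl fglift_fockb.
Qed.

Lemma copl_cop c s d s' b : copl c s (copl d s' (fockb b)) =
  if ((d \in b) == s') && ((c \in tog d b) == s) then
    ((-1) ^+ pos d b * (-1) ^+ pos c (tog d b)) *: fockb (tog c (tog d b)) else 0.
Proof.
rewrite {2}/copl fglift_fockb /cop; case: eqP => _ /=; last by rewrite (lin0 (copl_lin _ _)).
rewrite (copl_lin c s).2 /copl fglift_fockb /cop; case: eqP => _; last by rewrite scaler0.
by rewrite scalerA.
Qed.

(** For c different from d exactly one of them precedes the other ([lt_cre_anti]), so only one of
    the two orders of toggling picks up an additional sign. *)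
Lemma anticomm c s d s' v : copl c s (copl d s' v) + copl d s' (copl c s v) =
  if (c == d) && (s != s') then v else 0.
Proof.
apply: (lin_ext (f := fun v => copl c s (copl d s' v) + copl d s' (copl c s v))
  (g := fun v => if (c == d) && (s != s') then v else 0)) => [||b].
- by apply: linD; apply: lin_comp; exact: copl_lin.
- by case: (_ && _); [exact: lin_id|exact: lin_cst0].
rewrite !copl_cop !mem_tog [d == c]eq_sym.
case: (eqVneq c d) => [<-|cd] /=.
  rewrite !pos_tog togK /lt_cre eqxx andbF expr0 mulr1 sgn_sq scale1r.
  by case: (c \in b); case: s; case: s'; rewrite ?addr0 ?add0r.
rewrite [((c \in b) == s) && _]andbC; case: ifP => _; last by rewrite addr0.
rewrite [tog d (tog c b)]togC -scalerDl !pos_tog (lt_cre_anti cd).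
suff -> : (-1) ^+ pos d b * ((-1) ^+ pos c b * (-1) ^+ lt_cre d c) +
   (-1) ^+ pos c b * ((-1) ^+ pos d b * (-1) ^+ ~~ lt_cre d c) = 0 :> C by rewrite scale0r.
by case: (lt_cre d c); rewrite /= ?expr0 ?expr1; move: (_ ^+ _) (_ ^+ _) => x y; ring.
Qed.

Lemma coeff_copl c s b v : coeff (tog c b) (copl c s v) =
  if (c \in b) == s then (-1) ^+ pos c b * coeff b v else 0.
Proof.
elim/fock_ind: v => [|k b' v IH].
  by rewrite (lin0 (copl_lin _ _)) !coeff0 mulr0 if_same.
rewrite (copl_lin c s).1 (copl_lin c s).2 coeffD coeffZ IH coeffD coeffZ {IH}.
rewrite /copl fglift_fockb /cop coeff_fockb.
have tE : (tog c b' == tog c b) = (b' == b).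
  by apply/eqP/eqP => [/(congr1 (tog c))|->//]; rewrite !togK.
case: (eqVneq b' b) => [->|bb].
  case: ifP => _; last by rewrite coeff0 mulr0 addr0.
  by rewrite coeffZ coeff_fockb eqxx; move: (coeff b v) (_ ^+ _) => x y; ring.
rewrite mulr0 add0r [X in k * X](_ : _ = 0) ?mulr0 ?add0r//.
case: ifP => _; last by rewrite coeff0.
by rewrite coeffZ coeff_fockb tE (negbTE bb) mulr0.
Qed.

(* [(e, k)] labels the mode [psi e (k - e)], which lowers [ht] by [k]. *)
Definition op (a : bool * int) : fock -> fock := psi a.1 (a.2 - (a.1 : nat)%:Z).

Definition oc (a : bool * int) := pc a.1 (a.2 - (a.1 : nat)%:Z).
Definition os (a : bool * int) := ps (a.2 - (a.1 : nat)%:Z).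

Lemma opE a v : op a v = copl (oc a) (os a) v.
Proof. exact: psiE. Qed.

Lemma op_lin a : lin (op a). Proof. exact: psi_lin. Qed.

Lemma oc_dual a a' : (oc a == oc a') && (os a != os a') = (a.1 != a'.1) && (a.2 + a'.2 == 0).
Proof.
have key e m e' m' : (pc e m == pc e' m') && (ps m != ps m') = (e != e') && (m + m' == -1).
  case: m => j; case: m' => k; rewrite /pc /ps /= ?andbF ?andbT ?xpair_eqE.
  - by [].
  - have -> : (Posz j + Negz k == -1) = (j == k) by apply/idP/idP => /eqP ?; apply/eqP; lia.
    by case: e; case: e'.
  - have -> : (Negz j + Posz k == -1) = (j == k) by apply/idP/idP => /eqP ?; apply/eqP; lia.
    by case: e; case: e'.
  - by [].
case: a a' => [e k] [e' k']; rewrite /oc /os key /=; case: (eqVneq e e') => //= ee.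
by case: e ee; case: e' => //= _; apply/idP/idP => /eqP ?; apply/eqP; lia.
Qed.

Lemma op_anticomm a a' v : op a (op a' v) =
  (if (a.1 != a'.1) && (a.2 + a'.2 == 0) then v else 0) - op a' (op a v).
Proof. by apply/eqP; rewrite eq_sym subr_eq eq_sym !opE anticomm oc_dual. Qed.

Definition appl (X : seq (bool * int)) v : fock := foldr op v X.

Lemma appl_lin X : lin (appl X).
Proof. by elim: X => [|a X IH] /=; [exact: lin_id|apply: lin_comp IH; exact: op_lin]. Qed.

Lemma op_appl a X v (d : bool * int) : op a (appl X v) =
  \sum_(j < size X) (if (a.1 != (nth d X j).1) && (a.2 + (nth d X j).2 == 0)
     then (-1) ^+ j *: appl (del j X) v else 0) + (-1) ^+ size X *: appl X (op a v).
Proof.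
elim: X => [|x X IH] /=; first by rewrite big_ord0 add0r expr0 scale1r.
rewrite op_anticomm IH big_ord_recl /=.
have -> : del 0 (x :: X) = X by rewrite /del /= drop0.
rewrite expr0 scale1r -addrA; congr (_ + _).
rewrite (op_lin x).1 (op_lin x).2 opprD exprS mulN1r scaleNr; congr (_ + _).
have -> u : op x (\sum_(j < size X) u j) = \sum_(j < size X) op x (u j).
  by apply: (big_morph _ (op_lin x).1 (lin0 (op_lin x))).
rewrite -sumrN; apply: eq_bigr => j _; rewrite /bump /= add1n exprS mulN1r.
by case: ifP => _; rewrite ?(lin0 (op_lin x)) ?oppr0// (op_lin x).2 scaleNr.
Qed.

(** A word of modes sends a basis vector to a multiple of a single basis vector. This bounds all
    matrix entries by 1, uniformly in the word. *)
Definition sparse v := exists (b : basis) (k : C), v = k *: fockb b /\ nm k <= 1.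

Lemma sparse_appl X b : sparse (appl X (fockb b)).
Proof.
elim: X => [|a X [b' [k [E k1]]]] /=; first by exists b, 1; rewrite scale1r nm1.
rewrite -/(appl X _) E (op_lin a).2 opE /copl fglift_fockb /cop.
case: ifP => _; last by exists b, 0; rewrite scaler0 scale0r nm0 ler01.
exists (tog (oc a) b'), (k * (-1) ^+ pos (oc a) b'); rewrite scalerA; split=> //.
by rewrite nmM nmX nmN nm1 expr1n mulr1.
Qed.

Lemma nm_coeff_appl X b b' : nm (coeff b' (appl X (fockb b))) <= 1.
Proof.
have [b1 [k [-> k1]]] := sparse_appl X b; rewrite coeffZ coeff_fockb.
by case: eqP => _; rewrite ?mulr1// mulr0 nm0 ler01.
Qed.

Section Trace.
Variables (w : creator -> C) (W : R).
Hypothesis w0 : forall c, w c != 0.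
Hypothesis wW : bsum (fun c => nm (w c)) W.

Let wb b : C := \prod_(c <- b) w c.

Lemma trace_asum X : asum (fun b : basis => wb b * coeff b (appl X (fockb b))).
Proof.
apply: (asum_le (bsum_subsets wW)) => b; rewrite nmM nm_prod -[leRHS]mulr1.
by rewrite ler_wpM2l ?nm_coeff_appl// prodr_ge0// => c _; exact: nm_ge0.
Qed.

Definition trace X : C := tsum (fun b : basis => wb b * coeff b (appl X (fockb b))).

Lemma trace_has_sum X : has_sum (fun b : basis => wb b * coeff b (appl X (fockb b))) (trace X).
Proof. exact/asum_has_sum/trace_asum. Qed.

Definition om (a : bool * int) : C := if os a then w (oc a) else (w (oc a))^-1.

(** Toggling [oc a] is a bijection of the basis that matches the diagonal entries of the two words.
    The weight changes by the factor of that creator, or by its inverse if a creates it, which is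
    [om a]. *)
Lemma trace_cyclic a X :
  has_sum (fun b : basis => wb b * coeff b (appl X (op a (fockb b)))) (om a * trace (a :: X)).
Proof.
pose h (b : basis) : basis := tog (oc a) b.
have hi : injective h by move=> b b' /(congr1 (tog (oc a))); rewrite !togK.
have h1 := has_sumZ (om a) (trace_has_sum (a :: X)).
have {}h1 : has_sum (fun b => om a * (wb (h b) * coeff (h b) (appl (a :: X) (fockb (h b)))))
    (om a * trace (a :: X)).
  apply/(has_sum_inj (h := h) (f := fun b => om a * (wb b * coeff b (appl (a :: X) (fockb b))))) => //.
  by move=> b Hb; case: (Hb (h b)); rewrite /h togK.
apply: eq_has_sum h1 => b; rewrite /= -/(appl X _) opE coeff_copl opE /copl fglift_fockb /cop.
case: ifP => [/eqP cs|_]; last by rewrite (lin0 (appl_lin X)) coeff0 !mulr0.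
rewrite (appl_lin X).2 coeffZ -/(h b) /wb prod_tog// /om cs.
have := w0 (oc a); move: (w (oc a)) (\prod_(_ <- _) _) (_ ^+ _) (coeff _ _) => x y z u x0.
by case: (os a); field.
Qed.

(** Anticommuting a through the odd word X leaves the contractions and a sign -1, and cyclicity
    brings a back to the front with the factor [om a]. Hence 1 + [om a] on the left. *)
Lemma trace_wick a X (d : bool * int) : odd (size X) -> (1 + om a) * trace (a :: X) =
  \sum_(j < size X) (if (a.1 != (nth d X j).1) && (a.2 + (nth d X j).2 == 0)
     then (-1) ^+ j * trace (del j X) else 0).
Proof.
move=> oX; apply/eqP; rewrite mulrDl mul1r -subr_eq0 addrAC addr_eq0 -subr_eq0; apply/eqP.
suff : trace (a :: X) = \sum_(j < size X)
    (if (a.1 != (nth d X j).1) && (a.2 + (nth d X j).2 == 0)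
     then (-1) ^+ j * trace (del j X) else 0) - om a * trace (a :: X).
  by move=> h; rewrite {1}h; ring.
apply: (has_sum_unique (trace_has_sum (a :: X))).
have h2 := trace_cyclic a X.
have h1 : has_sum (fun b => \sum_(j < size X)
    (if (a.1 != (nth d X j).1) && (a.2 + (nth d X j).2 == 0) then
      (-1) ^+ j * (wb b * coeff b (appl (del j X) (fockb b))) else 0))
  (\sum_(j < size X) (if (a.1 != (nth d X j).1) && (a.2 + (nth d X j).2 == 0)
     then (-1) ^+ j * trace (del j X) else 0)).
  apply: has_sum_sum => j _; case: ifP => _; last exact: has_sum0.
  apply: has_sumZ; exact: trace_has_sum.
apply: eq_has_sum (has_sumB h1 h2) => b /=.
rewrite -/(appl X _) (op_appl a X _ d) coeffD coeffZ -signr_odd oX expr1 mulN1r.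
rewrite mulrBr; congr (_ - _); rewrite raddf_sum /= mulr_sumr; apply: eq_bigr => j _.
by case: ifP => _; rewrite ?coeff0 ?mulr0// coeffZ mulrCA.
Qed.

End Trace.

End FockAlgebra.

(** * The modes of the conformal, Heisenberg and fermion vectors *)

Section Modes.
Variable R : realType.
Local Notation C := (Cplx R).
Local Notation fock := (fock R).
Local Notation fockb := (@fockb R).
Local Notation vac := (vac R).
Implicit Types (b : basis) (c d : creator) (v w : fock).

Lemma fsum_nat (F : nat -> fock) N : (forall p, (N <= p)%N -> F p = 0) ->
  \sum_(i \in [set: nat]) F i = \sum_(i < N) F i.
Proof.
move=> F0; rewrite -(fsbig_widen `I_N setT) ?fsbig_ord//.
by move=> i /= [_ /negP]; rewrite -leqNgt => /F0.
Qed.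

Lemma fsum_nat1 (F : nat -> fock) p0 : (forall p, p != p0 -> F p = 0) ->
  \sum_(i \in [set: nat]) F i = F p0.
Proof.
move=> F0; rewrite (@fsum_nat _ p0.+1) => [|p pp]; last by apply: F0; rewrite gtn_eqF.
rewrite big_ord_recr /= big1 ?add0r// => i _; apply: F0.
by rewrite ltn_eqF.
Qed.

Lemma fsum_nat0 (F : nat -> fock) : (forall p, F p = 0) -> \sum_(i \in [set: nat]) F i = 0.
Proof. by move=> F0; rewrite (@fsum_nat1 _ 0%N) => [|p _]; exact: F0. Qed.

Lemma creators1 c : creators [fset c]%fset = [:: c].
Proof.
by apply: perm_small_eq => //; rewrite /creators perm_sort; apply: uniq_perm => // x; rewrite !inE.
Qed.

Lemma creators2 i j : creators [fset (true, i); (false, j)]%fset = [:: (true, i); (false, j)].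
Proof.
have tr : transitive le_cre.
  move=> [e k] [e' k'] [e'' k'']; rewrite /le_cre /=.
  by case: e; case: e'; case: e'' => //=; apply: leq_trans.
have an : antisymmetric le_cre.
  move=> [e k] [e' k']; rewrite /le_cre /= [e' == e]eq_sym.
  by case: (eqVneq e e') => [->|]; [move/anti_leq => ->|case: e; case: e'].
have tot : total le_cre.
  move=> [e k] [e' k']; rewrite /le_cre /= [e' == e]eq_sym.
  by case: (eqVneq e e') => [_|]; [exact: leq_total|case: e; case: e'].
apply: (sorted_eq tr an); [exact: sort_sorted|by []|].
by rewrite /creators perm_sort; apply: uniq_perm => // x; rewrite !inE.
Qed.

Lemma mode_fockb b n w : mode (fockb b) n w = monomial_mode (creators b) n w.
Proof. exact: fglift_fockb. Qed.

Lemma modeZ (k : C) u n w : mode (k *: u) n w = k *: mode u n w.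
Proof. exact: (fglift_lin _).2. Qed.

Lemma modeD u u' n w : mode (u + u') n w = mode u n w + mode u' n w.
Proof. exact: (fglift_lin _).1. Qed.

Lemma psi0 e m : psi e m (0 : fock) = 0.
Proof. exact: (lin0 (psi_lin _ e m)). Qed.

Lemma mode2E i j n w : monomial_mode [:: (true, i); (false, j)] n w =
  \sum_(p \in [set: nat]) 'C(i + p, p)%:R *:
    (psi true (Negz (i + p)) (monomial_mode [:: (false, j)] (n + p%:Z) w)
     - (-1) ^+ (i.+1 + 1) *:
       monomial_mode [:: (false, j)] (n - i.+1%:Z - p%:Z) (psi true p%:Z w)).
Proof. by []. Qed.

Lemma mode1_0 e n w : monomial_mode [:: (e, 0%N)] n w = psi e n w.
Proof.
rewrite /=; case: n => n.
  rewrite (@fsum_nat1 _ n) => [|p pn].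
    rewrite add0n [(n%:Z + n%:Z == -1)](_ : _ = false) ?psi0; last by apply/negbTE/eqP; lia.
    have -> : (n%:Z - 1%:Z - n%:Z == -1) = true by apply/eqP; lia.
    by rewrite binn -signr_odd /= expr1 scale1r scaleN1r opprK add0r.
  rewrite [(n%:Z + p%:Z == -1)](_ : _ = false) ?psi0; last by apply/negbTE/eqP; lia.
  have -> : (n%:Z - 1%:Z - p%:Z == -1) = false by apply/negbTE/eqP; move/eqP: pn; lia.
  by rewrite scaler0 subr0 scaler0.
rewrite (@fsum_nat1 _ n) => [|p pn].
  have -> : (Negz n + n%:Z == -1) = true by apply/eqP; lia.
  have -> : (Negz n - 1%:Z - n%:Z == -1) = false by apply/negbTE/eqP; lia.
  by rewrite add0n binn scale1r scaler0 subr0.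
rewrite [(Negz n + p%:Z == -1)](_ : _ = false) ?psi0; last first.
  by apply/negbTE/eqP; move/eqP: pn; lia.
have -> : (Negz n - 1%:Z - p%:Z == -1) = false by apply/negbTE/eqP; lia.
by rewrite scaler0 subr0 scaler0.
Qed.

(** The vector psi(-2)1 is L(-1) psi(-1)1, so its field is the z-derivative of the field of
    psi(-1)1. *)
Lemma mode1_1 e n w : monomial_mode [:: (e, 1%N)] n w = (- n)%:~R *: psi e (n - 1) w.
Proof.
rewrite /=; case: n => n.
  case: n => [|n].
    rewrite mulr0z scale0r fsum_nat0// => p.
    rewrite [(0%:Z + p%:Z == -1)](_ : _ = false) ?psi0; last by apply/negbTE/eqP; lia.
    have -> : (0%:Z - 2%:Z - p%:Z == -1) = false by apply/negbTE/eqP; lia.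
    by rewrite scaler0 subr0 scaler0.
  rewrite (@fsum_nat1 _ n) => [|p pn].
    rewrite [(n.+1%:Z + n%:Z == -1)](_ : _ = false) ?psi0; last by apply/negbTE/eqP; lia.
    have -> : (n.+1%:Z - 2%:Z - n%:Z == -1) = true by apply/eqP; lia.
    have -> : n.+1%:Z - 1 = n%:Z by lia.
    rewrite add1n binSn -signr_odd /= expr0 scale1r add0r scalerN -scaleNr mulrNz.
    by rewrite -pmulrn.
  rewrite [(n.+1%:Z + p%:Z == -1)](_ : _ = false) ?psi0; last by apply/negbTE/eqP; lia.
  have -> : (n.+1%:Z - 2%:Z - p%:Z == -1) = false by apply/negbTE/eqP; move/eqP: pn; lia.
  by rewrite scaler0 subr0 scaler0.
rewrite (@fsum_nat1 _ n) => [|p pn].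
  have -> : (Negz n + n%:Z == -1) = true by apply/eqP; lia.
  have -> : (Negz n - 2%:Z - n%:Z == -1) = false by apply/negbTE/eqP; lia.
  have -> : Negz n - 1 = Negz n.+1 by lia.
  have -> : - Negz n = n.+1%:Z by lia.
  by rewrite add1n binSn scaler0 subr0 -pmulrn.
rewrite [(Negz n + p%:Z == -1)](_ : _ = false) ?psi0; last first.
  by apply/negbTE/eqP; move/eqP: pn; lia.
have -> : (Negz n - 2%:Z - p%:Z == -1) = false by apply/negbTE/eqP; lia.
by rewrite scaler0 subr0 scaler0.
Qed.

Definition num c b : C := (c \in b)%:R.

Lemma psi_psi_num e j b :
  psi e (Negz j) (psi (~~ e) (Posz j) (fockb b)) = num (e, j) b *: fockb b.
Proof.
rewrite 2!psiE /pc /ps negbK copl_cop mem_tog eqxx pos_tog /lt_cre eqxx andbF mulr1 togK sgn_sq.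
by rewrite /num; case: (_ \in b); rewrite /= ?scale1r ?scale0r.
Qed.

Definition bnd b : nat := (\max_(c <- b) c.2.+1)%N.

Lemma num_bnd e j b : (bnd b <= j)%N -> num (e, j) b = 0.
Proof.
move=> bj; rewrite /num; case cb: (_ \in b) => //; have : (j < bnd b)%N; last by rewrite ltnNge bj.
by apply: (@leq_bigmax_seq _ _ _ (fun d : creator => d.2.+1) (e, j)).
Qed.

Lemma sum_num (F : creator -> C) b :
  \sum_(j < bnd b) (F (true, j : nat) * num (true, j : nat) b + F (false, j : nat) * num (false, j : nat) b) =
  \sum_(c <- b) F c.
Proof.
rewrite -(big_mkord predT (fun j => F (true, j) * num (true, j) b + F (false, j) * num (false, j) b)).
have us : uniq [seq (e, j) | e <- [:: true; false], j <- iota 0 (bnd b)].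
  by apply: allpairs_uniq; rewrite ?iota_uniq// => -[x1 x2] [y1 y2] _ _ [-> ->].
transitivity (\sum_(c <- [seq (e, j) | e <- [:: true; false], j <- iota 0 (bnd b)]) F c * num c b).
  rewrite big_allpairs_dep /= !big_cons big_nil addr0 big_split /= /index_iota subn0.
  by [].
rewrite (bigID (fun c => c \in b)) /= [X in _ + X]big1 ?addr0 => [|c /negbTE cb]; last first.
  by rewrite /num cb mulr0.
rewrite -big_filter (perm_big b).
  by rewrite big_seq [RHS]big_seq; apply: eq_bigr => c cb; rewrite /num cb mulr1.
apply: uniq_perm; rewrite ?filter_uniq ?fset_uniq// => -[e j].
rewrite mem_filter; case cb: ((e, j) \in b) => [|//]; rewrite andTb.
have jb : j \in iota 0 (bnd b).
  rewrite mem_iota /= add0n.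
  by apply: (@leq_bigmax_seq _ _ _ (fun d : creator => d.2.+1) (e, j)).
rewrite !mem_cat in_nil orbF; apply/orP.
by case: (e); [left|right]; apply/mapP; exists j.
Qed.

Lemma heisE : heis R = fockb [fset (true, 0%N); (false, 0%N)]%fset.
Proof.
rewrite /heis; have -> : psi false (-1) vac = fockb [fset (false, 0%N)]%fset.
  rewrite -[vac]/(fockb fset0) -[-1]/(Negz 0) psi_fockb /cop /pc /ps in_fset0 eqxx.
  rewrite /tog in_fset0 fsetU0 posE big_nil expr0 scale1r.
  by [].
rewrite -[-1]/(Negz 0) psi_fockb /cop /pc /ps !inE /=.
rewrite /tog !inE /= posE big_seq_fset1 /lt_cre /le_cre /= expr0 scale1r.
by [].
Qed.

Lemma omegaE : omega R = 2^-1 *: (fockb [fset (true, 1%N); (false, 0%N)]%fset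
   - fockb [fset (true, 0%N); (false, 1%N)]%fset).
Proof.
have h e : psi e (-1) vac = fockb [fset (e, 0%N)]%fset.
  rewrite -[vac]/(fockb fset0) -[-1]/(Negz 0) psi_fockb /cop /pc /ps in_fset0 eqxx.
  by rewrite /tog in_fset0 fsetU0 posE big_nil expr0 scale1r.
rewrite /omega !h -[-2]/(Negz 1) !psi_fockb /cop /pc /ps !inE /=.
rewrite /tog !inE /= !posE !big_seq_fset1 /lt_cre /le_cre /= expr0 scale1r.
by rewrite expr1 scaleN1r [(_ |` [fset (true, 0%N)])%fset]fsetUC.
Qed.

(** Stated for a vector v, not only for [fockb b], because [opexp_eigen] needs the action on all
    multiples of an eigenvector. *)
Definition isnum b v :=
  forall e j, psi e (Negz j) (psi (~~ e) (Posz j) v) = num (e, j) b *: v.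

Lemma isnumZ (k : C) b : isnum b (k *: fockb b).
Proof. by move=> e j; rewrite !(psi_lin _ _ _).2 psi_psi_num !scalerA mulrC. Qed.

(** With n+ and n- the occupation numbers at index j, the two terms of omega count j n+ + (j + 1) n-
    and (j + 1) n+ + j n-. Half their sum is (j + 1/2) (n+ + n-). *)
Lemma L0_num b v : isnum b v -> L0 v = (\sum_(c <- b) (c.2%:R + 2^-1)) *: v.
Proof.
move=> hv; rewrite /L0 omegaE modeZ modeD -scaleN1r modeZ !mode_fockb !creators2.
have h1 : monomial_mode [:: (true, 1%N); (false, 0%N)] 1 v =
   (\sum_(j < bnd b) (j%:R * num (true, j : nat) b + j.+1%:R * num (false, j : nat) b)) *: v.
  have e1 p : 'C(1 + p, p)%:R *: (psi true (Negz (1 + p))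
      (monomial_mode [:: (false, 0%N)] (1 + p%:Z) v) - (-1) ^+ (2 + 1) *:
      monomial_mode [:: (false, 0%N)] (1 - 2%:Z - p%:Z) (psi true p%:Z v)) =
      (p.+1%:R * (num (true, p.+1) b + num (false, p) b)) *: v.
    rewrite !mode1_0 add1n binSn.
    have -> : 1 - 2%:Z - p%:Z = Negz p by lia.
    have -> : 1 + p%:Z = Posz p.+1 by lia.
    rewrite (hv true) (hv false) -signr_odd /= expr1 scaleN1r opprK -scalerDl scalerA.
    by [].
  rewrite mode2E (@fsum_nat _ (bnd b)) => [|p bp]; last first.
    by rewrite e1 !num_bnd ?addr0 ?mulr0 ?scale0r// (leq_trans bp).
  under eq_bigr do rewrite e1.
  rewrite -scaler_suml; congr (_ *: _).
  rewrite (eq_bigr (fun p : 'I__ => p.+1%:R * num (true, p.+1) b + p.+1%:R * num (false, p : nat) b)); last first.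
    by move=> p _; rewrite mulrDr.
  rewrite !big_split /=; congr (_ + _).
  have -> : \sum_(p < bnd b) p.+1%:R * num (true, p.+1) b = \sum_(p < (bnd b).+1) p%:R * num (true, p : nat) b.
    by rewrite big_ord_recl /= mul0r add0r.
  by rewrite big_ord_recr /= num_bnd// mulr0 addr0.
have h2 : monomial_mode [:: (true, 0%N); (false, 1%N)] 1 v =
   - (\sum_(j < bnd b) (j.+1%:R * num (true, j : nat) b + j%:R * num (false, j : nat) b)) *: v.
  have e1 p : 'C(0 + p, p)%:R *: (psi true (Negz (0 + p))
      (monomial_mode [:: (false, 1%N)] (1 + p%:Z) v) - (-1) ^+ (1 + 1) *:
      monomial_mode [:: (false, 1%N)] (1 - 1%:Z - p%:Z) (psi true p%:Z v)) =
      (- (p.+1%:R * num (true, p) b + p%:R * num (false, p) b)) *: v.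
    rewrite !mode1_1 add0n binn scale1r.
    have -> : 1 - 1%:Z - p%:Z - 1 = Negz p by lia.
    have -> : 1 + p%:Z - 1 = Posz p by lia.
    rewrite (psi_lin _ _ _).2 (hv true) (hv false) -signr_odd /= expr0 scale1r !scalerA -scalerBl.
    congr (_ *: _).
    have -> : - (1 + p%:Z) = - (p.+1)%:Z by lia.
    have -> : - (1 - 1%:Z - p%:Z) = p%:Z by lia.
    by rewrite mulrNz -!pmulrn; ring.
  rewrite mode2E (@fsum_nat _ (bnd b)) => [|p bp]; last first.
    by rewrite e1 !num_bnd// !mulr0 addr0 oppr0 scale0r.
  under eq_bigr do rewrite e1.
  rewrite -scaler_suml sumrN.
  by [].
rewrite h1 h2 scaleN1r scaleNr opprK -scalerDl scalerA -big_split /= mulr_sumr.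
congr (_ *: _); rewrite -sum_num; apply: eq_bigr => j _ /=.
by rewrite -natr1; field.
Qed.

Lemma a0_num b v : isnum b v -> a0 v = chg R b *: v.
Proof.
move=> hv; rewrite /a0 heisE mode_fockb creators2.
have e1 p : 'C(0 + p, p)%:R *: (psi true (Negz (0 + p))
    (monomial_mode [:: (false, 0%N)] (0 + p%:Z) v) - (-1) ^+ (1 + 1) *:
    monomial_mode [:: (false, 0%N)] (0 - 1%:Z - p%:Z) (psi true p%:Z v)) =
    (1 * num (true, p) b + (-1) * num (false, p) b) *: v.
  rewrite !mode1_0 add0n binn scale1r add0r.
  have -> : 0 - 1%:Z - p%:Z = Negz p by lia.
  rewrite (hv true) (hv false) -signr_odd /= expr0 scale1r -scalerBl.
  by rewrite mul1r mulN1r.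
rewrite mode2E (@fsum_nat _ (bnd b)) => [|p bp]; last first.
  by rewrite e1 !num_bnd// !mulr0 addr0 scale0r.
under eq_bigr do rewrite e1.
  rewrite -scaler_suml; congr (_ *: _).
rewrite /chg -sum_num; apply: eq_bigr => j _; rewrite /dgr /=.
by [].
Qed.

Lemma psivE e : psiv R e = fockb [fset (e, 0%N)]%fset.
Proof.
rewrite /psiv -[vac]/(fockb fset0) psi_fockb /cop /pc /ps in_fset0 eqxx.
by rewrite /tog in_fset0 fsetU0 posE big_nil expr0 scale1r.
Qed.

Lemma mode_psiv e m w : mode (psiv R e) m w = psi e m w.
Proof. by rewrite psivE mode_fockb creators1 mode1_0. Qed.

(** Consequently the exponential of the positive modes of h in [Delta] is the identity on the
    inserted vectors. *)
Lemma heis_kill e n (x : C) : (0 < n)%N -> mode (heis R) n%:Z (x *: psiv R e) = 0.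
Proof.
move=> n0; rewrite heisE mode_fockb creators2 psivE mode2E fsum_nat0// => p.
have kill e' k : (0 < k)%N -> psi e' (Posz k) (x *: fockb [fset (e, 0%N)]%fset) = 0.
  move=> k0; rewrite (psi_lin _ _ _).2 psi_fockb /cop /pc /ps inE xpair_eqE eqn0Ngt k0 andbF.
  by rewrite scaler0.
rewrite !mode1_0 -PoszD kill ?psi0 ?addn_gt0 ?n0//.
rewrite sub0r; case: p => [|p]; last first.
  by rewrite kill// psi0 scaler0 oppr0 scaler0.
suff -> : psi false (n%:Z - 1 - 0%:Z) (psi true 0%:Z (x *: fockb [fset (e, 0%N)]%fset)) = 0.
  by rewrite scaler0 oppr0 scaler0.
have -> : n%:Z - 1 - 0%:Z = Posz n.-1 by lia.
rewrite (psi_lin _ _ _).2 (psi_lin _ _ _).2 [psi true _ _]psi_fockb /cop /pc /ps inE; case: eqP => [E|_]; last by rewrite psi0 scaler0.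
rewrite (psi_lin _ _ _).2 psi_fockb /cop /pc /ps mem_tog inE.
have -> : e = false by move/eqP: E; case: (e).
by rewrite xpair_eqE /= !scaler0.
Qed.

End Modes.
(** * The trace function on its domain of convergence *)

Section TraceTerm.
Variable R : realType.
Local Notation C := (Cplx R).
Local Notation fock := (fock R).
Local Notation fockb := (@fockb R).
Local Notation P := (twopii R).
Implicit Types (b : basis) (v w : fock).

Lemma exp_series_cvg (z : C) : (fun n => exp_sum n z) @ \oo --> cexp z.
Proof.
apply/climitP => e e0.
pose M := 2 * (expR (2 * nm z) * nm z) + 1.
have M0 : 0 < M by rewrite ltr_wpDl// !mulr_ge0 ?expR_ge0 ?nm_ge0.
have := cvg_exp_coeff (nm z); rewrite exp_coeffE => /cvgrPdist_lt/(_ _ (divr_gt0 e0 M0))[N _ NP].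
exists N.+1 => -[//|n]; rewrite ltnS => Nn.
have := NP n Nn; rewrite /= sub0r normrN => h.
rewrite (le_lt_trans (exp_sum_bound n z))//.
have x0 : 0 <= n`!%:R^-1 * nm z ^+ n.
  by rewrite mulr_ge0 ?invr_ge0 ?ler0n ?exprn_ge0 ?nm_ge0.
rewrite ger0_norm// in h; move: h; rewrite ltr_pdivlMr//; apply: le_lt_trans.
rewrite [nm z ^+ n / _]mulrC; move: (_^-1 * _) x0 => x x0; rewrite /M.
by move: (expR (2 * nm z)) (nm z) => a c; rewrite mulrDr mulr1; clear -x0; lra.
Qed.

(** Every [opexp] in the trace acts on an eigenvector and so becomes a scalar. The hypothesis speaks
    of all multiples of v since A is not assumed to be linear. *)
Lemma opexp_eigen (A : fock -> fock) v (l : C) :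
  (forall x : C, A (x *: v) = (x * l) *: v) -> opexp A v = cexp l *: v.
Proof.
move=> Av.
have it k : iter k A v = l ^+ k *: v.
  elim: k => [|k IH]; first by rewrite /= expr0 scale1r.
  by rewrite iterS IH Av exprSr.
have cv b : series (fun k => k`!%:R^-1 * coeff b (iter k A v)) @ \oo --> coeff b (cexp l *: v).
  have cc : (fun=> coeff b v) @ \oo --> (coeff b v : C) by exact: cvg_cst.
  rewrite coeffZ; have h := climitM (@exp_series_cvg l) cc; apply: (@climit_eq R _ _ _ _ h) => n.
  rewrite /series /= big_mkord /exp_sum mulr_suml; apply: eq_bigr => k _.
  by rewrite it coeffZ mulrA [_ / _]mulrC.
rewrite /opexp; case: xgetP => [w _ /= wP|/(_ (cexp l *: v))]; last by case.
apply/eqP/freeg_eqP => b; exact: (climit_unique (wP b) (cv b)).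
Qed.

Lemma autom_E x b (k : C) :
  autom x (k *: fockb b) = cexp (P * toC x * chg R b) *: (k *: fockb b).
Proof.
apply: opexp_eigen => y; rewrite scalerA (a0_num (isnumZ _ _)) !scalerA.
by congr (_ *: _); ring.
Qed.

Lemma sum_energy1 e : \sum_(c <- [fset (e, 0%N)]%fset) ((c : creator).2%:R + 2^-1) = 2^-1 :> C.
Proof. by rewrite big_seq_fset1 /= add0r. Qed.

Lemma chg1 e : chg R [fset (e, 0%N)]%fset = sgn R e.
Proof. by rewrite /chg big_seq_fset1. Qed.

Lemma mode_hvec be n v : mode (hvec be) n v = kappa be *: mode (heis R) n v.
Proof. exact: modeZ. Qed.

Lemma Delta_psiv be e (z x : C) :
  Delta (hvec be) z (x *: psiv R e) = cexp (- z * (kappa be * sgn R e)) *: (x *: psiv R e).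
Proof.
rewrite /Delta [X in opexp _ X](_ : _ = x *: psiv R e); last first.
  rewrite (opexp_eigen (l := 0)) ?cexp0 ?scale1r// => y.
  rewrite fsbig1 ?mulr0 ?scale0r// => n n0.
  by rewrite mode_hvec scalerA heis_kill// !scaler0.
apply: opexp_eigen => y.
rewrite scalerA mode_hvec -/(a0 _) psivE (a0_num (isnumZ _ _)) chg1 !scalerA.
by congr (_ *: _); ring.
Qed.

Definition zf1 (bt : C) (a : bool * C) (k : int) : C :=
  cexp (- (k%:~R + sgn R a.1 * bt) * a.2).

(** The exponent of q_i is - m - 1 from the mode, + 1/2 from L(0) and - kappa times the charge from
    [Delta]. The halves cancel, and the total is -(k + beta) with k = m + 1 for psi^+ and -(k -
    beta) with k = m for psi^-. *)
Lemma Ysg_psiv be e (z : C) (m : int) w :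
  Ysg be (psiv R e) z m w = zf1 (toC be) (e, z) (m + (e : nat)%:Z) *:
    op (e, m + (e : nat)%:Z) w.
Proof.
rewrite /Ysg (opexp_eigen (v := psiv R e) (l := z * 2^-1)) => [|x]; last first.
  by rewrite psivE (L0_num (isnumZ _ _)) sum_energy1 !scalerA; congr (_ *: _); ring.
rewrite Delta_psiv !modeZ mode_psiv !scalerA /op /= addrK; congr (_ *: _).
rewrite -cexpMz -2!cexpD /zf1; congr cexp; rewrite /kappa toCD toCV toC_nat !(intrD, intrN).
by case: e; rewrite /sgn /= ?mulr1z ?mulr0z; field.
Qed.

Fixpoint zf (bt : C) (s : seq (bool * C)) (ks : seq int) : C :=
  match s, ks with
  | [::], [::] => 1
  | a :: s', k :: ks' => zf1 bt a k * zf bt s' ks'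
  | _, _ => 0
  end.

Definition ops (s : seq (bool * C)) (ks : seq int) : seq (bool * int) := zip (map fst s) ks.

Definition vins (s : seq (bool * C)) : seq (fock * C) := [seq (psiv R a.1, a.2) | a <- s].

(* From the mode m of psi^+-(z) to the index k of op. *)
Definition shift (s : seq (bool * C)) (ms : seq int) : seq int :=
  [seq p.2 + (nat_of_bool p.1.1)%:Z | p <- zip s ms].

Lemma foldr_Ysg be (s : seq (bool * C)) (ms : seq int) u : size ms = size s ->
  foldr (fun vm w => Ysg be vm.1.1 vm.1.2 vm.2 w) u (zip (vins s) ms) =
  zf (toC be) s (shift s ms) *: appl (ops s (shift s ms)) u.
Proof.
elim: s ms => [|a s IH] [|m ms] //= => [_|[/IH ->]]; first by rewrite scale1r.
by rewrite Ysg_psiv (op_lin _ _).2 scalerA; case: a.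
Qed.

Lemma opexp_Lsg0 be (tau : C) b :
  opexp (fun u => (P * tau) *: (Lsg0 be u - 24^-1 *: u)) (fockb b) =
  cexp (P * tau * (\sum_(c <- b) (c.2%:R + 2^-1) - kappa be * chg R b +
    kappa be ^+ 2 / 2 - 24^-1)) *: fockb b.
Proof.
apply: opexp_eigen => x; have iv := isnumZ x b.
set v := x *: _ in iv *.
rewrite /Lsg0 (L0_num iv) mode_hvec -/(a0 _) (a0_num iv) !scalerA -scalerBl -scalerDl -scalerBl.
by rewrite /v !scalerA; congr (_ *: _); move: (\sum_(_ <- _) _) (chg R b) => *; ring.
Qed.

Definition pref (be : R) (tau : C) : C := cexp (P * tau * (kappa be ^+ 2 / 2 - 24^-1)).

Lemma weightE (al be : R) (tau : C) b :
  (-1) ^+ #|` b| * (cexp (P * toC al * chg R b) * cexp (P * tau *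
    (\sum_(c <- b) (c.2%:R + 2^-1) - kappa be * chg R b + kappa be ^+ 2 / 2 - 24^-1))) =
  pref be tau * \prod_(c <- b) wt predT (P * tau) (toC al * P - toC be * (P * tau)) c.
Proof.
have -> : P * tau * (\sum_(c <- b) (c.2%:R + 2^-1) - kappa be * chg R b +
    kappa be ^+ 2 / 2 - 24^-1) = P * tau * (kappa be ^+ 2 / 2 - 24^-1) +
    (P * tau * \sum_(c <- b) (c.2%:R + 2^-1) - P * tau * kappa be * chg R b).
  by move: (\sum_(_ <- _) _) (chg R b) => *; ring.
rewrite cexpD -/(pref be tau); set e1 := cexp _; set e2 := cexp _.
transitivity (pref be tau * ((-1) ^+ #|` b| * (e1 * e2))).
  by clearbody e1 e2; move: (pref be tau) (_ ^+ _) => *; ring.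
congr (_ * _); rewrite /e1 /e2 -cexpD; transitivity (\prod_(c <- b) (-1 * cexp (P * toC al * dgr R c +
   (P * tau * (c.2%:R + 2^-1) - P * tau * kappa be * dgr R c)))).
  rewrite [RHS]big_split /= prod_cexp; congr (_ * cexp _).
    have pE (r : seq creator) : \prod_(i <- r) -1 = (-1) ^+ size r :> C.
      by elim: r => [|c r IH]; rewrite ?big_nil// big_cons IH exprS.
    exact/esym/pE.
  by rewrite [RHS]big_split /= sumrB /chg !mulr_sumr.
apply: eq_bigr => -[e j] _; rewrite /wt mulN1r; congr (- cexp _).
by rewrite /dgr /ht /kappa toCD toCV toC_nat natrD; case: e => /=; rewrite ?addr0; field.
Qed.

Lemma trace_termE (al be : R) (s : seq (bool * C)) (tau : C)
    (i : (size (vins s)).-tuple int * basis) :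
  @trace_term R (al, be) (vins s) tau i = pref be tau *
  (zf (toC be) s (shift s i.1) *
   (\prod_(c <- i.2) wt predT (P * tau) (toC al * P - toC be * (P * tau)) c *
    coeff i.2 (appl (ops s (shift s i.1)) (fockb i.2)))).
Proof.
case: i => ms b; rewrite /trace_term /= opexp_Lsg0 foldr_Ysg; last first.
  by rewrite size_tuple size_map.
set X := ops s _; set z := zf _ _ _; rewrite (appl_lin R X).2 scalerA.
have [b' [k [E _]]] := sparse_appl R X b; rewrite E scalerA autom_E !coeffZ coeff_fockb.
have [->|_] := eqVneq b' b; last by rewrite !mulr0.
rewrite !mulr1; have := weightE al be tau b.
set e1 := cexp (P * toC al * _); set e2 := cexp (P * tau * (_ + _ - _)).
set W := \prod_(_ <- _) _; set sg := (-1) ^+ _ => H.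
transitivity ((sg * (e1 * e2)) * (z * k)); first by ring.
by rewrite H; ring.
Qed.

Lemma psumE (I : choiceType) (f : I -> C) (A : {fset I}) :
  summability.partial_sum f A = psum f A.
Proof. by rewrite /summability.partial_sum /psum [RHS]big_seq_fsetE. Qed.

Lemma has_sum_cvg (I : choiceType) (f : I -> C) (l : C) :
  has_sum f l <-> summability.partial_sum f @ summability.totally --> l.
Proof.
have FF : Filter (@summability.totally I) := summability.totally_filter.
split=> [fl|/(@cvgrPdist_lt _ _ _ _ FF) fl e e0].
  apply/(@cvgrPdist_lt _ _ _ _ FF) => _ /lt0C[e e0 ->]; have [A AP] := fl e e0.
  by exists A => // B /AP; rewrite /= nm_lt psumE nmBC.
have /fl[A _ AP] : 0 < toC e by rewrite toC_gt0.
by exists A => B /AP /=; rewrite nm_lt psumE nmBC.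
Qed.

Lemma has_sum_lim (I : choiceType) (f : I -> C) (l : C) : has_sum f l ->
  cvg (summability.partial_sum f @ summability.totally) /\
  lim (summability.partial_sum f @ summability.totally) = l.
Proof.
move=> /has_sum_cvg h; split; first by apply/cvg_ex; exists l.
have FF : ProperFilter (@summability.totally I) := summability.totally_filter.
by apply: cvg_lim h.
Qed.

Lemma cvg_has_sum (I : choiceType) (f : I -> C) :
  cvg (summability.partial_sum f @ summability.totally) -> exists l, has_sum f l.
Proof. by move=> /cvg_ex[l h]; exists l; apply/has_sum_cvg. Qed.

End TraceTerm.

(** * Summation over the modes *)

Section WickSum.
Variable R : realType.
Local Notation C := (Cplx R).
Local Notation P := (twopii R).
Local Notation ins := (bool * C)%type.
Local Notation fockb := (@fockb R).
Variable t : C.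
Hypothesis t0 : complex.Re t < 0.
Implicit Types (a : ins) (s : seq ins) (b : basis) (K : seq int).

Lemma bsum_ext (I J : choiceType) (h : J -> I) (g : I -> R) M :
  (forall i, (forall j, i <> h j) -> g i = 0) -> bsum (fun j => g (h j)) M -> bsum g M.
Proof.
move=> g0 [gh gM].
have dec i : {o : option J | match o with Some j => h j = i | None => g i = 0 end}.
  apply: cid; have [[j ji]|ni] := pselect (exists j, h j = i); first by exists (Some j).
  by exists None; apply: g0 => j ij; apply: ni; exists j.
pose f i := sval (dec i).
have fK : ocancel f h by move=> i; rewrite /f; case: (dec i) => -[j|].
have fN i : f i = None -> g i = 0 by rewrite /f; case: (dec i) => -[j|].
have gi i : 0 <= g i.
  by case E: (f i) => [j|]; [have := fK i; rewrite E /= => <-; exact: gh|rewrite fN].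
split=> // s us; apply: le_trans (gM _ (pmap_uniq fK us)).
elim: s {us} => [|i s IH]; first by rewrite !big_nil.
rewrite big_cons /=; case E: (f i) => [j|] /=; last by rewrite fN// add0r.
by rewrite big_cons; have := fK i; rewrite E /= => ->; rewrite lerD2l.
Qed.

Lemma bsum_single (I : choiceType) (g : I -> R) i0 : (forall i, 0 <= g i) ->
  (forall i, i != i0 -> g i = 0) -> bsum g (g i0).
Proof.
move=> gp g0; split=> // s us; have [si|si] := boolP (i0 \in s).
  by rewrite (bigD1_seq i0)//= big1 ?addr0// => i /g0.
by rewrite big_seq big1// => i is_; apply: g0; apply: contraNneq si => <-.
Qed.

Lemma asum_ext (I J : choiceType) (h : J -> I) (g : I -> C) :
  (forall i, (forall j, i <> h j) -> g i = 0) -> asum (fun j => g (h j)) -> asum g.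
Proof.
move=> g0 [M gM]; exists M; apply: (bsum_ext (h := h)) gM => i /g0 ->; exact: nm0.
Qed.

Lemma asum_sum (I : choiceType) (T : eqType) (r : seq T) (f : T -> I -> C) :
  (forall x, x \in r -> asum (f x)) -> asum (fun i => \sum_(x <- r) f x i).
Proof.
elim: r => [|x r IH] fa.
  by exists 0; split=> [i|s _]; [exact: nm_ge0|rewrite big1// => i _; rewrite big_nil nm0].
have [M HM] : asum (f x) by apply: fa; rewrite mem_head.
have [M' HM'] : asum (fun i => \sum_(x <- r) f x i).
  by apply: IH => y yr; apply: fa; rewrite inE yr orbT.
apply: (asum_le (bsumD HM HM')) => i; rewrite big_cons; exact: nmD.
Qed.

Lemma asumZ (I : choiceType) (f : I -> C) k : asum f -> asum (fun i => k * f i).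
Proof.
move=> [M HM]; apply: (asum_le (bsumZ (nm_ge0 k) HM)) => i; rewrite nmM; exact: lexx.
Qed.

Definition En b : nat := (\sum_(c <- b) ht c)%N.

Lemma op_ht (x : bool * int) : (ht (oc x))%:Z = if os x then x.2 else - x.2.
Proof.
case: x => [[] k]; rewrite /oc /os /= /ht /pc /ps; case E: (k - _) => [j|j] /=; lia.
Qed.

Lemma En_tog (x : bool * int) b : (oc x \in b) == os x ->
  (En (tog (oc x) b))%:Z = (En b)%:Z - x.2.
Proof.
move=> /eqP cb; have := op_ht x; rewrite /En /tog cb; case: ifP => ox h.
  by rewrite [in RHS](big_fsetD1 (oc x)) ?cb//= PoszD h; lia.
by rewrite big_fsetU1 ?cb ?ox//=; lia.
Qed.

Variables (al be : R).
Let bt : C := toC be.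
Let v : C := toC al * P - toC be * t.

Let w := wt predT t v.

Lemma nm_zf1 a k :
  nm (zf1 bt a k) = expR (- ((k%:~R + (if a.1 then be else - be)) * complex.Re a.2)).
Proof.
rewrite /zf1 nm_cexp; congr expR.
have -> : k%:~R + sgn R a.1 * bt = toC (k%:~R + (if a.1 then be else - be)).
  by rewrite /bt toCD toC_int /sgn; case: (a.1); rewrite ?toCN ?mul1r ?mulN1r.
by rewrite mulNr ReN ReM Re_toC Im_toC mul0r subr0.
Qed.

Definition reals s : seq R := [seq complex.Re a.2 | a <- s].

(** The sum runs over all mode words leading from b to b'. Since mode k lowers the energy [En] by k,
    the vector before the last mode has energy k + En b' >= 0. Summing over it gives a geometric
    series of ratio e^(-(x - x')) for consecutive real parts x > x'. The number y closes the chain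
    on the right and remains free. *)
Lemma path_bound s y : sorted (fun x x' : R => x' < x) (rcons (reals s) y) ->
  exists2 c : R, 0 <= c & forall b b', bsum (fun K => nm (zf bt s K) *
    nm (coeff b' (appl (ops s K) (fockb b))))
    (c * expR ((En b')%:R * head y (reals s) - (En b)%:R * y)).
Proof.
elim: s => [_|a s IH] /=.
  exists 1 => // b b'; rewrite mul1r.
  have -> : expR ((En b')%:R * y - (En b)%:R * y) = expR (((En b')%:R - (En b)%:R) * y).
    by rewrite mulrBl.
  pose g K := nm (zf bt [::] K) * nm (coeff b' (appl (ops ([::] : seq ins) K) (fockb b))).
  have gs : bsum g (g [::]).
    apply: bsum_single => K; first by rewrite mulr_ge0 ?nm_ge0.
    by case: K => // k K _; rewrite /g /= nm0 mul0r.
  suff gle : g [::] <= expR (((En b')%:R - (En b)%:R) * y).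
    by split=> [K|s us]; [exact: gs.1|exact: le_trans (gs.2 s us) gle].
  rewrite /g /= nm1 mul1r coeff_fockb; case: eqP => [->|_].
    by rewrite subrr mul0r expR0 nm1.
  by rewrite nm0 expR_ge0.
move=> ps; have [c c0 cP] := IH (path_sorted ps).
set x' := head y (reals s) in cP; pose xa := complex.Re a.2.
have xx : x' < xa by rewrite /x'; move: ps; case: (reals s) => [|z r] /= /andP[].
pose rho := expR (- (xa - x')).
have rho1 : 0 <= rho < 1 by rewrite expR_ge0 expR_lt1 oppr_lt0 subr_gt0.
pose si : R := if a.1 then be else - be.
have rho0 : 0 < (1 - rho)^-1 by rewrite invr_gt0 subr_gt0; case/andP: rho1.
exists (c * expR (- (si * xa)) * (2 * (1 - rho)^-1)).
  by rewrite !mulr_ge0 ?expR_ge0// ltW.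
move=> b b'.
(* The only basis vector that mode k of a can send to b'. *)
pose b0 k := tog (oc (a.1, k)) b'.
pose cond k := (oc (a.1, k) \in b0 k) == os (a.1, k).
pose g (x : int * seq int) := nm (zf1 bt a x.1) * (nm (zf bt s x.2) *
  (if cond x.1 then nm (coeff (b0 x.1) (appl (ops s x.2) (fockb b))) else 0)).
apply: (bsum_ext (h := fun x : int * seq int => x.1 :: x.2)) => [[|k K] H|].
- by rewrite /= nm0 mul0r.
- by case: (H (k, K)).
suff : bsum g (c * expR (- (si * xa)) * (2 * (1 - rho)^-1) *
    expR ((En b')%:R * xa - (En b)%:R * y)).
  apply: bsum_le => -[k K]; rewrite mulr_ge0 ?nm_ge0//= /g /= nmM -mulrA.
  rewrite !ler_wpM2l ?nm_ge0// opE -{1}(togK (oc (a.1, k)) b') coeff_copl -/(b0 k) -/(cond k).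
  by case: ifP => _; rewrite ?nm0// nmM nmX nmN nm1 expr1n mul1r.
pose m (k : int) := nm (zf1 bt a k) *
  (if cond k then c * expR ((En (b0 k))%:R * x' - (En b)%:R * y) else 0).
apply: (bsum_pair (m := m)) => [k|].
  rewrite /g /m /=; apply: bsumZ; first exact: nm_ge0.
  case: ifP => _; first exact: cP.
  by split=> [K|r _]; rewrite ?mulr0// big1// => K _; rewrite mulr0.
(* The shifted index k + En b' is the energy of [b0 k], in which the series is geometric. *)
have inj : injective (fun k : int => k + (En b')%:Z) by exact: addIr.
have h := bsumZ (mulr_ge0 (mulr_ge0 c0 (expR_ge0 (- (si * xa))))
  (expR_ge0 ((En b')%:R * xa - (En b)%:R * y))) (bsum_inj inj (bsum_int rho1)).
rewrite [X in bsum m X](_ : _ = c * expR (- (si * xa)) *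
  expR ((En b')%:R * xa - (En b)%:R * y) * (2 / (1 - rho))); last first.
  by move: (expR _) (expR _) (_^-1) => e1 e2 e3; ring.
apply: bsum_le h => k; rewrite /m; case: ifP => [ck|_]; last first.
  rewrite mulr0 lexx /= !mulr_ge0 ?expR_ge0//.
  by case: (k + _) => n; rewrite exprn_ge0 ?expR_ge0.
rewrite !mulr_ge0 ?nm_ge0 ?expR_ge0//=.
have Eb : (En (b0 k))%:Z = k + (En b')%:Z.
  by have := En_tog ck; rewrite /b0 togK /= => ->; lia.
rewrite -Eb nm_zf1 -/si -/xa /rho -expRM_natl.
have kE : k%:~R = (En (b0 k))%:R - (En b')%:R :> R.
  have k_ : k = (En (b0 k))%:Z - (En b')%:Z by rewrite Eb addrK.
  by rewrite [in LHS]k_ intrB -!pmulrn.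
rewrite kE mulrCA -expRD -!mulrA ler_wpM2l// -!expRD ler_expR.
by move: (En (b0 k))%:R (En b')%:R (En b)%:R => n1 n2 n3; lra.
Qed.

Definition dom s := pairwise (fun a a' : ins => 0 < complex.Re (a.2 - a'.2) < - complex.Re t) s.

Lemma wE (x : bool * int) : 1 + om w x = 1 - cexp (- (sgn R x.1 * v) + x.2%:~R * t).
Proof.
congr (_ + _); rewrite /om /w /wt /=; case: x => [e k]; rewrite /oc /os /=.
have nI (n : nat) (z : C) : n%:R * z = n%:~R * z by rewrite -pmulrn.
rewrite /pc /ps; case E: (k - _) => [j|j]; rewrite /dgr /ht /= nI ?invrN -?cexpN;
  congr (- cexp _).
  have -> : k = (j + ~~ ~~ e)%N%:Z by move: E; case: (e) => /=; lia.
  by rewrite /sgn; case: (e); rewrite /= ?mul1r ?mulN1r ?opprK.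
have -> : k = - (j + ~~ e)%N%:Z by move: E; case: (e) => /=; lia.
by rewrite mulrNz mulNr opprD /sgn; case: (e).
Qed.

Lemma zf_size s K : size K != size s -> zf bt s K = 0.
Proof.
elim: s K => [|a s IH] [|k K] //= => h; rewrite IH ?mulr0//.
Qed.

Lemma zf_del s K j d : size K = size s -> (j < size s)%N ->
  zf bt s K = zf1 bt (nth d s j) (nth 0 K j) * zf bt (del j s) (del j K).
Proof.
elim: s K j => [|a s IH] [|k K] //= [|j] [sK] js; first by rewrite /del /= !drop0.
by rewrite (IH K j)// /del /= mulrCA.
Qed.

Lemma ops_del s K j : size K = size s -> del j (ops s K) = ops (del j s) (del j K).
Proof.
rewrite /ops; elim: s K j => [|a s IH] [|k K] //= [|j] [sK]; first by rewrite /del /= !drop0.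
by rewrite /del /= -/(del j _) -/(del j _) -/(del j _) IH.
Qed.

Lemma size_ops s K : size K = size s -> size (ops s K) = size s.
Proof. by move=> h; rewrite size_zip size_map h minnn. Qed.

Lemma nth_ops s K j d : size K = size s -> (j < size s)%N ->
  nth (d.1, 0) (ops s K) j = ((nth d s j).1, nth 0 K j).
Proof.
by move=> h js; rewrite nth_zip ?size_map// (nth_map d).
Qed.

Definition ins_at (j : nat) (x : int) (L : seq int) := take j L ++ x :: drop j L.

Lemma size_ins j x L : size (ins_at j x L) = (size L).+1.
Proof. by rewrite size_cat /= addnS -size_cat cat_take_drop. Qed.

Lemma ins_inj j x L L' : ins_at j x L = ins_at j x L' -> L = L'.
Proof.
move=> E; have sE : size L = size L' by have := congr1 size E; rewrite !size_ins => -[].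
move: E => /eqP; rewrite /ins_at eqseq_cat ?size_take ?sE// => /andP[/eqP E1 /eqP[E2]].
by rewrite -(cat_take_drop j L) E1 E2 cat_take_drop.
Qed.

Lemma del_ins j x L : (j <= size L)%N -> del j (ins_at j x L) = L /\ nth 0 (ins_at j x L) j = x.
Proof.
move=> jL; have st : size (take j L) = j by rewrite size_take_min; apply/minn_idPl.
rewrite /del /ins_at; split; last by rewrite nth_cat st ltnn subnn.
rewrite take_size_cat// drop_cat st ltnNge leqnSn /= subSnn /= drop0.
exact: cat_take_drop.
Qed.

Lemma ins_del j K : (j < size K)%N -> ins_at j (nth 0 K j) (del j K) = K.
Proof.
move=> jK; have st : size (take j K) = j by rewrite size_take jK.
rewrite /ins_at /del take_size_cat// drop_size_cat//.
by rewrite -nth_split.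
Qed.

Hypothesis generic : (forall m : int, al <> m%:~R) \/ (forall m : int, be <> m%:~R).

Definition T X : C := trace w X.

Lemma w_neq0 c : w c != 0.
Proof. by rewrite /w /wt /= oppr_eq0 cexp_neq0. Qed.

Lemma dom_gen s : dom s -> gen t s.
Proof. by apply: sub_pairwise => a a' /(theta_z_neq0 t0). Qed.

Lemma dom_del j s : dom s -> dom (del j s).
Proof.
apply: subseq_pairwise; rewrite /del -{3}(cat_take_drop j s) cat_subseq//.
by rewrite -add1n -drop_drop drop_subseq.
Qed.

(** The ratio of [th t v] to [theta t v]: the trace of the empty word is [th t v], while
    [closed_form] is normalized with theta. *)
Definition c0 : C := cexp (- (t / 12 - v / 2)).

(** The contribution of contracting a in mode k with a' in mode - k. *)
Definition kap a a' (k : int) : C :=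
  zf1 bt a k * zf1 bt a' (- k) / (1 - cexp (- (sgn R a.1 * v) + k%:~R * t)).

Lemma kap_sum a a' : a'.1 != a.1 -> 0 < complex.Re (a.2 - a'.2) < - complex.Re t ->
  has_sum (kap a a') (ker t al be a a') /\ asum (kap a a').
Proof.
move=> aa zz; set z := a.2 - a'.2 in zz.
have ev := generic_theta t0 generic a.1.
have kE k : kap a a' k = cexp (- bt * sgn R a.1 * z) *
    (cexp (- (k%:~R * z)) / (1 - cexp (- (sgn R a.1 * v) + k%:~R * t))).
  rewrite /kap /zf1 mulrA -2!cexpD; congr (cexp _ / _).
  have -> : sgn R a'.1 = - sgn R a.1 by move: aa; rewrite /sgn; case: (a.1); case: (a'.1); rewrite // opprK.
  by rewrite intrN /z; ring.
split.
  apply: eq_has_sum (has_sumZ (cexp (- bt * sgn R a.1 * z)) _) => [k|]; first by rewrite kE.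
  rewrite -(kernel_E t0 zz ev); exact: kernel_has_sum.
have tv := th_neq0 ev.
have [B HB] := asumZ (cexp (- bt * sgn R a.1 * z)) (asumZ (th t (sgn R a.1 * v))^-1
  (Nk_asum t0 zz (sgn R a.1 * v))).
apply: (asum_le HB) => k; rewrite kE; set e := cexp (- bt * _ * _).
suff -> : cexp (- (k%:~R * z)) / (1 - cexp (- (sgn R a.1 * v) + k%:~R * t)) =
  (th t (sgn R a.1 * v))^-1 * (cexp (- (k%:~R * z)) * M t k (sgn R a.1 * v)) by exact: lexx.
have := M_mul t0 k (sgn R a.1 * v); set x := 1 - _ => tE.
have x0 : x != 0 by apply: contraNneq tv => x0; rewrite tE x0 mul0r.
have m0 : M t k (sgn R a.1 * v) != 0 by apply: contraNneq tv => x1; rewrite tE x1 mulr0.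
by rewrite tE; field; rewrite x0 m0.
Qed.

Lemma balanced_del e x s j d : balanced ((e, x) :: s) -> (j < size s)%N ->
  (nth d s j).1 != e -> balanced (del j s).
Proof.
rewrite /balanced /= => /eqP h js hj; have pm := permP (perm_del d js).
move: h; rewrite !pm /=; case: e hj; case: (nth d s j).1 => //= _; lia.
Qed.

Lemma balanced_odd a s : balanced (a :: s) -> odd (size s).
Proof.
rewrite /balanced /= -(count_predC (fun a : ins => a.1) s).
have -> : count (predC (fun a : ins => a.1)) s = count (fun a : ins => ~~ a.1) s.
  by apply: eq_count.
by case: a => -[] x /= /eqP h; rewrite oddD; lia.
Qed.

(** For fixed modes, [trace_wick] contracts the first insertion, in mode k, with one of opposite
    charge, whose mode must be - k. The terms belonging to partner j are thus indexed by k and the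
    other modes, and they factor into [kap] and the terms of the list without these two insertions.
    Induction sums them and [fay] reassembles the result. *)
Lemma wick_sum s : balanced s -> dom s ->
  has_sum (fun K => zf bt s K * T (ops s K)) (c0 * closed_form t al be s) /\
  asum (fun K => zf bt s K * T (ops s K)).
Proof.
have [n] := ubnP (size s); elim: n s => // n IH [|a s] sn bal ds.
  have T0 : T [::] = th t v.
    have [W HW] := bsum_wt1 predT v t0.
    apply: (has_sum_unique (trace_has_sum HW [::])).
    apply: eq_has_sum (pth_has_sum predT v t0) => b.
    by rewrite /= coeff_fockb eqxx mulr1.
  pose f K := zf bt [::] K * T (ops ([::] : seq ins) K).
  have f0 K : K != [::] -> f K = 0 by case: K => // k K _; rewrite /f /= mul0r.
  split; last first.
    exists (nm (f [::])); apply: (bsum_single (i0 := [::])) => K; first exact: nm_ge0.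
    by move=> /f0; rewrite /f => ->; rewrite nm0.
  have -> : c0 * closed_form t al be [::] = f [::].
    rewrite /f /= T0 /closed_form /= /Sg big_nil mulr0 cexp0 expr0 addr0 !mul1r mulr1 /theta mulrA -cexpD.
    by rewrite addNr cexp0 mul1r.
  exact: (has_sum1 (f := f)).
have [W HW] := bsum_wt1 predT v t0.
pose d : ins := (true, 0).
have osz := balanced_odd bal.
have /andP[/allP da ds'] : all (fun a' : ins => 0 < complex.Re (a.2 - a'.2) < - complex.Re t) s && dom s.
  exact: ds.
pose opp j := (nth d s j).1 != a.1.
pose G j (x : int * seq int) : C := if [&& size x.2 == size s, opp j & x.1 + nth 0 x.2 j == 0]
  then (-1) ^+ j * (kap a (nth d s j) x.1 * (zf bt (del j s) (del j x.2) *
    T (ops (del j s) (del j x.2)))) else 0.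
have FG k K : zf bt (a :: s) (k :: K) * T (ops (a :: s) (k :: K)) =
    \sum_(j <- enum 'I_(size s)) G (val j) (k, K).
  rewrite big_enum /=; have [sK|sK] := eqVneq (size K) (size s); last first.
    by rewrite zf_size// mulr0 mul0r big1// => j _; rewrite /G /= (negbTE sK).
  have oX : odd (size (ops s K)) by rewrite size_ops.
  have := trace_wick w_neq0 HW (a.1, k) (d.1, 0) oX; rewrite wE -/(T _) /=.
  set den := 1 - _ => TE.
  have den0 : den != 0.
    have := th_neq0 (generic_theta t0 generic a.1).
    by apply: contraNneq => x0; rewrite (M_mul t0 k) -/den x0 mul0r.
  rewrite -[T _](mulKf den0) TE size_ops// !mulr_sumr; apply: eq_bigr => j _.
  have nO := nth_ops d sK (ltn_ord j); rewrite /= in nO.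
  rewrite /G /= sK eqxx nO /= /opp eq_sym; case: ifP => [/andP[h1 /eqP h2]|_]; last first.
    by rewrite !mulr0.
  rewrite (zf_del d sK (ltn_ord j)) ops_del// /kap -/den.
  have -> : nth 0 K j = - k by apply/eqP; rewrite -addr_eq0 addrC h2.
  by rewrite -/(T _); move: (T _) (zf _ _ _) (zf1 _ _ _) (zf1 _ _ _) (_ ^+ _) => *; field.
have Gsum j : (j < size s)%N ->
    has_sum (G j) (if opp j then (-1) ^+ j * ker t al be a (nth d s j) * (c0 * closed_form t al be (del j s)) else 0)
    /\ asum (G j).
  move=> js; case: ifP => oj; last first.
    have -> : G j = fun=> 0 by apply/funext => x; rewrite /G oj /= andbF.
    split; first exact: has_sum0.
    by exists 0; split=> [i|r _]; rewrite ?nm0// big1// => i _; rewrite nm0.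
  (* The mode of the partner is determined by k, so [G j] is supported on the image of h. *)
  pose h (x : int * seq int) := (x.1, ins_at j (- x.1) x.2).
  have hi : injective h by move=> [k L] [k' L'] [<-] /ins_inj ->.
  have hN i : (forall x, i <> h x) -> G j i = 0.
    case: i => k K H; rewrite /G /=; case: ifP => // /and3P[/eqP sK _ /eqP kK].
    case: (H (k, del j K)); rewrite /h /=; congr (_, _).
    have -> : - k = nth 0 K j by apply/eqP; rewrite eq_sym -addr_eq0 addrC kK.
    by rewrite ins_del// sK.
  have [S1 S2] : has_sum (fun K => zf bt (del j s) K * T (ops (del j s) K)) (c0 * closed_form t al be (del j s))
      /\ asum (fun K => zf bt (del j s) K * T (ops (del j s) K)).
    apply: IH; first by rewrite size_del//; move: sn => /=; lia.
      by apply: (@balanced_del a.1 a.2 s j d) => //; rewrite -surjective_pairing.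
    exact: dom_del.
  have [k1 k2] := kap_sum oj (da _ (mem_nth d js)).
  have Gh x : G j (h x) = (-1) ^+ j * (kap a (nth d s j) x.1 *
      (zf bt (del j s) x.2 * T (ops (del j s) x.2))).
    case: x => k L; rewrite /G /h /= size_ins oj.
    have [sL|sL] := eqVneq (size L).+1 (size s).
      have jL : (j <= size L)%N by rewrite -ltnS sL.
      have [-> ->] := del_ins (- k) jL.
      by rewrite subrr eqxx.
    have z0 : zf bt (del j s) L = 0.
      apply: zf_size; rewrite size_del//.
      by apply: contra sL => /eqP ->; rewrite prednK// (leq_ltn_trans _ js).
    by rewrite /= z0 mul0r !mulr0.
  split.
    apply: (proj2 (@has_sum_inj R _ _ h (G j) _ hi hN)); rewrite -mulrA.
    apply: eq_has_sum (has_sumZ ((-1) ^+ j) (has_sum_prod k1 S1 k2 S2)) => x.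
    by rewrite Gh.
  apply: (asum_ext (h := h)) => //.
  have [M1 H1] := k2; have [M2 H2] := S2.
  apply: (asum_le (bsum_prod H1 H2)) => x; rewrite Gh !nmM nmX nmN nm1 expr1n mul1r.
  exact: lexx.
pose hh (x : int * seq int) := x.1 :: x.2.
have hhi : injective hh by move=> [k K] [k' K'] [<- <-].
have hhN K : (forall x, K <> hh x) -> zf bt (a :: s) K * T (ops (a :: s) K) = 0.
  by case: K => [|k K] H; [rewrite /= mul0r|case: (H (k, K))].
split.
  apply: (proj2 (@has_sum_inj R _ _ hh (fun K => zf bt (a :: s) K * T (ops (a :: s) K)) _ hhi hhN)).
  have -> : c0 * closed_form t al be (a :: s) = \sum_(j <- enum 'I_(size s))
     (if opp j then (-1) ^+ j * ker t al be a (nth d s j) * (c0 * closed_form t al be (del j s)) else 0).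
    have fa := @fay R t t0 al be generic a.1 a.2 s d; rewrite -surjective_pairing in fa.
    rewrite (fa (dom_gen ds) bal) mulr_sumr big_enum /=; apply: eq_bigr => j _.
    rewrite /opp /=; case: eqP => _ /=; first by rewrite mulr0.
    by rewrite mulrCA.
  apply: eq_has_sum (has_sum_sum (fun j _ => (Gsum (val j) (ltn_ord j)).1)) => -[k K].
  by rewrite /hh FG.
apply: (asum_ext (h := hh)) => //.
have [M1 H1] := asum_sum (r := enum 'I_(size s)) (fun j _ => (Gsum (val j) (ltn_ord j)).2).
by apply: (asum_le H1) => -[k K]; rewrite /hh FG.
Qed.

End WickSum.

(** * Absolute convergence and the value of the trace *)

Section TraceValue.
Variable R : realType.
Local Notation C := (Cplx R).
Local Notation P := (twopii R).
Local Notation ins := (bool * C)%type.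
Local Notation fockb := (@fockb R).
Variable t : C.
Hypothesis t0 : complex.Re t < 0.
Implicit Types (a : ins) (s : seq ins) (b : basis) (K : seq int).

(** The number y lies below the last real part by half of the slack in the spread condition, so that
    the spread from the first real part down to y is still less than - Re t. *)
Lemma dom_margin s : dom t s -> exists y : R,
  sorted (fun x x' : R => x' < x) (rcons (reals s) y) /\
  head y (reals s) - y + complex.Re t < 0.
Proof.
case: s => [_|a s ds]; first by exists 0; rewrite /= subrr add0r.
pose l := last (complex.Re a.2) (reals s).
have al_ : complex.Re a.2 - l < - complex.Re t.
  rewrite /l {l}; move: ds => /andP[/allP da _]; case: s da => [|a' s] da.
    by rewrite subrr oppr_gt0.
  rewrite /reals /= (last_map (fun x : ins => complex.Re x.2)).
  by have /andP[_] := da _ (mem_last a' s); rewrite ReD ReN.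
exists (l - (- complex.Re t - (complex.Re a.2 - l)) / 2); split; last first.
  by rewrite /=; move: (complex.Re a.2) l (complex.Re t) al_ => x y z h; lra.
rewrite /= rcons_path; apply/andP; split; last first.
  by rewrite -/l; move: (complex.Re a.2) l (complex.Re t) al_ => x y z h; lra.
rewrite -[path _ _ _]/(sorted (fun x x' : R => x' < x) (reals (a :: s))) /reals sorted_map.
apply: pairwise_sorted; apply: sub_pairwise ds => x x' /andP[h _].
by move: h; rewrite ReD ReN subr_gt0.
Qed.

Definition pair_term (al be : R) s (x : basis * seq int) : C :=
  zf (toC be) s x.2 * (\prod_(c <- x.1) wt predT t (toC al * P - toC be * t) c *
    coeff x.1 (appl (ops s x.2) (fockb x.1))).

Lemma nm_wt_al (al al' be : R) c : nm (wt predT t (toC al * P - toC be * t) c) =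
  nm (wt predT t (toC al' * P - toC be * t) c).
Proof.
rewrite /wt /= !nmN !nm_cexp; congr expR; rewrite !ReD; congr (_ + _).
rewrite !mulrBr !ReD; congr (_ + _).
have h x : complex.Re (dgr R c * (toC x * P)) = 0.
  have -> : dgr R c * (toC x * P) = toC (if c.1 then x else - x) * P.
    by rewrite /dgr; case: (c.1); rewrite ?toCN ?mul1r ?mulN1r ?mulNr.
  by rewrite ReM Re_toC Im_toC mul0r ?mulr0 subr0.
by rewrite !h.
Qed.

Lemma nm_pair_term (al al' be : R) s x :
  nm (pair_term al be s x) = nm (pair_term al' be s x).
Proof.
rewrite /pair_term !nmM !nm_prod; congr (_ * (_ * _)); apply: eq_bigr => c _.
exact: nm_wt_al.
Qed.

(** On the diagonal [path_bound] costs e^(En b (hd - y)). This turns the weights of period t into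
    those of period t + (hd - y), whose real part is still negative. *)
Lemma pair_asum (al be : R) s : dom t s -> asum (pair_term al be s).
Proof.
move=> /dom_margin[y [ys yt]]; have [c c0 cP] := path_bound t0 be ys.
set hd := head y (reals s) in yt cP.
pose de := hd - y; pose v := toC al * P - toC be * t.
have t1 : complex.Re (t + toC de) < 0 by rewrite ReD Re_toC addrC.
have [W HW] := bsum_wt1 predT v t1.
pose m b := nm (\prod_(d <- b) wt predT t v d) * (c * expR ((En b)%:R * hd - (En b)%:R * y)).
suff [M mM] : exists M, bsum m M.
  exists M; apply: (bsum_pair (m := m)) mM => b; rewrite /m.
  apply: bsum_le (bsumZ (nm_ge0 _) (cP b b)) => K; rewrite nm_ge0 /pair_term /= !nmM mulrCA.
  exact: lexx.
exists (c * expR W); apply: bsum_le (bsumZ c0 (bsum_subsets HW)) => b.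
rewrite mulr_ge0 ?nm_ge0 ?mulr_ge0 ?expR_ge0//= /m mulrCA ler_wpM2l//.
rewrite -mulrBr -/de nm_prod.
have -> : expR ((En b)%:R * de) = \prod_(d <- b) expR ((ht d)%:R * de).
  by rewrite -expR_sum -mulr_suml /En natr_sum.
rewrite -big_split /= le_eqVlt; apply/orP; left; apply/eqP; apply: eq_bigr => d _.
rewrite /wt /= !nmN !nm_cexp -expRD; congr expR.
clearbody v; rewrite 2!ReD -addrA; congr (_ + _).
by rewrite (Re_natM _ t) (Re_natM _ (t + toC de)) ReD Re_toC; clearbody de; rewrite mulrDr.
Qed.

Definition FVval (al be : R) s : C :=
  cexp (- (t / 12 - (toC al * P - toC be * t) / 2)) * closed_form t al be s.

Lemma pair_has_sum_generic (al be : R) s :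
  (forall m : int, al <> m%:~R) \/ (forall m : int, be <> m%:~R) ->
  balanced s -> dom t s -> has_sum (pair_term al be s) (FVval al be s).
Proof.
move=> gn bal ds.
have [S1 _] := wick_sum t0 gn bal ds.
have [M HM] := pair_asum al be ds.
pose sw (x : seq int * basis) := (x.2, x.1).
have swi : injective sw by move=> [K b] [K' b'] [-> ->].
have swN i : (forall x, i <> sw x) -> pair_term al be s i = 0.
  by case: i => b K /(_ (K, b)).
have A2 : asum (fun x => pair_term al be s (sw x)) by exists M; exact: bsum_inj swi HM.
have [W HW] := bsum_wt1 predT (toC al * P - toC be * t) t0.
have S2 := asum_has_sum A2.
have S3 : has_sum (fun K => zf (toC be) s K * T t al be (ops s K)) (tsum (fun x => pair_term al be s (sw x))).
  apply: (has_sum_pair S2) => K; rewrite /pair_term /sw /=; apply: has_sumZ.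
  exact: (trace_has_sum HW).
apply: (proj2 (@has_sum_inj R _ _ sw (pair_term al be s) _ swi swN)).
by rewrite /FVval (has_sum_unique S1 S3).
Qed.

Lemma entire_FVval (be : R) s : exists2 G : C -> C, entire G &
  forall al, FVval al be s = G (toC al * P - toC be * t).
Proof.
exists (fun v => cexp (- (t / 12 - v / 2)) * (cexp (- toC be * Sg s) * K t ^+ (size s)./2 *
  theta t (v + Sg s) * pair_prod t s)) => // v.
apply: cdfM.
  apply: cdf_cexp; have -> : (fun x : C => - (t / 12 - x / 2)) = fun x => - (t / 12) + x * 2^-1.
    by apply/funext => x; rewrite opprB addrC.
  by apply: cdfD; [exact: cdf_cst|apply: cdfM; [exact: cdf_id|exact: cdf_cst]].
apply: cdfM; last exact: cdf_cst.
apply: cdfM; first exact: cdf_cst.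
apply: (@cdf_comp R (fun x => x + Sg s)); last exact: entire_theta.
by apply: cdfD; [exact: cdf_id|exact: cdf_cst].
Qed.

Lemma half_not_int (m k : int) (r : R) : 0 < r < 1 -> m%:~R + r <> k%:~R :> R.
Proof.
move=> /andP[r0 r1] E; have E' : r = (k - m)%:~R by rewrite intrB -E addrC addKr.
have h0 : 0 < k - m by rewrite -(ltr0z R) -E'.
have h1 : k - m < 1 by rewrite -(ltrz1 R) -E'.
lia.
Qed.

(* The remaining case, al an integer, is the limit of the generic one
   as al varies: the terms have moduli independent of al. *)
Lemma pair_has_sum (al be : R) s : balanced s -> dom t s ->
  has_sum (pair_term al be s) (FVval al be s).
Proof.
move=> bal ds.
have [[m alm]|gn] := pselect (exists m : int, al = m%:~R); last first.
  apply: pair_has_sum_generic => //; left => m am; apply: gn; by exists m.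
have asm x : has_sum (pair_term x be s) (tsum (pair_term x be s)).
  exact/asum_has_sum/pair_asum.
suff -> : FVval al be s = tsum (pair_term al be s) by exact: asm.
have [M HM] := pair_asum al be ds.
have [G Gd GE] := entire_FVval be s.
have step x : toC (al + x) * P - toC be * t = toC al * P - toC be * t + toC x * P.
  by rewrite toCD; ring.
have nP : 0 < nm P + 1 by rewrite ltr_wpDl// nm_ge0.
have small x (r : R) : 0 <= x -> x < r / (nm P + 1) -> nm (toC x * P) < r.
  move=> x0; rewrite ltr_pdivlMr// nmM nm_toC ger0_norm//; apply: le_lt_trans.
  by rewrite ler_wpM2l// lerDl.
apply/eqP; rewrite -subr_eq0 -nm_eq0 eq_le nm_ge0 andbT; apply/ler_addgt0Pl => e e0; rewrite addr0.
have e2 : 0 < e / 2 by rewrite divr_gt0.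
have [r1 r10 r1P] := cdf_ccont_at (Gd (toC al * P - toC be * t)) e2.
(* The integer al is approached from above by al + x with 0 < x < 1, which is not an integer. *)
pose near (r : R) (x : R) := 0 <= x - al < r.
have [] := @has_sum_dominated R _ _ (fun x => pair_term x be s) (fun x => tsum (pair_term x be s))
  al near (fun i => nm (pair_term al be s i)) M HM _ asm _ _ (e / 2) e2.
- by move=> x i; rewrite (nm_pair_term x al).
- by move=> r r' x rr /andP[h1 h2]; rewrite /near h1 (lt_le_trans h2).
- move=> [b K] e' e'0.
  pose A := zf (toC be) s K * (\prod_(c <- b) wt predT t 0 c * coeff b (appl (ops s K) (fockb b))).
  pose H v := A * cexp (chg R b * v).
  have HE x : pair_term x be s (b, K) = H (toC x * P - toC be * t).
    by rewrite /pair_term /H /A /= prod_wt; move: (cexp _) (coeff _ _) => *; ring.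
  have Hd : entire H.
    move=> v; apply: cdfM; first exact: cdf_cst.
    by apply: cdf_cexp; apply: cdfM; [exact: cdf_cst|exact: cdf_id].
  have [r r0 rP] := cdf_ccont_at (Hd (toC al * P - toC be * t)) e'0.
  exists (r / (nm P + 1)); first by rewrite divr_gt0.
  move=> x /andP[h1 h2]; rewrite !HE.
  have := step (x - al); rewrite [al + _]addrC subrK => ->.
  by apply: rP; apply: small.
move=> r2 r20 r2P.
pose x := Num.min (Num.min (r1 / (nm P + 1)) r2) 1 / 2.
have m0 : 0 < Num.min (Num.min (r1 / (nm P + 1)) r2) 1 by rewrite !lt_min r20 ltr01 divr_gt0.
have x0 : 0 < x by rewrite divr_gt0.
have : x < Num.min (Num.min (r1 / (nm P + 1)) r2) 1 by rewrite ltr_pdivrMr// ltr_pMr// ltr1n.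
rewrite !lt_min => /andP[/andP[x1 x2] x3].
have gx : FVval (al + x) be s = tsum (pair_term (al + x) be s).
  apply: (has_sum_unique _ (asm _)); apply: pair_has_sum_generic => //; left => k.
  by rewrite alm; apply: half_not_int; rewrite x0.
have h1 : nm (FVval (al + x) be s - FVval al be s) < e / 2.
  by rewrite !GE step; apply: r1P; apply: small => //; exact: ltW.
have h2 : nm (tsum (pair_term (al + x) be s) - tsum (pair_term al be s)) < e / 2.
  by apply: r2P; rewrite /near addrC addKr (ltW x0).
have := nmD (FVval al be s - FVval (al + x) be s)
  (tsum (pair_term (al + x) be s) - tsum (pair_term al be s)).
rewrite gx in h1 *; rewrite addrA subrK.
move: (FVval al be s) (tsum (pair_term (al + x) be s)) (tsum _) h1 h2 => A B D h1 h2.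
rewrite (nmBC A D) => h3; apply: (le_trans h3).
by rewrite [leRHS]splitr; apply: lerD; exact: ltW.
Qed.

End TraceValue.

Section TraceTermSum.
Variable R : realType.
Local Notation C := (Cplx R).
Local Notation P := (twopii R).
Local Notation ins := (bool * C)%type.
Implicit Types (s : seq ins) (tau : C).

Lemma Re_twopiiM tau : complex.Re (P * tau) = - (2 * pi * complex.Im tau).
Proof. by rewrite ReM ?Re_twopii /= mul0r sub0r. Qed.

Lemma trace_term_pair (al be : R) tau s (x : (size (vins s)).-tuple int * basis) :
  @trace_term R (al, be) (vins s) tau x =
  pref be tau * pair_term (P * tau) al be s (x.2, shift s x.1).
Proof. exact: trace_termE. Qed.

Lemma shift_inj s (m m' : seq int) : size m = size s -> size m' = size s ->
  shift s m = shift s m' -> m = m'.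
Proof.
elim: s m m' => [|a s IH] [|k m] [|k' m'] //= [sm] [sm'] [/addIr -> /IH E].
by rewrite E.
Qed.

Lemma shift_surj s (K : seq int) : size K = size s ->
  exists2 m, size m = size s & shift s m = K.
Proof.
elim: s K => [|a s IH] [|k K] //= => [_|[/IH[m sm mK]]]; first by exists [::].
by exists (k - (nat_of_bool a.1)%:Z :: m); rewrite /= ?sm// /shift /= subrK -/(shift s m) mK.
Qed.

Definition tidx s (x : (size (vins s)).-tuple int * basis) : basis * seq int :=
  (x.2, shift s x.1).

Lemma tidx_inj s : injective (@tidx s).
Proof.
move=> [m b] [m' b'] [<-] E; congr (_, _); apply: val_inj => /=.
by apply: shift_inj E; rewrite size_tuple size_map.
Qed.

Lemma tidx_out (t : C) (al be : R) s i : (forall x, i <> @tidx s x) -> pair_term t al be s i = 0.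
Proof.
case: i => b K H; rewrite /pair_term /=.
have [sK|sK] := eqVneq (size K) (size s); last by rewrite zf_size// mul0r.
have [m sm mK] := shift_surj sK.
have sm' : size m == size (vins s) by rewrite size_map sm.
by case: (H (Tuple sm', b)); rewrite /tidx /= mK.
Qed.

Lemma trace_term_has_sum (al be : R) tau s (l : C) :
  has_sum (pair_term (P * tau) al be s) l ->
  has_sum (@trace_term R (al, be) (vins s) tau) (pref be tau * l).
Proof.
move=> h; have {}h := proj1 (@has_sum_inj R _ _ (@tidx s) _ _ (@tidx_inj s)
  (@tidx_out (P * tau) al be s)) h.
apply: eq_has_sum (has_sumZ (pref be tau) h) => x.
by rewrite trace_term_pair.
Qed.

Lemma FV_value (al be : R) tau s : 0 < complex.Im tau -> balanced s -> dom (P * tau) s ->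
  FV_cvg (al, be) (vins s) tau /\
  FV (al, be) (vins s) tau = pref be tau * FVval (P * tau) al be s.
Proof.
move=> tau0 bal ds; apply: has_sum_lim; apply: trace_term_has_sum.
apply: pair_has_sum => //.
by rewrite Re_twopiiM oppr_lt0 !mulr_gt0// pi_gt0.
Qed.

End TraceTermSum.
(** * Divergence outside the domain *)

Section Divergence.
Variable R : realType.
Local Notation C := (Cplx R).
Local Notation P := (twopii R).
Local Notation ins := (bool * C)%type.
Local Notation fockb := (@fockb R).
Implicit Types (p : C * C) (ps : seq (C * C)) (s : seq ins) (tau : C) (K : seq int).

(** Outside a suitable finite set each term is the difference of two partial sums within c / 2 of l,
    and an injective sequence leaves every finite set. *)
Lemma has_sum_small (I : choiceType) (f : I -> C) (l : C) (h : nat -> I) (n0 : nat) (c : R) :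
  injective h -> has_sum f l -> 0 < c -> (forall n, (n0 <= n)%N -> c <= nm (f (h n))) -> False.
Proof.
move=> hi fl cp lb; have [A AP] := fl (c / 2) (divr_gt0 cp (ltr0Sn _ 1)).
have [n nn hA] : exists2 n, (n0 <= n)%N & h n \notin A.
  apply: contrapT => H.
  have sub : {subset [seq h n | n <- iota n0 (size A).+1] <= A}.
    move=> i /mapP[n]; rewrite mem_iota => /andP[n1 _] ->.
    by apply: contrapT => /negP hn; apply: H; exists n.
  have := uniq_leq_size _ sub; rewrite map_inj_uniq ?iota_uniq// size_map size_iota ltnn.
  by move=> /(_ isT).
have h1 := AP A (fsubset_refl _); have h2 := AP (h n |` A)%fset (fsubsetU1 _ _).
have := lb n nn; apply/negP; rewrite -ltNge.
have -> : f (h n) = (psum f (h n |` A)%fset - l) + (l - psum f A).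
  by rewrite /psum big_fsetU1//= addrA subrK addrK.
by rewrite (le_lt_trans (nmD _ _))// (nmBC l) [ltRHS]splitr ltrD.
Qed.

Definition flat ps : seq ins := flatten [seq [:: (true, p.1); (false, p.2)] | p <- ps].

(** Modes that return the vacuum: in each pair psi^-(-1) creates a particle and psi^+(0) removes
    it. *)
Definition kp ps : seq int := flatten [seq [:: 1; -1] | _ <- ps].

Definition vac0 := fockb fset0.

Lemma op_vac (e : bool) (k : int) : ((nat_of_bool e)%:Z <= k) -> op (e, k) vac0 = 0.
Proof.
move=> ek; rewrite opE /copl fglift_fockb /cop in_fset0.
by have -> : os (e, k) = true by rewrite /os /=; case E: (k - _) => [j|j] //=; lia.
Qed.

Lemma op_pair e (k : int) (u : fock R) : op (e, k) (op (~~ e, - k) u) = u - op (~~ e, - k) (op (e, k) u).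
Proof. by rewrite op_anticomm /= subrr eqxx andbT; case: e. Qed.

Lemma op_pair_vac (e : bool) (k : int) : ((nat_of_bool e)%:Z <= k) -> op (e, k) (op (~~ e, - k) vac0) = vac0.
Proof. by move=> ek; rewrite op_pair op_vac// (lin0 (op_lin _ _)) subr0. Qed.

Lemma zf_cat bt s s' K K' : size K = size s -> zf bt (s ++ s') (K ++ K') = zf bt s K * zf bt s' K' :> C.
Proof.
by elim: s K => [|a s IH] [|k K] //= => [_|[/IH ->]]; rewrite ?mul1r ?mulrA.
Qed.

Lemma zf_pair (bt x y : C) (k l : int) :
  zf bt [:: (true, x); (false, y)] [:: k; l] = zf1 bt (true, x) k * zf1 bt (false, y) l.
Proof. by rewrite /= mulr1. Qed.

Lemma appl_cat s s' K K' (v : fock R) : size K = size s ->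
  appl (ops (s ++ s') (K ++ K')) v = appl (ops s K) (appl (ops s' K') v).
Proof.
by move=> h; rewrite /ops map_cat zip_cat ?size_map// /appl foldr_cat.
Qed.

Lemma size_kp ps : size (kp ps) = size (flat ps).
Proof. by elim: ps => //= p ps ->. Qed.

Lemma appl_kp ps : appl (ops (flat ps) (kp ps)) vac0 = vac0.
Proof.
elim: ps => //= p ps IH; rewrite -/(kp ps) -/(flat ps) -/(ops (flat ps) (kp ps)) -/(appl _ _) IH.
exact: (op_pair_vac (e := true)).
Qed.

Lemma zf_kp_neq0 bt ps : zf bt (flat ps) (kp ps) != 0 :> C.
Proof.
elim: ps => [|p ps IH] /=; first exact: oner_neq0.
by apply: mulf_neq0; [exact: cexp_neq0|apply: mulf_neq0 => //; exact: cexp_neq0].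
Qed.

(** The flat list without its first and last entries. Grouped as psi^- before psi^+, these pairs fix
    the vacuum when all modes have index 0. *)
Fixpoint mid p ps : seq ins :=
  if ps is p' :: ps' then [:: (false, p.2), (true, p'.1) & mid p' ps'] else [::].

Lemma flat_mid p ps : flat (p :: ps) = (true, p.1) :: mid p ps ++ [:: (false, (last p ps).2)].
Proof.
elim: ps p => [|p' ps IH] p //.
by rewrite -[flat (p :: p' :: ps)]/((true, p.1) :: (false, p.2) :: flat (p' :: ps)) IH.
Qed.

Lemma appl_mid p ps : appl (ops (mid p ps) (nseq (size (mid p ps)) 0)) vac0 = vac0.
Proof.
elim: ps p => //= p' ps IH p; rewrite -/(ops _ _) -/(appl _ _) IH.
have := @op_pair_vac false 0 isT; rewrite oppr0; exact.
Qed.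

Lemma zf_mid_neq0 bt p ps : zf bt (mid p ps) (nseq (size (mid p ps)) 0) != 0 :> C.
Proof. elim: ps p => [|p' ps IH] p /=; first exact: oner_neq0.
by apply: mulf_neq0; [exact: cexp_neq0|apply: mulf_neq0 => //; exact: cexp_neq0]. Qed.

Lemma balanced_flat ps : balanced (flat ps).
Proof.
by elim: ps => //= p ps; rewrite /balanced /= !add1n !add0n => /eqP ->.
Qed.

Variables (al be : R) (tau : C) (ps : seq (C * C)).
Hypothesis cv : FV_cvg (al, be) (vins (flat ps)) tau.
Let t := P * tau.

Lemma pair_sum_ex : exists l, has_sum (fun i => pref be tau * pair_term t al be (flat ps) i) l.
Proof.
have [l fl] := cvg_has_sum cv; exists l.
apply: (proj2 (@has_sum_inj R _ _ (@tidx R (flat ps)) _ _ (@tidx_inj R (flat ps)) _)).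
  by move=> i /(@tidx_out R t al be) ->; rewrite mulr0.
by apply: eq_has_sum fl => x; rewrite trace_term_pair.
Qed.

Lemma no_family (h : nat -> basis * seq int) (n0 : nat) (c : R) : injective h -> 0 < c ->
  (forall n, (n0 <= n)%N -> c <= nm (pair_term t al be (flat ps) (h n))) -> False.
Proof.
move=> hi cp lb; have [l fl] := pair_sum_ex.
have p0 : 0 < nm (pref be tau) by rewrite nm_gt0 cexp_neq0.
apply: (@has_sum_small _ _ _ h n0 _ hi fl (mulr_gt0 p0 cp)) => n nn.
by rewrite nmM ler_wpM2l ?nm_ge0// (lb n).
Qed.

Lemma pair_term_vac K : size K = size (flat ps) -> appl (ops (flat ps) K) vac0 = vac0 ->
  nm (pair_term t al be (flat ps) (fset0, K)) = nm (zf (toC be) (flat ps) K).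
Proof.
by move=> sK aK; rewrite /pair_term /= aK coeff_fockb eqxx mulr1 big_nil mulr1.
Qed.

Lemma flat_cat r r' : flat (r ++ r') = flat r ++ flat r'.
Proof. by rewrite /flat map_cat flatten_cat. Qed.

Lemma large_nat (x : R) : exists n0 : nat, forall n, (n0 <= n)%N -> x <= n%:R.
Proof.
exists (Num.truncn `|x|).+1 => n nn; rewrite (le_trans (ler_norm x))// ltW//.
by rewrite (lt_le_trans (truncnS_gt _))// ler_nat.
Qed.

(* In this lemma and the next two, a sequence of modes that returns the vacuum, or
   a one-particle state, to itself with coefficient of modulus one gives infinitely
   many terms bounded below unless the inequality holds. *)
Lemma cvg_decreasing_in_pair r p r' : ps = r ++ p :: r' -> complex.Re p.2 < complex.Re p.1.
Proof.
move=> psE; rewrite ltNge; apply/negP => le12.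
(* The pair p creates and removes a particle of energy n + 1. Up to a constant the term has modulus
   e^((n + 1 + beta) (Re p.2 - Re p.1)), at least 1 once n >= - beta. *)
pose Kn (n : nat) : seq int := kp r ++ [:: n.+1%:Z; - n.+1%:Z] ++ kp r'.
have flE : flat ps = flat r ++ [:: (true, p.1); (false, p.2)] ++ flat r' by rewrite psE flat_cat.
have sK n : size (Kn n) = size (flat ps) by rewrite flE !size_cat !size_kp.
have [n0 n0P] := large_nat (- be).
apply: (@no_family (fun n => (fset0, Kn n)) n0 (nm (zf (toC be) (flat r) (kp r)) *
  nm (zf (toC be) (flat r') (kp r')))).
- by move=> n n' [] /eqP; rewrite eqseq_cat// => /andP[_ /eqP[]].
- by rewrite mulr_gt0// nm_gt0 zf_kp_neq0.
move=> n nn; rewrite pair_term_vac//; last first.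
  rewrite flE !appl_cat ?size_kp// appl_kp /= -/(appl _ _).
  by rewrite (@op_pair_vac true)// appl_kp.
rewrite flE zf_cat ?size_kp// zf_cat// 2!nmM ler_wpM2l ?nm_ge0// ler_peMl ?nm_ge0//.
rewrite zf_pair nmM !nm_zf1 -expRD -[leLHS]expR0 ler_expR /=.
have := n0P n nn; rewrite intrN -pmulrn -natr1; move: (n%:R) => m.
by move: (complex.Re p.1) (complex.Re p.2) le12 => x y; nra.
Qed.

Lemma cvg_decreasing_between_pairs r p p' r' : ps = r ++ [:: p, p' & r'] -> complex.Re p'.1 < complex.Re p.2.
Proof.
move=> psE; rewrite ltNge; apply/negP => le12.
(* Between the creation at p'.2 and the removal at p.1, a particle of energy n goes from p'.1 to
   p.2. This contributes the factor e^((n - beta) (Re p'.1 - Re p.2)). *)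
pose Kn (n : nat) : seq int := kp r ++ [:: 1; n%:Z; - n%:Z; -1] ++ kp r'.
have flE : flat ps = flat r ++ [:: (true, p.1); (false, p.2); (true, p'.1); (false, p'.2)] ++ flat r'.
  by rewrite psE flat_cat.
have sK n : size (Kn n) = size (flat ps) by rewrite flE !size_cat !size_kp.
have [n0 n0P] := large_nat be.
apply: (@no_family (fun n => (fset0, Kn n)) n0 (nm (zf (toC be) (flat r) (kp r)) *
  (nm (zf1 (toC be) (true, p.1) 1) * nm (zf1 (toC be) (false, p'.2) (-1))) *
  nm (zf (toC be) (flat r') (kp r')))).
- by move=> n n' [] /eqP; rewrite eqseq_cat// => /andP[_ /eqP[]].
- by rewrite !mulr_gt0// nm_gt0 ?zf_kp_neq0// cexp_neq0.
move=> n nn; rewrite pair_term_vac//; last first.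
  rewrite flE !appl_cat ?size_kp// appl_kp /=.
  have -> : op (false, n%:Z) (op (true, - n%:Z) (op (false, -1) vac0)) = op (false, -1) vac0.
    have k0 : op (false, n%:Z) (op (false, -1) vac0) = 0.
      by rewrite op_anticomm /= op_vac// (lin0 (op_lin _ _)) subr0.
    have := @op_pair false n%:Z (op (false, -1) vac0); rewrite /= => ->.
    by rewrite k0 (lin0 (op_lin _ _)) subr0.
  by rewrite (@op_pair_vac true 1)// appl_kp.
have zfE : zf (toC be) [:: (true, p.1); (false, p.2); (true, p'.1); (false, p'.2)]
    [:: 1; n%:Z; - n%:Z; -1] = zf1 (toC be) (true, p.1) 1 * zf1 (toC be) (false, p'.2) (-1) *
    (zf1 (toC be) (false, p.2) n%:Z * zf1 (toC be) (true, p'.1) (- n%:Z)).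
  rewrite /= mulr1; move: (zf1 _ _ _) (zf1 _ _ _) (zf1 _ _ _) (zf1 _ _ _) => *; ring.
rewrite flE zf_cat ?size_kp// zf_cat// zfE 2!nmM -mulrA ler_wpM2l ?nm_ge0//.
rewrite ler_wpM2r ?nm_ge0// 3!nmM ler_peMr ?mulr_ge0 ?nm_ge0//.
rewrite !nm_zf1 -expRD -[leLHS]expR0 ler_expR /=.
have := n0P n nn; rewrite intrN -pmulrn; move: (n%:R) => m.
by move: (complex.Re p'.1) (complex.Re p.2) le12 => x y; nra.
Qed.

Lemma cvg_spread p r : ps = p :: r ->
  complex.Re p.1 - complex.Re (last p r).2 < - complex.Re t.
Proof.
move=> psE; rewrite ltNge; apply/negP => le12.
(* A particle of energy n travels around the trace: the last insertion removes it, the first one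
   creates it again. With the weight of [bn n] the dependence on n is e^(n (Re p.1 - Re y + Re
   t)). *)
pose Kn (n : nat) : seq int := - n%:Z :: nseq (size (mid p r)) 0 ++ [:: n%:Z].
pose bn (n : nat) : basis := [fset (true, n)]%fset.
have flE : flat ps = (true, p.1) :: mid p r ++ [:: (false, (last p r).2)] by rewrite psE flat_mid.
pose v := toC al * P - toC be * t.
pose y := (last p r).2.
apply: (@no_family (fun n => (bn n, Kn n)) 0%N
  (nm (zf (toC be) (mid p r) (nseq (size (mid p r)) 0)) * expR (complex.Re v - be * (complex.Re p.1 - complex.Re y)))).
- by move=> n n' [_] /oppr_inj[].
- by rewrite mulr_gt0 ?expR_gt0// nm_gt0 zf_mid_neq0.
have bE n : fockb (bn n) = op (true, - n%:Z) vac0.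
  rewrite opE /copl fglift_fockb /oc /os /=.
  have -> : - n%:Z - 1%:Z = Negz n by lia.
  by rewrite /cop in_fset0 /= posE big_nil expr0 scale1r /tog in_fset0 fsetU0.
move=> n nn.
have -> : pair_term t al be (flat ps) (bn n, Kn n) = zf (toC be) (flat ps) (Kn n) *
  (\prod_(c <- bn n) wt predT t (toC al * P - toC be * t) c *
   coeff (bn n) (appl (ops (flat ps) (Kn n)) (fockb (bn n)))) by [].
rewrite flE /Kn.
have -> : appl (ops ((true, p.1) :: mid p r ++ [:: (false, (last p r).2)])
    (- n%:Z :: nseq (size (mid p r)) 0 ++ [:: n%:Z])) (fockb (bn n)) = fockb (bn n).
  rewrite /= -/(appl _ _) -/(ops _ _) appl_cat ?size_nseq// bE /= (@op_pair_vac false)//.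
  by rewrite appl_mid.
rewrite coeff_fockb eqxx mulr1 big_seq_fset1 /= zf_cat ?size_nseq//= mulr1.
rewrite [X in _ <= nm X](_ : _ = zf (toC be) (mid p r) (nseq (size (mid p r)) 0) *
  (zf1 (toC be) (true, p.1) (- n%:Z) * (zf1 (toC be) (false, (last p r).2) n%:Z *
   wt predT t (toC al * P - toC be * t) (true, n)))); last first.
  by move: (zf _ _ _) (zf1 _ _ _) (zf1 _ _ _) (wt _ _ _ _) => *; ring.
rewrite 3!nmM ler_wpM2l ?nm_ge0//.
rewrite -/v; clearbody v.
rewrite !nm_zf1 /wt /= nmN nm_cexp -!expRD ler_expR /dgr /ht /= mul1r addn0 ReD Re_natM -/y.
have := ler0n R n; rewrite intrN -pmulrn; move: (n%:R) (complex.Re v) => m w.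
by move: le12; rewrite -/y; move: (complex.Re p.1) (complex.Re y) (complex.Re t) => x z u; nra.
Qed.

Lemma cvg_dom : dom t (flat ps).
Proof.
pose gtR := fun x x' : R => x' < x.
have gt_trans : transitive gtR by move=> x y z h1 h2; exact: lt_trans h2 h1.
have srt : sorted gtR (reals (flat ps)).
  have gA r p r' : ps = r ++ p :: r' -> complex.Re p.2 < complex.Re p.1 by exact: cvg_decreasing_in_pair.
  have gB r p p' r' : ps = r ++ [:: p, p' & r'] -> complex.Re p'.1 < complex.Re p.2 by exact: cvg_decreasing_between_pairs.
  have : forall r' r, ps = r ++ r' -> sorted gtR (reals (flat r')).
    elim=> // p [|p' r'] IH r E; rewrite /= /gtR (gA _ _ _ E)//=.
    rewrite (gB _ _ _ _ E) /=; have := IH (rcons r p); rewrite cat_rcons => /(_ E).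
    by [].
  by move=> /(_ ps [::] erefl).
have pw := srt; rewrite sorted_pairwise// in pw.
case E: ps pw => [|p r] // pw.
have bd := cvg_spread E; set y := (last p r).2 in bd.
have rng a : a \in flat (p :: r) -> complex.Re y <= complex.Re a.2 <= complex.Re p.1.
  move: pw; rewrite flat_mid -/y /reals /= map_cat /= => /andP[/allP h1].
  rewrite pairwise_cat => /and3P[/allrelP h2 _ _].
  have yp : complex.Re y < complex.Re p.1 by apply: h1; rewrite mem_cat inE eqxx orbT.
  rewrite inE mem_cat inE => /orP[/eqP ->|/orP[am|/eqP ->]] /=; rewrite ?lexx ?(ltW yp)//.
  have am' : complex.Re a.2 \in [seq complex.Re a0.2 | a0 <- mid p r] by apply: map_f.
  by rewrite !ltW//; [apply: h1; rewrite mem_cat am'|apply: h2; rewrite ?inE].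
have := pw; rewrite /reals pairwise_map /dom.
apply: (sub_in_pairwise (P := mem (flat (p :: r)))) => [a a' ia ia' h|]; last exact/allP.
have /andP[_ h1] := rng _ ia; have /andP[h2 _] := rng _ ia'.
have {}h : complex.Re a'.2 < complex.Re a.2 by exact: h.
rewrite ReD ReN subr_gt0 h /= (le_lt_trans _ bd)// lerB//.
Qed.

End Divergence.
(** * Meromorphic continuation *)

Section MeromorphicUnique.
Variables (R : realType).
Local Notation C := (Cplx R).
Variable E : normedModType C.
Implicit Types (f g G h a b : E -> C) (p q x y z : E).

Lemma line_differentiable f q u (s : C) : differentiable f (q + s *: u) ->
  cdf (fun s : C => f (q + s *: u)) s.
Proof.
move=> fd; apply/differentiableC.
have -> : (fun s : C => f (q + s *: u)) = f \o (fun s : C => q + s *: u) by [].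
by apply: differentiable_comp => //; apply: differentiableD.
Qed.

Lemma ball_near p z (r : R) : `|p - z| < toC r ->
  exists2 r' : R, 0 < r' & forall w, `|z - w| < toC r' -> `|p - w| < toC r.
Proof.
move=> zp; have zr : (fun x => `|p - x|) z \is Num.real by rewrite normr_real.
have : 0 < toC r - `|p - z| by rewrite subr_gt0.
move=> /lt0C[d d0 dE]; exists d => // w wz.
have -> : p - w = (p - z) + (z - w) by rewrite addrA subrK.
by rewrite (le_lt_trans (ler_normD _ _))// -ltrBrDl dE.
Qed.

(** The one-variable identity theorem is applied on the complex line that has q at parameter 0 and z
    at parameter 1. It needs parameters up to 3, which stay in the ball as r/8 + 3 r/4 < r. *)
Lemma ball_identity f p (r : R) q z : 0 < r ->
  (forall z, `|p - z| < toC r -> differentiable f z) ->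
  `|p - q| < toC (r / 8) -> (\forall w \near q, f w = 0) ->
  `|p - z| < toC (r / 8) -> f z = 0.
Proof.
move=> r0 fd qp /nbhsCP[d d0 f0] zp.
pose u := z - q.
have uq : `|u| <= toC (r / 4).
  have -> : u = (p - q) - (p - z) by rewrite /u opprB [RHS]addrC addrA subrK.
  rewrite (le_trans (ler_normB _ _))//.
  have -> : toC (r / 4) = toC (r / 8) + toC (r / 8) :> C by rewrite -toCD; congr toC; field.
  by rewrite lerD// ltW.
suff /(_ 1) : forall s : C, nm (s - 0) < 3 / 2 -> f (q + s *: u) = 0.
  by rewrite scale1r /u addrCA subrr addr0; apply; rewrite subr0 nm1; lra.
have d4 : 0 < d / (r / 4 + 1) by rewrite divr_gt0// ltr_wpDl// divr_ge0// ltW.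
apply: (@identity_theorem R (fun s : C => f (q + s *: u)) 0 (3 / 2) (d / (r / 4 + 1))) => //.
- move=> s; rewrite subr0 => s3; apply: line_differentiable; apply: fd.
  have -> : p - (q + s *: u) = (p - q) - s *: u by rewrite opprD addrA.
  rewrite (le_lt_trans (ler_normB _ _))// normrZ nmE.
  have -> : toC r = toC (r / 8) + toC (7 / 2) * toC (r / 4) :> C.
    by rewrite -toCM -toCD; congr toC; field.
  rewrite ltr_leD// ler_pM ?normr_ge0 ?nm_le//.
    by rewrite -nmE normr_ge0.
  by clear -s3; lra.
- move=> s; rewrite subr0 => sd; apply: f0.
  have -> : q - (q + s *: u) = - (s *: u) by rewrite opprD addrA subrr sub0r.
  rewrite normrN normrZ (@le_lt_trans _ _ (toC (nm s) * toC (r / 4)))//.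
    by rewrite ler_pM ?normr_ge0// nmE.
  rewrite -toCM ltcR.
  move: sd; rewrite ltr_pdivlMr; last by clear -r0; lra.
  by apply: le_lt_trans; rewrite ler_wpM2l ?nm_ge0// lerDl.
Qed.

Lemma differentiable_near f g z : (\forall w \near z, f w = g w) ->
  differentiable g z -> differentiable f z.
Proof.
move=> fg /diff_locallyP[dc /eqaddoP gE].
have fgz : f z = g z := nbhs_singleton fg.
have fg0 : \forall w \near (0 : E), f (w + z) = g (w + z).
  by move: fg; rewrite (near_shift 0) subr0.
have fE : f \o pseudometric_normed_Zmodule.shift z = cst (f z) + 'd g z +o_ 0 id.
  apply/eqaddoP => e e0; move: (gE e e0).
  apply: filter_app; move: fg0; apply: filter_app; near=> w => fgw.
  by rewrite /= !fctE /= fgw fgz.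
have dE := diff_unique dc fE.
apply/diff_locallyP; split; last by rewrite dE.
by rewrite dE.
Unshelve. all: by end_near. Qed.

Lemma hol_near f g p : (\forall w \near p, f w = g w) ->
  holomorphic_at g p -> holomorphic_at f p.
Proof.
move=> fg gp; have fg' := near_join fg; have gp' := gp; rewrite /holomorphic_at in gp'; near=> z.
apply: (@differentiable_near f g); last by near: z.
by near: z.
Unshelve. all: by end_near. Qed.

Lemma hol_diff f p : holomorphic_at f p -> differentiable f p.
Proof. exact: nbhs_singleton. Qed.

Lemma hol_near_hol f p : holomorphic_at f p -> \forall z \near p, holomorphic_at f z.
Proof. exact: near_join. Qed.

Lemma near_neq0 f p : differentiable f p -> f p != 0 -> \forall z \near p, f z != 0.
Proof.
move=> fd f0; have fc := differentiable_continuous fd.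
exact: (@cvgr_neq0 C C E (nbhs p) _ f (f p) fc f0).
Qed.

Lemma hol_quot f a b p : holomorphic_at a p -> holomorphic_at b p -> b p != 0 ->
  (\forall z \near p, b z != 0 -> f z = a z / b z) -> holomorphic_at f p.
Proof.
move=> ha hb b0 fE; have b0' := near_neq0 (hol_diff hb) b0.
apply: (@hol_near f (fun z => a z * (b z)^-1)); first by move: b0' fE; apply: filterS2 => z b0z ->.
near=> z.
have az : differentiable a z by near: z.
have bz : differentiable b z by near: z.
have bz0 : b z != 0 by near: z.
by apply: differentiableM => //; apply: differentiableV.
Unshelve. all: by end_near. Qed.

Lemma hol_entire f p : (forall z, differentiable f z) -> holomorphic_at f p.
Proof. by move=> fd; near=> z; exact: fd. Unshelve. all: by end_near. Qed.

Lemma dense_neq0 b p (P : E -> Prop) : ~ (\forall z \near p, b z = 0) ->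
  (\forall z \near p, P z) -> exists2 z, P z & b z != 0.
Proof.
move=> nb nP; apply: contrapT => nex; apply: nb; move: nP; apply: filterS => z Pz.
by apply/eqP/negPn/negP => bz; apply: nex; exists z.
Qed.

Lemma hol_continuous f p : holomorphic_at f p -> {for p, continuous f}.
Proof. by move=> /hol_diff /differentiable_continuous. Qed.

Lemma near_agree f g p : {for p, continuous f} -> {for p, continuous g} ->
  (forall P : E -> Prop, (\forall z \near p, P z) -> exists2 z, P z & f z = g z) ->
  f p = g p.
Proof.
move=> fc gc H; apply/eqP; rewrite -subr_eq0; apply/negPn/negP => n0.
have [z] := H _ (@cvgr_neq0 C C E (nbhs p) _ (fun z => f z - g z) (f p - g p) (cvgB fc gc) n0).
by move=> /negP n fg; apply: n; rewrite fg subrr.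
Qed.

Lemma dense_neq0_2 a b p (P : E -> Prop) :
  (\forall z \near p, differentiable a z) ->
  ~ (\forall z \near p, a z = 0) -> (\forall z \near p, ~ (\forall w \near z, b w = 0)) ->
  (\forall z \near p, P z) -> exists z, [/\ P z, a z != 0 & b z != 0].
Proof.
move=> ha na nb /near_join nP.
have hh : \forall z \near p, [/\ differentiable a z, ~ (\forall w \near z, b w = 0) & \forall w \near z, P w].
  by near=> z; split; near: z.
have [z [az bz Pz] az0] := dense_neq0 na hh.
have Q : \forall w \near z, P w /\ a w != 0.
  by have := near_neq0 az az0; move: Pz; apply: filterS2.
by have [w [Pw aw0] bw0] := dense_neq0 bz Q; exists w.
Unshelve. all: by end_near. Qed.

(** Only points where both functions are holomorphic are compared, so the conventional value 0 at
    singular points does not interfere with continuation. *)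
Definition agree_gen G G' x :=
  \forall z \near x, holomorphic_at G z -> holomorphic_at G' z -> G z = G' z.

(** Agreement of a / b and a' / b' means that a b' - a' b vanishes, and [ball_identity] spreads this
    over a ball. The radius serves all q and z in the ball, which is what [agree_all] needs in order
    to move in both directions. *)
Lemma agree_local G G' p : meromorphic G -> meromorphic G' ->
  exists2 rho : R, 0 < rho & forall q z, `|p - q| < toC rho -> agree_gen G G' q ->
    `|p - z| < toC rho -> holomorphic_at G z -> holomorphic_at G' z -> G z = G' z.
Proof.
move=> [/(_ p)[a [b [ha hb b0 GE]]] _ _] [/(_ p)[a' [b' [ha' hb' b0' GE']]] _ _].
have : \forall z \near p, [/\ differentiable a z, differentiable b z,
   differentiable a' z, differentiable b' z &
   (b z != 0 -> G z = a z / b z) /\ (b' z != 0 -> G' z = a' z / b' z)].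
  by near=> z; split; [near: z..|split; near: z].
move=> /nbhsCP[r r0 H].
have ninb (f : E -> C) (q : E) : (forall z, `|p - z| < toC r -> differentiable f z) ->
   ~ (\forall z \near p, f z = 0) -> `|p - q| < toC (r / 8) ->
   ~ (\forall z \near q, f z = 0).
  move=> fd nf qp fq; apply: nf; apply/nbhsCP; exists (r / 8); first by rewrite divr_gt0.
  by move=> z zp; apply: (ball_identity r0 fd qp fq zp).
have bd z : `|p - z| < toC r -> differentiable b z by move=> /H[].
have bd' z : `|p - z| < toC r -> differentiable b' z by move=> /H[].
have lt8 z : `|p - z| < toC (r / 8) -> `|p - z| < toC r.
  by move=> /lt_trans; apply; rewrite ltcR; lra.
have near8 z : `|p - z| < toC (r / 8) -> \forall w \near z, `|p - w| < toC (r / 8).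
  by move=> /ball_near[d d0 Hd]; apply/nbhsCP; exists d.
have holG z : `|p - z| < toC (r / 8) -> b z != 0 -> holomorphic_at G z.
  move=> zp bz; apply: (@hol_quot G a b z) => //; move: (near8 _ zp); apply: filterS => w /lt8 /H[] //.
  by move=> _ _ _ _ [].
have holG' z : `|p - z| < toC (r / 8) -> b' z != 0 -> holomorphic_at G' z.
  move=> zp bz; apply: (@hol_quot G' a' b' z) => //; move: (near8 _ zp); apply: filterS => w /lt8 /H[] //.
  by move=> _ _ _ _ [].
(* The second factor makes F vanish also at zeros of b and b', where agreement gives no
   information. *)
pose F z := (a z * b' z - a' z * b z) * (b z * b' z).
have Fd z : `|p - z| < toC r -> differentiable F z.
  by move=> /H[az bz az' bz' _]; apply: differentiableM; [apply: differentiableB; apply: differentiableM|apply: differentiableM].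
exists (r / 8); first by rewrite divr_gt0.
move=> q z qp gq zp Gz Gz'.
have Fq : \forall w \near q, F w = 0.
  move: gq (near8 _ qp); rewrite /agree_gen; apply: filterS2 => w gw wp.
  rewrite /F; have [->|bw] := eqVneq (b w) 0; first by rewrite mul0r mulr0.
  have [->|bw'] := eqVneq (b' w) 0; first by rewrite !mulr0.
  have [_ _ _ _ [/(_ bw) e1 /(_ bw') e2]] := H _ (lt8 _ wp).
  have := gw (holG _ wp bw) (holG' _ wp bw').
  by rewrite e1 e2 => /eqP; rewrite eqr_div// => /eqP ->; rewrite subrr mul0r.
apply: near_agree; [exact: hol_continuous|exact: hol_continuous|].
move=> Q nQ.
have nQ' : \forall w \near z, Q w /\ `|p - w| < toC (r / 8).
  by move: nQ (near8 _ zp); apply: filterS2.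
have [||| w [[Qw wp] bw bw']] := @dense_neq0_2 b b' z _ _ _ _ nQ'.
- by move: (near8 _ zp); apply: filterS => w /lt8 /bd.
- exact: (ninb _ _ bd).
- by move: (near8 _ zp); apply: filterS => w wp; apply: (ninb _ _ bd').
exists w => //.
have [_ _ _ _ [/(_ bw) e1 /(_ bw') e2]] := H _ (lt8 _ wp).
have := ball_identity r0 Fd qp Fq wp; rewrite /F => /eqP.
rewrite mulf_eq0 [X in _ || X]mulf_eq0 (negPf bw) (negPf bw') !orbF subr_eq0 => /eqP e.
by rewrite e1 e2; apply/eqP; rewrite eqr_div// e.
Unshelve. all: by end_near. Qed.

(** On the segment from p0 to x the set of parameters with agreement is open and closed, and the
    line is connected. *)
Lemma agree_all G G' p0 x : meromorphic G -> meromorphic G' ->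
  agree_gen G G' p0 -> agree_gen G G' x.
Proof.
move=> mG mG' g0.
pose c (s : R) := p0 + toC s *: (x - p0).
pose S := [set s : R | agree_gen G G' (c s)].
have step s : exists2 d : R, 0 < d & forall s', `|s - s'| < d -> (S s <-> S s').
  have [rho rho0 H] := agree_local (c s) mG mG'.
  have [m m0 mE] : exists2 m : R, 0 < m & `|x - p0| < toC m.
    have : 0 < `|x - p0| + 1 by rewrite ltr_wpDl.
    by move=> /lt0C[m m0 mE]; exists m => //; rewrite -mE ltrDl.
  exists (rho / m); first by rewrite divr_gt0.
  move=> s' ss'.
  have cc : `|c s - c s'| < toC rho.
    have -> : c s - c s' = toC (s - s') *: (x - p0).
      by rewrite /c opprD addrACA subrr add0r toCB scalerBl.
    rewrite normrZ nmE nm_toC; have [->|ss0] := eqVneq (s - s') 0.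
      by rewrite normr0 toC0 mul0r ltcR.
    have := mE; rewrite -(ltr_pM2l (x := toC `|s - s'|)); last by rewrite ltcR normr_gt0.
    move=> /lt_trans; apply; rewrite -toCM ltcR.
    by move: ss'; rewrite ltr_pdivlMr.
  have near_c z : `|c s - z| < toC rho -> \forall w \near z, `|c s - w| < toC rho.
    by move=> /ball_near[d d0 Hd]; apply/nbhsCP; exists d.
  have c0 : `|c s - c s| < toC rho by rewrite subrr normr0 toC_gt0.
  split => gs.
    by move: (near_c _ cc); apply: filterS => w wp; apply: (H _ _ c0 gs wp).
  by move: (near_c _ c0); apply: filterS => w wp; apply: (H _ _ cc gs wp).
have near_step s : \forall s' \near s, S s <-> S s'.
  have [d d0 Hd] := step s; apply/nbhs_ballP; exists d => // s' /=.
have oS : open S.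
  by rewrite openE => s Ss; move: (near_step s); apply: filterS => s' [+ _]; apply.
have oSC : open (~` S).
  by rewrite openE => s Ss; move: (near_step s); apply: filterS => s' [_ h] /h.
have ST : S = setT.
  have /(_ S) -> // : connected [set: R] by apply/connected_intervalP.
  - by exists 0; rewrite /S /= /c toC0 scale0r addr0.
  - by exists S => //; rewrite setTI.
  - by exists S; [rewrite -openC|rewrite setTI].
have : S 1 by rewrite ST.
by rewrite /S /= /c toC1 scale1r addrC subrK.
Qed.

Lemma mero_unique G G' p0 : meromorphic G -> meromorphic G' ->
  agree_gen G G' p0 -> G = G'.
Proof.
move=> mG mG' g0; apply/funext => x.
have gx := agree_all x mG mG' g0.
have [[_ G2 G3] [_ G2' G3']] := (mG, mG').
have [hx|nx] := pselect (holomorphic_at G x).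
  have hx' : holomorphic_at G' x.
    apply: (G2' _ _ hx); move: gx (hol_near_hol hx); rewrite /agree_gen.
    by apply: filterS2 => z gz hz hz'; rewrite gz.
  exact: (nbhs_singleton gx).
have [hx'|nx'] := pselect (holomorphic_at G' x); last by rewrite G3// G3'.
exfalso; apply: nx.
apply: (G2 _ _ hx'); move: gx (hol_near_hol hx'); rewrite /agree_gen.
by apply: filterS2 => z gz hz hz'; rewrite gz.
Qed.

End MeromorphicUnique.

(** * Quotients with removable singularities removed *)

Section Extension.
Variables (R : realType).
Local Notation C := (Cplx R).
Variable E : normedModType C.
Implicit Types (A B h : E -> C) (p z : E).

Definition ext_at A B p v := exists h, [/\ holomorphic_at h p,
  \forall z \near p, B z != 0 -> h z = A z / B z & v = h p].

(* The meromorphic function A / B, in the normalization of [meromorphic]. *)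
Definition ext A B p : C := xget 0 [set v | ext_at A B p v].

Lemma ext_at_unique A B p v v' : ~ (\forall z \near p, B z = 0) ->
  ext_at A B p v -> ext_at A B p v' -> v = v'.
Proof.
move=> nB [h [hp hE ->]] [h' [hp' hE' ->]].
apply: near_agree; [exact: hol_continuous|exact: hol_continuous|].
move=> P nP.
have nP' : \forall z \near p, [/\ P z, B z != 0 -> h z = A z / B z & B z != 0 -> h' z = A z / B z].
  by move: nP hE hE'; apply: filterS3.
by have [z [Pz e e'] bz] := dense_neq0 nB nP'; exists z => //; rewrite e// e'.
Qed.

Section Entire.
Variables A B : E -> C.
Hypothesis Ad : forall z, differentiable A z.
Hypothesis Bd : forall z, differentiable B z.
Hypothesis nB : forall p, ~ (\forall z \near p, B z = 0).

Lemma ext_val p v : ext_at A B p v -> ext A B p = v.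
Proof.
move=> pv; apply: (ext_at_unique (@nB p) _ pv).
exact: (xgetI 0 pv).
Qed.

Lemma ext_atE p : B p != 0 -> ext_at A B p (A p / B p).
Proof.
move=> bp; exists (fun z => A z / B z); split => //; last by near=> z.
apply: (@hol_quot _ _ _ A B) => //; [exact: hol_entire|exact: hol_entire|].
by near=> z.
Unshelve. all: by end_near. Qed.

Lemma ext_quot p : B p != 0 -> ext A B p = A p / B p.
Proof. by move=> bp; apply/ext_val/ext_atE. Qed.

Lemma ext_hol p h : holomorphic_at h p ->
  (\forall z \near p, B z != 0 -> h z = A z / B z) -> holomorphic_at (ext A B) p.
Proof.
move=> hp hE; apply: (hol_near _ hp).
move: (hol_near_hol hp) (near_join hE); apply: filterS2 => z hz Ez.
by apply: ext_val; exists h.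
Qed.

Lemma ext_meromorphic : meromorphic (ext A B).
Proof.
split.
- move=> p; exists A, B; split => //; [exact: hol_entire|exact: hol_entire|].
  by near=> z; exact: ext_quot.
- move=> p h hp hE; apply: (ext_hol hp); move: hE; apply: filterS => z zE bz.
  rewrite -ext_quot// zE//; have [h' [hz' hE' _]] := ext_atE bz.
  exact: (ext_hol hz' hE').
- move=> p np; rewrite /ext xgetPN// => v [h [hp hE _]]; apply: np.
  exact: (ext_hol hp hE).
Unshelve. all: by end_near. Qed.

End Entire.

Lemma ext_at_scale A B A' B' (l k : C) p v : l != 0 -> 
  (forall z, B' (l *: z) != 0 ->
    B z != 0 /\ A' (l *: z) / B' (l *: z) = k * (A z / B z)) ->
  ext_at A B p v -> ext_at A' B' (l *: p) (k * v).
Proof.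
move=> l0 H [h [hp hE ->]]; exists (fun w => k * h (l^-1 *: w)).
have cl : (fun w : E => l^-1 *: w) w @[w --> l *: p] --> p.
  rewrite -[X in _ --> X](scalerK l0); apply: cvgZr; exact: cvg_id.
have lw (w : E) : l *: (l^-1 *: w) = w by rewrite scalerA divff// scale1r.
split; last by rewrite scalerK.
- have : \forall w \near l *: p, differentiable h (l^-1 *: w) by exact: (cl _ hp).
  apply: filterS => w hw.
  apply: differentiableM; first exact: differentiable_cst.
  have -> : (fun w => h (l^-1 *: w)) = h \o (fun w => l^-1 *: w) by [].
  by apply: differentiable_comp => //; apply: differentiableZl.
- have : \forall w \near l *: p, B (l^-1 *: w) != 0 -> h (l^-1 *: w) = A (l^-1 *: w) / B (l^-1 *: w) by exact: (cl _ hE).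
  apply: filterS => w hw bw.
  have := H (l^-1 *: w); rewrite lw => /(_ bw)[b0 ->].
  by rewrite hw.
Qed.

(** If A / B has no holomorphic extension at p, then A' / B' has none at l p, as scaling back by
    l^-1 and k^-1 shows; both sides are then 0. *)
Lemma ext_scale A B A' B' (l k : C) p : l != 0 -> k != 0 ->
  (forall p, ~ (\forall z \near p, B z = 0)) ->
  (forall p, ~ (\forall z \near p, B' z = 0)) ->
  (forall z, (B' (l *: z) == 0) = (B z == 0)) ->
  (forall z, B z != 0 -> A' (l *: z) / B' (l *: z) = k * (A z / B z)) ->
  ext A' B' (l *: p) = k * ext A B p.
Proof.
move=> l0 k0 nB nB' BB H.
have [[v pv]|nv] := pselect (exists v, ext_at A B p v).
  rewrite (ext_val nB pv); apply: ext_val => //.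
  by apply: (ext_at_scale l0 _ pv) => z; rewrite BB => bz; split => //; rewrite H.
rewrite [ext A B p]/ext xgetPN ?mulr0; last by move=> v pv; apply: nv; exists v.
rewrite /ext xgetPN// => v pv; apply: nv; exists (k^-1 * v).
rewrite -[p](scalerK l0).
apply: (@ext_at_scale A' B' A B l^-1 k^-1 _ v _ _ pv); first by rewrite invr_eq0.
move=> z; have := BB (l^-1 *: z); have := H (l^-1 *: z).
rewrite scalerA divff// scale1r => e1 e2 bz; rewrite e2 bz; split => //.
by rewrite (e1 bz) mulrA mulVf// mul1r.
Qed.

End Extension.

(** * The modular group action *)

Section ModularList.
Variable R : realType.
Local Notation C := (Cplx R).
Local Notation P := (twopii R).
Local Notation ins := (bool * C)%type.
Implicit Types (t v z : C) (a b : ins) (s : seq ins) (al be : R).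

Definition chE s : C := \sum_(a <- s) sgn R a.1.
Definition mom2 s : C := \sum_(a <- s) sgn R a.1 * a.2 ^+ 2.
Definition scale_ins (l : C) s : seq ins := [seq (a.1, l * a.2) | a <- s].

Lemma Sg_scale l s : Sg (scale_ins l s) = l * Sg s.
Proof.
rewrite /Sg big_map mulr_sumr; apply: eq_bigr => a _ /=.
by rewrite mulrCA.
Qed.

Lemma chE_balanced s : balanced s -> chE s = 0.
Proof.
have E (r : seq ins) : chE r = (count (fun a : ins => a.1) r)%:R - (count (fun a : ins => ~~ a.1) r)%:R.
  elim: r => [|[e x] r IH]; first by rewrite /chE big_nil subrr.
  rewrite /chE big_cons -/(chE r) IH; case: e => /=; rewrite ?add0n ?add1n -natr1 /sgn; ring.
by rewrite E => /eqP ->; rewrite subrr.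
Qed.

Lemma cexpD_mul (x y z w : C) : (cexp x * y) * (cexp z * w) = cexp (x + z) * (y * w).
Proof. by rewrite cexpD mulrACA. Qed.

Lemma pair_factor_scale t t' l c1 c2 a b :
  (forall z, theta t' (l * z) = cexp (c1 + c2 * z ^+ 2) * theta t z) ->
  pair_factor t' (a.1, l * a.2) (b.1, l * b.2) =
  cexp (sgn R a.1 * sgn R b.1 * (c1 + c2 * (a.2 - b.2) ^+ 2)) * pair_factor t a b.
Proof.
move=> H; rewrite /pair_factor /= -mulrBr H.
case: a b => [[] x] [[] y]; rewrite /sgn /= ?mul1r ?mulrN1 ?opprK ?mul1r ?mulN1r //.
all: by rewrite invfM -cexpN.
Qed.

(** For total charge Q, second moment m and N insertions, the sum of e_i e_j over pairs is (Q^2 - N)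
    / 2, and the sum of e_i e_j (z_i - z_j)^2 is Q m - S^2. The induction removes one insertion at a
    time and so meets nonzero Q. *)
Lemma pair_prod_scale t t' l c1 c2 s :
  (forall z, theta t' (l * z) = cexp (c1 + c2 * z ^+ 2) * theta t z) ->
  pair_prod t' (scale_ins l s) =
  cexp (c1 * ((chE s ^+ 2 - (size s)%:R) / 2) + c2 * (chE s * mom2 s - Sg s ^+ 2)) * pair_prod t s.
Proof.
move=> H; elim: s => [|a s IH].
  rewrite /= /chE /mom2 /Sg !big_nil [X in cexp X](_ : _ = 0) ?cexp0 ?mulr1//.
  by rewrite expr0n subrr mul0r !mulr0 subrr mulr0 addr0.
have step (r : seq ins) : \prod_(b <- scale_ins l r) pair_factor t' (a.1, l * a.2) b =
   cexp (c1 * (sgn R a.1 * chE r) + c2 * (sgn R a.1 * (a.2 ^+ 2 * chE r - 2 * a.2 * Sg r + mom2 r))) *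
   \prod_(b <- r) pair_factor t a b.
  elim: r => [|b r IHr].
    rewrite !big_nil mulr1 /chE /mom2 /Sg !big_nil [X in cexp X](_ : _ = 0) ?cexp0//.
    by rewrite !mulr0 subrr addr0 !mulr0 addr0.
  rewrite /= !big_cons IHr (pair_factor_scale _ _ H) cexpD_mul.
  congr (cexp _ * _); rewrite /chE /mom2 /Sg !big_cons.
  move: (bigop.body _ _ _) (bigop.body _ _ _) (bigop.body _ _ _) (sgn _ _) (sgn _ _) => x y z w w'.
  by ring.
rewrite /= step IH cexpD_mul.
congr (cexp _ * _); rewrite /chE /mom2 /Sg !big_cons.
have -> : (size s).+1%:R = (size s)%:R + 1 :> C by rewrite -addn1 natrD.
have := sgn_sqr R a.1; clear.
move: (bigop.body _ _ _) (bigop.body _ _ _) (bigop.body _ _ _) (sgn _ _) ((size s)%:R) c1 c2 a.2 => x y z w N k1 k2 u ww.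
by field: ww.
Qed.

Definition trace_value t al be s : C :=
  cexp (t * toC be ^+ 2 / 2 + toC al * P / 2 - toC be * Sg s) *
  (K t ^+ (size s)./2 * (theta t (toC al * P - toC be * t + Sg s) * pair_prod t s)).

(* Since 1/8 - 1/24 = 1/12, the powers of q in pref and in theta cancel. *)
Lemma trace_valueE al be tau s :
  pref be tau * FVval (P * tau) al be s = trace_value (P * tau) al be s.
Proof.
rewrite /pref /FVval /closed_form /trace_value /kappa toCD.
set u := K _ ^+ _; set w := theta _ _; set p := pair_prod _ _; set S := Sg s.
have E : toC (2^-1 : R) = 2^-1 by rewrite toCV toC_nat.
rewrite E [LHS](_ : _ = (cexp (P * tau * ((toC be + 2^-1) ^+ 2 / 2 - 24^-1)) *
   cexp (- (P * tau / 12 - (toC al * P - toC be * (P * tau)) / 2)) * cexp (- toC be * S)) * (u * (w * p))).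
  by rewrite -2!cexpD; congr (cexp _ * _); field.
by move: (cexp _) (cexp _) (cexp _) u w p => x y z u w p; ring.
Qed.

Lemma half_size s n : size s = n.*2 -> (size s)./2 = n.
Proof. by move=> ->; rewrite doubleK. Qed.

Lemma scale_ins1 s : scale_ins 1 s = s.
Proof. by rewrite -[RHS]map_id; apply: eq_map => -[e x]; rewrite /= mul1r. Qed.

(** The exponents P / 12 occur n times from K, once from theta and - n times from the pairs; the one
    left over is the 1/6 of the multiplier. *)
Lemma trace_value_T t al be s n : size s = n.*2 -> balanced s ->
  trace_value (t + P) (al + be) be s = cexp (P / 2 * toC (be * (be + 1) + 6^-1)) * trace_value t al be s.
Proof.
move=> sz bal; rewrite /trace_value (half_size sz).
have H z : theta (t + P) (1 * z) = cexp (P / 12 + 0 * z ^+ 2) * theta t z.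
  by rewrite mul1r mul0r addr0 theta_shift.
have := pair_prod_scale s H; rewrite scale_ins1 => ->.
rewrite (chE_balanced bal) sz K_shift exprMn -cexpMn.
have -> : toC (al + be) * P - toC be * (t + P) + Sg s = toC al * P - toC be * t + Sg s.
  by rewrite toCD; ring.
rewrite theta_shift.
set u := K _ ^+ _; set w := theta _ _; set p := pair_prod _ _; set S := Sg s.
rewrite [LHS](_ : _ = (cexp ((t + P) * toC be ^+ 2 / 2 + toC (al + be) * P / 2 - toC be * S) *
   cexp (n%:R * (P / 12)) * cexp (P / 12) *
   cexp (P / 12 * ((0 ^+ 2 - n.*2%:R) / 2) + 0 * (0 * mom2 s - S ^+ 2))) * (u * (w * p))); last first.
  by move: (cexp _) (cexp _) (cexp _) (cexp _) u w p => x y z x' u w p; ring.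
rewrite [RHS](_ : _ = (cexp (P / 2 * toC (be * (be + 1) + 6^-1)) *
   cexp (t * toC be ^+ 2 / 2 + toC al * P / 2 - toC be * S)) * (u * (w * p))); last first.
  by move: (cexp _) (cexp _) u w p => x y u w p; ring.
rewrite -4!cexpD; congr (cexp _ * _).
rewrite !toCD !toCM toCD toCV toC1 toC_nat -muln2 natrM.
by move: (twopii R) (toC be) (toC al) (mom2 s) S => p' b a m S'; field.
Qed.

(** The powers of i are n from K, 1 from theta and - n from the pairs. In the exponent (v + S)^2
    from theta and - S^2 from the pairs leave v^2 + 2 v S over 2 t. Its linear part turns the
    prefactor into e^(- beta S). *)
Lemma trace_value_S t al be s n : complex.Re t < 0 -> size s = n.*2 -> balanced s ->
  trace_value (inv_period t) be (- al) (scale_ins (- P / t) s) =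
  (- t / P) ^+ n * cexp (P * toC ((2^-1 + be) * (2^-1 - al))) * trace_value t al be s.
Proof.
move=> t0 sz bal; have tn := Re_lt0_neq0 t0; have P0 := @twopii_neq0 R.
rewrite /trace_value size_map (half_size sz) Sg_scale.
have H z : theta (inv_period t) (- P / t * z) = cexp (P / 4 + (2 * t)^-1 * z ^+ 2) * theta t z.
  by rewrite cexpD cexp_quarter [(2 * t)^-1 * _]mulrC -theta_inv//; congr theta; rewrite mulrAC.
rewrite (pair_prod_scale s H) (chE_balanced bal) sz K_inv// exprMn exprMn -cexp_quarter -cexpMn.
have -> : toC be * P - toC (- al) * inv_period t + - P / t * Sg s =
   - P / t * (toC al * P - toC be * t + Sg s).
  by rewrite toCN /inv_period; move: (twopii R) (toC be) (toC al) (Sg s) P0 => p b a S p0; field.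
rewrite H.
set u := K _ ^+ _; set w := theta _ _; set p := pair_prod _ _; set S := Sg s.
set f := (- t / P) ^+ n.
rewrite [LHS](_ : _ = (cexp (inv_period t * toC (- al) ^+ 2 / 2 + toC be * P / 2 - toC (- al) * (- P / t * S)) *
   cexp (n%:R * (P / 4)) * cexp (P / 4 + (2 * t)^-1 * (toC al * P - toC be * t + S) ^+ 2) *
   cexp (P / 4 * ((0 ^+ 2 - n.*2%:R) / 2) + (2 * t)^-1 * (0 * mom2 s - S ^+ 2))) * (f * u * (w * p))); last first.
  by move: (cexp _) (cexp _) (cexp _) (cexp _) f u w p => x y z x' f u w p; ring.
rewrite [RHS](_ : _ = (cexp (P * toC ((2^-1 + be) * (2^-1 - al))) *
   cexp (t * toC be ^+ 2 / 2 + toC al * P / 2 - toC be * S)) * (f * u * (w * p))); last first.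
  by move: (cexp _) (cexp _) f u w p => x y f u w p; ring.
rewrite -4!cexpD; congr (cexp _ * _).
rewrite !toCM !toCB !toCD toCN toCV toC_nat -muln2 natrM /inv_period.
by move: (twopii R) (toC be) (toC al) (mom2 s) S P0 => p' b a m S' p0; field.
Qed.

End ModularList.

(** * Numerator and denominator of the trace as holomorphic functions *)

Section Quotient.
Variable R : realType.
Local Notation C := (Cplx R).
Local Notation P := (twopii R).
Local Notation ins := (bool * C)%type.
Implicit Types (t v z : C) (a b : ins) (s : seq ins) (al be : R) (q : bool).

(** Pairs of equal charge form the numerator of [pair_prod] (q true), pairs of opposite charge its
    denominator (q false); [ext] takes the two separately. *)
Fixpoint sign_prod t q s : C := if s is a :: s' then
  (\prod_(b <- s' | (a.1 == b.1) == q) theta t (a.2 - b.2)) * sign_prod t q s' else 1.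

Lemma pair_prodE t s : pair_prod t s = sign_prod t true s / sign_prod t false s.
Proof.
elim: s => [|a s IH]; first by rewrite /= divr1.
have E : \prod_(b <- s) pair_factor t a b = (\prod_(b <- s | (a.1 == b.1) == true) theta t (a.2 - b.2)) /
    \prod_(b <- s | (a.1 == b.1) == false) theta t (a.2 - b.2).
  elim: s {IH} => [|b s IH]; first by rewrite !big_nil divr1.
  rewrite !big_cons IH /pair_factor; case: eqP => _ /=; move: (bigop.body _ _ _) (bigop.body _ _ _) (theta _ _) => x y z.
    by rewrite mulrA.
  by rewrite invfM mulrCA mulrA.
by rewrite /= E IH invfM mulrACA.
Qed.

Lemma sign_prod_scale t t' (l : C) (c : C -> C) q s : (forall z, c z != 0) ->
  (forall z, theta t' (l * z) = c z * theta t z) ->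
  (sign_prod t' q (scale_ins l s) == 0) = (sign_prod t q s == 0).
Proof.
move=> c0 H; elim: s => //= a s IH.
rewrite mulf_eq0 IH [RHS]mulf_eq0; congr (_ || _).
elim: s {IH} => [|b s IH]; first by rewrite !big_nil.
rewrite /= !big_cons /=; case: ifP => // _.
by rewrite mulf_eq0 IH [RHS]mulf_eq0 -mulrBr H mulf_eq0 (negPf (c0 _)).
Qed.

Lemma sign_prod_gen t q s : gen t s -> sign_prod t q s != 0.
Proof.
elim: s => [|a s IH] /=; first by rewrite oner_neq0.
move=> /andP[h /IH {}IH]; rewrite mulf_neq0//.
elim: s h {IH} => [|b s IH]; first by rewrite big_nil oner_neq0.
by move=> /= /andP[h1 /IH h2]; rewrite big_cons; case: ifP => // _; rewrite mulf_neq0.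
Qed.

Definition trace_num t al be s : C :=
  cexp (t * toC be ^+ 2 / 2 + toC al * P / 2 - toC be * Sg s) *
  (K t ^+ (size s)./2 * (theta t (toC al * P - toC be * t + Sg s) * sign_prod t true s)).

Lemma trace_value_quot t al be s : trace_value t al be s = trace_num t al be s / sign_prod t false s.
Proof. by rewrite /trace_value /trace_num pair_prodE !mulrA. Qed.

Section Family.
Variables (E : normedModType C) (I : Type) (e : I -> bool) (f : I -> E -> C).
Hypothesis fd : forall i (x : E), differentiable (f i) x.
Variable t : C.
Hypothesis t0 : complex.Re t < 0.

Definition ev r (x : E) : seq ins := [seq (e i, f i x) | i <- r].

Lemma diff_entire (h : C -> C) (g : E -> C) x : entire h -> differentiable g x ->
  differentiable (fun x => h (g x)) x.
Proof.
move=> hh gx; have -> : (fun x => h (g x)) = h \o g by [].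
apply: differentiable_comp => //; have /differentiableC hd := hh (g x).
exact: hd.
Qed.

Lemma diff_prod (J : Type) (r : seq J) (p : pred J) (g : J -> E -> C) x :
  (forall j, differentiable (g j) x) -> differentiable (fun x => \prod_(j <- r | p j) g j x) x.
Proof.
move=> gd; elim: r => [|j r IH].
  rewrite (_ : (fun x => _) = cst 1); first exact: differentiable_cst.
  by apply/funext => y; rewrite big_nil.
case pj: (p j).
  rewrite (_ : (fun x => _) = (fun x => g j x * \prod_(j <- r | p j) g j x)); first exact: differentiableM.
  by apply/funext => y; rewrite big_cons pj.
rewrite (_ : (fun x => _) = (fun x => \prod_(j <- r | p j) g j x))//.
by apply/funext => y; rewrite big_cons pj.
Qed.

Lemma diff_sign_prod q r x : differentiable (fun x => sign_prod t q (ev r x)) x.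
Proof.
elim: r => [|i r IH]; first exact: differentiable_cst.
rewrite /=; apply: differentiableM => //.
rewrite (_ : (fun x => _) = (fun x => \prod_(j <- r | (e i == e j) == q) theta t (f i x - f j x))).
  by apply: diff_prod => j; apply: diff_entire; [exact: entire_theta|apply: differentiableB].
by apply/funext => y; rewrite big_map.
Qed.

Lemma diff_Sg r x : differentiable (fun x => Sg (ev r x)) x.
Proof.
elim: r => [|i r IH].
  rewrite (_ : (fun x => _) = cst 0); first exact: differentiable_cst.
  by apply/funext => y; rewrite /Sg big_nil.
rewrite (_ : (fun x => _) = (fun x => sgn R (e i) * f i x + Sg (ev r x))).
  by apply: differentiableD => //; apply: differentiableM => //; exact: differentiable_cst.
by apply/funext => y; rewrite /Sg big_cons.
Qed.

Lemma diff_trace_num al be r x : differentiable (fun x => trace_num t al be (ev r x)) x.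
Proof.
rewrite /trace_num; apply: differentiableM.
  apply: diff_entire; first by move=> z; apply: cdf_cexp; exact: cdf_id.
  by apply: differentiableB; [exact: differentiable_cst|apply: differentiableM; [exact: differentiable_cst|exact: diff_Sg]].
rewrite (_ : (fun x => _ * _) = (fun x => K t ^+ (size r)./2 * (theta t (toC al * P - toC be * t + Sg (ev r x)) * sign_prod t true (ev r x)))); last first.
  by apply/funext => y; rewrite size_map.
apply: differentiableM; first exact: differentiable_cst.
apply: differentiableM; last exact: diff_sign_prod.
apply: diff_entire; first exact: entire_theta.
by apply: differentiableD; [exact: differentiable_cst|exact: diff_Sg].
Qed.

Lemma theta_punctured c : exists2 rho : R, 0 < rho &
  forall s : C, s != 0 -> nm s < rho -> theta t (c + s) != 0.
Proof.
have [c0|c0] := eqVneq (theta t c) 0; last first.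
  have vd : differentiable (theta t) c by apply/differentiableC; exact: entire_theta.
  have /nbhsCP[r r0 H] := near_neq0 vd c0.
  exists r => // s _ sr; apply: H.
  by rewrite opprD addrA subrr sub0r normrN nm_lt.
have [d d0 dc] := theta_zero_simple t0 c0.
have [r r0 H] := zero_isolated d0 c0 dc.
exists r => // s s0 /H; rewrite -nm_gt0; apply: lt_le_trans.
by rewrite mulr_gt0 ?divr_gt0 ?nm_gt0.
Qed.

Variable u : E.
Hypothesis fu : forall i x (s : C), f i (x + s *: u) = f i x + (if e i then s else 0).

(** The direction u moves the positive insertions only, so every difference in the denominator
    changes by s or - s and leaves the isolated zeros of theta. *)
Lemma sign_prod_punctured r x : exists2 rho : R, 0 < rho &
  forall s : C, s != 0 -> nm s < rho -> sign_prod t false (ev r (x + s *: u)) != 0.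
Proof.
elim: r => [|i r [r1 r10 H1]]; first by exists 1 => // s _ _; rewrite oner_neq0.
have [r2 r20 H2] : exists2 rho : R, 0 < rho & forall s : C, s != 0 -> nm s < rho ->
    \prod_(j <- r | (e i == e j) == false) theta t (f i (x + s *: u) - f j (x + s *: u)) != 0.
  elim: r {H1} => [|j r [r2 r20 H2]]; first by exists 1 => // s _ _; rewrite big_nil oner_neq0.
  have [r3 r30 H3] := theta_punctured (f i x - f j x).
  exists (Num.min r2 r3) => [|s s0]; first by rewrite lt_min r20.
  rewrite lt_min => /andP[s2 s3]; rewrite big_cons; case: ifP => [ij|_]; last exact: H2.
  rewrite mulf_neq0 ?H2// !fu; case: (e i) (e j) ij => -[]//= _.
    by rewrite addr0 addrAC H3.
  by rewrite addr0 opprD addrA H3 ?oppr_eq0 ?nmN.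
exists (Num.min r1 r2) => [|s s0]; first by rewrite lt_min r10.
rewrite lt_min => /andP[s1 s2] /=; rewrite mulf_neq0 ?H1//.
by have := H2 s s0 s2; rewrite big_map.
Qed.

Lemma sign_prod_not_near0 r (x : E) : ~ (\forall y \near x, sign_prod t false (ev r y) = 0).
Proof.
move=> /nbhsCP[r1 r10 H1]; have [r2 r20 H2] := sign_prod_punctured r x.
have : 0 < `|u| + 1 by rewrite ltr_wpDl.
move=> /lt0C[m m0 mE].
pose s := Num.min (r1 / m) r2 / 2.
have m1 : 0 < Num.min (r1 / m) r2 by rewrite lt_min r20 divr_gt0.
have s0 : 0 < s by rewrite divr_gt0.
have ss : s < Num.min (r1 / m) r2 by rewrite /s; move: (Num.min _ _) m1 => y y0; rewrite ltr_pdivrMr// ltr_pMr// ltr1n.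
have /H2 : toC s != 0 by rewrite gt_eqF// toC_gt0.
move: ss; rewrite lt_min => /andP[ss1 ss2]; rewrite nm_toC gtr0_norm// => /(_ ss2).
rewrite H1 ?eqxx//.
rewrite opprD addrA subrr sub0r normrN normrZ nmE nm_toC gtr0_norm//.
have um : `|u| < toC m by rewrite -mE ltrDl.
have := um; rewrite -(ltr_pM2l (x := toC s)); last by rewrite toC_gt0.
by move=> /lt_trans; apply; rewrite -toCM ltcR -ltr_pdivlMr.
Qed.

End Family.
End Quotient.
Section UpperHalf.
Variable R : realType.
Local Notation P := (twopii R).
Implicit Types tau : Cplx R.

Lemma Im_gt0_neq0 tau : 0 < complex.Im tau -> tau != 0.
Proof. by apply: contraTneq => ->; rewrite ltxx. Qed.

Lemma Re_period_lt0 tau : 0 < complex.Im tau -> complex.Re (P * tau) < 0.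
Proof. by move=> tau0; rewrite Re_twopiiM oppr_lt0 !mulr_gt0// pi_gt0. Qed.

Lemma inv_period_tau tau : 0 < complex.Im tau -> P * (- tau^-1) = inv_period (P * tau).
Proof.
move=> /Im_gt0_neq0 tn; have := @twopii_neq0 R; rewrite /inv_period.
by move: (twopii R) => p p0; field; rewrite ?p0 ?tn ?oppr_eq0.
Qed.

Lemma Im_inv_gt0 tau : 0 < complex.Im tau -> 0 < complex.Im (- tau^-1).
Proof.
move=> tau0; have := inv_period_lt0 (Re_period_lt0 tau0).
rewrite -inv_period_tau// Re_twopiiM oppr_lt0 pmulr_rgt0//.
by rewrite mulr_gt0// pi_gt0.
Qed.

End UpperHalf.

(** * The generating function as a quotient, and its behaviour under S and T *)

Section Space.
Variable R : realType.
Local Notation C := (Cplx R).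
Local Notation P := (twopii R).
Local Notation ins := (bool * C)%type.
Variable n : nat.
Local Notation E := ('rV[C]_n * 'rV[C]_n)%type.
Implicit Types (x y z : E) (al be : R) (tau : C).

Definition coord (i : bool * 'I_n) (x : E) : C := if i.1 then x.1 0 i.2 else x.2 0 i.2.

Definition slots : seq (bool * 'I_n) := flatten [seq [:: (true, i); (false, i)] | i <- enum 'I_n].

Definition coords (x : E) : seq ins := ev fst coord slots x.

Lemma coordsE x : coords x = flat [seq (x.1 0 i, x.2 0 i) | i <- enum 'I_n].
Proof.
rewrite /coords /ev /slots /flat map_flatten -!map_comp.
by congr flatten; apply: eq_map => i.
Qed.

Lemma insertionsE x : insertions x = vins (coords x).
Proof.
rewrite coordsE /insertions /vins /flat map_flatten -!map_comp.
by congr flatten; apply: eq_map => i.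
Qed.

Lemma coords_balanced x : balanced (coords x).
Proof. by rewrite coordsE balanced_flat. Qed.

Lemma size_coords x : size (coords x) = n.*2.
Proof.
rewrite size_map /slots -[in RHS](size_enum_ord n).
by elim: (enum 'I_n) => //= i s ->.
Qed.

Lemma coords_scale (l : C) x : coords (l *: x) = scale_ins l (coords x).
Proof.
rewrite /coords /ev /scale_ins -map_comp; apply: eq_map => -[e i] /=.
by rewrite /coord /=; case: e; rewrite mxE.
Qed.

Lemma coord_diff i x : differentiable (coord i) x.
Proof.
have fstd : differentiable (fst : E -> _) x.
  by apply: linear_differentiable => z; exact: cvg_fst.
have sndd : differentiable (snd : E -> _) x.
  by apply: linear_differentiable => z; exact: cvg_snd.
case: i => -[] i; rewrite /coord /=.
  rewrite (_ : (fun x => _) = (fun M : 'rV[C]_n => M 0 i : C) \o (fst : E -> _))//.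
  by apply: differentiable_comp => //; exact: differentiable_coord.
rewrite (_ : (fun x => _) = (fun M : 'rV[C]_n => M 0 i : C) \o (snd : E -> _))//.
by apply: differentiable_comp => //; exact: differentiable_coord.
Qed.

Lemma coordD i x (s : C) : coord i (x + s *: (const_mx 1, 0)) = coord i x + (if i.1 then s else 0).
Proof. by rewrite /coord; case: i => -[] i /=; rewrite !mxE ?mulr1 ?mulr0. Qed.

Section Domain.
Variable t : C.
Hypothesis t0 : complex.Re t < 0.

Lemma dom_of_sorted s (lo hi : R) : hi - lo <= - complex.Re t ->
  (all (fun a : ins => lo < complex.Re a.2 < hi) s) ->
  pairwise (fun a a' : ins => complex.Re a'.2 < complex.Re a.2) s -> dom t s.
Proof.
move=> hl; rewrite /dom; elim: s => //= a s IH /andP[al hs] /andP[ps /IH ->//].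
rewrite andbT; apply/allP => b bs; have := allP ps _ bs; have := allP hs _ bs.
move=> /andP[b1 b2] b3; move/andP: al => [a1 a2].
rewrite ReD ReN.
by apply/andP; split; lra.
Qed.

Lemma flat_sorted (I : eqType) (r : seq I) (lt : rel I) (g : I -> C * C) : 
  (forall i, complex.Re (g i).2 < complex.Re (g i).1) ->
  (forall i j, lt i j -> complex.Re (g j).1 < complex.Re (g i).2) ->
  pairwise lt r ->
  pairwise (fun a a' : ins => complex.Re a'.2 < complex.Re a.2) (flat [seq g i | i <- r]).
Proof.
move=> H1 H2; elim: r => //= i r IH /andP[ri /IH ->]; rewrite H1 /= andbT.
have H j : j \in r -> complex.Re (g j).1 < complex.Re (g i).2 by move=> /(allP ri) /H2.
have A (c : R) : (complex.Re (g i).2 <= c) ->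
    all (fun a' : ins => complex.Re a'.2 < c) (flat [seq g i | i <- r]).
  move=> ic; elim: r H {IH ri} => //= j r IH H.
  have h := lt_le_trans (H j (mem_head _ _)) ic.
  rewrite h (lt_trans (H1 _) h) IH// => k kr; apply: H.
  by rewrite inE kr orbT.
by rewrite !A// ltW.
Qed.

(** The spacing of the 2n insertions of [base], whose real parts are 0, - d, - 2 d and so on. *)
Definition base_step : R := - complex.Re t / n.+1.*2%:R.

Definition base : E := (\row_i toC (- (i.*2%:R * base_step)), \row_i toC (- (i.*2.+1%:R * base_step))).

Lemma base_step_gt0 : 0 < base_step.
Proof. by rewrite divr_gt0 ?oppr_gt0 ?ltr0n. Qed.

(** If each point moves by less than d / 4 the order persists, and all real parts stay in a window
    of length (2n + 1) d, below - Re t = (2n + 2) d. This is the open set on which the trace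
    determines the continuation. *)
Lemma dom_near : \forall z \near base, dom t (coords z).
Proof.
have d0 := base_step_gt0.
have near_coord (i : bool * 'I_n) : \forall z \near base,
    nm (coord i z - coord i base) < base_step / 4.
  have /differentiable_continuous cc := @coord_diff i base.
  have : \forall w \near coord i base, nm (w - coord i base) < base_step / 4.
    apply/nbhsCP; exists (base_step / 4); first by rewrite divr_gt0.
    by move=> w; rewrite nm_lt -nmN opprB.
  exact: cc.
have : \forall z \near base, forall i : bool * 'I_n, nm (coord i z - coord i base) < base_step / 4.
  exact: (@filter_forall E (bool * 'I_n)%type (fun i => [set z | nm (coord i z - coord i base) < base_step / 4]) (nbhs base) _ near_coord).
apply: filterS => z H.
have H1 (i : 'I_n) : `|complex.Re (z.1 0 i) + i.*2%:R * base_step| < base_step / 4.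
  have := le_lt_trans (Re_le_nm _) (H (true, i)).
  by rewrite /coord /= mxE toCN opprK ReD Re_toC.
have H2 (i : 'I_n) : `|complex.Re (z.2 0 i) + i.*2.+1%:R * base_step| < base_step / 4.
  have := le_lt_trans (Re_le_nm _) (H (false, i)).
  by rewrite /coord /= mxE toCN opprK ReD Re_toC.
rewrite coordsE.
have dE : (n.+1)%:R * base_step * 2 = - complex.Re t.
  by rewrite mulrAC mulrC -natrM muln2 divfK ?pnatr_eq0.
have E1 (i : 'I_n) : i.*2%:R * base_step = (i%:R * base_step) * 2.
  by rewrite -muln2 natrM mulrAC.
have E2 (i : 'I_n) : i.*2.+1%:R * base_step = (i%:R * base_step) * 2 + base_step.
  by rewrite -addn1 natrD mulrDl mul1r E1.
have K2 (i j : nat) : (i < j)%N -> i%:R * base_step + base_step <= j%:R * base_step.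
  by move=> ij; rewrite -{2}[base_step]mul1r -mulrDl natr1 ler_wpM2r ?ler_nat// ltW.
have K (i : 'I_n) : 0 <= i%:R * base_step /\ i%:R * base_step + base_step <= n%:R * base_step.
  by split; [rewrite mulr_ge0// ltW|apply: K2].
apply: (@dom_of_sorted _ (- (n%:R * base_step * 2)) base_step).
- rewrite -dE; have := K2 n n.+1 (ltnSn n); move: d0; clear.
  by move: base_step => b; move: (n%:R * b) (n.+1%:R * b) => x y; lra.
- apply/allP => a /flattenP[l /mapP[p /mapP[i _ ->] ->]]; have [k0 k1] := K i.
  rewrite !inE => /orP[] /eqP -> /=.
    by have := H1 i; rewrite E1 ltr_norml => /andP[h1 h2]; apply/andP; split; clear -k0 k1 h1 h2 d0; lra.
  by have := H2 i; rewrite E2 ltr_norml => /andP[h1 h2]; apply/andP; split; clear -k0 k1 h1 h2 d0; lra.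
- apply: (@flat_sorted _ _ (fun i j : 'I_n => (i < j)%N)) => [i|i j ij|] /=.
  + have := H1 i; have := H2 i; rewrite E1 E2 !ltr_norml => /andP[h1 h2] /andP[h3 h4].
    by clear -h1 h2 h3 h4 d0; lra.
  + have := H1 j; have := H2 i; rewrite E1 E2 !ltr_norml => /andP[h1 h2] /andP[h3 h4].
    have := K2 i j ij; clear -h1 h2 h3 h4 d0; lra.
  + rewrite -(@pairwise_map _ _ val ltn) val_enum_ord -sorted_pairwise; first exact: iota_ltn_sorted.
    exact: ltn_trans.
Qed.

End Domain.

Definition quot_num t al be (x : E) : C := trace_num t al be (coords x).
Definition quot_den t (x : E) : C := sign_prod t false (coords x).

Section QuotientHolomorphy.
Variable t : C.
Hypothesis t0 : complex.Re t < 0.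

Lemma quot_num_diff al be x : differentiable (quot_num t al be) x.
Proof. by apply: diff_trace_num => // i y; exact: coord_diff. Qed.

Lemma quot_den_diff x : differentiable (quot_den t) x.
Proof. by apply: diff_sign_prod => // i y; exact: coord_diff. Qed.

Lemma quot_den_not_near0 x : ~ (\forall y \near x, quot_den t y = 0).
Proof.
apply: (@sign_prod_not_near0 R E _ fst coord t t0 (const_mx 1, 0)).
exact: coordD.
Qed.

End QuotientHolomorphy.

(** The quotient satisfies [is_G2n] because convergence of the trace forces the point into the
    domain ([cvg_dom]), where the value is known. Any other solution agrees with it near [base],
    hence everywhere by [mero_unique]. *)
Lemma G2n_ext al be tau (x y : 'rV[C]_n) : 0 < complex.Im tau ->
  G2n (al, be) x y tau = ext (quot_num (P * tau) al be) (quot_den (P * tau)) (x, y).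
Proof.
move=> tau0; set G := ext _ _.
have t0 := Re_period_lt0 tau0.
have hG : is_G2n (al, be) tau G.
  split.
    apply: ext_meromorphic; [exact: quot_num_diff|exact: quot_den_diff|exact: quot_den_not_near0].
  move=> z; rewrite insertionsE => cv.
  have dz : dom (P * tau) (coords z).
    by move: cv; rewrite coordsE => cv; apply: (@cvg_dom _ al be).
  have [_ ->] := FV_value al be tau0 (coords_balanced z) dz.
  rewrite trace_valueE trace_value_quot; apply: ext_quot; [exact: quot_num_diff|exact: quot_den_diff|exact: quot_den_not_near0|].
  by apply: sign_prod_gen; apply: dom_gen.
rewrite /G2n; congr (_ (x, y)).
have : is_G2n (al, be) tau (xget (fun=> 0) [set G : E -> C | is_G2n (al, be) tau G]).
  exact: (xgetI (fun=> 0) hG).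
move: (xget _ _) => G' hG'.
apply: (@mero_unique R E G' G (base (P * tau))); [exact: hG'.1|exact: hG.1|].
move: (dom_near t0); apply: filterS => z dz _ _.
have cv : FV_cvg (al, be) (insertions z) tau.
  by rewrite insertionsE; exact: (FV_value al be tau0 (coords_balanced z) dz).1.
by rewrite (hG'.2 _ cv) (hG.2 _ cv).
Qed.

Lemma G2n_T al be tau (x y : 'rV[C]_n) : 0 < complex.Im tau ->
  G2n (al + be, be) x y (tau + 1) =
  cexp (P / 2 * toC (be * (be + 1) + 6^-1)) * G2n (al, be) x y tau.
Proof.
move=> tau0.
have t0 := Re_period_lt0 tau0.
have tau1 : 0 < complex.Im (tau + 1) by rewrite ImD addr0.
have t1 := Re_period_lt0 tau1.
rewrite !G2n_ext// -[(x, y) in LHS]scale1r.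
apply: ext_scale; rewrite ?oner_neq0 ?cexp_neq0//.
- exact: quot_den_not_near0.
- exact: quot_den_not_near0.
- move=> z; rewrite /quot_den coords_scale mulrDr mulr1.
  apply: (@sign_prod_scale _ _ _ _ (fun=> cexp (P / 12))); first by move=> _; exact: cexp_neq0.
  by move=> w; rewrite mul1r theta_shift.
- move=> z _; rewrite /quot_den /quot_num coords_scale scale_ins1 -!trace_value_quot mulrDr mulr1.
  by apply: trace_value_T; [exact: size_coords|exact: coords_balanced].
Qed.

Lemma G2n_S al be tau (x y : 'rV[C]_n) : 0 < complex.Im tau ->
  G2n (be, - al) ((- tau)^-1 *: x) ((- tau)^-1 *: y) (- tau^-1) =
  (- tau) ^+ n * cexp (P * toC ((2^-1 + be) * (2^-1 - al))) * G2n (al, be) x y tau.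
Proof.
move=> tau0.
have tn := Im_gt0_neq0 tau0.
have P0 := @twopii_neq0 R.
have t0 := Re_period_lt0 tau0.
have tE := inv_period_tau tau0.
have t1 := inv_period_lt0 t0.
have tau1 := Im_inv_gt0 tau0.
have lE : (- tau)^-1 = - P / (P * tau).
  by move: (twopii R) P0 => p p0; field; rewrite ?p0 ?tn ?oppr_eq0 //.
have fE : - tau = - (P * tau) / P.
  by move: (twopii R) P0 => p p0; field; rewrite ?p0 ?tn ?oppr_eq0 //.
rewrite !G2n_ext// tE.
rewrite (_ : (_, _) = (- tau)^-1 *: (x, y))//.
apply: ext_scale.
- by rewrite invr_eq0 oppr_eq0.
- by rewrite mulf_neq0 ?cexp_neq0// expf_neq0// oppr_eq0.
- exact: quot_den_not_near0.
- exact: quot_den_not_near0.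
- move=> z; rewrite /quot_den coords_scale.
  apply: (@sign_prod_scale _ _ _ _ (fun w => iu R * cexp (w ^+ 2 / (2 * (P * tau))))).
    by move=> w; rewrite mulf_neq0 ?cexp_neq0// -cexp_quarter cexp_neq0.
  by move=> w; rewrite -theta_inv// lE; congr theta; rewrite mulrAC.
- move=> z _; rewrite /quot_den /quot_num coords_scale -!trace_value_quot lE [X in X ^+ n]fE.
  by apply: trace_value_S => //; [exact: size_coords|exact: coords_balanced].
Qed.

End Space.

(** * Generation of SL(2,Z) by S and T as a monoid *)

Section SL2.

Lemma mx2E (g : 'M[int]_2) : g = mx2 (g 0 0) (g 0 1) (g 1 0) (g 1 1).
Proof.
apply/matrixP => i j; rewrite mxE.
by case: i => -[|[]]// ?; case: j => -[|[]]// ?; congr (g _ _); apply: val_inj.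
Qed.

Lemma mx2_entries a b c d : let g := mx2 a b c d in
  [/\ g 0 0 = a, g 0 1 = b, g 1 0 = c & g 1 1 = d].
Proof. by split; rewrite mxE. Qed.

Lemma mul_mx2 a b c d a' b' c' d' : mx2 a b c d *m mx2 a' b' c' d' =
  mx2 (a * a' + b * c') (a * b' + b * d') (c * a' + d * c') (c * b' + d * d').
Proof.
apply/matrixP => i j; rewrite !mxE big_ord_recl big_ord1 !mxE.
by case: i => -[|[]]// ?; case: j => -[|[]].
Qed.

Lemma det_mx2 a b c d : \det (mx2 a b c d) = a * d - b * c.
Proof.
rewrite (expand_det_row _ 0) big_ord_recl big_ord1 /cofactor !det_mx11 !mxE /=.
by rewrite /bump /= expr0 mul1r expr1 mulN1r mulrN.
Qed.

(** The Euclidean algorithm on the first column, with T^(-1) = S T S T S and - 1 = S^2 as words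
    without inverses. *)
Lemma SL2_generated (Q : 'M[int]_2 -> Prop) : Q Smx -> Q Tmx ->
  (forall g1 g2, \det g1 = 1 -> \det g2 = 1 -> Q g1 -> Q g2 -> Q (g1 *m g2)) ->
  forall g, \det g = 1 -> Q g.
Proof.
move=> QS QT QM.
have dS : \det Smx = 1 by rewrite det_mx2.
have dT : \det Tmx = 1 by rewrite det_mx2.
pose Q1 g := \det g = 1 /\ Q g.
have M1 g1 g2 : Q1 g1 -> Q1 g2 -> Q1 (g1 *m g2).
  by move=> [d1 q1] [d2 q2]; split; [rewrite det_mulmx d1 d2|exact: QM].
have S1 : Q1 Smx by split.
have T1 : Q1 Tmx by split.
have U1 : Q1 (mx2 1 (-1) 0 1).
  have -> : mx2 1 (-1) 0 1 = Smx *m Tmx *m Smx *m Tmx *m Smx.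
    by rewrite /Smx /Tmx !mul_mx2; congr mx2.
  exact: (M1 _ _ (M1 _ _ (M1 _ _ (M1 _ _ S1 T1) S1) T1) S1).
have N1 : Q1 (mx2 (-1) 0 0 (-1)).
  have -> : mx2 (-1) 0 0 (-1) = Smx *m Smx by rewrite /Smx !mul_mx2; congr mx2.
  exact: M1.
have I1 : Q1 (mx2 1 0 0 1).
  have -> : mx2 1 0 0 1 = mx2 (-1) 0 0 (-1) *m mx2 (-1) 0 0 (-1) by rewrite !mul_mx2; congr mx2.
  exact: M1.
have Tpow (k : int) : Q1 (mx2 1 k 0 1).
  case: k => m.
    elim: m => // m IH.
    have -> : mx2 1 (Posz m.+1) 0 1 = Tmx *m mx2 1 (Posz m) 0 1.
      by rewrite /Tmx mul_mx2; congr mx2; lia.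
    exact: M1.
  rewrite NegzE; elim: m => // m IH.
  have -> : mx2 1 (- (Posz m.+2)) 0 1 = mx2 1 (-1) 0 1 *m mx2 1 (- (Posz m.+1)) 0 1.
    by rewrite mul_mx2; congr mx2; lia.
  exact: M1.
(* Induction on |c|: splitting off T^q S, with q the quotient of a by c, replaces c by the
   remainder. *)
suff H (m : nat) a b c d : (`|c| < m)%N -> a * d - b * c = 1 -> Q1 (mx2 a b c d).
  by move=> g; rewrite {1}(mx2E g) det_mx2 => dg; rewrite (mx2E g); case: (H _ _ _ _ _ (ltnSn _) dg).
elim: m a b c d => // m IH a b c d cm ad.
have [c0|c0] := eqVneq c 0.
  have : a * d = 1 by move: ad; rewrite c0 mulr0 subr0.
  move=> ad1; have : (a == 1) && (d == 1) || (a == -1) && (d == -1).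
    have /eqP : (`|a| * `|d|)%N = 1%N by rewrite -abszM ad1.
    by rewrite muln_eq1 => /andP[/eqP a1 /eqP d1]; clear -ad1 a1 d1; nia.
  rewrite c0; case/orP => /andP[/eqP -> /eqP ->]; first exact: Tpow.
  have -> : mx2 (-1) b 0 (-1) = mx2 (-1) 0 0 (-1) *m mx2 1 (- b) 0 1.
    by rewrite mul_mx2; congr mx2; lia.
  exact: M1.
pose q := (a %/ c)%Z; pose r := (a %% c)%Z.
have aE : a = q * c + r by exact: divz_eq.
have r0 : 0 <= r by exact: modz_ge0.
have rc : r < `|c| by exact: ltz_mod.
have -> : mx2 a b c d = mx2 1 q 0 1 *m Smx *m mx2 (- c) (- d) r (b - q * d).
  by rewrite /Smx !mul_mx2; congr mx2; rewrite ?aE; ring.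
apply: (M1 _ _ (M1 _ _ (Tpow q) S1)).
apply: IH; first by clear -cm rc r0; lia.
by rewrite -ad aE; ring.
Qed.

End SL2.

(** * Cocycle relations and the transformation law *)

Section Cocycle.
Variable R : realType.
Local Notation C := (Cplx R).
Implicit Types (g : 'M[int]_2) (tau : C).

Lemma mul_entries g1 g2 : 
  [/\ (g1 *m g2) 0 0 = g1 0 0 * g2 0 0 + g1 0 1 * g2 1 0,
      (g1 *m g2) 0 1 = g1 0 0 * g2 0 1 + g1 0 1 * g2 1 1,
      (g1 *m g2) 1 0 = g1 1 0 * g2 0 0 + g1 1 1 * g2 1 0 &
      (g1 *m g2) 1 1 = g1 1 0 * g2 0 1 + g1 1 1 * g2 1 1].
Proof.
by split; rewrite !mxE big_ord_recl big_ord1; congr (_ * _ + g1 _ _ * g2 _ _); apply: val_inj.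
Qed.

Lemma autfactorM g1 g2 tau : autfactor g2 tau != 0 ->
  autfactor (g1 *m g2) tau = autfactor g1 (act_tau g2 tau) * autfactor g2 tau.
Proof.
move=> n2; have t2 : act_tau g2 tau * autfactor g2 tau = (g2 0 0)%:~R * tau + (g2 0 1)%:~R.
  by rewrite divfK.
rewrite {1 2}/autfactor mulrDl -mulrA t2 /autfactor.
have [_ _ -> ->] := mul_entries g1 g2.
by rewrite !intrD !intrM; ring.
Qed.

Lemma act_tauM g1 g2 tau : autfactor g2 tau != 0 ->
  act_tau (g1 *m g2) tau = act_tau g1 (act_tau g2 tau).
Proof.
move=> n2; have t2 : act_tau g2 tau * autfactor g2 tau = (g2 0 0)%:~R * tau + (g2 0 1)%:~R.
  by rewrite divfK.
rewrite [LHS]/act_tau autfactorM// [RHS]/act_tau -[RHS](mulfK n2) -[in RHS]mulrA mulrCA.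
rewrite invfM [X in _ = X](_ : _ = ((g1 0 0)%:~R * (act_tau g2 tau * autfactor g2 tau) + (g1 0 1)%:~R * autfactor g2 tau) *
  ((autfactor g1 (act_tau g2 tau))^-1 * (autfactor g2 tau)^-1)).
  rewrite t2; congr (_ * _).
  have [-> -> _ _] := mul_entries g1 g2.
  by rewrite !intrD !intrM /autfactor; ring.
move: (autfactor g1 (act_tau g2 tau))^-1 => x.
move: (act_tau g2 tau) => z; move: (autfactor g2 tau) => y.
move: (y^-1) => y'; ring.
Qed.

Lemma act_fgM g1 g2 (fg : R * R) : act_fg (g1 *m g2) fg = act_fg g1 (act_fg g2 fg).
Proof.
rewrite /act_fg /=; have [-> -> -> ->] := mul_entries g1 g2.
by rewrite !intrD !intrM; congr (_, _); ring.
Qed.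

Lemma act_zM n g1 g2 tau (z : 'rV[C]_n) : autfactor g2 tau != 0 ->
  act_z (g1 *m g2) tau z = act_z g1 (act_tau g2 tau) (act_z g2 tau z).
Proof. by move=> n2; rewrite /act_z autfactorM// invfM scalerA mulrC. Qed.

End Cocycle.

Section ModularTransformation.
Variable R : realType.
Local Notation C := (Cplx R).
Variables (eps : 'M[int]_2 -> R * R -> C) (heps : is_multiplier eps) (n : nat).

(** The automorphy factor and the sign of the imaginary part are included because composition uses
    them at the intermediate point. *)
Definition modular_at (g : 'M[int]_2) := forall (fg : R * R) (tau : C), 0 < complex.Im tau ->
  [/\ autfactor g tau != 0, 0 < complex.Im (act_tau g tau) &
    forall x y : 'rV[C]_n,
      G2n (act_fg g fg) (act_z g tau x) (act_z g tau y) (act_tau g tau) =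
      autfactor g tau ^+ n * eps g fg * G2n fg x y tau].

Lemma modular_T : modular_at Tmx.
Proof.
case: heps => _ eT _ -[al be] tau tau0.
have [e1 e2 e3 e4] := mx2_entries 1 1 0 1.
have aE : autfactor Tmx tau = 1 by rewrite /autfactor e3 e4 mul0r add0r.
have tE : act_tau Tmx tau = tau + 1 by rewrite /act_tau e1 e2 aE mul1r divr1.
split; [by rewrite aE oner_neq0|by rewrite tE ImD addr0|move=> x y].
rewrite tE /act_z aE invr1 !scale1r /act_fg e1 e2 e3 e4 /= !mul1r mul0r add0r.
by rewrite G2n_T// eT expr1n mul1r.
Qed.

Lemma modular_S : modular_at Smx.
Proof.
case: heps => eS _ _ -[al be] tau tau0.
have tn := Im_gt0_neq0 tau0.
have [e1 e2 e3 e4] := mx2_entries 0 1 (-1) 0.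
have aE : autfactor Smx tau = - tau by rewrite /autfactor e3 e4 addr0 mulN1r.
have tE : act_tau Smx tau = - tau^-1 by rewrite /act_tau e1 e2 aE mul0r add0r invrN mul1r.
split; [by rewrite aE oppr_eq0|by rewrite tE; exact: Im_inv_gt0|move=> x y].
rewrite tE /act_z aE /act_fg e1 e2 e3 e4 /= !mul0r add0r mul1r mulN1r addr0.
by rewrite G2n_S// eS.
Qed.

Lemma modular_all g : \det g = 1 -> modular_at g.
Proof.
apply: SL2_generated; [exact: modular_S|exact: modular_T|].
move=> g1 g2 d1 d2 m1 m2 fg tau tau0.
have [n2 im2 h2] := m2 fg tau tau0.
have [n1 im1 h1] := m1 (act_fg g2 fg) _ im2.
have n12 : autfactor (g1 *m g2) tau != 0 by rewrite autfactorM// mulf_neq0.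
split; [by []|by rewrite act_tauM|move=> x y].
rewrite act_fgM !act_zM// act_tauM// h1 h2.
case: heps => _ _ -> //; rewrite autfactorM// exprMn.
move: (_ ^+ _) (_ ^+ _) (eps _ _) (eps _ _) (G2n _ _ _ _) => a b c d e; ring.
Qed.

End ModularTransformation.

Theorem proposition6p13 (R : realType)
  (eps : 'M[int]_2 -> R * R -> Cplx R) (heps : is_multiplier eps)
  (n : nat) (alpha beta : R) (g : 'M[int]_2) (hg : \det g = 1)
  (tau : Cplx R) (htau : 0 < complex.Im tau) (x y : 'rV[Cplx R]_n) :
  G2n (act_fg g (alpha, beta)) (act_z g tau x) (act_z g tau y) (act_tau g tau)
  = autfactor g tau ^+ n * eps g (alpha, beta) * G2n (alpha, beta) x y tau.
Proof. by have [_ _ ->] := modular_all heps n hg (alpha, beta) htau. Qed.
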